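(* Let $\beta\in(0,1)$ be the absolute constant (weak Beurling exponent) fixed in the context. There exist absolute constants $C_1,C_2>0$ such that the following holds. Let $\Omega\subseteq\mathbb{R}^2$ be a bounded simply connected domain, let $\alpha\in(0,1)$, let $g:\mathbb{R}^2\to\mathbb{R}$ be $\alpha$-Hölder, and let $G=(V^\bullet\sqcup V^\circ,E)$ be a finite orthodiagonal map with edges of length at most $\varepsilon>0$ such that $\widehat G\subseteq\Omega$ and $\mathrm{dist}(z,\partial\Omega)\le\varepsilon$ for every $z\in\partial\widehat G$. Let $h$ be the solution of the continuous Dirichlet problem $\Delta h=0$ in $\Omega$, $h=g$ on $\partial\Omega$, and let $h^\bullet:V^\bullet\to\mathbb{R}$ be the solution of the discrete Dirichlet problem $\Delta^\bullet h^\bullet(v)=0$ for $v\in\mathrm{Int}(V^\bullet)$, $h^\bullet(v)=g(v)$ for $v\in\partial V^\bullet$. Then for every $v\in V^\bullet$: $$|h^\bullet(v)-h(v)|\le\begin{cases}\big(C_1\|g\|+C_2\frac{\beta}{\beta-\alpha}\|g\|_\alpha\,\mathrm{diam}(\Omega)^\alpha\big)\Big(\frac{\varepsilon}{\mathrm{diam}(\Omega)}\Big)^{\lambda(\alpha,\beta)} & \text{if }\alpha\in(0,\beta),\\[4pt] \big(C_1\|g\|+C_2\|g\|_\alpha\,\mathrm{diam}(\Omega)^\alpha\big)\log\Big(\frac{\mathrm{diam}(\Omega)}{\varepsilon}\Big)\Big(\frac{\varepsilon}{\mathrm{diam}(\Omega)}\Big)^{\lambda(\alpha,\beta)} & \text{if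 }\alpha=\beta,\\[4pt] \big(C_1\|g\|+C_2\frac{\alpha}{\alpha-\beta}\|g\|_\alpha\,\mathrm{diam}(\Omega)^\alpha\big)\Big(\frac{\varepsilon}{\mathrm{diam}(\Omega)}\Big)^{\lambda(\alpha,\beta)} & \text{if }\alpha\in(\beta,1),\end{cases}$$ where $\lambda:(0,1)^2\to(0,\infty)$ is given by $$\lambda(\alpha,\beta)=\inf_{r\in[0,1)}\ \sup_{s\in(r,1)}\Xi(\alpha,\beta,r,s),$$ $$\Xi(\alpha,\beta,r,s)=\max\Big\{(\alpha\wedge\beta)r,\ \min\Big\{\beta(s-r),\ \tfrac{\beta}{1+\beta}-\big(2+\tfrac{\beta}{1+\beta}\big)s+\tfrac r2,\ (\alpha\wedge\beta)s\Big\}\Big\}.$$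
   Context: Norms: $\|g\|=\sup_{x\in\mathbb{R}^2}|g(x)|$, $\|g\|_\alpha=\sup_{x\ne y}\frac{|g(x)-g(y)|}{|x-y|^\alpha}$; $a\wedge b=\min\{a,b\}$, $a\vee b=\max\{a,b\}$. The solution $h$ lies in $C^2(\Omega)\cap C(\overline\Omega)$, so $h(v)=g(v)$ if $v\in\partial\Omega$. ''Absolute constant'' means a numerical constant not depending on $\Omega,g,\alpha,G,\varepsilon$. Orthodiagonal maps. A finite orthodiagonal map is a finite connected plane graph $G$ all of whose edges are straight line segments, each of whose inner (bounded) faces is a quadrilateral with orthogonal diagonals (non-convex quadrilaterals are allowed), and such that the boundary of the outer face is a simple closed curve. Such a $G$ is bipartite; write its vertex set as $V^\bullet\sqcup V^\circ$ (primal and dual vertices). Each inner face $Q$ has two primal and two dual vertices; let $|e_Q^\bullet|$, $|e_Q^\circ|$ be the distances between its two primal, resp. two dual, vertices. The primal network $G^\bullet$ has vertex set $V^\bullet$ and, for every inner face $Q$ of $G$, an edge joining the two primal vertices of $Q$ with conductance $c=|e_Q^\circ|/|e_Q^\bullet|$. The discrete Laplacian of $f:V^\bullet\to\mathbb{R}$ is $\Delta^\bullet f(x)=\sum_{y\sim x}c(x,y)(f(y)-f(x))$. $\partial V^\bullet$ is the set of primal vertices on the boundary of the outer face of $G$ and $\mathrm{Int}(V^\bullet)=V^\bullet\setminus\partial V^\bullet$. A function $V^\bullet\to\mathbb R$ is called harmonic if $\Delta^\bullet$ of it vanishes on $\mathrm{Int}(V^\bullet)$. $\widehat G$ is the open planar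 domain equal to the interior of the union of the inner faces, edges and vertices of $G$. Simple random walk on $G^\bullet$ is the Markov chain jumping from $x$ to $y\sim x$ with probability $c(x,y)/\sum_{y'\sim x}c(x,y')$. The constant $\beta$. There exist absolute constants $C,C',K>0$ and $\beta\in(0,1)$ such that for every finite orthodiagonal map $G$ with edges of length at most $\varepsilon$: (i) (weak Beurling estimate) for every $u\in\mathrm{Int}(V^\bullet)$ and $r>0$, simple random walk $(S_n)$ on $G^\bullet$ started at $u$, with $\tau$ the hitting time of $\partial V^\bullet$, satisfies $\mathbb{P}^u(|S_\tau-u|\ge r)\le C\big(\frac{d_u\vee K\varepsilon}{r}\big)^\beta$ with $d_u=\mathrm{dist}(u,\partial V^\bullet)$; (ii) for every harmonic $h:V^\bullet\to\mathbb{R}$ and $x,y\in V^\bullet$ with $d=\mathrm{dist}(x,\partial V^\bullet)\wedge\mathrm{dist}(y,\partial V^\bullet)>0$, $|h(y)-h(x)|\le C'\|h\|_\infty\big(\frac{|y-x|\vee K\varepsilon}{d}\big)^\beta$. Such constants are fixed once and for all, and $\beta$ denotes this exponent.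
   Formalization: In the case α=β the factor log(diam(Ω)/ε) is replaced by log(max(diam(Ω)/ε, 2)): as printed the bound fails for ε near or above diam(Ω) (e.g. g a nonzero constant and ε>diam(Ω) gives 0 ≤ a negative number); for ε ≤ diam(Ω)/2 the two agree. *)

(* Defs.v *)
From HB Require Import structures.
From mathcomp Require Import all_boot all_order all_algebra.
From mathcomp Require Import all_classical all_reals all_analysis.

Set Implicit Arguments.
Unset Strict Implicit.
Unset Printing Implicit Defensive.

Import Order.TTheory GRing.Theory Num.Theory.
Import numFieldNormedType.Exports.

Local Open Scope classical_set_scope.
Local Open Scope ring_scope.

Section Plane.
Context {R : realType}.

(* The library's norm on [R * R] is the maximum norm.  It induces the right
   topology and bounded sets, so it is harmless for [closure], [derive],
   [bounded_set], etc.; all metric quantities use [dist2]. *)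
Definition dist2 (x y : R * R) : R :=
  Num.sqrt ((x.1 - y.1) ^+ 2 + (x.2 - y.2) ^+ 2).

Definition dot2 (x y : R * R) : R := x.1 * y.1 + x.2 * y.2.

(* Both are meaningful for nonempty (and, for [diam], bounded) sets only. *)
Definition dist_set (x : R * R) (A : set (R * R)) : R :=
  inf [set dist2 x a | a in A].

Definition diam (A : set (R * R)) : R :=
  sup [set dist2 p.1 p.2 | p in A `*` A].

Definition frontier (A : set (R * R)) : set (R * R) :=
  closure A `\` interior A.

Definition segment2 (x y : R * R) : set (R * R) :=
  [set (1 - t) *: x + t *: y | t in `[0, 1]%classic].

Definition simple_closed_curve (A : set (R * R)) : Prop :=
  exists gamma : R -> R * R,
    [/\ {within `[0, 1]%classic, continuous gamma},
        gamma 0 = gamma 1,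
        {in `[0, 1[%classic &, injective gamma} &
        gamma @` `[0, 1]%classic = A].

Definition is_domain (A : set (R * R)) : Prop :=
  [/\ A !=set0, open A & connected A].

(* [is_domain] already makes [A] path connected, so that freely null-homotopic
   loops amount to a trivial fundamental group. *)
Definition simply_connected (A : set (R * R)) : Prop :=
  forall gamma : R -> R * R,
    {within `[0, 1]%classic, continuous gamma} ->
    gamma 0 = gamma 1 -> gamma @` `[0, 1]%classic `<=` A ->
  exists2 H : R * R -> R * R,
    {within `[0, 1]%classic `*` `[0, 1]%classic, continuous H} &
    [/\ forall t, t \in `[0, 1] -> H (0, t) = gamma t,
        forall s, s \in `[0, 1] -> H (s, 0) = H (s, 1),
        forall t, t \in `[0, 1] -> H (1, t) = H (1, 0) &
        H @` (`[0, 1]%classic `*` `[0, 1]%classic) `<=` A].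

Definition basis2 (i : bool) : R * R := if i then (0, 1) else (1, 0).

Definition C2_on (A : set (R * R)) (f : R * R -> R) : Prop :=
  forall x, A x ->
    {for x, continuous f} /\
    forall i : bool,
      [/\ derivable f x (basis2 i), {for x, continuous ('D_(basis2 i) f)} &
          forall j : bool,
            derivable ('D_(basis2 i) f) x (basis2 j) /\
            {for x, continuous ('D_(basis2 j) ('D_(basis2 i) f))}].

Definition laplacian (f : R * R -> R) (x : R * R) : R :=
  \sum_(i : bool) 'D_(basis2 i) ('D_(basis2 i) f) x.

Definition dirichlet_solution (A : set (R * R)) (g h : R * R -> R) : Prop :=
  [/\ C2_on A h, {within closure A, continuous h},
      forall x, A x -> laplacian h x = 0 &
      forall x, frontier A x -> h x = g x].

(* These norms may be infinite. *)
Definition sup_norm (g : R * R -> R) : \bar R :=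
  ereal_sup [set (`|g x|)%:E | x in [set: R * R]].

Definition hoelder_norm (alpha : R) (g : R * R -> R) : \bar R :=
  ereal_sup [set (`|g p.1 - g p.2| / dist2 p.1 p.2 `^ alpha)%:E
            | p in [set p : (R * R) * (R * R) | p.1 <> p.2]].

Definition is_hoelder (alpha : R) (g : R * R -> R) : Prop :=
  (hoelder_norm alpha g < +oo)%E.

End Plane.

Section PlaneGraph.
Context {R : realType} {V W : finType}.
Variables (ppos : V -> R * R) (dpos : W -> R * R) (edge : V -> W -> bool).

Definition vpos (x : V + W) : R * R :=
  match x with inl v => ppos v | inr w => dpos w end.

Definition adj (x y : V + W) : bool :=
  match x, y with
  | inl v, inr w | inr w, inl v => edge v w
  | _, _ => false
  end.

Definition drawing : set (R * R) :=
  [set z | exists x, z = vpos x] `|`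
  [set z | exists v w, edge v w /\ segment2 (ppos v) (dpos w) z].

Definition plane_drawing : Prop :=
  [/\ injective vpos,
      forall v w x, edge v w -> segment2 (ppos v) (dpos w) (vpos x) ->
        x = inl v \/ x = inr w &
      forall v w v' w' z, edge v w -> edge v' w' -> (v, w) <> (v', w') ->
        segment2 (ppos v) (dpos w) z -> segment2 (ppos v') (dpos w') z ->
        exists x, z = vpos x].

Definition inner_face (F : set (R * R)) : Prop :=
  (exists2 z, ~ drawing z & F = connected_component (~` drawing) z) /\
  bounded_set F.

Definition outer_face : set (R * R) :=
  [set z | ~ drawing z /\
           ~ bounded_set (connected_component (~` drawing) z)].

(* [v1 w1 v2 w2] is a 4-cycle of the graph bounding the face [F]. *)
Definition face_quad (F : set (R * R)) (v1 v2 : V) (w1 w2 : W) : Prop :=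
  [/\ v1 <> v2, w1 <> w2,
      [/\ edge v1 w1, edge v2 w1, edge v2 w2 & edge v1 w2] &
      frontier F =
        segment2 (ppos v1) (dpos w1) `|` segment2 (dpos w1) (ppos v2) `|`
        segment2 (ppos v2) (dpos w2) `|` segment2 (dpos w2) (ppos v1)].

End PlaneGraph.

(* The bipartition is part of the data: [primal_vertex] and [dual_vertex] are
   the two classes, and [edge] only joins vertices of different classes. *)
Record orthodiagonal_map (R : realType) := OrthodiagonalMap {
  primal_vertex : finType;
  dual_vertex : finType;
  ppos : primal_vertex -> R * R;
  dpos : dual_vertex -> R * R;
  edge : primal_vertex -> dual_vertex -> bool;
  om_plane : plane_drawing ppos dpos edge;
  om_connected : forall x y, connect (adj edge) x y;
  om_faces : forall F, inner_face ppos dpos edge F ->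
    exists v1 v2 w1 w2, face_quad ppos dpos edge F v1 v2 w1 w2 /\
      dot2 (ppos v1 - ppos v2) (dpos w1 - dpos w2) = 0;
  om_outer : simple_closed_curve (frontier (outer_face ppos dpos edge))
}.

Section OrthodiagonalMap.
Context {R : realType}.
Variable G : orthodiagonal_map R.

Definition mesh_le (eps : R) : Prop :=
  forall (v : primal_vertex G) (w : dual_vertex G),
    edge v w -> dist2 (ppos v) (dpos w) <= eps.

Definition is_inner_face (F : set (R * R)) : Prop :=
  inner_face (@ppos R G) (@dpos R G) (@edge R G) F.

(* \hat G *)
Definition hat_domain : set (R * R) :=
  interior (drawing (@ppos R G) (@dpos R G) (@edge R G) `|`
            \bigcup_(F in is_inner_face) F).

Definition bdry (v : primal_vertex G) : Prop :=
  frontier (outer_face (@ppos R G) (@dpos R G) (@edge R G)) (ppos v).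

Definition inner_quad (v1 v2 : primal_vertex G) (w1 w2 : dual_vertex G) : Prop :=
  exists2 F, is_inner_face F &
    face_quad (@ppos R G) (@dpos R G) (@edge R G) F v1 v2 w1 w2.

(* Total conductance of the (possibly parallel) edges of the primal network
   between [x] and [y]: there is one edge per inner face with primal vertices
   [x], [y]. Such a face is determined by its two dual vertices and is listed
   twice, as [(w1, w2)] and [(w2, w1)], whence the factor 1/2. *)
Definition conductance (x y : primal_vertex G) : R :=
  2^-1 * \sum_(w1 : dual_vertex G)
            \sum_(w2 : dual_vertex G | `[< inner_quad x y w1 w2 >])
           dist2 (dpos w1) (dpos w2) / dist2 (ppos x) (ppos y).

Definition dlaplacian (f : primal_vertex G -> R) (x : primal_vertex G) : R :=
  \sum_(y : primal_vertex G) conductance x y * (f y - f x).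

Definition dharmonic (f : primal_vertex G -> R) : Prop :=
  forall x, ~ bdry x -> dlaplacian f x = 0.

Definition discrete_dirichlet_solution (g : R * R -> R) (f : primal_vertex G -> R) :
    Prop :=
  dharmonic f /\ (forall x, bdry x -> f x = g (ppos x)).

Definition step_prob (x y : primal_vertex G) : R :=
  conductance x y / \sum_(z : primal_vertex G) conductance x z.

Definition is_srw (d : measure_display) (T : measurableType d)
    (P : probability T R) (u : primal_vertex G) (S : nat -> T -> primal_vertex G) :
    Prop :=
  [/\ forall n x, measurable [set t | S n t = x],
      P [set t | S 0%N t = u] = 1%E &
      forall (n : nat) (x : nat -> primal_vertex G),
        P [set t | forall i, (i <= n.+1)%N -> S i t = x i] =
        (P [set t | forall i, (i <= n)%N -> S i t = x i] *
         (step_prob (x n) (x n.+1))%:E)%E].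

(* [n] is the hitting time of the boundary by the trajectory [s]. *)
Definition hits_at (s : nat -> primal_vertex G) (n : nat) : Prop :=
  bdry (s n) /\ forall m, (m < n)%N -> ~ bdry (s m).

Definition dist_bdry (x : primal_vertex G) : R :=
  dist_set (ppos x) [set ppos v | v in bdry].

End OrthodiagonalMap.

Definition weak_beurling (R : realType) (C K beta : R) : Prop :=
  forall (G : orthodiagonal_map R) (eps : R), mesh_le G eps ->
  forall (u : primal_vertex G) (r : R), ~ bdry u -> 0 < r ->
  forall (d : measure_display) (T : measurableType d) (P : probability T R)
    (S : nat -> T -> primal_vertex G), is_srw P u S ->
  (P [set t | exists n, hits_at (S ^~ t) n /\
                        (r <= dist2 (ppos (S n t)) (ppos u))%R]
   <= (C * (Num.max (dist_bdry u) (K * eps) / r) `^ beta)%:E)%E.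

Definition hoelder_harmonic (R : realType) (C K beta : R) : Prop :=
  forall (G : orthodiagonal_map R) (eps : R), mesh_le G eps ->
  forall f : primal_vertex G -> R, dharmonic f ->
  forall x y : primal_vertex G,
    let d := Num.min (dist_bdry x) (dist_bdry y) in
    0 < d ->
    `|f y - f x| <= C * (\big[Num.max/0]_(v : primal_vertex G) `|f v|) *
      (Num.max (dist2 (ppos y) (ppos x)) (K * eps) / d) `^ beta.

Section Exponent.
Context {R : realType}.

Definition Xi (alpha beta r s : R) : R :=
  Num.max (Num.min alpha beta * r)
    (Num.min (beta * (s - r))
       (Num.min
          (beta / (1 + beta) - (2 + beta / (1 + beta)) * s + r / 2)
          (Num.min alpha beta * s))).

Definition lambda (alpha beta : R) : R :=
  inf [set sup [set Xi alpha beta r s | s in `]r, 1[%classic]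
      | r in `[0, 1[%classic].

End Exponent.

(* Main.v *)
(* Let D = diam Omega and q = eps / D.  A layer of width d = D q^(1/4) along the boundary is treated
   separately; this suffices because lambda(alpha, beta) is at most min(alpha, beta) / 4, 3 / 32 and
   beta / (4 (1 + beta)).

   In the layer both solutions are compared with g.  For the discrete one, the Hoelder bound of g is
   summed over dyadic annuli weighted by the Beurling exit probabilities, a geometric sum of ratio
   2^(alpha - beta), whence the three regimes.  For h, no circle around a point outside the simply
   connected Omega lies in Omega, so Carleman's differential inequality for L^2 norms over circles
   gives a Hoelder modulus of exponent min(alpha, 3 / 8) at the boundary.

   Away from the layer let u = h_d - h, truncated below at its bound in the layer.  With a local
   harmonic conjugate phi of h, the flow c(x, y) (h(y) - h(x)) differs from the increment of phi along
   the dual edge by a second-order error, and the increments of phi cancel around an interior vertex.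
   This bounds the Dirichlet energy of u.  The increments of the angle under which a point near v sees
   the dual edges form a flow with source at v, and testing it against u recovers u(v) from the energy;
   near v, where the flow is singular, u is almost constant by the Hoelder estimate for discrete
   harmonic functions. *)
Require Import Defs.
From HB Require Import structures.
From mathcomp Require Import all_boot all_order all_algebra.
From mathcomp Require Import all_classical all_reals all_analysis.
From mathcomp Require Import measurable_realfun.
From mathcomp Require Import ring lra.

Set Implicit Arguments.
Unset Strict Implicit.
Unset Printing Implicit Defensive.

Import Order.TTheory GRing.Theory Num.Theory.
Import numFieldNormedType.Exports.

Local Open Scope classical_set_scope.
Local Open Scope ring_scope.

(** Two obstacles shape the proof. The Beurling hypothesis speaks of random walks, so a walk is
    built from one uniform variable, and its exit probabilities become bounds for discrete harmonic
    functions. The map is given only by its drawing, so the local structure (faces on both sides of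
    an edge, orientation of a quadrilateral, its being the inside of its boundary) is derived from
    winding numbers of polygons.

    The exponent 1/4 is fixed away from the layer. Second derivatives of [h] are there of order
    [N / d^2], where [N] bounds [g]. With [L] of order [N eps / d^2] the energy is at most a
    constant times [L^2 D^2], and the flow gives [U(v) t d <= const L D^2], where [t d] is the
    radius around [v] on which [u] is almost constant. For [d = D q^a] this reads
    [U(v) t <= const N q^(1 - 3 a)], and [a = 1/4] equates this power with that of the layer width.
    As almost constant means [N t^beta] of order [U(v)], the result is [q^(beta / (4 (1 + beta)))].
    Carleman's inequality allows boundary exponents up to 1/2; 3/8 is chosen as four times 3/32. *)

Ltac keep_arithmetic := repeat match goal with H : ?T |- _ =>
  lazymatch type of T with Prop =>
    lazymatch T with is_true _ => fail | @eq (Real.sort _) _ _ => fail | _ => clear H end end end.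
Ltac rlra := first [solve [keep_arithmetic; lra] | lra].

(** * Second derivatives and the maximum principle *)

Section SecondDerivatives.
Context {R : realType}.
Implicit Types (f g : R -> R) (x a b c k : R).

Lemma dcst x k : is_derive x 1 (fun=> k) 0.
Proof. exact: is_derive_cst. Qed.

Lemma did x : is_derive x 1 (fun s => s) 1.
Proof. exact: is_derive_id. Qed.

Lemma dD f g x a b : is_derive x 1 f a -> is_derive x 1 g b ->
  is_derive x 1 (fun s => f s + g s) (a + b).
Proof. by move=> df dg; apply: is_deriveD. Qed.

Lemma dB f g x a b : is_derive x 1 f a -> is_derive x 1 g b ->
  is_derive x 1 (fun s => f s - g s) (a - b).
Proof. by move=> df dg; apply: is_deriveB. Qed.

Lemma dZ f x a k : is_derive x 1 f a -> is_derive x 1 (fun s => k * f s) (k * a).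
Proof. by move=> df; apply: (@is_deriveZ _ _ _ f k x 1 a). Qed.

Lemma dM f g x a b : is_derive x 1 f a -> is_derive x 1 g b ->
  is_derive x 1 (fun s => f s * g s) (a * g x + f x * b).
Proof.
move=> df dg; have := @is_deriveM _ _ f g x 1 a b df dg.
by rewrite /GRing.scale /= addrC (mulrC (g x)).
Qed.

Lemma dsqr f x a : is_derive x 1 f a ->
  is_derive x 1 (fun s => f s ^+ 2) (2 * f x * a).
Proof.
move=> df; have := dM df df.
have -> : a * f x + f x * a = 2 * f x * a by ring.
by under eq_fun do rewrite -expr2.
Qed.

Lemma dcomp f g x a b : is_derive (g x) 1 f a -> is_derive x 1 g b ->
  is_derive x 1 (fun s => f (g s)) (a * b).
Proof.
by move=> df dg; apply: (@is_derive1_comp R f g x a b df dg).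
Qed.

Lemma dder f x a : is_derive x 1 f a -> derivable f x 1.
Proof. by case. Qed.

Lemma dval f x a : is_derive x 1 f a -> 'D_1 f x = a.
Proof. by case. Qed.

Lemma duniq f x a b : is_derive x 1 f a -> is_derive x 1 f b -> a = b.
Proof. by move=> /dval <- /dval. Qed.

Lemma dcont f x a : is_derive x 1 f a -> {for x, continuous f}.
Proof. by move=> [df _]; exact/differentiable_continuous/derivable1_diffP. Qed.

(** A relation instead of an iterated derivative operator: the first derivative needs a formula only
    near [x]. *)
Definition d2 f x a := exists2 f' : R -> R,
  (\forall y \near x, is_derive (y : R) 1 f (f' y)) & is_derive (x : R) 1 f' a.

Lemma d2D f g x a b : d2 f x a -> d2 g x b -> d2 (fun s => f s + g s) x (a + b).
Proof.
move=> [f' nf df] [g' ng dg]; exists (fun s => f' s + g' s); last exact: dD.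
by near=> y; apply: dD; near: y.
Unshelve. all: by end_near. Qed.

Lemma d2Z f x a k : d2 f x a -> d2 (fun s => k * f s) x (k * a).
Proof.
move=> [f' nf df]; exists (fun s => k * f' s); last exact: dZ.
by near=> y; apply: dZ; near: y.
Unshelve. all: by end_near. Qed.

Lemma d2_cst k x : d2 (fun=> k) x 0.
Proof.
by exists (fun=> 0); [near=> y; exact: dcst|exact: dcst].
Unshelve. all: by end_near. Qed.

Lemma d2_id x : d2 (fun s => s) x 0.
Proof.
by exists (fun=> 1); [near=> y; exact: did|exact: dcst].
Unshelve. all: by end_near. Qed.

Lemma d2_sqr x : d2 (fun s => s ^+ 2) x 2.
Proof.
exists (fun s => 2 * s).
  by near=> y; have := dsqr (did y); rewrite mulr1.
by have := dZ 2 (did x); rewrite mulr1.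
Unshelve. all: by end_near. Qed.

Lemma is_derive_affine f x a k c : is_derive (k * x + c) 1 f a ->
  is_derive x 1 (fun s => f (k * s + c)) (k * a).
Proof.
move=> df; have dg := dD (dZ k (did x)) (dcst x c).
by rewrite mulr1 addr0 in dg; rewrite mulrC; exact: (@dcomp f (fun s => k * s + c) _ _ _ df dg).
Qed.

Lemma d2_affine f x a k c : d2 f (k * x + c) a ->
  d2 (fun s => f (k * s + c)) x (k ^+ 2 * a).
Proof.
move=> [f' nf df]; exists (fun s => k * f' (k * s + c)).
  have cc : {for x, continuous (fun s => k * s + c)}.
    exact: (dcont (dD (dZ k (did x)) (dcst x c))).
  have cn : \forall y \near x, is_derive (k * y + c : R) 1 f (f' (k * y + c)).
    exact: cc _ nf.
  by near=> y; apply: is_derive_affine; near: y.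
rewrite expr2 -mulrA.
exact: (dZ k (is_derive_affine df)).
Unshelve. all: by end_near. Qed.

(* If the second derivative were positive at a maximum, [f'] would be positive
   just to the right of it. *)
Lemma d2_at_max f x a : d2 f x a -> (\forall y \near x, f y <= f x) -> a <= 0.
Proof.
move=> [f' nf df] mf; rewrite leNgt; apply/negP => a0.
have [e /= e0 He] : exists2 e : R, 0 < e & forall y, `|x - y| < e ->
    is_derive y 1 f (f' y) /\ f y <= f x.
  have : \forall y \near x, is_derive (y : R) 1 f (f' y) /\ f y <= f x.
    by apply: filterI.
  by move=> [e /= e0 H]; exists e => // y xy; apply: H.
have fx0 : f' x = 0.
  have xx : x \in `](x - e), (x + e)[ by rewrite in_itv /=; apply/andP; split; rlra.
  have Hd y : y \in `](x - e), (x + e)[ -> is_derive y 1 f (f' y) /\ f y <= f x.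
    by rewrite in_itv /= => /andP[y1 y2]; apply: He; rewrite ltr_norml; rlra.
  have := @derive1_at_max _ f (x - e) (x + e) x _ _ xx.
  have [H1 _] := Hd _ xx; move=> H.
  have D : is_derive x (1 : R) f 0.
    apply: H => [|y /Hd[H2 _]|y /Hd[]//]; first rlra.
    exact: dder H2.
  exact: duniq H1 D.
have f'pos : \forall h \near 0^'+, 0 < f' (x + h).
  have Hc : (fun h : R => h^-1 *: (f' (h *: 1 + x) - f' x)) @ 0^' --> a.
    by rewrite -(dval df); exact: (dder df).
  have H2 : \forall h \near 0^'+, 0 < h^-1 *: (f' (h *: 1 + x) - f' x).
    have [d /= d0 Hd] := cvgr_gt a Hc _ a0.
    by exists d => //= h hd h0; apply: Hd => //; rewrite gt_eqF.
  near=> h.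
  have h0 : 0 < h by near: h; exact: nbhs_right_gt.
  have : 0 < h^-1 *: (f' (h *: 1 + x) - f' x) by near: h.
  by rewrite fx0 subr0 /GRing.scale /= mulr1 addrC pmulr_rgt0 ?invr_gt0.
have [d /= d0 Hd] : exists2 d : R, 0 < d & forall h, 0 < h < d -> 0 < f' (x + h).
  have [d /= d0 Hd] := f'pos; exists d => // h /andP[h0 hd].
  by apply: Hd => //=; rewrite sub0r normrN gtr0_norm.
pose h := Num.min e d / 2.
have h0 : 0 < h by rewrite divr_gt0 // lt_min e0.
have m1 : Num.min e d <= e by rewrite ge_min lexx.
have m2 : Num.min e d <= d by rewrite ge_min lexx orbT.
have he : h < e by rewrite /h; rlra.
have hd : h < d by rewrite /h; rlra.
have Hde y : x <= y <= x + h -> is_derive y 1 f (f' y).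
  by move=> yx; apply: (He _ _).1; rewrite ltr_norml; rlra.
have [c cx E] : exists2 c, c \in `]x, (x + h)[ & f (x + h) - f x = f' c * (x + h - x).
  apply: MVT; first rlra.
    by move=> y; rewrite in_itv /= => yx; apply: Hde; rlra.
  apply: derivable_within_continuous => y; rewrite in_itv /= => yx.
  exact: dder (Hde _ yx).
have : f (x + h) <= f x by apply: (He _ _).2; rewrite ltr_norml; rlra.
move: cx; rewrite in_itv /= => cx.
have : 0 < f' c.
  have -> : c = x + (c - x) by ring.
  by apply: Hd; rlra.
nra.
Unshelve. all: by end_near. Qed.

End SecondDerivatives.

(** * Coordinate boxes and the maximum principle in the plane *)

Section PlaneTopology.
Context {R : realType}.
Implicit Types (p q : R * R) (A K U : set (R * R)) (f : R * R -> R) (e d M : R).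

Definition box p e q : Prop := `|q.1 - p.1| < e /\ `|q.2 - p.2| < e.

Lemma nbhs_box p A : nbhs p A <-> exists2 e : R, 0 < e & forall q, box p e q -> A q.
Proof.
split=> [/nbhs_ballP[e /= e0 He]|[e e0 He]].
  exists e => // q [q1 q2]; apply: He; split; rewrite /ball /= distrC //.
by apply/nbhs_ballP; exists e => //= q [q1 q2]; apply: He; split; rewrite distrC.
Qed.

Lemma open_box U p : open U -> U p -> exists2 e : R, 0 < e & forall q, box p e q -> U q.
Proof. by move=> oU Up; apply/nbhs_box; exact: open_nbhs_nbhs. Qed.

Lemma closure_box A p : closure A p <->
  forall e, 0 < e -> exists2 q, A q & box p e q.
Proof.
split=> [Ap e e0|H B].
  have [q [Aq Bq]] : A `&` box p e !=set0 by apply: Ap; apply/nbhs_box; exists e.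
  by exists q.
by move/nbhs_box => [e e0 He]; have [q Aq Bq] := H e e0; exists q; split; auto.
Qed.

Lemma interior_box A p : interior A p <-> exists2 e : R, 0 < e & forall q, box p e q -> A q.
Proof. exact: nbhs_box. Qed.

Lemma continuous_box f p : {for p, continuous f} <->
  forall e, 0 < e -> exists2 d : R, 0 < d & forall q, box p d q -> `|f q - f p| < e.
Proof.
split=> [cf e e0|H].
  have /cvgrPdist_lt/(_ _ e0)/nbhs_box[d d0 Hd] := cf.
  by exists d => // q /Hd; rewrite distrC.
apply/cvgrPdist_lt => e e0; have [d d0 Hd] := H e e0.
by apply/nbhs_box; exists d => // q /Hd; rewrite distrC.
Qed.

Lemma within_continuous_box A f : {within A, continuous f} <->
  forall p, A p -> forall e, 0 < e ->
    exists2 d : R, 0 < d & forall q, A q -> box p d q -> `|f q - f p| < e.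
Proof.
split=> [/subspace_continuousP cf p Ap e e0|H].
  have /cvgrPdist_lt/(_ _ e0) := cf p Ap.
  rewrite /within /= => /nbhs_box [d d0 Hd].
  by exists d => // q Aq /Hd/(_ Aq); rewrite distrC.
apply/subspace_continuousP => p Ap; apply/cvgrPdist_lt => e e0.
have [d d0 Hd] := H p Ap e e0.
by apply/nbhs_box; exists d => // q bq Aq; rewrite distrC; apply: Hd.
Qed.

Lemma bounded_set2P A : bounded_set A <->
  exists2 M : R, 0 < M & forall p, A p -> `|p.1| <= M /\ `|p.2| <= M.
Proof.
split=> [/(@ex_strict_bound_gt0 _ _ _ _ _ _)[M M0 HM]|[M M0 HM]].
  exists M => // p /HM /=; rewrite prod_normE gt_max => /andP[/ltW ? /ltW ?]; split=> //.
rewrite /bounded_set /bounded_near; near=> N; move=> p /HM [p1 p2].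
have : M <= N by near: N; apply: nbhs_pinfty_ge; rewrite num_real.
by move=> MN; rewrite /= prod_normE ge_max !(le_trans _ MN).
Unshelve. all: by end_near. Qed.

Lemma bounded_closed_compact2 K : bounded_set K -> closed K -> compact K.
Proof.
move=> /bounded_set2P[M M0 HM] cK.
apply: (@subclosed_compact _ _ (`[- M, M] `*` `[- M, M])) => //.
  by apply: compact_setX; exact: segment_compact.
by move=> p /HM[p1 p2]; split; rewrite /= in_itv /= -ler_norml.
Qed.

Lemma bounded_closure2 A : bounded_set A -> bounded_set (closure A).
Proof.
move=> /bounded_set2P[M M0 HM]; apply/bounded_set2P; exists (M + 1); first rlra.
move=> p /closure_box/(_ 1 ltr01)[q /HM[q1 q2] [b1 b2]].
have t1 := ler_normD (p.1 - q.1) q.1; have t2 := ler_normD (p.2 - q.2) q.2.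
by rewrite !subrK in t1 t2; rewrite distrC in b1; rewrite distrC in b2; split; rlra.
Qed.

Lemma compact_max2 K f : K !=set0 -> compact K -> {within K, continuous f} ->
  exists2 p, K p & forall q, K q -> f q <= f p.
Proof.
move=> K0 cK cf; have [c /set_mem Kc Hc] := compact_EVT_max K0 cK cf.
by exists c => // q Kq; apply: Hc; exact: mem_set.
Qed.

(** Only the two pure second derivatives at one point are asked for, which is all that the maximum
    principle consumes. *)
Definition lap2 f p L := exists a b,
  [/\ d2 (fun s => f (s, p.2)) p.1 a, d2 (fun s => f (p.1, s)) p.2 b & L = a + b].

Lemma lap2D f g p a b : lap2 f p a -> lap2 g p b ->
  lap2 (fun q => f q + g q) p (a + b).
Proof.
move=> [a1 [a2 [f1 f2 ->]]] [b1 [b2 [g1 g2 ->]]]; exists (a1 + b1), (a2 + b2).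
by split; [exact: d2D|exact: d2D|ring].
Qed.

Lemma lap2Z k f p a : lap2 f p a -> lap2 (fun q => k * f q) p (k * a).
Proof.
move=> [a1 [a2 [f1 f2 ->]]]; exists (k * a1), (k * a2).
by split; [exact: d2Z|exact: d2Z|ring].
Qed.

(** At an interior maximum of [f + d |q|^2] both pure second derivatives are nonpositive, although
    their sum is at least [4 d]. *)
Lemma max_principle U f M : open U -> bounded_set U ->
  {within closure U, continuous f} ->
  (forall p, U p -> exists2 L, lap2 f p L & 0 <= L) ->
  (forall p, closure U p -> ~ U p -> f p <= M) ->
  forall p, closure U p -> f p <= M.
Proof.
move=> oU bU cf Lf bf p0 Kp0; rewrite leNgt; apply/negP => fp0.
have bK := bounded_closure2 bU.
have /bounded_set2P[B B0 HB] := bK.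
(* As [|q|^2 <= 2 B^2] on the closure, the perturbation costs at most half of the gap [f p0 - M]. *)
pose d := (f p0 - M) / (4 * B ^+ 2).
have d0 : 0 < d by rewrite divr_gt0 ?subr_gt0 ?mulr_gt0 ?exprn_gt0.
pose g q := f q + d * (q.1 ^+ 2 + q.2 ^+ 2).
have sqB q : closure U q -> q.1 ^+ 2 + q.2 ^+ 2 <= 2 * B ^+ 2.
  move=> /HB[q1 q2]; have := ler_norml q.1 B; have := ler_norml q.2 B.
  rewrite q1 q2 => /esym/andP[h1 h2] /esym/andP[h3 h4].
  nra.
have cg : {within closure U, continuous g}.
  apply/subspace_continuousP => x Kx.
  apply: (@cvgD _ _ _ _ _ f (fun q => d * (q.1 ^+ 2 + q.2 ^+ 2))).
    exact: (subspace_continuousP _ _).1 cf x Kx.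
  have : {within closure U, continuous (fun q : R * R => d * (q.1 ^+ 2 + q.2 ^+ 2))}.
    apply: continuous_subspaceT => q.
    have -> : (fun q : R * R => d * (q.1 ^+ 2 + q.2 ^+ 2)) =
        (fun q => d * (q.1 * q.1 + q.2 * q.2)) by apply/funext => z; ring.
    apply: cvgM; first exact: cvg_cst.
    by apply: cvgD; apply: cvgM; (exact: cvg_fst || exact: cvg_snd).
  by move/subspace_continuousP; apply.
have [c Kc Hc] : exists2 p, closure U p & forall q, closure U q -> g q <= g p.
  apply: compact_max2 => //; first by exists p0.
  by apply: bounded_closed_compact2 => //; exact: closed_closure.
have dB : d * (4 * B ^+ 2) = f p0 - M by rewrite /d mulfVK // mulf_neq0 // ?expf_neq0 ?gt_eqF.
have [Uc|nUc] := pselect (U c); last first.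
  have := bf _ Kc nUc; have := Hc _ Kp0; rewrite /g.
  have := sqB _ Kc; have : 0 <= p0.1 ^+ 2 + p0.2 ^+ 2 by nra.
  move=> h1 h2 h3 h4.
  have : d * (c.1 ^+ 2 + c.2 ^+ 2) <= d * (2 * B ^+ 2) by rewrite ler_pM2l.
  have : 0 <= d * (p0.1 ^+ 2 + p0.2 ^+ 2) by rewrite mulr_ge0 // ltW.
  rlra.
have [L [a [b [da db LE]]] L0] := Lf _ Uc.
have [e e0 He] := open_box oU Uc.
have sq x : d2 (fun s => d * s ^+ 2) x (d * 2) by exact: d2Z (d2_sqr x).
have ga : d2 (fun s => g (s, c.2)) c.1 (a + d * 2).
  have := d2D da (d2D (sq c.1) (d2_cst (d * c.2 ^+ 2) c.1)).
  rewrite addr0; under eq_fun do rewrite -mulrDr.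
  by [].
have gb : d2 (fun s => g (c.1, s)) c.2 (b + d * 2).
  have := d2D db (d2D (d2_cst (d * c.1 ^+ 2) c.2) (sq c.2)).
  rewrite add0r; under eq_fun do rewrite -mulrDr.
  by [].
have cE : (c.1, c.2) = c by case: (c).
have a0 : a + d * 2 <= 0.
  apply: (d2_at_max ga); exists e => //= s se.
  rewrite cE; apply: Hc; apply: subset_closure; apply: He.
  by split => /=; rewrite ?subrr ?normr0 // distrC.
have b0 : b + d * 2 <= 0.
  apply: (d2_at_max gb); exists e => //= s se.
  rewrite cE; apply: Hc; apply: subset_closure; apply: He.
  by split => /=; rewrite ?subrr ?normr0 // distrC.
rlra.
Qed.

End PlaneTopology.

(** * Interior estimates for harmonic functions *)

Section HarmonicEstimates.
Context {R : realType}.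
Implicit Types (p q c a b : R * R) (U : set (R * R)) (f : R * R -> R) (e d M x : R).

Lemma open_boxset c d : open [set q | box c d q].
Proof.
rewrite openE => q [q1 q2]; apply/interior_box.
exists (Num.min (d - `|q.1 - c.1|) (d - `|q.2 - c.2|)).
  by rewrite lt_min !subr_gt0 q1 q2.
move=> z [z1 z2]; rewrite !lt_min in z1 z2.
move: z1 z2 => /andP[z1 _] /andP[_ z2].
split; [have := ler_normD (z.1 - q.1) (q.1 - c.1)|
        have := ler_normD (z.2 - q.2) (q.2 - c.2)]; rewrite addrA subrK; rlra.
Qed.

Definition harmonic_on U f := forall p, U p -> lap2 f p 0 /\ {for p, continuous f}.

Lemma harmonicS U V f : U `<=` V -> harmonic_on V f -> harmonic_on U f.
Proof. by move=> UV hf p /UV; exact: hf. Qed.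

Lemma continuous_pair2 (u v : R * R -> R) p : {for p, continuous u} ->
  {for p, continuous v} -> {for p, continuous (fun q => (u q, v q) : R * R)}.
Proof. by move=> cu cv; exact: (cvg_pair cu cv). Qed.

Lemma continuous_comp_affine1 f k s p :
  {for (k * p.1 + s, p.2), continuous f} ->
  {for p, continuous (fun q => f (k * q.1 + s, q.2))}.
Proof.
move=> cf; apply: (@continuous_comp _ _ _ (fun q : R * R => (k * q.1 + s, q.2))) => //.
apply: continuous_pair2; last exact: cvg_snd.
by apply: cvgD; [apply: cvgM; [exact: cvg_cst|exact: cvg_fst]|exact: cvg_cst].
Qed.

Lemma lap2_affine1 f k s p L : k ^+ 2 = 1 -> lap2 f (k * p.1 + s, p.2) L ->
  lap2 (fun q => f (k * q.1 + s, q.2)) p L.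
Proof.
move=> k2 [x [y [/= fx fy ->]]]; exists x, y; split => //=.
have -> : x = k ^+ 2 * x by rewrite k2 mul1r.
exact: (@d2_affine _ (fun s => f (s, p.2))).
Qed.

Lemma continuous_comp_swap f p :
  {for (p.2, p.1), continuous f} -> {for p, continuous (fun q => f (q.2, q.1))}.
Proof.
move=> cf; apply: (@continuous_comp _ _ _ (fun q : R * R => (q.2, q.1))) => //.
by apply: continuous_pair2; [exact: cvg_snd|exact: cvg_fst].
Qed.

Lemma harmonic_swap U f : harmonic_on U f ->
  harmonic_on [set p | U (p.2, p.1)] (fun q => f (q.2, q.1)).
Proof.
move=> hf p /= /hf[[x [y [fx fy E]]] cf]; split; last exact: continuous_comp_swap.
by exists y, x; split => //; rewrite E addrC.
Qed.

Lemma harmonicN U f : harmonic_on U f -> harmonic_on U (fun q => - f q).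
Proof.
move=> hf p /hf[lf cf]; split; last by apply: continuousN.
have := lap2Z (-1) lf; rewrite mulr0.
by under eq_fun do rewrite mulN1r.
Qed.

Lemma lap2_quad (k1 k2 l c0 : R) c p :
  lap2 (fun q => k1 * (q.1 - c.1) ^+ 2 + k2 * (q.2 - c.2) ^+ 2 + l * (q.1 - c.1) + c0)
    p (2 * k1 + 2 * k2).
Proof.
have H k (x y : R) : d2 (fun s => k * (s - x) ^+ 2) y (k * 2).
  have := d2Z k (d2_affine (k := 1) (c := - x) (d2_sqr (1 * y - x))).
  rewrite expr1n mul1r.
  by under eq_fun do rewrite mul1r.
have H1 (x y : R) : d2 (fun s => l * (s - x)) y 0.
  have := d2Z l (d2D (d2_id y) (d2_cst (- x) y)).
  by rewrite addr0 mulr0.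
exists (2 * k1), (2 * k2); split; last by [].
  have := d2D (d2D (d2D (H k1 c.1 p.1) (d2_cst (k2 * (p.2 - c.2) ^+ 2) p.1)) (H1 c.1 p.1)) (d2_cst c0 p.1).
  by rewrite !addr0 [k1 * 2]mulrC.
have := d2D (d2D (d2D (d2_cst (k1 * (p.1 - c.1) ^+ 2) p.2) (H k2 c.2 p.2)) (d2_cst (l * (p.1 - c.1)) p.2)) (d2_cst c0 p.2).
by rewrite !addr0 add0r [k2 * 2]mulrC.
Qed.

(** The difference of [f] and its mirror image vanishes on the vertical axis through [c]. In the
    right half square a harmonic quadratic barrier dominates it, and along the horizontal axis this
    barrier grows at most linearly. *)
Lemma reflection_diff_le c d f M x : harmonic_on [set q | box c d q] f ->
  (forall q, box c d q -> `|f q| <= M) -> 0 <= x -> x <= d / 2 -> 0 < d ->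
  f (c.1 + x, c.2) - f (c.1 - x, c.2) <= 8 * M * x / d.
Proof.
move=> hf bM x0 xd d0.
pose r := d / 2; have r0 : 0 < r by rewrite divr_gt0.
pose refl q : R * R := (-1 * q.1 + 2 * c.1, q.2).
pose g q := f q + -1 * f (refl q).
have rE : d = 2 * r by rewrite /r mulrC divfK // pnatr_eq0.
pose m := 2 * M / r ^+ 2.
have m0 : 0 <= M by apply: le_trans (bM c _); rewrite ?normr_ge0 //; split; rewrite subrr normr0.
have mr : m * r ^+ 2 = 2 * M by rewrite /m divfK // expf_neq0 // gt_eqF.
have mge0 : 0 <= m by apply: divr_ge0; [exact: mulr_ge0|exact: sqr_ge0].
(* In coordinates centred at [c], [- w = m (y^2 + x (2 r - x))]: this is nonnegative on the axis, at
   least [m r^2 = 2 M] on the three other sides, and at most [2 r m x = 8 M x / d] for [y = 0]. *)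
pose w q := m * (q.1 - c.1) ^+ 2 + (- m) * (q.2 - c.2) ^+ 2 + (- 2 * r * m) * (q.1 - c.1) + 0.
pose U : set (R * R) := [set q | [/\ 0 < q.1 - c.1, q.1 - c.1 < r & `|q.2 - c.2| < r]].
have Ubox q : (0 <= q.1 - c.1) -> q.1 - c.1 <= r -> `|q.2 - c.2| <= r -> box c d q.
  by move=> q1 q2 q3; split; [rewrite ger0_norm //; rlra|rlra].
have Ubox' q : (0 <= q.1 - c.1) -> q.1 - c.1 <= r -> `|q.2 - c.2| <= r -> box c d (refl q).
  move=> q1 q2 q3; split => /=; last rlra.
  by rewrite (_ : _ - _ = - (q.1 - c.1)); [rewrite normrN ger0_norm; rlra|ring].
have oU : open U.
  have -> : U = [set q | box (c.1 + r / 2, c.2) r q] `&`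
      [set q | box (c.1 + r / 2, c.2) (r / 2) (q.1, c.2)].
    apply/seteqP; split=> q /=; rewrite /box /=.
      move=> [q1 q2 q3]; split; split => //; rewrite ?subrr ?normr0 ?ltr_norml; rlra.
    move=> [[_ q3] [q1 _]]; move: q1; rewrite ltr_norml => /andP[q1 q2].
    by split => //; rlra.
  apply: openI; first exact: open_boxset.
  have cc : continuous (fun q : R * R => (q.1, c.2) : R * R).
    by move=> q; apply: continuous_pair2; [exact: cvg_fst|exact: cvg_cst].
  by move/continuousP: cc; apply; exact: open_boxset.
have bU : bounded_set U.
  apply/bounded_set2P; exists (`|c.1| + `|c.2| + r + 1).
    by rewrite !ltr_wpDl ?addr_ge0 // ltW.
  move=> q [q1 q2 q3].
  have := ler_normD (q.1 - c.1) c.1; have := ler_normD (q.2 - c.2) c.2.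
  have := normr_ge0 c.1; have := normr_ge0 c.2.
  by rewrite !subrK (gtr0_norm q1); split; rlra.
have cU q : closure U q -> [/\ 0 <= q.1 - c.1, q.1 - c.1 <= r & `|q.2 - c.2| <= r].
  move=> /closure_box H.
  have K e : 0 < e -> [/\ - e <= q.1 - c.1, q.1 - c.1 <= r + e & `|q.2 - c.2| <= r + e].
    move=> e0; have [z [z1 z2 z3] [b1 b2]] := H e e0.
    rewrite ltr_norml in b1; move/andP: b1 => [b3 b4].
    split; [rlra|rlra|].
    have := ler_normD (q.2 - z.2) (z.2 - c.2); rewrite addrA subrK.
    by rewrite distrC in b2; rlra.
  split; apply/ler_addgt0Pr => e /K[k1 k2 k3]; rlra.
have gbd q : closure U q -> `|g q| <= 2 * M.
  move=> /cU[q1 q2 q3]; rewrite /g.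
  apply: le_trans (ler_normD _ _) _; rewrite mulN1r normrN.
  have := bM _ (Ubox _ q1 q2 q3); have := bM _ (Ubox' _ q1 q2 q3); rlra.
have key q : closure U q -> g q + w q <= 0.
  apply: (@max_principle _ U (fun q => g q + w q)) => //.
  - apply/subspace_continuousP => z /cU[z1 z2 z3].
    have cg : {for z, continuous g}.
      apply: (@cvgD _ _ _ _ _ f (fun q => -1 * f (refl q))).
        exact: (hf _ (Ubox _ z1 z2 z3)).2.
      apply: cvgM; first exact: cvg_cst.
      exact: (continuous_comp_affine1 (hf _ (Ubox' _ z1 z2 z3)).2).
    have cw : {for z, continuous w}.
      have -> : w = (fun q => m * ((q.1 - c.1) * (q.1 - c.1)) +
          (- m) * ((q.2 - c.2) * (q.2 - c.2)) + (- 2 * r * m) * (q.1 - c.1)).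
        by apply/funext => y; rewrite /w; ring.
      have c1 : {for z, continuous (fun q : R * R => q.1 - c.1)}.
        by apply: cvgB; [exact: cvg_fst|exact: cvg_cst].
      have c2 : {for z, continuous (fun q : R * R => q.2 - c.2)}.
        by apply: cvgB; [exact: cvg_snd|exact: cvg_cst].
      apply: cvgD; last by apply: cvgM => //; exact: cvg_cst.
      by apply: cvgD; (apply: cvgM; first exact: cvg_cst); apply: cvgM.
    by apply: cvg_within_filter; exact: (cvgD cg cw).
  - move=> z [z1 z2 z3].
    have bz := Ubox _ (ltW z1) (ltW z2) (ltW z3).
    have bz' := Ubox' _ (ltW z1) (ltW z2) (ltW z3).
    exists (0 + (-1) * 0 + (2 * m + 2 * (- m))); last by rewrite mulr0 !add0r mulrN addrN.
    apply: lap2D; last exact: lap2_quad.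
    apply: lap2D; first exact: (hf _ bz).1.
    apply: lap2Z; apply: lap2_affine1; first by ring.
    exact: (hf _ bz').1.
  - move=> z cz nUz; have [z1 z2 z3] := cU _ cz; have gz := gbd _ cz.
    have gz' : g z <= 2 * M by apply: le_trans gz; exact: ler_norm.
    have wE : w z = m * (- (z.2 - c.2) ^+ 2 - (z.1 - c.1) * (2 * r - (z.1 - c.1))).
      by rewrite /w; ring.
    move: z1; rewrite le_eqVlt => /orP[/eqP z1|z1].
      have z1' : z.1 = c.1 by apply/eqP; rewrite -subr_eq0 -z1.
      have -> : g z = 0.
        rewrite /g /refl (_ : -1 * z.1 + 2 * c.1 = z.1); last by rewrite z1'; ring.
        by rewrite -surjective_pairing mulN1r addrN.
      rewrite wE -z1 mul0r subr0 add0r mulrN oppr_le0.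
      by rewrite mulr_ge0 // sqr_ge0.
    have [z2'|z2'] := ltP (z.1 - c.1) r.
      have z3' : `|z.2 - c.2| = r.
        by apply/eqP; rewrite eq_le z3 /= leNgt; apply/negP => z3'; apply: nUz.
      have : (z.2 - c.2) ^+ 2 = r ^+ 2 by rewrite -z3' real_normK // num_real.
      move=> E; rewrite wE E mulrDr mulrN mr.
      have : 0 <= m * ((z.1 - c.1) * (2 * r - (z.1 - c.1))).
        by rewrite mulr_ge0 // mulr_ge0 //; rlra.
      rlra.
    have E : z.1 - c.1 = r by apply/eqP; rewrite eq_le z2 z2'.
    rewrite wE E (_ : r * (2 * r - r) = r ^+ 2); last by ring.
    have : 0 <= m * (z.2 - c.2) ^+ 2 by rewrite mulr_ge0 // sqr_ge0.
    have -> : m * (- (z.2 - c.2) ^+ 2 - r ^+ 2) = - (m * (z.2 - c.2) ^+ 2) - m * r ^+ 2 by ring.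
    rlra.
have xU : closure U (c.1 + x, c.2).
  apply/closure_box => e e0.
  pose y := Num.max (Num.min (e / 2) (r / 2)) (x - Num.min (e / 2) (r / 2)).
  have mn0 : 0 < Num.min (e / 2) (r / 2) by rewrite lt_min !divr_gt0.
  have mn1 : Num.min (e / 2) (r / 2) <= e / 2 by rewrite ge_min lexx.
  have mn2 : Num.min (e / 2) (r / 2) <= r / 2 by rewrite ge_min lexx orbT.
  have y1 : Num.min (e / 2) (r / 2) <= y by rewrite le_max lexx.
  have y2 : x - Num.min (e / 2) (r / 2) <= y by rewrite le_max lexx orbT.
  have y3 : y <= Num.max (r / 2) (x - Num.min (e / 2) (r / 2)).
    by rewrite ge_max !le_max mn2 lexx orbT.
  have y4 : y < r by rewrite /y gt_max; apply/andP; split; rewrite /r; rlra.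
  have y5 : y < x + e by rewrite /y gt_max; apply/andP; split; rlra.
  exists (c.1 + y, c.2); first by split; rewrite /= ?subrr ?normr0 //; rlra.
  by split; rewrite /= ?subrr ?normr0 // ltr_norml; rlra.
have := key _ xU.
rewrite /g /refl /w /= (_ : -1 * (c.1 + x) + 2 * c.1 = c.1 - x); last by ring.
rewrite subrr expr0n /= mulr0 !addr0 (_ : c.1 + x - c.1 = x); last by ring.
have : m * x ^+ 2 >= 0 by rewrite mulr_ge0 // sqr_ge0.
have -> : 8 * M * x / d = 2 * r * m * x.
  have -> : 8 * M = 4 * (m * r ^+ 2) by rewrite mr; ring.
  by rewrite rE; field; rewrite gt_eqF.
rlra.
Qed.

End HarmonicEstimates.

(** * Lipschitz bounds for harmonic functions and their first derivatives *)

Section GradientEstimates.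
Context {R : realType}.
Implicit Types (p q c a b : R * R) (U : set (R * R)) (f : R * R -> R) (e d M x : R).

Lemma reflection_diff_norm c d f M x : harmonic_on [set q | box c d q] f ->
  (forall q, box c d q -> `|f q| <= M) -> 0 <= x -> x <= d / 2 -> 0 < d ->
  `|f (c.1 + x, c.2) - f (c.1 - x, c.2)| <= 8 * M * x / d.
Proof.
move=> hf bM x0 xd d0; rewrite ler_norml reflection_diff_le // andbT.
have := @reflection_diff_le _ c d (fun q => - f q) M x (harmonicN hf) _ x0 xd d0.
rewrite lerNl => H; apply: le_trans (H _) => [|q /bM]; last by rewrite normrN.
by rewrite opprD !opprK addrC.
Qed.

Lemma boxD c d e q : box c d q -> forall z, box q e z -> box c (d + e) z.
Proof.
move=> [q1 q2] z [z1 z2].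
have := ler_normD (z.1 - q.1) (q.1 - c.1); have := ler_normD (z.2 - q.2) (q.2 - c.2).
by rewrite !addrA !subrK => t1 t2; split; rlra.
Qed.

Lemma boxW c d e : d <= e -> forall q, box c d q -> box c e q.
Proof. by move=> de q [q1 q2]; split; rlra. Qed.

(** Two points on a horizontal line are mirror images in the vertical line through their midpoint,
    around which a box of half the size is still available. *)
Lemma harmonic_lip1 c d f M : harmonic_on [set q | box c d q] f ->
  (forall q, box c d q -> `|f q| <= M) ->
  forall x y z, box c (d / 4) (x, z) -> box c (d / 4) (y, z) ->
  `|f (x, z) - f (y, z)| <= 8 * M / d * `|x - y|.
Proof.
move=> hf bM x y z.
wlog xy : x y / y <= x.
  move=> H b1 b2; have [yx|/ltW xy] := leP y x; first exact: H.
  by rewrite distrC (distrC x); exact: H.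
move=> [/= x1 z1] [/= y1 _].
have d0 : 0 < d by have := normr_ge0 (x - c.1); rlra.
pose m : R * R := ((x + y) / 2, z).
have bm : box c (d / 2) m.
  by move: x1 y1; rewrite !ltr_norml => x1 y1; split => /=; [rewrite ltr_norml; rlra|rlra].
have hm : harmonic_on [set q | box m (d / 2) q] f.
  apply: harmonicS hf => q /= bq; have := boxD bm bq.
  by rewrite (_ : d / 2 + d / 2 = d) //; field.
have bmM q : box m (d / 2) q -> `|f q| <= M.
  move=> bq; apply: bM; have := boxD bm bq.
  by rewrite (_ : d / 2 + d / 2 = d) //; field.
have h0 : 0 <= (x - y) / 2 by rlra.
have h1 : (x - y) / 2 <= d / 2 / 2 by move: x1 y1; rewrite !ltr_norml => x1 y1; rlra.
have d2 : 0 < d / 2 by rlra.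
have := reflection_diff_norm hm bmM h0 h1 d2; rewrite /m /=.
rewrite (_ : (x + y) / 2 + (x - y) / 2 = x); last by field.
rewrite (_ : (x + y) / 2 - (x - y) / 2 = y); last by field.
rewrite (_ : 8 * M * ((x - y) / 2) / (d / 2) = 8 * M / d * (x - y)); last by field; rewrite gt_eqF.
by rewrite (ger0_norm (_ : 0 <= x - y)) // subr_ge0.
Qed.

Lemma harmonic_lip2 c d f M : harmonic_on [set q | box c d q] f ->
  (forall q, box c d q -> `|f q| <= M) ->
  forall x y z, box c (d / 4) (z, x) -> box c (d / 4) (z, y) ->
  `|f (z, x) - f (z, y)| <= 8 * M / d * `|x - y|.
Proof.
move=> hf bM x y z [/= x1 x2] [/= y1 y2].
have H : harmonic_on [set q | box (c.2, c.1) d q] (fun q => f (q.2, q.1)).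
  by apply: harmonicS (harmonic_swap hf) => q [/= q1 q2]; split.
apply: (harmonic_lip1 H); [|by split|by split].
by move=> q [/= q1 q2]; apply: bM; split.
Qed.

Lemma harmonic_lip c d f M : harmonic_on [set q | box c d q] f ->
  (forall q, box c d q -> `|f q| <= M) ->
  forall a b, box c (d / 4) a -> box c (d / 4) b ->
  `|f a - f b| <= 8 * M / d * (`|a.1 - b.1| + `|a.2 - b.2|).
Proof.
move=> hf bM [a1 a2] [b1 b2] [/= ha1 ha2] [/= hb1 hb2].
have := ler_normD (f (a1, a2) - f (b1, a2)) (f (b1, a2) - f (b1, b2)).
rewrite addrA subrK => /le_trans; apply; rewrite mulrDr; apply: lerD.
  by apply: (harmonic_lip1 hf bM); split.
by apply: (harmonic_lip2 hf bM); split.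
Qed.

Lemma is_derive_epsP (f : R -> R) x (a : R) : is_derive x 1 f a -> forall e, 0 < e ->
  exists2 d : R, 0 < d & forall t, t != 0 -> `|t| < d -> `|(f (x + t) - f x) / t - a| < e.
Proof.
move=> df e e0.
have Hc : (fun h : R => h^-1 *: (f (h *: 1 + x) - f x)) @ 0^' --> a.
  by rewrite -(dval df); exact: (dder df).
have /cvgrPdist_lt/(_ _ e0)[d /= d0 Hd] := Hc.
exists d => // t t0 td; have := Hd t; rewrite /ball_ /= sub0r normrN => /(_ td t0).
by rewrite distrC /GRing.scale /= mulr1 mulrC [t + x]addrC.
Qed.

(** The symmetric difference quotients [k t] are harmonic and, by [harmonic_lip1], bounded by
    [8 M / d] uniformly in [t]. [harmonic_lip] on the box of radius [d / 8] gives the constant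
    [8 (8 M / d) / (d / 8)], and [t] tends to 0. *)
Lemma harmonic_derive_lip1 c d f M (f1 : R * R -> R) :
  harmonic_on [set q | box c d q] f -> (forall q, box c d q -> `|f q| <= M) ->
  (forall q, box c d q -> is_derive q.1 1 (fun s => f (s, q.2)) (f1 q)) ->
  forall a b, box c (d / 32) a -> box c (d / 32) b ->
  `|f1 a - f1 b| <= 512 * M / d ^+ 2 * (`|a.1 - b.1| + `|a.2 - b.2|).
Proof.
move=> hf bM df a b ba bb.
have d0 : 0 < d by case: ba => b1 _; have := normr_ge0 (a.1 - c.1); rlra.
pose k t q := (2 * t)^-1 * (f (1 * q.1 + t, q.2) + -1 * f (1 * q.1 + - t, q.2)).
have bsh t q : `|t| < d / 8 -> box c (d / 8) q -> box c (d / 4) (1 * q.1 + t, q.2).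
  move=> td [q1 q2]; rewrite mul1r; split => /=; last rlra.
  have := ler_normD (q.1 - c.1) t; rewrite (_ : q.1 - c.1 + t = q.1 + t - c.1); [rlra|ring].
have d4d : d / 4 <= d by rlra.
have kh t : `|t| < d / 8 -> harmonic_on [set q | box c (d / 8) q] (k t).
  move=> td q bq; have td' : `|- t| < d / 8 by rewrite normrN.
  have [h1 c1] := hf _ (boxW d4d (bsh _ _ td bq)).
  have [h2 c2] := hf _ (boxW d4d (bsh _ _ td' bq)).
  split.
    have -> : 0 = (2 * t)^-1 * (0 + -1 * 0) :> R by ring.
    apply: lap2Z; apply: lap2D; first by apply: lap2_affine1 => //; ring.
    by apply: lap2Z; apply: lap2_affine1 => //; ring.
  apply: cvgM; first exact: cvg_cst.
  apply: cvgD; first exact: continuous_comp_affine1.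
  by apply: cvgM; [exact: cvg_cst|exact: continuous_comp_affine1].
have kb t : t != 0 -> `|t| < d / 8 -> forall q, box c (d / 8) q -> `|k t q| <= 8 * M / d.
  move=> t0 td q bq; have td' : `|- t| < d / 8 by rewrite normrN.
  have := harmonic_lip1 hf bM (bsh _ _ td bq) (bsh _ _ td' bq).
  rewrite (_ : 1 * q.1 + t - (1 * q.1 + - t) = 2 * t); last by ring.
  move=> H; rewrite /k normrM normfV mulN1r.
  by rewrite mulrC ler_pdivrMr // normr_gt0 mulf_neq0 // pnatr_eq0.
have kl t : t != 0 -> `|t| < d / 8 ->
    `|k t a - k t b| <= 512 * M / d ^+ 2 * (`|a.1 - b.1| + `|a.2 - b.2|).
  move=> t0 td.
  have E : d / 8 / 4 = d / 32 by field.
  have := harmonic_lip (kh _ td) (kb _ t0 td) (a := a) (b := b); rewrite E => /(_ ba bb).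
  rewrite (_ : 8 * (8 * M / d) / (d / 8) = 512 * M / d ^+ 2) //; field.
  by rewrite gt_eqF.
have d32 : d / 32 <= d by rlra.
have klim q : box c d q -> forall e, 0 < e -> exists2 r : R, 0 < r &
    forall t, t != 0 -> `|t| < r -> `|k t q - f1 q| < e.
  move=> bq e e0; have [r r0 Hr] := is_derive_epsP (df _ bq) e0.
  exists r => // t t0 tr.
  have H1 := Hr t t0 tr; have H2 := Hr (- t); rewrite oppr_eq0 normrN in H2.
  have {}H2 := H2 t0 tr.
  have -> : k t q - f1 q = 2^-1 * (((f (q.1 + t, q.2) - f (q.1, q.2)) / t - f1 q) +
      ((f (q.1 + - t, q.2) - f (q.1, q.2)) / (- t) - f1 q)).
    by rewrite /k !mul1r; field.
  rewrite normrM gtr0_norm ?invr_gt0 //.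
  have := ler_normD ((f (q.1 + t, q.2) - f (q.1, q.2)) / t - f1 q)
     ((f (q.1 + - t, q.2) - f (q.1, q.2)) / (- t) - f1 q).
  rlra.
apply/ler_addgt0Pr => e e0.
have e20 : 0 < e / 2 by rlra.
have [r1 r10 H1] := klim a (boxW d32 ba) _ e20.
have [r2 r20 H2] := klim b (boxW d32 bb) _ e20.
pose t := Num.min (d / 8) (Num.min r1 r2) / 2.
have mn : 0 < Num.min (d / 8) (Num.min r1 r2) by rewrite !lt_min r10 r20 divr_gt0.
have [m1 m2 m3] : [/\ Num.min (d / 8) (Num.min r1 r2) <= d / 8,
   Num.min (d / 8) (Num.min r1 r2) <= r1 & Num.min (d / 8) (Num.min r1 r2) <= r2].
  by split; rewrite !ge_min lexx ?orbT.
have t0 : 0 < t by rewrite /t; rlra.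
have tn : t != 0 by rewrite gt_eqF.
have {}H1 : `|k t a - f1 a| < e / 2 by apply: H1 => //; rewrite gtr0_norm // /t; rlra.
have {}H2 : `|k t b - f1 b| < e / 2 by apply: H2 => //; rewrite gtr0_norm // /t; rlra.
have H3 : `|k t a - k t b| <= 512 * M / d ^+ 2 * (`|a.1 - b.1| + `|a.2 - b.2|).
  by apply: kl => //; rewrite gtr0_norm // /t; rlra.
have -> : f1 a - f1 b = (k t a - k t b) + ((k t b - f1 b) - (k t a - f1 a)) by ring.
have := ler_normD (k t a - k t b) ((k t b - f1 b) - (k t a - f1 a)).
have := ler_normB (k t b - f1 b) (k t a - f1 a).
rlra.
Qed.

Lemma harmonic_derive_lip2 c d f M (f2 : R * R -> R) :
  harmonic_on [set q | box c d q] f -> (forall q, box c d q -> `|f q| <= M) ->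
  (forall q, box c d q -> is_derive q.2 1 (fun s => f (q.1, s)) (f2 q)) ->
  forall a b, box c (d / 32) a -> box c (d / 32) b ->
  `|f2 a - f2 b| <= 512 * M / d ^+ 2 * (`|a.1 - b.1| + `|a.2 - b.2|).
Proof.
move=> hf bM df [a1 a2] [b1 b2] [/= ha1 ha2] [/= hb1 hb2].
have H : harmonic_on [set q | box (c.2, c.1) d q] (fun q => f (q.2, q.1)).
  by apply: harmonicS (harmonic_swap hf) => q [/= q1 q2]; split.
have := @harmonic_derive_lip1 (c.2, c.1) d _ M (fun q => f2 (q.2, q.1)) H.
rewrite [`|a1 - b1| + _]addrC.
move=> /(_ _ _ (a2, a1) (b2, b1)) /=; apply; [| |by split|by split].
  by move=> q [/= q1 q2]; apply: bM; split.
by move=> q [/= q1 q2]; apply: (df (q.2, q.1)); split.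
Qed.

Lemma mvt_affine (g g' : R -> R) (al eta x y : R) :
  (forall s, Num.min x y <= s <= Num.max x y -> is_derive s 1 g (g' s) /\ `|g' s - al| <= eta) ->
  `|g y - g x - al * (y - x)| <= eta * `|y - x|.
Proof.
wlog xy : x y / x <= y.
  move=> H D; have [xy|/ltW yx] := leP x y; first exact: H.
  rewrite (_ : g y - g x - al * (y - x) = - (g x - g y - al * (x - y))); last by ring.
  by rewrite normrN [`|y - x|]distrC; apply: H => // s; rewrite minC maxC; exact: D.
rewrite (min_idPl xy) (max_idPr xy) => D.
move: xy; rewrite le_eqVlt => /orP[/eqP <-|xy].
  by rewrite !subrr mulr0 normr0 subr0 normr0 mulr0.
have [c cx E] : exists2 c, c \in `]x, y[ & g y - g x = g' c * (y - x).
  apply: MVT => // [s|].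
    by rewrite in_itv /= => /andP[s1 s2]; apply: (D _ _).1; rlra.
  apply: derivable_within_continuous => s; rewrite in_itv /= => sx.
  exact: (dder (D _ sx).1).
rewrite E -mulrBl normrM ler_wpM2r //; apply: (D _ _).2.
by move: cx; rewrite in_itv /= => /andP[c1 c2]; rlra.
Qed.

(** Moving first horizontally and then vertically stays in the box, so control of the two partial
    derivatives suffices. *)
Lemma rect_mvt c d (f f1 f2 : R * R -> R) (al be eta : R) :
  (forall q, box c d q -> [/\ is_derive q.1 1 (fun s => f (s, q.2)) (f1 q),
     is_derive q.2 1 (fun s => f (q.1, s)) (f2 q), `|f1 q - al| <= eta & `|f2 q - be| <= eta]) ->
  forall a b, box c d a -> box c d b ->
  `|f b - f a - (al * (b.1 - a.1) + be * (b.2 - a.2))| <= eta * (`|b.1 - a.1| + `|b.2 - a.2|).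
Proof.
move=> H [a1 a2] [b1 b2] [/= ha1 ha2] [/= hb1 hb2].
have E1 : `|f (b1, a2) - f (a1, a2) - al * (b1 - a1)| <= eta * `|b1 - a1|.
  apply: (@mvt_affine (fun s => f (s, a2)) (fun s => f1 (s, a2))) => s.
  rewrite ge_min le_max => sx.
  have bs : box c d (s, a2).
    split => //=; move: ha1 hb1; rewrite !ltr_norml.
    by case/andP: sx => /orP[] ? /orP[] ?; rlra.
  by have [] := H _ bs.
have E2 : `|f (b1, b2) - f (b1, a2) - be * (b2 - a2)| <= eta * `|b2 - a2|.
  apply: (@mvt_affine (fun s => f (b1, s)) (fun s => f2 (b1, s))) => s.
  rewrite ge_min le_max => sx.
  have bs : box c d (b1, s).
    split => //=; move: ha2 hb2; rewrite !ltr_norml.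
    by case/andP: sx => /orP[] ? /orP[] ?; rlra.
  by have [] := H _ bs.
have := ler_normD (f (b1, a2) - f (a1, a2) - al * (b1 - a1))
  (f (b1, b2) - f (b1, a2) - be * (b2 - a2)).
rewrite (_ : f (b1, a2) - f (a1, a2) - al * (b1 - a1) + (f (b1, b2) - f (b1, a2) - be * (b2 - a2)) =
  f (b1, b2) - f (a1, a2) - (al * (b1 - a1) + be * (b2 - a2))); last by ring.
rlra.
Qed.

End GradientEstimates.

(** * Wirtinger's inequality and Carleman's estimate in polar coordinates *)

Section Integrals.
Context {R : realType}.
Implicit Types (f g : R -> R) (a b c s t x k m : R).

Definition intg a b f : R := (\int[lebesgue_measure]_(t in `[a, b]) f t)%R.

Definition cont_on a b f := forall t, a <= t <= b -> {for t, continuous f}.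

Lemma cont_onW a b c d f : a <= c -> d <= b -> cont_on a b f -> cont_on c d f.
Proof. by move=> ac db cf t /andP[ct td]; apply: cf; rlra. Qed.

Lemma cont_on_within a b f : cont_on a b f -> {within `[a, b], continuous f}.
Proof.
move=> cf; apply: continuous_in_subspaceT => t /set_mem /=.
by rewrite in_itv /=; exact: cf.
Qed.

Lemma cont_on_integrable a b f : cont_on a b f ->
  lebesgue_measure.-integrable `[a, b] (EFin \o f).
Proof.
move=> cf; apply: continuous_compact_integrable; first exact: segment_compact.
exact: cont_on_within.
Qed.

Lemma intD a b f g : cont_on a b f -> cont_on a b g ->
  intg a b (fun t => f t + g t) = intg a b f + intg a b g.
Proof.
by move=> cf cg; apply: RintegralD; [exact: measurable_itv|exact: cont_on_integrable|exact: cont_on_integrable].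
Qed.

Lemma intZ a b k f : cont_on a b f -> intg a b (fun t => k * f t) = k * intg a b f.
Proof.
by move=> cf; apply: RintegralZl; [exact: measurable_itv|exact: cont_on_integrable].
Qed.

Lemma le_int a b f g : cont_on a b f -> cont_on a b g ->
  (forall t, a <= t <= b -> f t <= g t) -> intg a b f <= intg a b g.
Proof.
move=> cf cg fg; apply: le_Rintegral;
  [exact: measurable_itv|exact: cont_on_integrable|exact: cont_on_integrable|].
by move=> t /=; rewrite in_itv /=; exact: fg.
Qed.

Lemma eq_int a b f g : (forall t, a <= t <= b -> f t = g t) -> intg a b f = intg a b g.
Proof. by move=> fg; apply: eq_Rintegral => t /set_mem /=; rewrite in_itv /= => /fg. Qed.

Lemma cont_cst a b k : cont_on a b (fun=> k).
Proof. by move=> t _; exact: cvg_cst. Qed.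

Lemma contD a b f g : cont_on a b f -> cont_on a b g -> cont_on a b (fun t => f t + g t).
Proof. by move=> cf cg t tab; apply: cvgD; [exact: cf|exact: cg]. Qed.

Lemma contM a b f g : cont_on a b f -> cont_on a b g -> cont_on a b (fun t => f t * g t).
Proof. by move=> cf cg t tab; apply: cvgM; [exact: cf|exact: cg]. Qed.

Lemma contZ a b k f : cont_on a b f -> cont_on a b (fun t => k * f t).
Proof. by move=> cf; apply: contM => //; exact: cont_cst. Qed.

Lemma int_ge0 a b f : (forall t, a <= t <= b -> 0 <= f t) -> 0 <= intg a b f.
Proof. by move=> f0; apply: Rintegral_ge0 => t /=; rewrite in_itv /=; exact: f0. Qed.

Lemma int_FTC2 a b (F f : R -> R) : a <= b -> cont_on a b f ->
  (forall t, a <= t <= b -> is_derive t 1 F (f t)) -> intg a b f = F b - F a.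
Proof.
rewrite le_eqVlt => /predU1P[<- _ _|ab cf dF].
  by rewrite /intg set_itv1 Rintegral_set1 subrr.
rewrite /intg /Rintegral (@continuous_FTC2 _ f F a b) //.
- exact: cont_on_within.
- split.
  + by move=> t; rewrite in_itv /= => /andP[t1 t2]; apply: dder (dF t _); rlra.
  + by apply: cvg_at_right_filter; apply: (dcont (dF a _)); rewrite lexx ltW.
  + by apply: cvg_at_left_filter; apply: (dcont (dF b _)); rewrite lexx ltW.
- move=> t; rewrite in_itv /= => /andP[t1 t2]; rewrite derive1E.
  by apply: dval; apply: dF; rlra.
Qed.

Lemma int_FTC1 a b f x : cont_on a b f -> a < x -> x < b ->
  is_derive x 1 (fun y => intg a y f) (f x).
Proof.
move=> cf ax xb.
have xab : a <= x <= b by rewrite !ltW.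
have [d1 d2] := continuous_FTC1_closed xb (cont_on_integrable cf) ax (cf x xab).
by rewrite -d2 derive1E; exact: derivableP.
Qed.

Lemma dint a b (F G : R -> R -> R) (s0 r K : R) : 0 < r ->
  (forall s t, `|s - s0| < r -> a <= t <= b ->
     is_derive s 1 (F ^~ t) (G s t) /\ `|G s t| <= K) ->
  (forall s, `|s - s0| < r -> cont_on a b (F s)) ->
  is_derive s0 1 (fun s => intg a b (F s)) (intg a b (G s0)).
Proof.
move=> r0 dF cF.
have [ab|ba] := leP a b; last first.
  have E f : intg a b f = 0.
    rewrite /intg (_ : `[a, b]%classic = set0) ?Rintegral_set0 //.
    by rewrite set_itv_ge // bnd_simp -ltNge.
  have -> : (fun s => intg a b (F s)) = (fun=> 0) by apply/funext => s; rewrite E.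
  by rewrite E; exact: dcst.
have I0 : `]s0 - r, s0 + r[%classic s0 by rewrite /= in_itv /=; rlra.
have II s : `]s0 - r, s0 + r[%classic s -> `|s - s0| < r.
  by rewrite /= in_itv /= ltr_norml; rlra.
have K0 : 0 <= K.
  have h0 : `|s0 - s0| < r by rewrite subrr normr0.
  have ha : a <= a <= b by rewrite lexx.
  by apply: le_trans (dF s0 a h0 ha).2.
have h1 s : `]s0 - r, s0 + r[%classic s ->
    lebesgue_measure.-integrable `[a, b] (EFin \o F s).
  by move=> /II/cF; exact: cont_on_integrable.
have h2 s t : `]s0 - r, s0 + r[%classic s -> `[a, b]%classic t -> derivable (F^~ t) s 1.
  by move=> /II h /=; rewrite in_itv /= => /(dF _ _ h)[] /dder.
have h3 : lebesgue_measure.-integrable `[a, b] (EFin \o (fun _ : R => K)).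
  by apply: cont_on_integrable; exact: cont_cst.
have h4 s t : `]s0 - r, s0 + r[%classic s -> `[a, b]%classic t ->
    `|partial1of2 F s t| <= K.
  move=> /II h /=; rewrite in_itv /= => /(dF _ _ h)[d1 d2].
  by rewrite partial1of2E (dval d1).
have mB : measurable (`[a, b]%classic : set (measurableTypeR R)) by exact: measurable_itv.
have D := derivable_under_integral mB I0 h1 h2 (G := fun=> K) (fun=> K0) h3 h4.
have E := differentiation_under_integral mB I0 h1 h2 (G := fun=> K) (fun=> K0) h3 h4.
have -> : intg a b (G s0) = (fun s => intg a b (F s))^`()%classic s0.
  rewrite E; apply: eq_int => t tab; rewrite partial1of2E.
  by have [d1 _] := dF s0 t (II _ I0) tab; rewrite (dval d1).
by rewrite derive1E; exact: derivableP.
Qed.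

Lemma derive0_const (F : R -> R) a b : (forall t, a <= t <= b -> is_derive t 1 F 0) -> a <= b -> F b = F a.
Proof.
move=> dF ab; have := @mvt_affine R F (fun=> 0) 0 0 a b.
rewrite (min_idPl ab) (max_idPr ab) !mul0r subr0 => H.
have D s : a <= s <= b -> is_derive s 1 F 0 /\ `|0 : R| <= 0.
  by move=> /dF ds; rewrite normr0.
by have := H D; rewrite subr0 normr_le0 subr_eq0 => /eqP.
Qed.

(** As a function of its left end, the integral over a window of one period has derivative
    [f (t + T) - f t = 0]. *)
Lemma int_periodic f (T : R) : 0 <= T -> continuous f -> (forall t, f (t + T) = f t) ->
  forall a, 0 <= a -> intg a (a + T) f = intg 0 T f.
Proof.
move=> T0 cf per a a0.
have C x y : cont_on x y f by move=> t _; exact: cf.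
(* Starting at -1 makes this primitive differentiable at 0 too. *)
pose P x := intg (-1) x f.
have dP x : -1 < x -> is_derive x 1 P (f x).
  by move=> x1; apply: (@int_FTC1 (-1) (x + 1)) => //; rlra.
have E x y : 0 <= x -> x <= y -> intg x y f = P y - P x.
  by move=> x0 xy; apply: int_FTC2 => // t /andP[t1 _]; apply: dP; rlra.
rewrite !E //; last rlra.
suff D t : 0 <= t <= a -> is_derive t 1 (fun x => P (x + T) - P x) 0.
  by have := derive0_const D a0; rewrite add0r.
move=> /andP[t0 ta]; have -> : 0 = 1 * f (1 * t + T) - f t by rewrite !mul1r per subrr.
apply: dB; last by apply: dP; rlra.
have := @is_derive_affine R P t (f (1 * t + T)) 1 T (dP _ _).
under eq_fun do rewrite mul1r.
by apply; rlra.
Qed.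

Lemma derivable_cont_on a b f f' : (forall t, a <= t <= b -> is_derive t 1 f (f' t)) -> cont_on a b f.
Proof. by move=> df t /df; exact: dcont. Qed.

Lemma dtan x : cos x != 0 -> is_derive x 1 (@tan R) (1 + tan x ^+ 2).
Proof. by move=> cx; rewrite -(cos2_tan2 cx); exact: is_derive_tan. Qed.

(* With [c = - k tan (k (t - t1))], which solves [c' + c^2 = - k^2], one has
   [f'^2 - k^2 f^2 = (f' - c f)^2 + (c f^2)']. *)
Lemma wirtinger_window k f f' a : 0 < k -> k * pi < pi / 2 ->
  (forall t, is_derive t 1 f (f' t)) -> continuous f' ->
  f a = 0 -> f (a + 2 * pi) = 0 ->
  k ^+ 2 * intg a (a + 2 * pi) (fun t => f t ^+ 2) <=
    intg a (a + 2 * pi) (fun t => f' t ^+ 2).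
Proof.
move=> k0 kpi df cf' fa fb.
have pi0 := pi_gt0 R.
pose c t := - k * tan (k * t + - (k * (a + pi))).
have cos0 t : a <= t <= a + 2 * pi -> cos (k * t + - (k * (a + pi))) != 0.
  move=> /andP[t1 t2]; rewrite gt_eqF // cos_gt0_pihalf //.
  have -> : k * t + - (k * (a + pi)) = k * (t - (a + pi)) by ring.
  have h1 : - (k * pi) <= k * (t - (a + pi)) by rewrite -mulrN ler_pM2l //; rlra.
  have h2 : k * (t - (a + pi)) <= k * pi by rewrite ler_pM2l //; rlra.
  rlra.
have dc t : a <= t <= a + 2 * pi -> is_derive t 1 c (- k ^+ 2 - c t ^+ 2).
  move=> ht; have := dZ (- k) (is_derive_affine (dtan (cos0 t ht))).
  by rewrite (_ : - k * (k * _) = - k ^+ 2 - c t ^+ 2) // /c; ring.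
pose g t := (- k ^+ 2 - c t ^+ 2) * f t ^+ 2 + c t * (2 * f t * f' t).
have dg t : a <= t <= a + 2 * pi -> is_derive t 1 (fun s => c s * f s ^+ 2) (g t).
  by move=> ht; apply: dM; [exact: dc|exact: dsqr].
have Cf : cont_on a (a + 2 * pi) f by apply: derivable_cont_on => t _; exact: df.
have Cf' : cont_on a (a + 2 * pi) f' by move=> t _; exact: cf'.
have Cc : cont_on a (a + 2 * pi) c by exact: derivable_cont_on dc.
have Csq h : cont_on a (a + 2 * pi) h -> cont_on a (a + 2 * pi) (fun t => h t ^+ 2).
  by move=> ch; have := contM ch ch; under eq_fun do rewrite -expr2.
have Cg : cont_on a (a + 2 * pi) g.
  apply: contD; last by apply: contM => //; apply: contM => //; apply: contZ.
  apply: contM; last exact: Csq.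
  by apply: contD; [exact: cont_cst|move=> t ht; apply: cvgN; exact: (Csq c)].
have : intg a (a + 2 * pi) g = 0.
  by rewrite (int_FTC2 _ Cg dg) ?fa ?fb ?expr0n ?mulr0 ?subrr //; rlra.
move=> I0; rewrite -[leLHS]addr0 -I0 -intZ; last exact: Csq.
rewrite -intD //; [|by apply: contZ; exact: Csq].
apply: le_int; [by apply: contD => //; apply: contZ; exact: Csq|exact: Csq|].
move=> t _; rewrite /g.
have : 0 <= (f' t - c t * f t) ^+ 2 by exact: sqr_ge0.
nra.
Qed.

(** A periodic function with one zero is a function vanishing at both ends of a window of length
    [2 pi], whose first Dirichlet eigenvalue is 1/4; hence every [k < 1/2] is allowed. The pointwise
    bound integrates [2 f f' <= f^2 + f'^2] from the zero. *)
Lemma wirtinger k f f' a : 0 < k -> k * pi < pi / 2 ->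
  (forall t, is_derive t 1 f (f' t)) -> continuous f' ->
  (forall t, f (t + 2 * pi) = f t) -> (forall t, f' (t + 2 * pi) = f' t) ->
  0 <= a -> f a = 0 ->
  k ^+ 2 * intg 0 (2 * pi) (fun t => f t ^+ 2) <= intg 0 (2 * pi) (fun t => f' t ^+ 2) /\
  forall t, a <= t <= a + 2 * pi ->
    f t ^+ 2 <= (1 + (k ^+ 2)^-1) * intg 0 (2 * pi) (fun t => f' t ^+ 2).
Proof.
move=> k0 kpi df cf' per per' a0 fa.
have pi0 := pi_gt0 R.
have fb : f (a + 2 * pi) = 0 by rewrite per.
have csq (h : R -> R) : continuous h -> continuous (fun t => h t ^+ 2).
  by move=> ch t; under eq_fun do rewrite expr2; apply: cvgM; exact: ch.
have cf : continuous f by move=> t; exact: (dcont (df t)).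
have E (h : R -> R) : continuous h -> (forall t, h (t + 2 * pi) = h t) ->
    intg a (a + 2 * pi) (fun t => h t ^+ 2) = intg 0 (2 * pi) (fun t => h t ^+ 2).
  move=> ch hp; apply: int_periodic => //; [by rlra|exact: csq|].
  by move=> t; rewrite hp.
have W := wirtinger_window k0 kpi df cf' fa fb.
rewrite !E // in W; split => // t /andP[t1 t2].
have C x y h : continuous h -> cont_on x y h by move=> ch z _; exact: ch.
have : intg a t (fun s => 2 * f s * f' s) = f t ^+ 2.
  have D s : a <= s <= t -> is_derive s 1 (fun s => f s ^+ 2) (2 * f s * f' s).
    by move=> _; exact: dsqr.
  have C2 : cont_on a t (fun s => 2 * f s * f' s).
    by apply: contM; [apply: contZ|]; exact: C.
  by rewrite (int_FTC2 t1 C2 D) fa expr0n subr0.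
move=> <-.
have k20 : 0 < k ^+ 2 by rewrite exprn_gt0.
pose w s := f s ^+ 2 + f' s ^+ 2.
have cw : continuous w by move=> s; apply: cvgD; exact: csq.
pose P x := intg (a - 1) x w.
have dP x : a - 1 < x -> is_derive x 1 P (w x).
  by move=> x1; apply: (@int_FTC1 _ (x + 1)) => //; [exact: C|rlra].
have PE x y : a <= x -> x <= y -> intg x y w = P y - P x.
  by move=> x1 xy; apply: int_FTC2 => //; [exact: C|move=> s /andP[s1 _]; apply: dP; rlra].
apply: (@le_trans _ _ (intg a t w)).
  apply: le_int; [by apply: contM; [apply: contZ|]; exact: C|exact: C|].
  by move=> s _; rewrite /w; have := sqr_ge0 (f s - f' s); nra.
apply: (@le_trans _ _ (intg a (a + 2 * pi) w)).
  rewrite !PE //; [|rlra].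
  have : 0 <= intg t (a + 2 * pi) w by apply: int_ge0 => s _; rewrite addr_ge0 // sqr_ge0.
  by rewrite PE //; rlra.
rewrite intD; [|exact: C (csq _ cf)|exact: C (csq _ cf')].
rewrite !E // [leRHS]mulrDl mul1r addrC lerD2l.
by rewrite [leRHS]mulrC ler_pdivlMr // [leLHS]mulrC.
Qed.

End Integrals.

(** * Carleman's differential inequality in logarithmic polar coordinates *)

Section Carleman.
Context {R : realType}.
Variables (W Ws Wt Wss Wtt : R -> R -> R) (L k : R).
Hypotheses (k0 : 0 < k) (kpi : k * pi < pi / 2).
Hypothesis dW : forall s t, s < L ->
  [/\ is_derive s 1 (W ^~ t) (Ws s t), is_derive s 1 (Ws ^~ t) (Wss s t),
      is_derive t 1 (W s) (Wt s t) & is_derive t 1 (Wt s) (Wtt s t)].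
Hypothesis cW : forall s, s < L ->
  [/\ continuous (Ws s), continuous (Wss s) & continuous (Wtt s)].
Hypothesis bW : forall s0, s0 < L -> exists r K : R, 0 < r /\
  forall s t, `|s - s0| < r -> 0 <= t <= 2 * pi ->
    [/\ s < L, `|W s t| <= K, `|Ws s t| <= K & `|Wss s t| <= K].
Hypothesis perW : forall s t, s < L -> W s (t + 2 * pi) = W s t.
Hypothesis perWt : forall s t, s < L -> Wt s (t + 2 * pi) = Wt s t.
Hypothesis W01 : forall s t, s < L -> 0 <= W s t <= 1.
Hypothesis subW : forall s t, s < L -> 0 <= W s t * (Wss s t + Wtt s t).
Hypothesis zeroW : forall s, s < L -> exists2 a : R, 0 <= a <= 2 * pi & W s a = 0.

(** Here [s] is the logarithm of the radius and [t] the angle. The derivative of [m] is [2 n], that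
    of [n] is [n'], and Carleman's inequality is [2 k n <= n']. *)
Let I (f : R -> R) := intg 0 (2 * pi) f.
Let m s := I (fun t => W s t ^+ 2).
Let n s := I (fun t => W s t * Ws s t).
Let n' s := I (fun t => Ws s t ^+ 2 + W s t * Wss s t).

Let pi0 := pi_gt0 R.
Let tp : 0 <= 2 * (pi : R).
Proof. by rewrite mulr_ge0 // ltW. Qed.

Let contW s : s < L -> continuous (W s).
Proof. by move=> sL t; have [_ _ d _] := dW t sL; exact: (dcont d). Qed.

Let contWt s : s < L -> continuous (Wt s).
Proof. by move=> sL t; have [_ _ _ d] := dW t sL; exact: (dcont d). Qed.

Let cM (f g : R -> R) : continuous f -> continuous g -> continuous (fun t => f t * g t).
Proof. by move=> cf cg t; apply: cvgM; [exact: cf|exact: cg]. Qed.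

Let cD (f g : R -> R) : continuous f -> continuous g -> continuous (fun t => f t + g t).
Proof. by move=> cf cg t; apply: cvgD; [exact: cf|exact: cg]. Qed.

Let cS (f : R -> R) : continuous f -> continuous (fun t => f t ^+ 2).
Proof. by move=> cf t; under eq_fun do rewrite expr2; exact: cM. Qed.

Let cO a b (f : R -> R) : continuous f -> cont_on a b f.
Proof. by move=> cf t _; exact: cf. Qed.

Let dm s : s < L -> is_derive s 1 m (2 * n s).
Proof.
move=> sL; have [r [K [r0 HK]]] := bW sL.
rewrite /n /I -intZ; last by apply: cO; apply: cM; [exact: contW|case: (cW sL)].
apply: (@dint _ _ _ (fun s t => W s t ^+ 2) (fun s t => 2 * (W s t * Ws s t)) s r (2 * K ^+ 2)) => //.
  move=> x t xs tpi; have [xL K1 K2 K3] := HK _ _ xs tpi.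
  have [d1 _ _ _] := dW t xL; split; first by rewrite mulrA; exact: (dsqr d1).
  by rewrite normrM normrM ger0_norm // ler_pM2l // expr2 ler_pM.
move=> x xs; apply: cO; apply: cS; apply: contW.
have h0 : 0 <= (0 : R) <= 2 * pi by rewrite lexx tp.
by have [] := HK x 0 xs h0.
Qed.

Let dn s : s < L -> is_derive s 1 n (n' s).
Proof.
move=> sL; have [r [K [r0 HK]]] := bW sL.
apply: (@dint _ _ _ (fun s t => W s t * Ws s t) (fun s t => Ws s t ^+ 2 + W s t * Wss s t) s r (K ^+ 2 + K ^+ 2)) => //.
  move=> x t xs tpi; have [xL K1 K2 K3] := HK _ _ xs tpi.
  have [d1 d2 _ _] := dW t xL; split; first by rewrite expr2; exact: (dM d1 d2).
  apply: le_trans (ler_normD _ _) _; rewrite !expr2 !normrM.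
  by apply: lerD; rewrite ler_pM.
move=> x xs; have h0 : 0 <= (0 : R) <= 2 * pi by rewrite lexx tp.
have [xL _ _ _] := HK x 0 xs h0.
by apply: cO; apply: cM; [exact: contW|case: (cW xL)].
Qed.

(** Subharmonicity replaces [W Wss] by [- W Wtt], and integration by parts over a period turns this
    into [Wt^2]. *)
Let n'_ge s : s < L -> I (fun t => Ws s t ^+ 2) + I (fun t => Wt s t ^+ 2) <= n' s.
Proof.
move=> sL; have [c1 c2 c3] := cW sL.
have cw := contW sL; have cwt := contWt sL.
have z : I (fun t => Wt s t * Wt s t + W s t * Wtt s t) = 0.
  have C : cont_on 0 (2 * pi) (fun t => Wt s t * Wt s t + W s t * Wtt s t).
    by apply: cO; apply: cD; apply: cM.
  have D t : 0 <= t <= 2 * pi ->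
      is_derive t 1 (fun t => W s t * Wt s t) (Wt s t * Wt s t + W s t * Wtt s t).
    by move=> _; have [_ _ d1 d2] := dW t sL; exact: (dM d1 d2).
  by rewrite /I (int_FTC2 tp C D) -(add0r (2 * pi)) perW // perWt // subrr.
have -> : I (fun t => Wt s t ^+ 2) = - I (fun t => W s t * Wtt s t).
  have := z; rewrite /I intD; try by apply: cO; apply: cM.
  by under eq_int do rewrite -expr2; move=> /eqP; rewrite addr_eq0 => /eqP.
rewrite /n' /I intD; [|by apply: cO; exact: cS|by apply: cO; exact: cM].
rewrite lerD2l lerNl -subr_ge0 opprK -intD; try by apply: cO; apply: cM.
by apply: int_ge0 => t _; rewrite -mulrDr addrC subW.
Qed.

Let wirt s : s < L -> k ^+ 2 * m s <= I (fun t => Wt s t ^+ 2) /\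
  forall t, 0 <= t <= 2 * pi -> W s t ^+ 2 <= (1 + (k ^+ 2)^-1) * I (fun t => Wt s t ^+ 2).
Proof.
move=> sL; have [a /andP[a0 a2] Wa] := zeroW sL.
have [w1 w2] := @wirtinger _ k (W s) (Wt s) a k0 kpi (fun t => let: And4 _ _ d _ := dW t sL in d)
  (contWt sL) (fun t => perW t sL) (fun t => perWt t sL) a0 Wa.
split => // t /andP[t0 t2].
have [ta|ta] := leP a t; first by apply: w2; lra.
by rewrite -perW //; apply: w2; lra.
Qed.

Let nI s : s < L -> I (fun t => Wt s t ^+ 2) <= n' s.
Proof.
move=> sL; apply: le_trans (n'_ge sL); rewrite lerDr.
by apply: int_ge0 => t _; exact: sqr_ge0.
Qed.

(** Wirtinger bounds the integral of [Wt^2] below by [k^2 m], and [Ws^2 + k^2 W^2 >= 2 k W Ws]. *)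
Let n'_growth s : s < L -> 2 * k * n s <= n' s.
Proof.
move=> sL; apply: le_trans (n'_ge sL); have [w _] := wirt sL.
have [c1 c2 c3] := cW sL; have cw := contW sL.
apply: (@le_trans _ _ (I (fun t => Ws s t ^+ 2) + k ^+ 2 * m s)); last by rewrite lerD2l.
rewrite /m /n /I -!intZ; [|by apply: cO; exact: cS|by apply: cO; exact: cM].
rewrite -intD; [|by apply: cO; exact: cS|by apply: contZ; apply: cO; exact: cS].
apply: le_int.
- by apply: contZ; apply: cO; exact: cM.
- by apply: contD; [apply: cO; exact: cS|apply: contZ; apply: cO; exact: cS].
- move=> t _; have := sqr_ge0 (Ws s t - k * W s t); nra.
Qed.

Let mvtL (f f' : R -> R) x y : x < y -> y < L -> (forall s, s < L -> is_derive s 1 f (f' s)) ->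
  exists2 z, x <= z <= y & f y - f x = f' z * (y - x).
Proof.
move=> xy yL df; have [c cx E] : exists2 c, c \in `]x, y[ & f y - f x = f' c * (y - x).
  apply: MVT => // [s|].
    by rewrite in_itv /= => /andP[s1 s2]; apply: df; lra.
  apply: derivable_within_continuous => s; rewrite in_itv /= => /andP[s1 s2].
  by apply: (dder (df _ _)); lra.
by exists c => //; move: cx; rewrite in_itv /= => /andP[c1 c2]; lra.
Qed.

Let n'_ge0 s : s < L -> 0 <= n' s.
Proof. by move=> sL; apply: le_trans (nI sL); apply: int_ge0 => t _; exact: sqr_ge0. Qed.

Let n_nd x y : x <= y -> y < L -> n x <= n y.
Proof.
rewrite le_eqVlt => /predU1P[->//|xy] yL.
have [z /andP[z1 z2] E] := mvtL xy yL dn.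
have : 0 <= n' z * (y - x) by rewrite mulr_ge0 ?n'_ge0 //; lra.
by rewrite -E; lra.
Qed.

Let m_le s : s < L -> 0 <= m s <= 2 * pi.
Proof.
move=> sL; apply/andP; split; first by apply: int_ge0 => t _; exact: sqr_ge0.
have -> : 2 * pi = intg 0 (2 * pi) (fun=> 1 : R).
  have D (t : R) : 0 <= t <= 2 * pi -> is_derive t 1 (fun s : R => s) 1.
    by move=> _; exact: did.
  by rewrite (int_FTC2 tp (@cont_cst _ 0 (2 * pi) 1) D) subr0.
apply: le_int; [by apply: cO; apply: cS; exact: contW|exact: cont_cst|].
by move=> t _; have /andP[w0 w1] := W01 t sL; rewrite expr_le1.
Qed.

(** Since [n] is nondecreasing, a negative value at [s] would bound the slope of [m] above by
    [2 n s < 0] on the whole half line to the left, and [m] would exceed its bound [2 pi] at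
    [s - d]. *)
Let n_ge0 s : s < L -> 0 <= n s.
Proof.
move=> sL; rewrite leNgt; apply/negP => n0.
pose d := (2 * pi + 1) / (- n s).
have d0 : 0 < d by apply: divr_gt0; move: pi0 n0; lra.
have ds : s - d < s by lra.
have [z /andP[z1 z2] E] := mvtL ds sL dm.
have zL : z < L by lra.
have nz : n z <= n s by exact: n_nd.
have /andP[m1 m2] := m_le sL; have /andP[m3 m4] : 0 <= m (s - d) <= 2 * pi by apply: m_le; lra.
have nd : n s * d = - (2 * pi + 1) by rewrite /d; field; lra.
have : n z * d <= n s * d by rewrite ler_pM2r.
lra.
Qed.

Let n_exp x y : x <= y -> y < L -> n x <= n y * expR (- (2 * k * (y - x))).
Proof.
rewrite le_eqVlt => /predU1P[-> _|xy yL]; first by rewrite subrr mulr0 oppr0 expR0 mulr1.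
have d s : s < L -> is_derive s 1 (fun s => n s * expR (- (2 * k) * s + 0))
    ((n' s - 2 * k * n s) * expR (- (2 * k) * s + 0)).
  move=> sL; have := dM (dn sL) (is_derive_affine (k := - (2 * k)) (c := 0) (is_derive_expR (- (2 * k) * s + 0))).
  by congr (is_derive _ _ _ _); ring.
have [z /andP[z1 z2] E] := mvtL xy yL d.
have zL : z < L by lra.
have : 0 <= (n' z - 2 * k * n z) * expR (- (2 * k) * z + 0) * (y - x).
  by rewrite !mulr_ge0 ?expR_ge0 ?subr_ge0 ?n'_growth // ltW.
rewrite -E subr_ge0 !addr0 => H.
have -> : - (2 * k * (y - x)) = - (2 * k) * y + 2 * k * x by ring.
rewrite expRD mulrA -ler_pdivrMr ?expR_gt0 // -expRN.
by rewrite -mulNr.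
Qed.

(** [m <= 2 pi] on [[L - 2, L - 1]] forces [n (L - 2) <= pi], and [n_exp] carries this down to
    [s + 1] with exponential gain. Somewhere in [[s, s + 1]] the derivative [n'] is at most
    [n (s + 1)], and there it controls the supremum of [W^2] over the circle. *)
Lemma carleman_polar s : s < L - 3 -> exists2 x, s <= x <= s + 1 &
  forall t, 0 <= t <= 2 * pi ->
    W x t ^+ 2 <= (1 + (k ^+ 2)^-1) * (pi * expR (- (2 * k * (L - 3 - s)))).
Proof.
move=> sL.
have s1 : s < s + 1 by lra.
have s1L : s + 1 < L by lra.
have [x /andP[x1 x2] E] := mvtL s1 s1L dn.
exists x; first by rewrite x1 x2.
move=> t tpi; have xL : x < L by lra.
apply: le_trans ((wirt xL).2 t tpi) _.
rewrite ler_pM2l; last by rewrite ltr_pwDl // invr_ge0 sqr_ge0.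
apply: le_trans (nI xL) _.
have ns := @n_ge0 s _.
apply: (@le_trans _ _ (n (s + 1))).
  have : 0 <= n s by apply: n_ge0; lra.
  by move: E; rewrite (_ : s + 1 - s = 1); [lra|ring].
have h1 : s + 1 <= L - 2 by lra.
have h2 : L - 2 < L by lra.
apply: le_trans (n_exp h1 h2) _.
have -> : L - 2 - (s + 1) = L - 3 - s by ring.
rewrite ler_pM2r ?expR_gt0 //.
have h3 : L - 2 < L - 1 by lra.
have h4 : L - 1 < L by lra.
have [z /andP[z1 z2] Ez] := mvtL h3 h4 dm.
have nz : n (L - 2) <= n z by apply: n_nd => //; lra.
have /andP[m1 m2] := m_le h2; have /andP[m3 m4] := m_le h4.
by move: Ez; rewrite (_ : L - 1 - (L - 2) = 1); [lra|ring].
Qed.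

End Carleman.

(** * Angles and winding numbers of polygons *)

Section Angles.
Context {R : realType}.
Implicit Types (a b c p q : R * R) (x y t : R).

Definition cross a b : R := a.1 * b.2 - a.2 * b.1.
Definition nrm a : R := Num.sqrt (a.1 ^+ 2 + a.2 ^+ 2).

Lemma nrm_ge0 a : 0 <= nrm a. Proof. exact: sqrtr_ge0. Qed.

Lemma nrm_sqr a : nrm a ^+ 2 = a.1 ^+ 2 + a.2 ^+ 2.
Proof. by rewrite sqr_sqrtr // addr_ge0 // sqr_ge0. Qed.

Lemma nrm_eq0 a : nrm a = 0 -> a = 0.
Proof.
move=> a0; have := nrm_sqr a; rewrite a0 expr0n /= => /eqP; rewrite eq_sym.
rewrite paddr_eq0 ?sqr_ge0 // !sqrf_eq0 => /andP[/eqP a1 /eqP a2].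
by case: a a1 a2 {a0} => u v /= -> ->.
Qed.

Lemma nrm0 : nrm 0 = 0.
Proof. by rewrite /nrm /= !expr0n /= addr0 sqrtr0. Qed.

Lemma lagrange2 a b : dot2 a b ^+ 2 + cross a b ^+ 2 = (nrm a * nrm b) ^+ 2.
Proof. by rewrite exprMn !nrm_sqr /dot2 /cross; ring. Qed.

Lemma nrmM_ge0 a b : 0 <= nrm a * nrm b.
Proof. by rewrite mulr_ge0 ?nrm_ge0. Qed.

Lemma dot_le a b : `|dot2 a b| <= nrm a * nrm b.
Proof.
rewrite -(ger0_norm (nrmM_ge0 a b)) -ler_sqr ?nnegrE ?normr_ge0 //.
by rewrite !real_normK ?num_real // -lagrange2 lerDl sqr_ge0.
Qed.

Lemma cross_le a b : `|cross a b| <= nrm a * nrm b.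
Proof.
rewrite -(ger0_norm (nrmM_ge0 a b)) -ler_sqr ?nnegrE ?normr_ge0 //.
by rewrite !real_normK ?num_real // -lagrange2 lerDr sqr_ge0.
Qed.

Lemma nrm_triangle a b : nrm (a + b) <= nrm a + nrm b.
Proof.
rewrite -ler_sqr ?nnegrE ?nrm_ge0 ?addr_ge0 ?nrm_ge0 //.
have -> : nrm (a + b) ^+ 2 = nrm a ^+ 2 + nrm b ^+ 2 + 2 * dot2 a b.
  by rewrite !nrm_sqr /dot2 /=; ring.
have := le_trans (ler_norm _) (dot_le a b).
nra.
Qed.

Lemma nrmN a : nrm (- a) = nrm a.
Proof. by rewrite /nrm /= !sqrrN. Qed.

Lemma nrmZ x a : nrm (x *: a) = `|x| * nrm a.
Proof. by rewrite /nrm /= !exprMn -mulrDr sqrtrM ?sqr_ge0 // sqrtr_sqr. Qed.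

Lemma nrm_dist2 a b : dist2 a b = nrm (a - b).
Proof. by []. Qed.

Lemma nrm_ge1 a : `|a.1| <= nrm a.
Proof. by rewrite -(sqrtr_sqr a.1) ler_wsqrtr // lerDl sqr_ge0. Qed.

Lemma nrm_ge2 a : `|a.2| <= nrm a.
Proof. by rewrite -(sqrtr_sqr a.2) ler_wsqrtr // lerDr sqr_ge0. Qed.

Lemma nrm_le12 a : nrm a <= `|a.1| + `|a.2|.
Proof.
rewrite -ler_sqr ?nnegrE ?nrm_ge0 ?addr_ge0 // nrm_sqr.
rewrite sqrrD !real_normK ?num_real // lerD2r lerDl mulrn_wge0 // mulr_ge0 //.
Qed.

(** Both vectors are nonzero and they do not point in opposite directions; this is also the
    positivity of the denominator in [ang]. *)
Definition nonopp a b : Prop := 0 < nrm a * nrm b + dot2 a b.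

Lemma nonopp_cross a b : cross a b != 0 -> nonopp a b.
Proof.
move=> c0; have : 0 < cross a b ^+ 2 by rewrite lt_def sqrf_eq0 c0 sqr_ge0.
have := lagrange2 a b; have := nrmM_ge0 a b; rewrite /nonopp; nra.
Qed.

Lemma nonopp_seg a b : ~ segment2 a b 0 -> nonopp a b.
Proof.
move=> H; rewrite /nonopp lt_neqAle; apply/andP; split; last first.
  by have := dot_le a b; rewrite ler_norml => /andP[]; rlra.
apply/eqP => E; apply: H.
have [a0|a0] := eqVneq (nrm a) 0.
  exists 0; first by rewrite /= in_itv /= lexx ler01.
  by rewrite (nrm_eq0 a0) scaler0 scale0r addr0.
have ap : 0 < nrm a by rewrite lt_def a0 nrm_ge0.
have bp := nrm_ge0 b.
have abn : nrm a + nrm b != 0 by rewrite gt_eqF //; rlra.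
exists (nrm a / (nrm a + nrm b)).
  rewrite /= in_itv /=; apply/andP; split; first by rewrite divr_ge0 //; rlra.
  by rewrite ler_pdivrMr; rlra.
apply: nrm_eq0; apply/eqP; rewrite -sqrf_eq0 nrm_sqr.
apply/eqP.
have -> : 1 - nrm a / (nrm a + nrm b) = nrm b / (nrm a + nrm b) by field.
rewrite /= /GRing.scale /=.
have -> : (nrm b / (nrm a + nrm b) * a.1 + nrm a / (nrm a + nrm b) * b.1) ^+ 2 +
  (nrm b / (nrm a + nrm b) * a.2 + nrm a / (nrm a + nrm b) * b.2) ^+ 2 =
  (nrm b ^+ 2 * (a.1 ^+ 2 + a.2 ^+ 2) + nrm a ^+ 2 * (b.1 ^+ 2 + b.2 ^+ 2) +
   2 * (nrm a * nrm b) * dot2 a b) / (nrm a + nrm b) ^+ 2 by rewrite /dot2; field.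
rewrite -!nrm_sqr.
have -> : dot2 a b = - (nrm a * nrm b) by rlra.
by rewrite (_ : _ + _ = 0) ?mul0r //; ring.
Qed.

(** The signed angle from [a] to [b], by the half-angle formula [tan (x / 2) = sin x / (1 + cos x)]:
    a single formula with values in the open interval from [- pi] to [pi], continuous wherever
    [nonopp] holds. *)
Definition ang a b : R := 2 * atan (cross a b / (nrm a * nrm b + dot2 a b)).

Lemma cos_sin_ang a b : nonopp a b ->
  nrm a * nrm b * cos (ang a b) = dot2 a b /\ nrm a * nrm b * sin (ang a b) = cross a b.
Proof.
rewrite /nonopp /ang; set N := nrm a * nrm b; set d := dot2 a b; set c := cross a b => Nd.
have L : d ^+ 2 + c ^+ 2 = N ^+ 2 by exact: lagrange2.
have N0 : 0 <= N by exact: nrmM_ge0.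
have Np : 0 < N.
  rewrite lt_def N0 andbT; apply/eqP => Nz; move: L Nd; rewrite Nz expr0n /= add0r => L dp.
  by have := sqr_ge0 c; nra.
set T := c / (N + d).
have c2 : cos (atan T) ^+ 2 = (1 + T ^+ 2)^-1.
  by rewrite cos_atan exprVn sqr_sqrtr // addr_ge0 // sqr_ge0.
have T2 : 1 + T ^+ 2 = 2 * N / (N + d).
  have -> : 1 + T ^+ 2 = ((N ^+ 2 - d ^+ 2) + (N + d) ^+ 2) / (N + d) ^+ 2.
    by rewrite -L /T; field; rlra.
  by field; rlra.
have cn0 : cos (atan T) != 0 by apply/eqP => z; move: c2; rewrite z expr0n /= T2 => /eqP; rewrite eq_sym invr_eq0 mulf_eq0 invr_eq0; apply/negP; rewrite negb_or mulf_eq0 negb_or pnatr_eq0 /=; apply/andP; split; rlra.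
have st : sin (atan T) = T * cos (atan T) by rewrite -{2}(atanK T) /tan mulfVK.
rewrite mulr_natl cos_mulr2n sin_mulr2n st.
have -> : (cos (atan T) * (T * cos (atan T))) *+ 2 = 2 * T * cos (atan T) ^+ 2 by rewrite -mulr_natl; ring.
rewrite -mulr_natl c2 T2 /T; split; first by field; rlra.
by field; rlra.
Qed.

Lemma ang_lt a b : `|ang a b| < pi.
Proof.
have := @atan_gtNpi2 R (cross a b / (nrm a * nrm b + dot2 a b)).
have := @atan_ltpi2 R (cross a b / (nrm a * nrm b + dot2 a b)).
by rewrite /ang ltr_norml => h1 h2; apply/andP; split; rlra.
Qed.

Lemma angC a b : ang b a = - ang a b.
Proof.
rewrite /ang -mulrN -atanN -mulNr; congr (2 * atan (_ / _)); rewrite /cross /dot2; ring.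
Qed.

Lemma ang_id a : ang a a = 0.
Proof. by rewrite /ang /cross (mulrC a.2) subrr mul0r atan0 mulr0. Qed.

Lemma atan_le (x : R) : `|atan x| <= `|x|.
Proof.
have := @mvt_affine R atan (fun s => (1 + s ^+ 2)^-1) 0 1 0 x.
rewrite atan0 !subr0 mul0r subr0 mul1r; apply=> s _; split.
  by have := @derivable_atan R s => /derivableP; rewrite -derive1E derive1_atan.
rewrite subr0 ger0_norm ?invr_ge0 ?addr_ge0 ?sqr_ge0 // invf_le1 ?lerDl ?sqr_ge0 //.
by rewrite ltr_pwDl // sqr_ge0.
Qed.

(** The denominator in [ang] is at least [|a|^2], and its numerator equals [cross a (b - a)]. *)
Lemma ang_small a b : 0 < nrm a -> 4 * nrm (b - a) <= nrm a ->
  nonopp a b /\ `|ang a b| <= 2 * (nrm (b - a) / nrm a).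
Proof.
move=> a0 h.
have E : dot2 a b = nrm a ^+ 2 + dot2 a (b - a) by rewrite nrm_sqr /dot2 /=; ring.
have F : cross a b = cross a (b - a) by rewrite /cross /=; ring.
have := dot_le a (b - a); rewrite ler_norml => /andP[h1 _].
have h2 : nrm a * nrm (b - a) * 4 <= nrm a ^+ 2.
  by rewrite expr2 -mulrA ler_pM2l // mulrC.
have h3 : 3 / 4 * nrm a ^+ 2 <= dot2 a b by rewrite E; rlra.
have a2 : 0 < nrm a ^+ 2 by rewrite exprn_gt0.
have h4 : nrm a ^+ 2 <= nrm a * nrm b + dot2 a b.
  have := le_trans (ler_norm _) (dot_le a b); rlra.
split; first by rewrite /nonopp; rlra.
rewrite /ang normrM ger0_norm // ler_pM2l //.
apply: le_trans (atan_le _) _.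
rewrite normrM F normfV [`|nrm a * _ + _|]gtr0_norm; last by rlra.
rewrite ler_pdivrMr; last by rlra.
apply: le_trans (cross_le _ _) _.
rewrite mulrC -mulrA ler_wpM2l ?nrm_ge0 //.
rewrite mulrC ler_pdivlMr // -expr2; exact: h4.
Qed.

Lemma cos1_eq0 x : cos x = 1 -> `|x| < 2 * pi -> x = 0.
Proof.
wlog x0 : x / 0 <= x.
  move=> H cx xp; have [x0|x0] := leP 0 x; first exact: H.
  by apply/eqP; rewrite -oppr_eq0; apply/eqP; apply: H; rewrite ?cosN ?normrN //; rlra.
move=> cx; rewrite ger0_norm // => xp; apply/eqP; rewrite eq_le x0 andbT leNgt.
apply/negP => xpos.
have : 0 < sin (x / 2) by apply: sin_gt0_pi; apply/andP; split; rlra.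
have : cos x = 1 - 2 * sin (x / 2) ^+ 2.
  rewrite (_ : x = (x / 2) *+ 2); last by rewrite -mulr_natl; field.
  rewrite cos_mulr2n cos2sin2 -mulr_natl (_ : ((x / 2) *+ 2) / 2 = x / 2); last by rewrite -mulr_natl; field.
  ring.
rewrite cx; nra.
Qed.

(* [P] is a polygonal path with vertices [P 0, .., P n], and [turn p P n] is the
   total angle under which it is seen from [p]. *)
Definition turn p (P : nat -> R * R) n : R := \sum_(i < n) ang (P i - p) (P i.+1 - p).

Definition avoids p (P : nat -> R * R) n : Prop :=
  forall i, (i < n)%N -> nonopp (P i - p) (P i.+1 - p).

Lemma nonopp_gt0 a b : nonopp a b -> 0 < nrm a /\ 0 < nrm b.
Proof.
rewrite /nonopp => H; have := le_trans (ler_norm _) (dot_le a b) => H2.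
have N : 0 < nrm a * nrm b by rlra.
by split; rewrite lt_def nrm_ge0 andbT; apply/eqP => z; move: N; rewrite z ?mul0r ?mulr0 ltxx.
Qed.

(** Angles add up like arguments of complex products; the induction step is multiplied by the
    squared length of the middle vector, through which the product passes. *)
Lemma cos_sin_turn p P n : avoids p P n -> (0 < n)%N ->
  nrm (P 0%N - p) * nrm (P n - p) * cos (turn p P n) = dot2 (P 0%N - p) (P n - p) /\
  nrm (P 0%N - p) * nrm (P n - p) * sin (turn p P n) = cross (P 0%N - p) (P n - p).
Proof.
elim: n => // n IH av _.
have av' : avoids p P n by move=> i ni; apply: av; rewrite ltnS ltnW.
have [c1 s1] := cos_sin_ang (av n (ltnSn n)).
have [p1 p2] := nonopp_gt0 (av n (ltnSn n)).
case: n => [|n] in IH av av' c1 s1 p1 p2 *; first by rewrite /turn big_ord_recr big_ord0 /= add0r.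
have [c2 s2] := IH av' isT.
rewrite /turn big_ord_recr /= -/(turn p P n.+1) cosD sinD.
set C := cos (turn _ _ _) in c2 *; set S := sin (turn _ _ _) in s2 *.
set C' := cos (ang _ _) in c1 *; set S' := sin (ang _ _) in s1 *.
set u := P 0%N - p in c2 s2 *; set v := P n.+1 - p in c1 s1 c2 s2 p1 *; set w := P n.+2 - p in c1 s1 p2 *.
have v2 : nrm v ^+ 2 != 0 by rewrite expf_eq0 /= gt_eqF.
split; apply: (mulfI v2).
- have -> : nrm v ^+ 2 * (nrm u * nrm w * (C * C' - S * S')) =
    (nrm u * nrm v * C) * (nrm v * nrm w * C') - (nrm u * nrm v * S) * (nrm v * nrm w * S') by ring.
  by rewrite c1 c2 s1 s2 nrm_sqr /dot2 /cross; ring.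
- have -> : nrm v ^+ 2 * (nrm u * nrm w * (S * C' + C * S')) =
    (nrm u * nrm v * S) * (nrm v * nrm w * C') + (nrm u * nrm v * C) * (nrm v * nrm w * S') by ring.
  by rewrite c1 c2 s1 s2 nrm_sqr /dot2 /cross; ring.
Qed.

Lemma turn_closed p P n : avoids p P n -> P n = P 0%N -> cos (turn p P n) = 1 /\ sin (turn p P n) = 0.
Proof.
case: n => [|n] av E; first by rewrite /turn big_ord0 cos0 sin0.
have [c s] := cos_sin_turn av isT; rewrite E in c s.
have [p0 _] := nonopp_gt0 (av 0%N isT).
have p2 : nrm (P 0%N - p) * nrm (P 0%N - p) != 0 by rewrite mulf_neq0 // gt_eqF.
split; apply: (mulfI p2).
  by rewrite c mulr1 -expr2 nrm_sqr /dot2; ring.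
by rewrite s mulr0 /cross; ring.
Qed.

(** For a closed polygon both numbers are multiples of [2 pi]. *)
Lemma turn_eq p q P n : avoids p P n -> avoids q P n -> P n = P 0%N ->
  `|turn p P n - turn q P n| < 2 * pi -> turn p P n = turn q P n.
Proof.
move=> ap aq E lt; have [c1 s1] := turn_closed ap E; have [c2 s2] := turn_closed aq E.
apply/eqP; rewrite -subr_eq0; apply/eqP; apply: cos1_eq0 => //.
by rewrite cosB c1 c2 s1 s2; ring.
Qed.

Lemma turn_eq0 p P n : avoids p P n -> P n = P 0%N -> `|turn p P n| < 2 * pi -> turn p P n = 0.
Proof. by move=> ap E; apply: cos1_eq0; case: (turn_closed ap E). Qed.

End Angles.

(** * Winding numbers: constancy off the polygon and the jump across an edge *)

Section Winding.
Context {R : realType}.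
Implicit Types (a b c p q : R * R) (x y t : R) (P : nat -> R * R) (A : set (R * R)).

Lemma continuous_nrm_shift a p : {for p, continuous (fun q => nrm (a - q))}.
Proof.
apply/continuous_box => e e0; exists (e / 2) => [|q [q1 q2]]; first by rewrite divr_gt0.
have H (u v : R * R) : nrm u - nrm v <= nrm (u - v).
  by have := nrm_triangle (u - v) v; rewrite subrK; rlra.
have E : nrm (q - p) < e by apply: le_lt_trans (nrm_le12 _) _; move: q1 q2 => /=; rlra.
have h1 := H (a - q) (a - p); have h2 := H (a - p) (a - q).
rewrite (_ : a - q - (a - p) = - (q - p)) ?nrmN in h1; last by rewrite !opprB addrC addrA subrK.
rewrite (_ : a - p - (a - q) = q - p) in h2; last by rewrite opprB addrC addrA subrK.
by rewrite ltr_norml; apply/andP; split; rlra.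
Qed.

Lemma continuous_sub1 a p : {for p, continuous (fun q : R * R => (a - q).1)}.
Proof. by apply: cvgB; [exact: cvg_cst|exact: cvg_fst]. Qed.

Lemma continuous_sub2 a p : {for p, continuous (fun q : R * R => (a - q).2)}.
Proof. by apply: cvgB; [exact: cvg_cst|exact: cvg_snd]. Qed.

Lemma continuous_den a b p :
  {for p, continuous (fun q => nrm (a - q) * nrm (b - q) + dot2 (a - q) (b - q))}.
Proof.
apply: cvgD; first by apply: cvgM; exact: continuous_nrm_shift.
by apply: cvgD; apply: cvgM; (exact: continuous_sub1 || exact: continuous_sub2).
Qed.

Lemma continuous_ang a b p : nonopp (a - p) (b - p) ->
  {for p, continuous (fun q => ang (a - q) (b - q))}.
Proof.
move=> no; apply: cvgM; first exact: cvg_cst.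
apply: (@continuous_comp _ _ _ (fun q => cross (a - q) (b - q) /
  (nrm (a - q) * nrm (b - q) + dot2 (a - q) (b - q)))); last exact: continuous_atan.
apply: cvgM; last by apply: cvgV; [rewrite gt_eqF|exact: continuous_den].
by apply: cvgB; apply: cvgM; (exact: continuous_sub1 || exact: continuous_sub2).
Qed.

Lemma near_nonopp a b p : nonopp (a - p) (b - p) ->
  exists2 d : R, 0 < d & forall q, box p d q -> nonopp (a - q) (b - q).
Proof.
move=> no; have /continuous_box/(_ _ no)[d d0 Hd] := @continuous_den a b p.
exists d => // q /Hd; rewrite ltr_norml /nonopp => /andP[h1 h2].
by move: h1; rewrite ltrBrDr addrC subrr.
Qed.

Lemma continuous_turn P n p : avoids p P n -> {for p, continuous (fun q => turn q P n)}.
Proof.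
elim: n => [|n IH] av.
  have -> : (fun q => turn q P 0) = (fun=> 0) by apply/funext => q; rewrite /turn big_ord0.
  exact: cvg_cst.
have -> : (fun q => turn q P n.+1) = (fun q => turn q P n + ang (P n - q) (P n.+1 - q)).
  by apply/funext => q; rewrite /turn big_ord_recr.
apply: cvgD; first by apply: IH => i ni; apply: av; rewrite ltnS ltnW.
exact: continuous_ang (av n (ltnSn n)).
Qed.

(** A continuous function with values in the multiples of [2 pi] cannot vary on a connected set. *)
Lemma turn_const A P n : connected A -> (forall p, A p -> avoids p P n) -> P n = P 0%N ->
  forall p q, A p -> A q -> turn p P n = turn q P n.
Proof.
move=> cA avA E p q Ap Aq.
have pi0 := pi_gt0 R.
wlog pq : p q Ap Aq / turn p P n <= turn q P n.
  by move=> H; have [h|/ltW h] := leP (turn p P n) (turn q P n); [|symmetry]; exact: H.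
have [lt|ge] := ltP (turn q P n - turn p P n) (2 * pi).
  by apply: turn_eq => //; [exact: avA|exact: avA|rewrite distrC ger0_norm // subr_ge0].
have ci : connected [set turn z P n | z in A].
  apply: connected_continuous_connected => //.
  apply: continuous_in_subspaceT => z /set_mem Az.
  exact: continuous_turn (avA _ Az).
move/connected_intervalP: ci => ci.
(* If the values at [p] and [q] differ by at least [2 pi], the value half a turn above the smaller
   one is attained at some [r]; there [turn_eq] forces equality with the value at [p]. *)
have [r Ar rE] : [set turn z P n | z in A] (turn p P n + pi).
  apply: (ci (turn p P n) (turn q P n)); [by exists p|by exists q|].
  by apply/andP; split; rlra.
have : turn p P n = turn r P n.
  by apply: turn_eq => //; [exact: avA|exact: avA|rewrite rE ltr_norml; apply/andP; split; rlra].
rewrite rE; rlra.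
Qed.

Lemma continuous_sum (I : Type) (r : seq I) (B : pred I) (F : I -> R * R -> R) p :
  (forall i, B i -> {for p, continuous (F i)}) ->
  {for p, continuous (fun q => \sum_(i <- r | B i) F i q)}.
Proof.
move=> cF; elim: r => [|i r IH].
  have -> : (fun q => \sum_(i <- [::] | B i) F i q) = (fun=> 0).
    by apply/funext => q; rewrite big_nil.
  exact: cvg_cst.
have [Bi|nBi] := boolP (B i); last first.
  have -> : (fun q => \sum_(i <- i :: r | B i) F i q) = (fun q => \sum_(i <- r | B i) F i q).
    by apply/funext => q; rewrite big_cons (negPf nBi).
  exact: IH.
have -> : (fun q => \sum_(i <- i :: r | B i) F i q) = (fun q => F i q + \sum_(i <- r | B i) F i q).
  by apply/funext => q; rewrite big_cons Bi.
by apply: cvgD => //; exact: cF.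
Qed.

Lemma ang_gt_pihalf a b : 0 < cross a b -> dot2 a b < 0 -> pi / 2 < ang a b.
Proof.
move=> c0 d0; have no : nonopp a b by apply: nonopp_cross; rewrite gt_eqF.
rewrite /ang; have N := nrmM_ge0 a b; have L := lagrange2 a b.
rewrite /nonopp in no.
have : 1 < cross a b / (nrm a * nrm b + dot2 a b).
  rewrite ltr_pdivlMr // mul1r -ltr_sqr ?nnegrE; [|rlra|rlra].
  nra.
move/lt_atan; rewrite atan1; rlra.
Qed.

(** Near an interior point [m] of edge [k] the other angles together vary by less than [pi], while
    that of the edge exceeds [pi / 2] on its left and is below [- pi / 2] on its right. The
    difference lies strictly between 0 and [3 pi] and is a multiple of [2 pi]. *)
Lemma turn_jump P n k m : (k < n)%N -> P n = P 0%N ->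
  (exists2 t, 0 < t < 1 & m = (1 - t) *: P k + t *: P k.+1) -> P k <> P k.+1 ->
  (forall i, (i < n)%N -> i != k -> nonopp (P i - m) (P i.+1 - m)) ->
  exists2 d : R, 0 < d & forall p q, box m d p -> box m d q ->
    0 < cross (P k.+1 - P k) (p - P k) -> cross (P k.+1 - P k) (q - P k) < 0 ->
    turn p P n = turn q P n + 2 * pi.
Proof.
move=> kn E [t /andP[t0 t1] mE] ab avm.
have pi0 := pi_gt0 R.
set a := P k in mE ab *; set b := P k.+1 in mE ab *.
pose oth q := \sum_(i < n | i != Ordinal kn) ang (P i - q) (P i.+1 - q).
have coth : {for m, continuous oth}.
  apply: continuous_sum => i ik; apply: continuous_ang; exact: avm.
have dE (q : R * R) : q = m -> dot2 (a - q) (b - q) < 0.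
  move=> ->; have -> : dot2 (a - m) (b - m) = - (t * (1 - t) * nrm (b - a) ^+ 2).
    by rewrite nrm_sqr mE /dot2 /= /GRing.scale /=; ring.
  rewrite oppr_lt0; apply: mulr_gt0; first by rewrite mulr_gt0 // subr_gt0.
  rewrite exprn_gt0 // lt_def nrm_ge0 andbT.
  by apply/eqP => /nrm_eq0 /eqP; rewrite subr_eq0 => /eqP ba; apply: ab.
have cdot : {for m, continuous (fun q => dot2 (a - q) (b - q))}.
  by apply: cvgD; apply: cvgM; (exact: continuous_sub1 || exact: continuous_sub2).
have dm : 0 < - dot2 (a - m) (b - m) by rewrite oppr_gt0; exact: dE.
have /continuous_box/(_ _ dm)[d1 d10 H1] := cdot.
have p20 : 0 < pi / 2 :> R by rewrite divr_gt0.
have /continuous_box/(_ _ p20)[d2 d20 H2] := coth.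
have [d3 d30 H3] : exists2 d : R, 0 < d & forall q, box m d q ->
    forall i, (i < n)%N -> i != k -> nonopp (P i - q) (P i.+1 - q).
  have : forall j, (j <= n)%N -> exists2 d : R, 0 < d & forall q, box m d q ->
    forall i, (i < j)%N -> i != k -> nonopp (P i - q) (P i.+1 - q).
    elim=> [_|j IH jn]; first by exists 1.
    have [d d0 Hd] := IH (ltnW jn).
    have [jk|jk] := eqVneq j k.
      exists d => // q /Hd H i; rewrite ltnS leq_eqVlt => /predU1P[->|]; last exact: H.
      by rewrite jk eqxx.
    have [d' d'0 Hd'] := near_nonopp (avm j jn jk).
    exists (Num.min d d'); first by rewrite lt_min d0.
    move=> q [q1 q2]; rewrite !lt_min in q1 q2.
    move: q1 q2 => /andP[q1 q1'] /andP[q2 q2'] i.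
    rewrite ltnS leq_eqVlt => /predU1P[-> _|]; first by apply: Hd'.
    by apply: Hd.
  by move/(_ n (leqnn n)).
pose d := Num.min d1 (Num.min d2 d3).
have bd q : box m d q -> [/\ box m d1 q, box m d2 q & box m d3 q].
  by move=> [q1 q2]; rewrite /d !lt_min in q1 q2;
     move: q1 q2 => /and3P[? ? ?] /and3P[? ? ?]; split.
exists d; first by rewrite !lt_min d10 d20.
move=> p q /bd[p1 p2 p3] /bd[q1 q2 q3].
have cE z : cross (a - z) (b - z) = cross (b - a) (z - a) by rewrite /cross /=; ring.
rewrite -!cE => cp cq.
have TE z : turn z P n = ang (a - z) (b - z) + oth z.
  by rewrite /turn (bigD1 (Ordinal kn)).
have avz z : box m d3 z -> cross (a - z) (b - z) != 0 -> avoids z P n.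
  move=> bz cz i ni; have [->|ik] := eqVneq i k; first exact: nonopp_cross.
  exact: H3.
have avp : avoids p P n by apply: avz; rewrite ?gt_eqF.
have avq : avoids q P n by apply: avz; rewrite ?lt_eqF.
have [c1 s1] := turn_closed avp E; have [c2 s2] := turn_closed avq E.
have hp := H1 _ p1; have hq := H1 _ q1.
rewrite ltr_norml in hp; rewrite ltr_norml in hq.
have ap : pi / 2 < ang (a - p) (b - p) by apply: ang_gt_pihalf => //; rlra.
have aq : pi / 2 < ang (b - q) (a - q).
  apply: ang_gt_pihalf; first by have := cq; rewrite /cross; rlra.
  have -> : dot2 (b - q) (a - q) = dot2 (a - q) (b - q) by rewrite /dot2; ring.
  rlra.
rewrite angC in aq.
have := H2 _ p2; have := H2 _ q2; rewrite !ltr_norml => /andP[w1 w2] /andP[w3 w4].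
have := ang_lt (a - p) (b - p); have := ang_lt (a - q) (b - q).
rewrite !ltr_norml => /andP[l1 l2] /andP[l3 l4].
apply/eqP; rewrite -subr_eq0 opprD addrA; apply/eqP; apply: cos1_eq0; last first.
  by rewrite !TE ltr_norml; apply/andP; split; rlra.
by rewrite (_ : 2 * pi = pi *+ 2) ?mulr_natl // cosB cos2pi sin2pi cosB c1 c2 s1 s2; ring.
Qed.

End Winding.

(** * Circles around a point outside a simply connected domain *)

Section CirclesHitComplement.
Context {R : realType}.
Implicit Types (p q z : R * R) (Om : set (R * R)).

Let sq : set (R * R) := `[0, 1]%classic `*` `[0, 1]%classic.

Lemma compact_unif_continuous (K : set (R * R)) (f : R * R -> R) : compact K ->
  {within K, continuous f} -> forall e, 0 < e ->
  exists2 d : R, 0 < d & forall p q, K p -> K q -> box p d q -> `|f q - f p| < e.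
Proof.
move=> cK /within_continuous_box cf e e0.
have e20 : 0 < e / 2 by rewrite divr_gt0.
pose Pr (d : R) (p : R * R) : Prop := K p -> forall q, K q -> box p d q -> `|f q - f p| < e.
have [d d0 Hd] : exists2 d : R, 0 < d & forall p, K p -> Pr d p; last first.
  by exists d => // p q Kp Kq; exact: Hd.
have : \forall d \near 0^'+, forall p, K p -> Pr d p.
  apply: ((compact_near_coveringP K).1 cK) => p Kp.
  have [d d0 Hd] := cf p Kp _ e20.
  exists ([set p' | box p (d / 2) p'], [set d' : R | d' < d / 2]).
    split => /=; first by apply/nbhs_box; exists (d / 2) => //; rewrite divr_gt0.
    by apply: nbhs_right_lt; rewrite divr_gt0.
  move=> [p' d'] /= [[b1 b2] dd'] Kp' q Kq [c1 c2].
  have h1 : `|f p' - f p| < e / 2 by apply: Hd => //; split; rlra.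
  have h2 : `|f q - f p| < e / 2.
    apply: Hd => //; split.
      by have := ler_normD (q.1 - p'.1) (p'.1 - p.1); rewrite addrA subrK; rlra.
    by have := ler_normD (q.2 - p'.2) (p'.2 - p.2); rewrite addrA subrK; rlra.
  have := ler_normB (f q - f p) (f p' - f p).
  by rewrite opprB addrA subrK; rlra.
move=> H; near (0 : R)^'+ => d; exists d; first by near: d; exact: nbhs_right_gt.
by near: d.
Unshelve. all: by end_near. Qed.

Lemma ang_small_step z a b : 0 < nrm (a - z) -> 8 * nrm (b - a) <= nrm (a - z) ->
  nonopp (a - z) (b - z) /\ `|ang (a - z) (b - z)| <= 1 / 4.
Proof.
move=> a0 h; have E : b - z - (a - z) = b - a by rewrite opprB addrA subrK.
have n0 := nrm_ge0 (b - a).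
have h4 : 4 * nrm (b - z - (a - z)) <= nrm (a - z) by rewrite E; rlra.
have [no l] := ang_small a0 h4; split => //; apply: le_trans l _.
rewrite E; have : nrm (b - a) / nrm (a - z) <= 1 / 8 by rewrite ler_pdivrMr //; rlra.
rlra.
Qed.

(** Each grid cell is a closed quadrilateral whose four angles are at most 1/4, so its winding
    number is 0. Summed over a row, the contributions of the vertical sides telescope. *)
Lemma turn_rows (H : nat -> nat -> R * R) z n i :
  (forall j, (j <= n)%N -> [/\ 0 < nrm (H i j - z), 0 < nrm (H i.+1 j - z) &
     8 * nrm (H i.+1 j - H i j) <= nrm (H i j - z)]) ->
  (forall j, (j < n)%N -> 8 * nrm (H i j.+1 - H i j) <= nrm (H i j - z) /\
     8 * nrm (H i.+1 j.+1 - H i.+1 j) <= nrm (H i.+1 j - z)) ->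
  H i n = H i 0%N -> H i.+1 n = H i.+1 0%N ->
  turn z (H i) n = turn z (H i.+1) n.
Proof.
move=> Hv Hh E1 E2.
have pi2 := @pi_ge2 R.
pose v j := ang (H i j - z) (H i.+1 j - z).
have cell (j : 'I_n) : ang (H i j - z) (H i j.+1 - z) - ang (H i.+1 j - z) (H i.+1 j.+1 - z) =
    - (v j.+1 - v j).
  have [p1 p2 vj] := Hv j (ltnW (ltn_ord j)).
  have [p3 p4 vj1] := Hv j.+1 (ltn_ord j).
  have [hj hj'] := Hh j (ltn_ord j).
  have [n1 l1] := ang_small_step p1 hj.
  have [n2 l2] := ang_small_step p3 vj1.
  have [n3 l3] := ang_small_step p2 hj'.
  have [n4 l4] := ang_small_step p1 vj.
  have nC (a b : R * R) : nonopp a b -> nonopp b a.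
    by rewrite /nonopp mulrC (_ : dot2 a b = dot2 b a) // /dot2; ring.
  pose Q := nth (0 : R * R) [:: H i j; H i j.+1; H i.+1 j.+1; H i.+1 j; H i j].
  have : turn z Q 4 = 0.
    apply: turn_eq0 => //; first by case=> [|[|[|[|]]]] //= _; exact: nC.
    rewrite /turn !big_ord_recr big_ord0 /= add0r.
    rewrite (angC (H i.+1 j - z)) (angC (H i j - z) (H i.+1 j - z)).
    move: l1 l2 l3 l4; rewrite !ler_norml ltr_norml => /andP[? ?] /andP[? ?] /andP[? ?] /andP[? ?].
    by apply/andP; split; rlra.
  rewrite /turn !big_ord_recr big_ord0 /= add0r.
  rewrite (angC (H i.+1 j - z) (H i.+1 j.+1 - z)) (angC (H i j - z) (H i.+1 j - z)) /v.
  rlra.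
apply/eqP; rewrite -subr_eq0 /turn -sumrB (eq_bigr _ (fun j _ => cell j)).
rewrite sumrN oppr_eq0 -(big_mkord xpredT (fun j => v j.+1 - v j)).
by rewrite telescope_sumr // /v E1 E2 subrr.
Qed.

(** Otherwise the circle contracts inside [Om], which misses [z]. On a fine grid of the homotopy all
    rows have the same winding number around [z], but it is [2 pi] for the circle and 0 for the
    final constant loop. *)
Lemma circle_meets_complement Om z (rho : R) : simply_connected Om -> ~ Om z -> 0 < rho ->
  exists2 t : R, 0 <= t <= 2 * pi & ~ Om (z.1 + rho * cos t, z.2 + rho * sin t).
Proof.
move=> sOm nz rho0; apply: contrapT => none.
have pi0 := pi_gt0 R.
have inOm t : 0 <= t <= 2 * pi -> Om (z.1 + rho * cos t, z.2 + rho * sin t).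
  by move=> ht; apply: contrapT => nO; apply: none; exists t.
pose ga (u : R) : R * R := (z.1 + rho * cos (2 * pi * u), z.2 + rho * sin (2 * pi * u)).
have cga : {within `[0, 1]%classic, continuous ga}.
  apply: continuous_subspaceT => u.
  have cu : {for u, continuous (fun u : R => 2 * pi * u)}.
    by apply: cvgM; [exact: cvg_cst|exact: cvg_id].
  have c1 : {for u, continuous (fun u : R => z.1 + rho * cos (2 * pi * u))}.
    apply: cvgD; first exact: cvg_cst.
    apply: cvgM; first exact: cvg_cst.
    by apply: (@continuous_comp _ _ _ (fun u : R => 2 * pi * u)) => //; exact: continuous_cos.
  have c2 : {for u, continuous (fun u : R => z.2 + rho * sin (2 * pi * u))}.
    apply: cvgD; first exact: cvg_cst.
    apply: cvgM; first exact: cvg_cst.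
    by apply: (@continuous_comp _ _ _ (fun u : R => 2 * pi * u)) => //; exact: continuous_sin.
  exact: (cvg_pair c1 c2).
have ga01 : ga 0 = ga 1.
  by rewrite /ga mulr0 mulr1 cos0 sin0 (_ : 2 * pi = pi *+ 2) ?cos2pi ?sin2pi // mulr_natl.
have gaOm : ga @` `[0, 1]%classic `<=` Om.
  move=> y [u]; rewrite /= in_itv /= => /andP[u0 u1] <-; apply: inOm.
  by rewrite mulr_ge0 ?mulr_ge0 ?(ltW pi0) //= ler_piMr // mulr_ge0 // ltW.
have [H cH [H0 H1 H2 H3]] := sOm ga cga ga01 gaOm.
have sq0 : sq (0, 0) by split; rewrite /= in_itv /= lexx ler01.
have csq : compact sq by apply: compact_setX; exact: segment_compact.
have ccomp (g : R * R -> R) : continuous g -> {within sq, continuous (fun p => g (H p))}.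
  move=> cg; apply/subspace_continuousP => p sp.
  have /subspace_continuousP/(_ p sp) := cH.
  by move=> h; apply: (cvg_comp _ _ h); exact: cg.
have cnz : {within sq, continuous (fun p => - nrm (z - H p))}.
  by apply: (ccomp (fun q => - nrm (z - q))) => q; apply: cvgN; exact: continuous_nrm_shift.
have [p0 sp0 Hp0] := compact_max2 (ex_intro _ _ sq0) csq cnz.
pose de := nrm (z - H p0).
have de0 : 0 < de.
  rewrite lt_def nrm_ge0 andbT; apply/eqP => /nrm_eq0 /eqP; rewrite subr_eq0 => /eqP E.
  by apply: nz; rewrite E; apply: H3; exists p0.
have dist p : sq p -> de <= nrm (H p - z).
  by move=> /Hp0; rewrite lerN2 -(nrmN (z - H p)) opprB.
(* Two coordinates within [de / 16] give [8 |H q - H p| <= de], as [ang_small_step] asks. *)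
have e0 : 0 < de / 16 by rewrite divr_gt0.
have [d1 d10 U1] := compact_unif_continuous csq (ccomp fst (fun _ => cvg_fst)) e0.
have [d2 d20 U2] := compact_unif_continuous csq (ccomp snd (fun _ => cvg_snd)) e0.
pose d := Num.min d1 d2.
have d0 : 0 < d by rewrite lt_min d10.
have [N N2 Nd] : exists2 N, (1 < N)%N & N%:R^-1 < d.
  exists (Num.bound d^-1).+2 => //.
  rewrite invf_plt ?posrE //; apply: lt_trans (archi_boundP _) _; first by rewrite invr_ge0 ltW.
  by rewrite ltr_nat.
have N0 : 0 < N%:R :> R by rewrite ltr0n ltnW.
have step p q : sq p -> sq q -> box p d q -> 8 * nrm (H q - H p) <= de.
  move=> sp sq' [b1 b2]; rewrite !lt_min in b1 b2.
  move: b1 b2 => /andP[b11 b12] /andP[b21 b22].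
  have h1 := U1 p q sp sq' (conj b11 b21); have h2 := U2 p q sp sq' (conj b12 b22).
  have := nrm_le12 (H q - H p) => /=; rlra.
pose pt (i j : nat) : R * R := (i%:R / N%:R, j%:R / N%:R).
have sqpt i j : (i <= N)%N -> (j <= N)%N -> sq (pt i j).
  have h k : (k <= N)%N -> `[0, 1]%classic (k%:R / N%:R : R).
    by move=> kN; rewrite /= in_itv /= divr_ge0 //= ler_pdivrMr // mul1r ler_nat.
  by move=> iN jN; split; exact: h.
have inc (k : nat) : k.+1%:R / N%:R - k%:R / N%:R = N%:R^-1 :> R.
  by rewrite -mulrBl -natrB // subSnn mul1r.
have boxh i j : box (pt i j) d (pt i j.+1).
  by split; rewrite /= ?subrr ?normr0 // inc ger0_norm // invr_ge0 ltW.
have boxv i j : box (pt i j) d (pt i.+1 j).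
  by split; rewrite /= ?subrr ?normr0 // inc ger0_norm // invr_ge0 ltW.
pose HH i j := H (pt i j).
have close i : (i <= N)%N -> HH i N = HH i 0%N.
  move=> iN; rewrite /HH /pt divff ?gt_eqF // mul0r; symmetry; apply: H1.
  by have [] := sqpt i 0%N iN isT.
have row i : (i <= N)%N -> turn z (HH 0%N) N = turn z (HH i) N.
  elim: i => // i IH iN; rewrite IH; last exact: ltnW.
  apply: turn_rows; [|move=> j jN|exact/close/ltnW|exact: close].
    move=> j jN; have s1 := sqpt i j (ltnW iN) jN; have s2 := sqpt i.+1 j iN jN.
    split; [exact: lt_le_trans (dist _ s1)|exact: lt_le_trans (dist _ s2)|].
    exact: le_trans (step _ _ s1 s2 (boxv i j)) (dist _ s1).
  have s1 := sqpt i j (ltnW iN) (ltnW jN); have s2 := sqpt i j.+1 (ltnW iN) jN.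
  have s3 := sqpt i.+1 j iN (ltnW jN); have s4 := sqpt i.+1 j.+1 iN jN.
  split; first exact: le_trans (step _ _ s1 s2 (boxh i j)) (dist _ s1).
  exact: le_trans (step _ _ s3 s4 (boxh i.+1 j)) (dist _ s3).
have last0 : turn z (HH N) N = 0.
  rewrite /turn big1 // => j _; have e k : (k <= N)%N -> HH N k = H (1, 0).
    move=> kN; rewrite /HH /pt divff ?gt_eqF //; apply: H2.
    by have [] := sqpt 0%N k isT kN.
  by rewrite !e ?ang_id // ltnW.
have first2pi : turn z (HH 0%N) N = 2 * pi.
  rewrite /turn (eq_bigr (fun=> 2 * pi / N%:R)); last first.
    move=> j _.
    have s1 := sqpt 0%N j isT (ltnW (ltn_ord j)); have s2 := sqpt 0%N j.+1 isT (ltn_ord j).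
    have ge k : (k <= N)%N -> HH 0%N k = ga (k%:R / N%:R).
      by move=> kN; rewrite /HH /pt mul0r H0 //; have [] := sqpt 0%N k isT kN.
    have p1 : 0 < nrm (HH 0%N j - z) by exact: lt_le_trans (dist _ s1).
    have [no _] := ang_small_step p1 (le_trans (step _ _ s1 s2 (boxh 0%N j)) (dist _ s1)).
    have [c1 c2] := cos_sin_ang no.
    pose th := 2 * pi * (j%:R / N%:R) : R; pose hh := 2 * pi / N%:R : R.
    have ej : HH 0%N j - z = (rho * cos th, rho * sin th).
      by rewrite (ge _ (ltnW (ltn_ord j))) /ga -/th; congr (_, _) => /=; ring.
    have ej1 : HH 0%N j.+1 - z = (rho * cos (th + hh), rho * sin (th + hh)).
      have E : 2 * pi * (j.+1%:R / N%:R) = th + hh.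
        by rewrite /th /hh -natr1; field; rewrite gt_eqF.
      by rewrite (ge _ (ltn_ord j)) /ga E; congr (_, _) => /=; ring.
    have nr x : nrm (rho * cos x, rho * sin x) = rho.
      by rewrite /nrm /= !exprMn -mulrDr cos2Dsin2 mulr1 sqrtr_sqr gtr0_norm.
    rewrite ej ej1 !nr in c1 c2 *.
    set A := ang _ _ in c1 c2 *.
    have r2 : rho * rho != 0 by rewrite mulf_neq0 // gt_eqF.
    have t1 := cos2Dsin2 th.
    have cA : cos A = cos hh.
      apply: (mulfI r2); rewrite c1 /dot2 /= cosD sinD.
      have -> : rho * cos th * (rho * (cos th * cos hh - sin th * sin hh)) +
        rho * sin th * (rho * (sin th * cos hh + cos th * sin hh)) =
        rho * rho * (cos th ^+ 2 + sin th ^+ 2) * cos hh by ring.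
      by rewrite t1 mulr1.
    have sA : sin A = sin hh.
      apply: (mulfI r2); rewrite c2 /cross /= cosD sinD.
      have -> : rho * cos th * (rho * (sin th * cos hh + cos th * sin hh)) -
        rho * sin th * (rho * (cos th * cos hh - sin th * sin hh)) =
        rho * rho * (cos th ^+ 2 + sin th ^+ 2) * sin hh by ring.
      by rewrite t1 mulr1.
    have := ang_lt (rho * cos th, rho * sin th) (rho * cos (th + hh), rho * sin (th + hh)).
    rewrite -/A ltr_norml => /andP[A1 A2].
    have hh0 : 0 < hh by rewrite !mulr_gt0 // invr_gt0.
    (* This uses that there are at least two steps; beyond [pi] the angle [A], which is below [pi],
       would not be [hh] but [hh - 2 pi]. *)
    have hhpi : hh <= pi.
      rewrite /hh ler_pdivrMr // mulrC ler_pM2l //.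
      by rewrite ler_nat.
    apply/eqP; rewrite -subr_eq0; apply/eqP; apply: cos1_eq0.
      by rewrite cosB cA sA -!expr2 cos2Dsin2.
    by rewrite -/hh ltr_norml; apply/andP; split; rlra.
  by rewrite sumr_const card_ord -[LHS]mulr_natr divfK // gt_eqF.
have := row N (leqnn N); rewrite first2pi last0; rlra.
Qed.

End CirclesHitComplement.

(** * Boundary regularity in simply connected domains *)

Section C1Functions.
Context {R : realType}.
Implicit Types (p q z : R * R) (f g fx fy : R * R -> R) (U : set (R * R)).

Definition C1at p f fx fy :=
  [/\ is_derive p.1 1 (fun s => f (s, p.2)) (fx p),
      is_derive p.2 1 (fun s => f (p.1, s)) (fy p),
      {for p, continuous fx} & {for p, continuous fy}].

Lemma is_derive_eps (f : R -> R) (x a : R) :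
  (forall e, 0 < e -> exists2 d : R, 0 < d &
     forall t, t != 0 -> `|t| < d -> `|(f (x + t) - f x) / t - a| < e) ->
  is_derive x 1 f a.
Proof.
move=> H; have Hc : (fun h : R => h^-1 *: (f (h *: 1 + x) - f x)) @ 0^' --> a.
  apply/cvgrPdist_lt => e e0; have [d d0 Hd] := H e e0.
  exists d => // t; rewrite /ball_ /= sub0r normrN => td t0.
  by rewrite distrC /GRing.scale /= mulr1 mulrC [t + x]addrC; exact: Hd.
apply: DeriveDef; first by apply/cvg_ex; exists a.
exact/cvg_lim.
Qed.

Lemma eqbox_derive1 f g p (a e : R) : 0 < e -> (forall q, box p e q -> f q = g q) ->
  is_derive p.1 1 (fun s => f (s, p.2)) a -> is_derive p.1 1 (fun s => g (s, p.2)) a.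
Proof.
move=> e0 fg; apply: near_eq_is_derive; exists e => //= s se.
by apply: fg; split; rewrite /= ?subrr ?normr0 // distrC.
Qed.

Lemma eqbox_derive2 f g p (a e : R) : 0 < e -> (forall q, box p e q -> f q = g q) ->
  is_derive p.2 1 (fun s => f (p.1, s)) a -> is_derive p.2 1 (fun s => g (p.1, s)) a.
Proof.
move=> e0 fg; apply: near_eq_is_derive; exists e => //= s se.
by apply: fg; split; rewrite /= ?subrr ?normr0 // distrC.
Qed.

Lemma eqbox_continuous f g p (e : R) : 0 < e -> (forall q, box p e q -> f q = g q) ->
  {for p, continuous f} -> {for p, continuous g}.
Proof.
move=> e0 fg /continuous_box cf; apply/continuous_box => e1 e10.
have [d d0 Hd] := cf _ e10; exists (Num.min d e); first by rewrite lt_min d0.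
move=> q [q1 q2]; rewrite !lt_min in q1 q2.
move: q1 q2 => /andP[q1 q1'] /andP[q2 q2'].
rewrite -!fg; [by apply: Hd|by split; rewrite subrr normr0|by []].
Qed.

Lemma eqbox_C1 f fx fy g gx gy p (e : R) : 0 < e ->
  (forall q, box p e q -> [/\ f q = g q, fx q = gx q & fy q = gy q]) ->
  C1at p f fx fy -> C1at p g gx gy.
Proof.
move=> e0 H [d1 d2 c1 c2].
have bp : box p e p by split; rewrite subrr normr0.
have [_ ex ey] := H _ bp; rewrite /C1at -ex -ey.
split.
- by apply: (eqbox_derive1 e0) d1 => q /H[].
- by apply: (eqbox_derive2 e0) d2 => q /H[].
- by apply: (eqbox_continuous e0) c1 => q /H[].
- by apply: (eqbox_continuous e0) c2 => q /H[].
Qed.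

Lemma C1_cst p (k : R) : C1at p (fun=> k) (fun=> 0) (fun=> 0).
Proof. by split; [exact: dcst|exact: dcst|exact: cvg_cst|exact: cvg_cst]. Qed.

Lemma C1_near p f fx fy U : open U -> U p -> (forall q, U q -> C1at q f fx fy) ->
  forall e, 0 < e -> exists2 d : R, 0 < d & forall q, box p d q ->
    [/\ is_derive q.1 1 (fun s => f (s, q.2)) (fx q),
        is_derive q.2 1 (fun s => f (q.1, s)) (fy q), `|fx q - fx p| <= e & `|fy q - fy p| <= e].
Proof.
move=> oU Up H e e0; have [r r0 Hr] := open_box oU Up.
have [_ _ /continuous_box/(_ _ e0)[d1 d10 H1] /continuous_box/(_ _ e0)[d2 d20 H2]] := H _ Up.
exists (Num.min r (Num.min d1 d2)); first by rewrite !lt_min r0 d10.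
move=> q [q1 q2]; rewrite !lt_min in q1 q2.
move: q1 q2 => /and3P[a1 a2 a3] /and3P[b1 b2 b3].
have [h1 h2 _ _] := H q (Hr q (conj a1 b1)).
by split => //; apply: ltW; [apply: H1|apply: H2].
Qed.

Lemma C1_continuous p f fx fy U : open U -> U p -> (forall q, U q -> C1at q f fx fy) ->
  {for p, continuous f}.
Proof.
move=> oU Up H; apply/continuous_box => e e0.
have [d d0 Hd] := C1_near oU Up H ltr01.
have K := @rect_mvt R p d f fx fy (fx p) (fy p) 1 Hd p.
pose N := `|fx p| + `|fy p| + 2.
have N0 : 0 < N by have := normr_ge0 (fx p); have := normr_ge0 (fy p); rewrite /N; rlra.
have eN : 0 < e / (2 * N) by rewrite divr_gt0 // mulr_gt0.
exists (Num.min d (e / (2 * N))); first by rewrite lt_min d0.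
move=> q [q1 q2]; rewrite !lt_min in q1 q2.
move: q1 q2 => /andP[a1 a2] /andP[b1 b2].
have bp : box p d p by split; rewrite subrr normr0.
have := K q bp (conj a1 b1); rewrite mul1r => Kq.
rewrite ltr_pdivlMr ?mulr_gt0 // in a2; rewrite ltr_pdivlMr ?mulr_gt0 // in b2.
have t1 := ler_normD (f q - f p - (fx p * (q.1 - p.1) + fy p * (q.2 - p.2)))
  (fx p * (q.1 - p.1) + fy p * (q.2 - p.2)).
rewrite subrK in t1.
have t2 := ler_normD (fx p * (q.1 - p.1)) (fy p * (q.2 - p.2)); rewrite !normrM in t2.
have u1 := normr_ge0 (q.1 - p.1); have u2 := normr_ge0 (q.2 - p.2).
have v1 := normr_ge0 (fx p); have v2 := normr_ge0 (fy p).
rewrite /N in a2 b2; nra.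
Qed.

(** [rect_mvt] linearises [f] on a box with relative error [eta], and the difference quotients of
    [g1] and [g2] are within [eta] of their limits; [eta] is small against all the coefficients in
    [N]. *)
Lemma C1_chain p f fx fy U (g1 g2 : R -> R) (t a1 a2 : R) : open U ->
  (forall q, U q -> C1at q f fx fy) -> U (g1 t, g2 t) ->
  is_derive t 1 g1 a1 -> is_derive t 1 g2 a2 ->
  is_derive t 1 (fun s => f (g1 s, g2 s)) (fx (g1 t, g2 t) * a1 + fy (g1 t, g2 t) * a2).
Proof.
move=> oU H Up d1 d2; apply: is_derive_eps => e e0.
set q := (g1 t, g2 t).
pose N := `|fx q| + `|fy q| + `|a1| + `|a2| + 4.
have n1 := normr_ge0 (fx q); have n2 := normr_ge0 (fy q).
have n3 := normr_ge0 a1; have n4 := normr_ge0 a2.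
have N0 : 0 < N by rewrite /N; rlra.
pose eta := Num.min 1 (e / (2 * N)).
have eN : 0 < e / (2 * N) by rewrite divr_gt0 // mulr_gt0.
have eta0 : 0 < eta by rewrite lt_min ltr01.
have eta1 : eta <= 1 by rewrite ge_min lexx.
have eta2 : eta * (2 * N) <= e by rewrite -ler_pdivlMr ?mulr_gt0 // ge_min lexx orbT.
have [d d0 Hd] := C1_near oU Up H eta0.
have bq : box q d q by split; rewrite subrr normr0.
have K := @rect_mvt R q d f fx fy (fx q) (fy q) eta Hd q _ bq.
have [r1 r10 H1] := is_derive_epsP d1 eta0.
have [r2 r20 H2] := is_derive_epsP d2 eta0.
have /(@cvgrPdist_lt _ _ _ (nbhs t) _ g1 (g1 t))/(_ _ d0)[s1 /= s10 S1] := dcont d1.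
have /(@cvgrPdist_lt _ _ _ (nbhs t) _ g2 (g2 t))/(_ _ d0)[s2 /= s20 S2] := dcont d2.
exists (Num.min (Num.min r1 r2) (Num.min s1 s2)); first by rewrite !lt_min r10 r20 s10.
move=> h h0; rewrite !lt_min => /andP[/andP[h1 h2] /andP[h3 h4]].
have k1 := H1 h h0 h1; have k2 := H2 h h0 h2.
have b : box q d (g1 (t + h), g2 (t + h)).
  by split; rewrite /= distrC; [apply: S1|apply: S2]; rewrite /ball_ /= opprD addrA subrr sub0r normrN.
have := K _ b; rewrite /= => Kh.
set x1 := (g1 (t + h) - g1 t) / h in k1; set x2 := (g2 (t + h) - g2 t) / h in k2.
have e1 : g1 (t + h) - g1 t = x1 * h by rewrite /x1 divfK.
have e2 : g2 (t + h) - g2 t = x2 * h by rewrite /x2 divfK.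
rewrite e1 e2 (normrM x1) (normrM x2) in Kh.
have hp : 0 < `|h| by rewrite normr_gt0.
have {}Kh : `|(f (g1 (t + h), g2 (t + h)) - f q) / h - (fx q * x1 + fy q * x2)| <= eta * (`|x1| + `|x2|).
  have -> : (f (g1 (t + h), g2 (t + h)) - f q) / h - (fx q * x1 + fy q * x2) =
    (f (g1 (t + h), g2 (t + h)) - f q - (fx q * (x1 * h) + fy q * (x2 * h))) / h by field.
  rewrite normrM normfV ler_pdivrMr //; apply: le_trans Kh _.
  by rewrite -[leRHS]mulrA [in leRHS]mulrDl.
have t1 := ler_normD ((f (g1 (t + h), g2 (t + h)) - f q) / h - (fx q * x1 + fy q * x2))
  (fx q * (x1 - a1) + fy q * (x2 - a2)).
have t2 := ler_normD (fx q * (x1 - a1)) (fy q * (x2 - a2)); rewrite !normrM in t2.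
have -> : (f (g1 (t + h), g2 (t + h)) - f q) / h - (fx q * a1 + fy q * a2) =
  (f (g1 (t + h), g2 (t + h)) - f q) / h - (fx q * x1 + fy q * x2) + (fx q * (x1 - a1) + fy q * (x2 - a2)).
  by ring.
have t3 := ler_normD (x1 - a1) a1; have t4 := ler_normD (x2 - a2) a2.
rewrite !subrK in t3 t4.
apply: le_lt_trans t1 _; apply: lt_le_trans eta2.
have u1 : `|fx q| * `|x1 - a1| <= `|fx q| * eta by rewrite ler_wpM2l // ltW.
have u2 : `|fy q| * `|x2 - a2| <= `|fy q| * eta by rewrite ler_wpM2l // ltW.
have u3 : eta * (`|x1| + `|x2|) <= eta * (`|a1| + `|a2| + 2) by rewrite ler_pM2l //; rlra.
have u4 : eta * N * 1 < eta * N * 2 by rewrite ltr_pM2l ?mulr_gt0 // ltr1n.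
rewrite /N in u4 *; nra.
Qed.

Lemma partial1P f p : derivable f p (1, 0) ->
  is_derive p.1 1 (fun s => f (s, p.2)) ('D_(1, 0) f p).
Proof.
rewrite /derivable /derive => df.
have E : (fun h : R => h^-1 *: ((f \o shift p) (h *: (1, 0)) - f p)) =
  (fun h : R => h^-1 *: (((fun s => f (s, p.2)) \o shift p.1) (h *: 1) - f (p.1, p.2))).
  apply/funext => h; rewrite -surjective_pairing /=; congr (_ *: (f _ - _)).
  by apply: injective_projections => /=; rewrite /GRing.scale /= ?mulr0 ?add0r.
by rewrite E in df *; apply: DeriveDef.
Qed.

Lemma partial2P f p : derivable f p (0, 1) ->
  is_derive p.2 1 (fun s => f (p.1, s)) ('D_(0, 1) f p).
Proof.
rewrite /derivable /derive => df.
have E : (fun h : R => h^-1 *: ((f \o shift p) (h *: (0, 1)) - f p)) =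
  (fun h : R => h^-1 *: (((fun s => f (p.1, s)) \o shift p.2) (h *: 1) - f (p.1, p.2))).
  apply/funext => h; rewrite -surjective_pairing /=; congr (_ *: (f _ - _)).
  by apply: injective_projections => /=; rewrite /GRing.scale /= ?mulr0 ?add0r.
by rewrite E in df *; apply: DeriveDef.
Qed.

End C1Functions.

(** * A twice continuously differentiable substitute for the positive part *)

Section PositivePartCubed.
Context {R : realType}.
Implicit Types (t d : R).

Let pp t : R := Num.max t 0.

Lemma dpp_sq t : is_derive t 1 (fun s => pp s ^+ 2) (2 * pp t).
Proof.
have [t0|t0|->] := ltgtP t 0.
- rewrite /pp (max_r (ltW t0)) mulr0.
  have H : \forall s \near t, 0 = Num.max s 0 ^+ 2 :> R.
    exists (- t) => /= [|s]; first rlra.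
    by rewrite /ball_ /= ltr_norml => /andP[s1 s2]; rewrite max_r ?expr0n //; rlra.
  exact: (near_eq_is_derive H (dcst t 0)).
- rewrite /pp (max_l (ltW t0)); have := dsqr (did t); rewrite mulr1.
  apply: near_eq_is_derive.
  exists t => //= s; rewrite /ball_ /= ltr_norml => /andP[s1 s2].
  by rewrite max_l //; rlra.
- apply: is_derive_eps => e e0; exists e => // h h0 he.
  rewrite /pp maxxx mulr0 add0r expr0n /= !subr0.
  have [hp|hn] := leP 0 h.
    by rewrite expr2 mulfK.
  by rewrite expr0n /= mul0r normr0.
Qed.

Lemma dpp_cube t : is_derive t 1 (fun s => pp s ^+ 3) (3 * pp t ^+ 2).
Proof.
have [t0|t0|->] := ltgtP t 0.
- rewrite /pp (max_r (ltW t0)) expr0n mulr0.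
  have H : \forall s \near t, 0 = Num.max s 0 ^+ 3 :> R.
    exists (- t) => /= [|s]; first rlra.
    by rewrite /ball_ /= ltr_norml => /andP[s1 s2]; rewrite max_r ?expr0n //; rlra.
  exact: (near_eq_is_derive H (dcst t 0)).
- rewrite /pp (max_l (ltW t0)); have := dM (did t) (dsqr (did t)).
  have -> : 1 * t ^+ 2 + t * (2 * t * 1) = 3 * t ^+ 2 by ring.
  apply: near_eq_is_derive.
  exists t => //= s; rewrite /ball_ /= ltr_norml => /andP[s1 s2].
  by rewrite max_l -?exprS //; rlra.
- apply: is_derive_eps => e e0; exists (Num.min 1 e); first by rewrite lt_min ltr01.
  move=> h h0; rewrite lt_min => /andP[h1 he].
  rewrite /pp maxxx add0r !expr0n /= mulr0 !subr0.
  have [hp|hn] := leP 0 h.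
    rewrite exprSr mulfK // ger0_norm ?sqr_ge0 //.
    by rewrite ger0_norm // in h1 he; apply: le_lt_trans he; rewrite expr2 ler_piMl // ltW.
  by rewrite expr0n /= mul0r normr0.
Qed.

(* The second primitive of a hat function: [ramp d] is convex, twice
   continuously differentiable, and equal to [max t 0] off [(- d, d)]. *)
Definition ramp d t := (pp (t + d) ^+ 3 - 2 * pp t ^+ 3 + pp (t - d) ^+ 3) / (6 * d ^+ 2).
Definition ramp1 d t := (3 * pp (t + d) ^+ 2 - 2 * (3 * pp t ^+ 2) + 3 * pp (t - d) ^+ 2) / (6 * d ^+ 2).
Definition ramp2 d t := (6 * pp (t + d) - 2 * (6 * pp t) + 6 * pp (t - d)) / (6 * d ^+ 2).

Lemma dramp d t : is_derive t 1 (ramp d) (ramp1 d t).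
Proof.
have S c : is_derive t 1 (fun s => pp (s + c) ^+ 3) (3 * pp (t + c) ^+ 2).
  have := is_derive_affine (k := 1) (c := c) (dpp_cube (1 * t + c)).
  by rewrite !mul1r; under eq_fun do rewrite mul1r.
have := dZ (6 * d ^+ 2)^-1 (dD (dB (S d) (dZ 2 (dpp_cube t))) (S (- d))).
rewrite [X in is_derive _ _ _ X]mulrC /ramp1.
by under eq_fun do rewrite mulrC.
Qed.

Lemma dramp1 d t : is_derive t 1 (ramp1 d) (ramp2 d t).
Proof.
have S c : is_derive t 1 (fun s => 3 * pp (s + c) ^+ 2) (6 * pp (t + c)).
  have := is_derive_affine (k := 1) (c := c) (dpp_sq (1 * t + c)).
  rewrite !mul1r; under eq_fun do rewrite mul1r.
  by move=> /(dZ 3); rewrite (_ : 3 * (2 * pp (t + c)) = 6 * pp (t + c)) //; ring.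
have S0 : is_derive t 1 (fun s => 3 * pp s ^+ 2) (6 * pp t).
  by have := dZ 3 (dpp_sq t); rewrite (_ : 3 * (2 * pp t) = 6 * pp t) //; ring.
have := dZ (6 * d ^+ 2)^-1 (dD (dB (S d) (dZ 2 S0)) (S (- d))).
rewrite [X in is_derive _ _ _ X]mulrC /ramp2.
by under eq_fun do rewrite mulrC.
Qed.

Lemma continuous_ramp2 d : continuous (ramp2 d).
Proof.
have cpp (c t : R) : {for t, continuous (fun s => pp (s + c))}.
  apply: (@continuous_max _ _ (fun s => s + c) (fun=> 0)); last exact: cvg_cst.
  by apply: cvgD; [exact: cvg_id|exact: cvg_cst].
move=> t; apply: cvgM; last exact: cvg_cst.
apply: cvgD; last by apply: cvgM; [exact: cvg_cst|exact: cpp].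
apply: cvgB; first by apply: cvgM; [exact: cvg_cst|exact: cpp].
apply: cvgM; first exact: cvg_cst.
apply: cvgM; first exact: cvg_cst.
by apply: (@continuous_max _ _ id (fun=> 0)); [exact: cvg_id|exact: cvg_cst].
Qed.

Lemma ramp2_ge0 d t : 0 < d -> 0 <= ramp2 d t.
Proof.
move=> d0; apply: divr_ge0; last by rewrite mulr_ge0 // sqr_ge0.
rewrite /pp.
have [a|a] := leP 0 t; have [b|b] := leP 0 (t + d); have [c|c] := leP 0 (t - d); rlra.
Qed.

Lemma ramp_eq0 d t : 0 < d -> t <= - d -> [/\ ramp d t = 0, ramp1 d t = 0 & ramp2 d t = 0].
Proof.
move=> d0 td; rewrite /ramp /ramp1 /ramp2 /pp.
have h1 : t + d <= 0 by rlra. have h2 : t <= 0 by rlra. have h3 : t - d <= 0 by rlra.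
by rewrite !max_r // !expr0n /= !mulr0 subr0 addr0 mul0r.
Qed.

Lemma ramp_bounds d t : 0 < d -> Num.max t 0 <= ramp d t <= Num.max t 0 + d.
Proof.
move=> d0; have d2 : 0 < 6 * d ^+ 2 by rewrite mulr_gt0 // exprn_gt0.
rewrite /ramp ler_pdivlMr // ler_pdivrMr // /pp.
have [a|a] := leP 0 t; have [b|b] := leP 0 (t + d); have [c|c] := leP 0 (t - d); try rlra.
- have -> : (t + d) ^+ 3 - 2 * t ^+ 3 + (t - d) ^+ 3 = t * (6 * d ^+ 2) by ring.
  by rewrite lexx /= ler_pM2r //; rlra.
- have E : (t + d) ^+ 3 - 2 * t ^+ 3 + 0 ^+ 3 = t * (6 * d ^+ 2) + (d - t) ^+ 3 by rewrite expr0n /=; ring.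
  have h1 : 0 <= (d - t) ^+ 3 by rewrite exprn_ge0 //; rlra.
  have h2 : (d - t) ^+ 3 <= d ^+ 3 by rewrite lerXn2r ?nnegrE; rlra.
  have h3 : d * (6 * d ^+ 2) = 6 * d ^+ 3 by ring.
  have h4 : 0 <= d ^+ 3 by rewrite exprn_ge0 // ltW.
  have h5 : (t + d) * (6 * d ^+ 2) = t * (6 * d ^+ 2) + 6 * d ^+ 3 by ring.
  by rewrite E h5; apply/andP; split; rlra.
- rewrite !expr0n /= mulr0 subr0 addr0 mul0r add0r.
  have h1 : 0 <= (t + d) ^+ 3 by rewrite exprn_ge0.
  have h2 : (t + d) ^+ 3 <= d ^+ 3 by rewrite lerXn2r ?nnegrE; rlra.
  have h3 : d * (6 * d ^+ 2) = 6 * d ^+ 3 by ring.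
  have h4 : 0 <= d ^+ 3 by rewrite exprn_ge0 // ltW.
  by rewrite h3; apply/andP; split; rlra.
- rewrite !expr0n /= mulr0 subr0 addr0 mul0r lexx add0r /=.
  by rewrite mulr_ge0 // ltW.
Qed.

End PositivePartCubed.

(** * Carleman's estimate on a disc *)

Section CarlemanDisc.
Context {R : realType}.
Implicit Types (p q z : R * R) (f g fx fy : R * R -> R) (U : set (R * R)).

Definition disc z (r : R) : set (R * R) := [set p | nrm (p - z) < r].

Lemma open_disc z r : open (disc z r).
Proof.
rewrite openE => p pz; apply/interior_box; exists ((r - nrm (p - z)) / 2).
  by rewrite divr_gt0 // subr_gt0.
move=> q [q1 q2]; rewrite /disc /=.
have -> : q - z = (q - p) + (p - z) by rewrite addrA subrK.
apply: le_lt_trans (nrm_triangle _ _) _.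
have := nrm_le12 (q - p) => /=; rlra.
Qed.

Lemma bounded_disc z r : bounded_set (disc z r).
Proof.
apply/bounded_set2P; exists (`|z.1| + `|z.2| + `|r| + 1).
  by rewrite ltr_wpDl // !addr_ge0.
move=> p /= pz; have h1 := nrm_ge1 (p - z); have h2 := nrm_ge2 (p - z).
have t1 := ler_normD (p.1 - z.1) z.1; have t2 := ler_normD (p.2 - z.2) z.2.
rewrite !subrK in t1 t2; rewrite /= in h1 h2.
have := normr_ge0 z.1; have := normr_ge0 z.2; have := ler_norm r.
by rewrite /disc /= in pz; split; rlra.
Qed.

Lemma closure_disc z r p : closure (disc z r) p -> nrm (p - z) <= r.
Proof.
move=> /closure_box H; apply/ler_addgt0Pr => e e0.
have [q qz [q1 q2]] := H (e / 2) (divr_gt0 e0 (ltr0Sn _ 1)).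
have -> : p - z = (p - q) + (q - z) by rewrite addrA subrK.
apply: le_trans (nrm_triangle _ _) _.
have := nrm_le12 (p - q); rewrite /disc /= in qz => /=.
rewrite distrC in q1; rewrite distrC in q2; rlra.
Qed.

(** The radius is [expR s], so that the Laplacian becomes conformal: [Wss + Wtt] is [expR (2 s)]
    times the planar Laplacian. *)
Definition polar z (s t : R) : R * R := (z.1 + expR s * cos t, z.2 + expR s * sin t).

Lemma nrm_polar z s t : nrm (polar z s t - z) = expR s.
Proof.
have -> : polar z s t - z = expR s *: (cos t, sin t).
  by apply: injective_projections => /=; rewrite /GRing.scale /= addrC addrA addNr add0r.
by rewrite nrmZ /nrm /= cos2Dsin2 sqrtr1 mulr1 gtr0_norm // expR_gt0.
Qed.

Lemma polar_rep z p (s : R) : nrm (p - z) = expR s ->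
  exists2 t : R, 0 <= t <= 2 * pi & p = polar z s t.
Proof.
move=> E; have e0 := expR_gt0 s; have pi0 := pi_gt0 R.
set u := (p.1 - z.1) / expR s; set v := (p.2 - z.2) / expR s.
have uv : u ^+ 2 + v ^+ 2 = 1.
  have := nrm_sqr (p - z); rewrite E /= => E2.
  by rewrite /u /v !expr_div_n -mulrDl -E2 divff // expf_neq0 // gt_eqF.
have u1 : -1 <= u <= 1 by rewrite -ler_norml -(expr_le1 (n := 2)) // real_normK ?num_real //; have := sqr_ge0 v; rlra.
have pE t : cos t = u -> sin t = v -> p = polar z s t.
  move=> ct st; have h x : expR s * (x / expR s) = x by rewrite mulrC divfK // gt_eqF.
  rewrite /polar ct st /u /v !h.
  by apply: injective_projections => /=; rewrite addrC subrK.
have cu : cos (acos u) = u by rewrite acosK // in_itv.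
have su : sin (acos u) = `|v|.
  by rewrite sin_acos // -uv addrC addKr sqrtr_sqr.
have a0 := acos_ge0 u1; have a1 := acos_lepi u1.
have [v0|v0] := leP 0 v.
  by exists (acos u); [rlra|apply: pE => //; rewrite su ger0_norm].
exists (2 * pi - acos u); first rlra.
have e2 : 2 * pi = pi *+ 2 :> R by rewrite mulr_natl.
apply: pE; first by rewrite cosB e2 cos2pi sin2pi cu mul1r mul0r addr0.
by rewrite sinB e2 cos2pi sin2pi su ltr0_norm // mul0r mul1r sub0r opprK.
Qed.

Variables (z : R * R) (r k : R) (V Vx Vy Vxx Vxy Vyx Vyy : R * R -> R).
Hypotheses (r0 : 0 < r) (k0 : 0 < k) (kpi : k * pi < pi / 2).
Hypothesis C1V : forall p, disc z r p -> C1at p V Vx Vy.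
Hypothesis C1Vx : forall p, disc z r p -> C1at p Vx Vxx Vxy.
Hypothesis C1Vy : forall p, disc z r p -> C1at p Vy Vyx Vyy.
Hypothesis V01 : forall p, disc z r p -> 0 <= V p <= 1.
Hypothesis subV : forall p, disc z r p -> 0 <= Vxx p + Vyy p.
Hypothesis zeroV : forall s, expR s < r -> exists2 t : R, 0 <= t <= 2 * pi & V (polar z s t) = 0.

Let L := ln r.

Let in_disc s t : s < L -> disc z r (polar z s t).
Proof. by move=> sL; rewrite /disc /= nrm_polar -(lnK (x := r)) ?posrE // ltr_expR. Qed.

Let e := fun s : R => expR s.
(** Partial derivatives by the chain rule. The first-order terms [Ws] and [- Ws] cancel in
    [Wss + Wtt]. *)
Let W s t := V (polar z s t).
Let Ws s t := e s * (cos t * Vx (polar z s t) + sin t * Vy (polar z s t)).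
Let Wt s t := e s * (cos t * Vy (polar z s t) - sin t * Vx (polar z s t)).
Let Wss s t := Ws s t + e s ^+ 2 * (cos t ^+ 2 * Vxx (polar z s t) +
   cos t * sin t * (Vxy (polar z s t) + Vyx (polar z s t)) + sin t ^+ 2 * Vyy (polar z s t)).
Let Wtt s t := - Ws s t + e s ^+ 2 * (sin t ^+ 2 * Vxx (polar z s t) -
   cos t * sin t * (Vxy (polar z s t) + Vyx (polar z s t)) + cos t ^+ 2 * Vyy (polar z s t)).

Let ds1 (s t : R) : is_derive s 1 (fun x => z.1 + expR x * cos t) (e s * cos t).
Proof.
have := dD (dcst s z.1) (dM (is_derive_expR s) (dcst s (cos t))).
by rewrite add0r mulr0 addr0.
Qed.

Let ds2 (s t : R) : is_derive s 1 (fun x => z.2 + expR x * sin t) (e s * sin t).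
Proof.
have := dD (dcst s z.2) (dM (is_derive_expR s) (dcst s (sin t))).
by rewrite add0r mulr0 addr0.
Qed.

Let dt1 (s t : R) : is_derive t 1 (fun x => z.1 + expR s * cos x) (- (e s * sin t)).
Proof.
have := dD (dcst t z.1) (dZ (expR s) (is_derive_cos t)).
by rewrite add0r mulrN.
Qed.

Let dt2 (s t : R) : is_derive t 1 (fun x => z.2 + expR s * sin x) (e s * cos t).
Proof. by have := dD (dcst t z.2) (dZ (expR s) (is_derive_sin t)); rewrite add0r. Qed.

Let chain_s f fx fy (s t : R) : (forall p, disc z r p -> C1at p f fx fy) -> s < L ->
  is_derive s 1 (fun x => f (polar z x t))
    (fx (polar z s t) * (e s * cos t) + fy (polar z s t) * (e s * sin t)).
Proof.
move=> C1f sL.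
exact: (@C1_chain R _ _ fx fy _ (fun x => z.1 + expR x * cos t) (fun x => z.2 + expR x * sin t)
  s _ _ (@open_disc z r) C1f (in_disc t sL) (ds1 s t) (ds2 s t)).
Qed.

Let chain_t f fx fy (s t : R) : (forall p, disc z r p -> C1at p f fx fy) -> s < L ->
  is_derive t 1 (fun x => f (polar z s x))
    (fx (polar z s t) * (- (e s * sin t)) + fy (polar z s t) * (e s * cos t)).
Proof.
move=> C1f sL.
exact: (@C1_chain R _ _ fx fy _ (fun x => z.1 + expR s * cos x) (fun x => z.2 + expR s * sin x)
  t _ _ (@open_disc z r) C1f (in_disc t sL) (dt1 s t) (dt2 s t)).
Qed.

Let dWall s t : s < L ->
  [/\ is_derive s 1 (W ^~ t) (Ws s t), is_derive s 1 (Ws ^~ t) (Wss s t),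
      is_derive t 1 (W s) (Wt s t) & is_derive t 1 (Wt s) (Wtt s t)].
Proof.
move=> sL; split.
- by have := chain_s t C1V sL; congr (is_derive _ _ _ _); rewrite /Ws; ring.
- have := dM (is_derive_expR s) (dD (dZ (cos t) (chain_s t C1Vx sL)) (dZ (sin t) (chain_s t C1Vy sL))).
  by congr (is_derive _ _ _ _); rewrite /Wss /Ws /e; ring.
- by have := chain_t t C1V sL; congr (is_derive _ _ _ _); rewrite /Wt; ring.
- have := dZ (e s) (dB (dM (is_derive_cos t) (chain_t t C1Vy sL)) (dM (is_derive_sin t) (chain_t t C1Vx sL))).
  by congr (is_derive _ _ _ _); rewrite /Wtt /Ws /e; ring.
Qed.

Let cpolar f q : {for polar z q.1 q.2, continuous f} ->
  {for q, continuous (fun x : R * R => f (polar z x.1 x.2))}.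
Proof.
move=> cf; apply: (@continuous_comp _ _ _ (fun x : R * R => polar z x.1 x.2)) => //.
have ce : {for q, continuous (fun x : R * R => expR x.1)}.
  by apply: (@continuous_comp _ _ _ (fun x : R * R => x.1)); [exact: cvg_fst|exact: continuous_expR].
apply: continuous_pair2.
  apply: cvgD; first exact: cvg_cst.
  apply: cvgM => //.
  by apply: (@continuous_comp _ _ _ (fun x : R * R => x.2)); [exact: cvg_snd|exact: continuous_cos].
apply: cvgD; first exact: cvg_cst.
apply: cvgM => //.
by apply: (@continuous_comp _ _ _ (fun x : R * R => x.2)); [exact: cvg_snd|exact: continuous_sin].
Qed.

Let jc q : q.1 < L -> [/\ {for q, continuous (fun x : R * R => W x.1 x.2)},
  {for q, continuous (fun x : R * R => Ws x.1 x.2)},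
  {for q, continuous (fun x : R * R => Wss x.1 x.2)} &
  {for q, continuous (fun x : R * R => Wtt x.1 x.2)}].
Proof.
move=> qL; have pd := in_disc q.2 qL.
have ce : {for q, continuous (fun x : R * R => e x.1)}.
  by apply: (@continuous_comp _ _ _ (fun x : R * R => x.1)); [exact: cvg_fst|exact: continuous_expR].
have cc : {for q, continuous (fun x : R * R => cos x.2)}.
  by apply: (@continuous_comp _ _ _ (fun x : R * R => x.2)); [exact: cvg_snd|exact: continuous_cos].
have cs : {for q, continuous (fun x : R * R => sin x.2)}.
  by apply: (@continuous_comp _ _ _ (fun x : R * R => x.2)); [exact: cvg_snd|exact: continuous_sin].
have [_ _ /cpolar cx /cpolar cy] := C1V pd.
have [_ _ /cpolar cxx /cpolar cxy] := C1Vx pd.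
have [_ _ /cpolar cyx /cpolar cyy] := C1Vy pd.
have cV := cpolar (C1_continuous (@open_disc z r) pd C1V).
have sq (g : R * R -> R) : {for q, continuous g} -> {for q, continuous (fun x => g x ^+ 2)}.
  move=> cg; rewrite (_ : (fun x => g x ^+ 2) = (fun x => g x * g x)); last by apply/funext => x; ring.
  exact: cvgM.
have cWs : {for q, continuous (fun x : R * R => Ws x.1 x.2)}.
  by apply: cvgM => //; apply: cvgD; apply: cvgM.
have c1 := sq _ cc; have c2 := sq _ cs; have c3 := sq _ ce.
have c4 : {for q, continuous (fun x : R * R => cos x.2 * sin x.2)} by exact: cvgM.
have c5 : {for q, continuous (fun x : R * R => Vxy (polar z x.1 x.2) + Vyx (polar z x.1 x.2))} by exact: cvgD.
have c6 : {for q, continuous (fun x : R * R => cos x.2 * sin x.2 *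
  (Vxy (polar z x.1 x.2) + Vyx (polar z x.1 x.2)))} by exact: cvgM.
split => //.
  apply: cvgD => //; apply: cvgM => //; apply: cvgD; last exact: cvgM.
  by apply: cvgD => //; exact: cvgM.
apply: cvgD; first exact: cvgN.
apply: cvgM => //; apply: cvgD; last exact: cvgM.
by apply: cvgB => //; exact: cvgM.
Qed.

Let slice (G : R -> R -> R) s : (forall t, {for (s, t), continuous (fun x : R * R => G x.1 x.2)}) ->
  continuous (G s).
Proof.
move=> cG t; apply: (@continuous_comp _ _ _ (fun x : R => (s, x)) (fun x : R * R => G x.1 x.2)); last exact: cG.
by have := cvg_pair (cvg_cst s : (fun=> s) @ t --> s) (cvg_id : id @ t --> t); exact.
Qed.

Let bound (G : R -> R -> R) s : s < L ->
  (forall q, q.1 < L -> {for q, continuous (fun x : R * R => G x.1 x.2)}) ->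
  exists K : R, forall x t, `|x - s| < (L - s) / 2 -> 0 <= t <= 2 * pi -> `|G x t| <= K.
Proof.
move=> sL cG; have pi0 := pi_gt0 R.
pose K0 : set (R * R) := `[s - (L - s) / 2, s + (L - s) / 2]%classic `*` `[0, 2 * pi]%classic.
have cK : compact K0 by apply: compact_setX; exact: segment_compact.
have K00 : K0 !=set0.
  by exists (s, 0); split; rewrite /= in_itv /=; apply/andP; split; lra.
have cA : {within K0, continuous (fun x : R * R => `|G x.1 x.2|)}.
  apply: continuous_in_subspaceT => q /set_mem [q1 _].
  move: q1; rewrite /= in_itv /= => /andP[q1 q2].
  apply: (@continuous_comp _ _ _ (fun x : R * R => G x.1 x.2)); last exact: norm_continuous.
  by apply: cG; lra.
have [p _ Hp] := compact_max2 K00 cK cA.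
exists `|G p.1 p.2| => x t xs tpi; apply: (Hp (x, t)).
by move: xs; rewrite ltr_norml => xs; split; rewrite /= in_itv /=; lra.
Qed.

Let C0 := (1 + (k ^+ 2)^-1) * pi : R.

Lemma carleman_disc s : s < L - 3 -> exists2 x, s <= x <= s + 1 &
  forall t, 0 <= t <= 2 * pi -> V (polar z x t) ^+ 2 <= C0 * expR (- (2 * k * (L - 3 - s))).
Proof.
move=> sL.
have h1 x : x < L -> [/\ continuous (Ws x), continuous (Wss x) & continuous (Wtt x)].
  by move=> xL; split; apply: slice => t; have [] := @jc (x, t) xL.
have h2 x : x < L -> exists r0 K : R, 0 < r0 /\ forall y t, `|y - x| < r0 -> 0 <= t <= 2 * pi ->
    [/\ y < L, `|W y t| <= K, `|Ws y t| <= K & `|Wss y t| <= K].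
  move=> xL.
  have [K1 H1] := bound xL (fun q h => let: And4 a _ _ _ := jc h in a).
  have [K2 H2] := bound xL (fun q h => let: And4 _ a _ _ := jc h in a).
  have [K3 H3] := bound xL (fun q h => let: And4 _ _ a _ := jc h in a).
  exists ((L - x) / 2), (Num.max K1 (Num.max K2 K3)); split; first by rewrite divr_gt0 // subr_gt0.
  move=> y t yx tpi; split; first by move: yx; rewrite ltr_norml; lra.
  - by rewrite le_max H1.
  - by rewrite !le_max H2 // orbT.
  - by rewrite !le_max H3 // !orbT.
have e2 : 2 * pi = pi *+ 2 :> R by rewrite mulr_natl.
have h3 x t : x < L -> W x (t + 2 * pi) = W x t.
  by move=> xL; rewrite /W /polar e2 cosD2pi sinD2pi.
have h4 x t : x < L -> Wt x (t + 2 * pi) = Wt x t.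
  by move=> xL; rewrite /Wt /polar e2 !cosD2pi !sinD2pi.
have h5 x t : x < L -> 0 <= W x t <= 1 by move=> xL; exact: V01 (in_disc t xL).
have h6 x t : x < L -> 0 <= W x t * (Wss x t + Wtt x t).
  move=> xL; have pd := in_disc t xL.
  rewrite /Wss /Wtt.
  have -> : W x t * (Ws x t + e x ^+ 2 * (cos t ^+ 2 * Vxx (polar z x t) +
     cos t * sin t * (Vxy (polar z x t) + Vyx (polar z x t)) + sin t ^+ 2 * Vyy (polar z x t)) +
     (- Ws x t + e x ^+ 2 * (sin t ^+ 2 * Vxx (polar z x t) -
      cos t * sin t * (Vxy (polar z x t) + Vyx (polar z x t)) + cos t ^+ 2 * Vyy (polar z x t)))) =
     W x t * (e x ^+ 2 * ((cos t ^+ 2 + sin t ^+ 2) * (Vxx (polar z x t) + Vyy (polar z x t)))) by ring.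
  rewrite cos2Dsin2 mul1r mulr_ge0 //; first by have /andP[] := V01 pd.
  by rewrite mulr_ge0 ?sqr_ge0 // subV.
have h7 x : x < L -> exists2 a : R, 0 <= a <= 2 * pi & W x a = 0.
  by move=> xL; apply: zeroV; rewrite -(lnK (x := r)) ?posrE // ltr_expR.
have [x xs H] := carleman_polar k0 kpi dWall h1 h2 h3 h4 h5 h6 h7 sL.
by exists x => // t tpi; rewrite /C0 -(mulrA _ pi); exact: H.
Qed.

(** The bound holds on some circle of radius [expR x >= rho], and the maximum principle carries it
    into the disc. *)
Lemma carleman_interior p (rho : R) : 0 < rho -> nrm (p - z) < rho -> ln rho < L - 4 ->
  V p ^+ 2 <= C0 * expR (- (2 * k * (L - 3 - ln rho))).
Proof.
move=> rho0 pz rL; have sL : ln rho < L - 3 by lra.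
have [x /andP[x1 x2] Hx] := carleman_disc sL.
have xL : x < L by lra.
have er : expR x < r by rewrite -(lnK (x := r)) ?posrE // ltr_expR.
have rx : rho <= expR x by rewrite -(lnK (x := rho)) ?posrE // ler_expR.
have C0p : 0 <= C0.
  by apply: mulr_ge0; [apply: addr_ge0; rewrite // invr_ge0 sqr_ge0|exact: pi_ge0].
set B := C0 * _.
have B0 : 0 <= B by rewrite mulr_ge0 ?expR_ge0.
have Vp := fun q (h : nrm (q - z) <= expR x) => V01 (le_lt_trans h er : disc z r q).
have : V p <= Num.sqrt B.
  apply: (@max_principle R (disc z (expR x)) V).
  - exact: open_disc.
  - exact: bounded_disc.
  - apply: continuous_in_subspaceT => q /set_mem /closure_disc qz.
    by apply: (C1_continuous (@open_disc z r) _ C1V); exact: le_lt_trans er.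
  - move=> q qx; have qr : disc z r q by exact: lt_trans er.
    exists (Vxx q + Vyy q); last exact: subV.
    exists (Vxx q), (Vyy q); split => //.
      exists (fun s => Vx (s, q.2)); last by have [] := C1Vx qr.
      have [d d0 Hd] := open_box (@open_disc z r) qr.
      exists d => //= s sd; have : disc z r (s, q.2).
        by apply: Hd; split; rewrite /= ?subrr ?normr0 // distrC.
      by move/C1V => [].
    exists (fun s => Vy (q.1, s)); last by have [] := C1Vy qr.
    have [d d0 Hd] := open_box (@open_disc z r) qr.
    exists d => //= s sd; have : disc z r (q.1, s).
      by apply: Hd; split; rewrite /= ?subrr ?normr0 // distrC.
    by move/C1V => [].
  - move=> q /closure_disc qx nq.
    have qe : nrm (q - z) = expR x by apply/eqP; rewrite eq_le qx /= leNgt; apply/negP.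
    have [t tpi ->] := polar_rep qe.
    rewrite -ler_sqr ?nnegrE ?sqrtr_ge0 //; first by rewrite sqr_sqrtr //; exact: Hx.
    by have /andP[] := V01 (in_disc t xL).
  - by apply: subset_closure; exact: lt_le_trans rx.
move=> Vs; rewrite -(sqr_sqrtr B0) ler_sqr ?nnegrE ?sqrtr_ge0 //.
by have /andP[] := V01 (lt_trans (lt_le_trans pz rx) er : disc z r p).
Qed.

End CarlemanDisc.

(** * One step of decay towards the boundary *)

Section Boundary.
Context {R : realType}.
Implicit Types (p q z : R * R) (f g fx fy : R * R -> R) (U Om : set (R * R)).

Definition C2harm U h hx hy hxx hxy hyx hyy := forall p, U p ->
  [/\ C1at p h hx hy, C1at p hx hxx hxy, C1at p hy hyx hyy & hxx p + hyy p = 0 :> R].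

Lemma C2_on_harm U f : C2_on U f -> (forall x, U x -> laplacian f x = 0) ->
  exists hx hy hxx hxy hyx hyy, C2harm U f hx hy hxx hxy hyx hyy.
Proof.
move=> C2 L0; pose fx := 'D_(1, 0) f; pose fy := 'D_(0, 1) f.
exists fx, fy, ('D_(1, 0) fx), ('D_(0, 1) fx), ('D_(1, 0) fy), ('D_(0, 1) fy) => p Up.
have [_ H] := C2 p Up.
have [a1 a2 a3] := H false; have [b1 b2 b3] := H true.
have [c1 c2] := a3 false; have [c3 c4] := a3 true.
have [d1 d2] := b3 false; have [d3 d4] := b3 true.
have LE := L0 p Up; rewrite /laplacian big_bool in LE.
by split; [split; [exact: partial1P a1|exact: partial2P b1|exact: a2|exact: b2]
  |split; [exact: partial1P c1|exact: partial2P c3|exact: c2|exact: c4]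
  |split; [exact: partial1P d1|exact: partial2P d3|exact: d2|exact: d4]|rewrite addrC; exact: LE].
Qed.

Lemma C1_lap2 U f fx fy fxx fxy fyx fyy p : open U -> U p ->
  (forall p, U p -> C1at p f fx fy) -> (forall p, U p -> C1at p fx fxx fxy) ->
  (forall p, U p -> C1at p fy fyx fyy) -> lap2 f p (fxx p + fyy p).
Proof.
move=> oU Up H Hx Hy; have [d d0 Hd] := open_box oU Up.
exists (fxx p), (fyy p); split => //.
  exists (fun s => fx (s, p.2)); last by have [] := Hx p Up.
  exists d => //= s sd; have : U (s, p.2).
    by apply: Hd; split; rewrite /= ?subrr ?normr0 // distrC.
  by move/H => [].
exists (fun s => fy (p.1, s)); last by have [] := Hy p Up.
exists d => //= s sd; have : U (p.1, s).
  by apply: Hd; split; rewrite /= ?subrr ?normr0 // distrC.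
by move/H => [].
Qed.

Lemma C2harm_harmonic_on U h hx hy hxx hxy hyx hyy : open U ->
  C2harm U h hx hy hxx hxy hyx hyy -> harmonic_on U h.
Proof.
move=> oU H p Up.
have C1h q : U q -> C1at q h hx hy by move=> /H[].
split; last exact: C1_continuous oU Up C1h.
have [_ _ _ <-] := H p Up.
have C1x q : U q -> C1at q hx hxx hxy by move=> /H[].
have C1y q : U q -> C1at q hy hyx hyy by move=> /H[].
exact: C1_lap2 oU Up C1h C1x C1y.
Qed.

Lemma C1_outer p (ph ph' : R -> R) f fx fy U : open U -> U p ->
  (forall q, U q -> C1at q f fx fy) -> (forall t : R, is_derive t 1 ph (ph' t)) ->
  continuous ph' ->
  C1at p (fun q => ph (f q)) (fun q => ph' (f q) * fx q) (fun q => ph' (f q) * fy q).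
Proof.
move=> oU Up H dph cph; have [d1 d2 c1 c2] := H p Up.
have cf := C1_continuous oU Up H.
have cc : {for p, continuous (fun q => ph' (f q))}.
  by apply: (@continuous_comp _ _ _ f); [exact: cf|exact: cph].
case: p Up d1 d2 c1 c2 cf cc => a b /= Up d1 d2 c1 c2 cf cc; split => /=.
- exact: (dcomp (dph (f (a, b))) d1).
- exact: (dcomp (dph (f (a, b))) d2).
- exact: cvgM.
- exact: cvgM.
Qed.

Lemma C1_mul p f fx fy g gx gy U : open U -> U p ->
  (forall q, U q -> C1at q f fx fy) -> (forall q, U q -> C1at q g gx gy) ->
  C1at p (fun q => f q * g q) (fun q => fx q * g q + f q * gx q) (fun q => fy q * g q + f q * gy q).
Proof.
move=> oU Up Hf Hg; have [d1 d2 c1 c2] := Hf p Up; have [e1 e2 k1 k2] := Hg p Up.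
have cf := C1_continuous oU Up Hf; have cg := C1_continuous oU Up Hg.
case: p Up d1 d2 c1 c2 e1 e2 k1 k2 cf cg => a b /= Up d1 d2 c1 c2 e1 e2 k1 k2 cf cg; split => /=.
- exact: (dM d1 e1).
- exact: (dM d2 e2).
- by apply: cvgD; exact: cvgM.
- by apply: cvgD; exact: cvgM.
Qed.

Lemma C1_affine p f fx fy (c c' : R) : C1at p f fx fy ->
  C1at p (fun q => c * f q + c') (fun q => c * fx q) (fun q => c * fy q).
Proof.
case: p => a b [d1 d2 c1 c2]; split => /=.
- by have := dD (dZ c d1) (dcst a c'); rewrite addr0.
- by have := dD (dZ c d2) (dcst b c'); rewrite addr0.
- by apply: cvgM; [exact: cvg_cst|exact: c1].
- by apply: cvgM; [exact: cvg_cst|exact: c2].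
Qed.

Lemma continuous_ramp1 (d : R) : continuous (ramp1 d).
Proof. by move=> t; exact: dcont (dramp1 d t). Qed.

Lemma restrict_C1 Om (f fx fy : R * R -> R) p :
  (Om p -> open Om /\ C1at p f fx fy) ->
  (~ Om p -> exists2 e : R, 0 < e & forall q, box p e q -> Om q ->
     [/\ f q = 0, fx q = 0 & fy q = 0]) ->
  C1at p (fun q => if `[< Om q >] then f q else 0)
    (fun q => if `[< Om q >] then fx q else 0) (fun q => if `[< Om q >] then fy q else 0).
Proof.
move=> H1 H0; have [Op|nOp] := pselect (Om p).
  have [oO C1p] := H1 Op; have [e e0 He] := open_box oO Op.
  apply: eqbox_C1 e0 _ C1p => q qe.
  by have -> : `[< Om q >] by apply/asboolP; exact: He.
have [e e0 He] := H0 nOp.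
apply: eqbox_C1 e0 _ (C1_cst p 0) => q qe.
by case: asboolP => // Oq; have [-> -> ->] := He q qe Oq.
Qed.

Section Step.
Variables (Om : set (R * R)) (h hx hy hxx hxy hyx hyy : R * R -> R) (z0 : R * R).
Hypotheses (oOm : open Om) (sOm : simply_connected Om).
Hypothesis ch : {within closure Om, continuous h}.
Hypothesis H : C2harm Om h hx hy hxx hxy hyx hyy.
Hypothesis z0O : ~ Om z0.

(** Carleman's estimate is applied to [ramp dl (c h + c' - 2 dl)], extended by 0 outside [Om]. The
    shift makes the argument at most [- dl] near boundary points, where the ramp and its derivatives
    vanish, so the extension stays C^2; convexity of the ramp makes it subharmonic. Every circle
    around [z0] leaves [Om], which supplies the zeros. *)
Lemma boundary_step (c c' r dl : R) : 0 < r -> 0 < dl -> dl < 1 ->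
  (forall p, disc z0 r p -> frontier Om p -> c * h p + c' <= 0) ->
  (forall p, disc z0 r p -> Om p -> c * h p + c' <= 1) ->
  forall p (rho : R), 0 < rho -> disc z0 rho p -> Om p -> ln rho < ln r - 4 ->
  (Num.max (c * h p + c' - 2 * dl) 0) ^+ 2 <=
    (1 + ((9 / 20 : R) ^+ 2)^-1) * pi * expR (- (2 * (9 / 20) * (ln r - 3 - ln rho))).
Proof.
move=> r0 d0 d1 Hb Hi p rho rho0 pr Op lr.
pose f q := c * h q + (c' - 2 * dl).
have fE q : f q = c * h q + c' - 2 * dl by rewrite /f addrA.
have C1f q : Om q -> C1at q f (fun q => c * hx q) (fun q => c * hy q).
  by move=> /H[h1 _ _ _]; exact: C1_affine.
have C1fx q : Om q -> C1at q (fun q => c * hx q) (fun q => c * hxx q) (fun q => c * hxy q).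
  move=> /H[_ h1 _ _]; have := C1_affine c 0 h1.
  by apply: eqbox_C1 (ltr01 : (0 : R) < 1) _ => ? _; rewrite addr0.
have C1fy q : Om q -> C1at q (fun q => c * hy q) (fun q => c * hyx q) (fun q => c * hyy q).
  move=> /H[_ _ h1 _]; have := C1_affine c 0 h1.
  by apply: eqbox_C1 (ltr01 : (0 : R) < 1) _ => ? _; rewrite addr0.
pose F := fun q => ramp dl (f q).
pose Fx := fun q => ramp1 dl (f q) * (c * hx q).
pose Fy := fun q => ramp1 dl (f q) * (c * hy q).
pose Fxx := fun q => ramp2 dl (f q) * (c * hx q) * (c * hx q) + ramp1 dl (f q) * (c * hxx q).
pose Fxy := fun q => ramp2 dl (f q) * (c * hy q) * (c * hx q) + ramp1 dl (f q) * (c * hxy q).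
pose Fyx := fun q => ramp2 dl (f q) * (c * hx q) * (c * hy q) + ramp1 dl (f q) * (c * hyx q).
pose Fyy := fun q => ramp2 dl (f q) * (c * hy q) * (c * hy q) + ramp1 dl (f q) * (c * hyy q).
have C1F q : Om q -> C1at q F Fx Fy.
  by move=> Oq; exact: (C1_outer oOm Oq C1f (dramp dl) (@continuous_ramp1 dl)).
have C1r q : Om q -> C1at q (fun q => ramp1 dl (f q)) (fun q => ramp2 dl (f q) * (c * hx q))
    (fun q => ramp2 dl (f q) * (c * hy q)).
  by move=> Oq; exact: (C1_outer oOm Oq C1f (dramp1 dl) (@continuous_ramp2 R dl)).
have C1Fx q : Om q -> C1at q Fx Fxx Fxy by move=> Oq; exact: (C1_mul oOm Oq C1r C1fx).
have C1Fy q : Om q -> C1at q Fy Fyx Fyy by move=> Oq; exact: (C1_mul oOm Oq C1r C1fy).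
have flat q : disc z0 r q -> ~ Om q -> exists2 e : R, 0 < e & forall q', box q e q' -> Om q' ->
    f q' <= - dl.
  move=> qd nq; have [cq|ncq] := pselect (closure Om q); last first.
    have oc : open (~` closure Om) by apply: closed_openC; exact: closed_closure.
    have [e e0 He] := open_box oc ncq.
    by exists e => // q' /He nc Oq'; case: nc; exact: subset_closure.
  have fq : frontier Om q by split => // /interior_subset.
  have hq := Hb q qd fq.
  have e0 : 0 < dl / (`|c| + 1) by rewrite divr_gt0 // ltr_wpDl.
  have [e ee0 He] := (@within_continuous_box R _ h).1 ch q cq _ e0.
  exists e => // q' bq' Oq'; have := He q' (subset_closure Oq') bq'.
  rewrite ltr_pdivlMr ?ltr_wpDl // => hh; rewrite fE.
  have : `|c * (h q' - h q)| <= dl.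
    rewrite normrM; have := normr_ge0 (h q' - h q); have := normr_ge0 c; nra.
  rewrite ler_norml => /andP[_]; lra.
have ext (G Gx Gy : R * R -> R) : (forall q, Om q -> C1at q G Gx Gy) ->
   (forall q, Om q -> f q <= - dl -> [/\ G q = 0, Gx q = 0 & Gy q = 0]) ->
   forall q, disc z0 r q -> C1at q (fun q => if `[< Om q >] then G q else 0)
    (fun q => if `[< Om q >] then Gx q else 0) (fun q => if `[< Om q >] then Gy q else 0).
  move=> CG G0 q qd; apply: restrict_C1; first by move=> Oq; split => //; exact: CG.
  move=> nq; have [e e0 He] := flat q qd nq; exists e => // q' bq' Oq'.
  by apply: G0 => //; exact: He.
have k0 : (0 : R) < 9 / 20 by lra.
have kpi : (9 / 20 : R) * pi < pi / 2 by have := pi_gt0 R; lra.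
pose V q := if `[< Om q >] then F q else 0.
have VE q : Om q -> V q = F q by move=> /asboolP Oq; rewrite /V Oq.
have rb q := @ramp_bounds R dl (f q) d0.
have := @carleman_interior R z0 r (9 / 20) V _ _ _ _ _ _ r0 k0 kpi (ext _ _ _ C1F _) (ext _ _ _ C1Fx _)
  (ext _ _ _ C1Fy _) _ _ _ p rho rho0 pr lr.
rewrite VE //.
have mm : Num.max (c * h p + c' - 2 * dl) 0 <= F p by rewrite -fE; have /andP[] := rb p.
move=> HH; apply: le_trans (HH _ _ _ _ _ _).
- by rewrite ler_sqr ?nnegrE // ?le_max ?lexx ?orbT //; apply: le_trans mm; rewrite le_max lexx orbT.
- by move=> q _ /(ramp_eq0 d0)[e1 e2 e3]; rewrite /F /Fx /Fy e1 e2 !mul0r.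
- by move=> q _ /(ramp_eq0 d0)[e1 e2 e3]; rewrite /Fx /Fxx /Fxy e2 e3 !mul0r addr0.
- by move=> q _ /(ramp_eq0 d0)[e1 e2 e3]; rewrite /Fy /Fyx /Fyy e2 e3 !mul0r addr0.
- move=> q qd; rewrite /V; case: asboolP => [Oq|_]; last by rewrite lexx ler01.
  have /andP[a1 a2] := rb q; have := Hi q qd Oq; have := fE q => fq hq.
  apply/andP; split; first by apply: le_trans a1; rewrite le_max lexx orbT.
  apply: le_trans a2 _; have [m0|m0] := leP 0 (f q); lra.
- move=> q qd; case: asboolP => [Oq|_]; last by rewrite addr0.
  have [_ _ _ E] := H Oq; rewrite /Fxx /Fyy.
  have -> : ramp2 dl (f q) * (c * hx q) * (c * hx q) + ramp1 dl (f q) * (c * hxx q) +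
     (ramp2 dl (f q) * (c * hy q) * (c * hy q) + ramp1 dl (f q) * (c * hyy q)) =
     ramp2 dl (f q) * ((c * hx q) ^+ 2 + (c * hy q) ^+ 2) + ramp1 dl (f q) * c * (hxx q + hyy q) by ring.
  by rewrite E mulr0 addr0 mulr_ge0 ?ramp2_ge0 // addr_ge0 ?sqr_ge0.
- move=> s sr; have [t tpi nt] := circle_meets_complement sOm z0O (expR_gt0 s).
  by exists t => //; rewrite /V; case: asboolP.
Qed.

Definition Cb : R := (1 + ((9 / 20 : R) ^+ 2)^-1) * pi.

(** Square roots are taken and [dl] tends to 0. *)
Lemma boundary_step_lim (c c' r : R) : 0 < r ->
  (forall p, disc z0 r p -> frontier Om p -> c * h p + c' <= 0) ->
  (forall p, disc z0 r p -> Om p -> c * h p + c' <= 1) ->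
  forall p (rho : R), 0 < rho -> disc z0 rho p -> Om p -> ln rho < ln r - 4 ->
  c * h p + c' <= Num.sqrt Cb * expR (- ((9 / 20) * (ln r - 3 - ln rho))).
Proof.
move=> r0 Hb Hi p rho rho0 pr Op lr.
have Cb0 : 0 <= Cb by rewrite /Cb mulr_ge0 ?pi_ge0 // addr_ge0 // invr_ge0 sqr_ge0.
apply/ler_addgt0Pr => e e0; pose dl := Num.min (e / 2) (1 / 2).
have d0 : 0 < dl by rewrite lt_min !divr_gt0.
have d1 : dl < 1 by rewrite gt_min; apply/orP; right; lra.
have de : dl <= e / 2 by rewrite ge_min lexx.
have := boundary_step r0 d0 d1 Hb Hi rho0 pr Op lr.
set E := 9 / 20 * (ln r - 3 - ln rho).
have -> : - (2 * (9 / 20) * (ln r - 3 - ln rho)) = (- E) + (- E) by rewrite /E; ring.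
rewrite expRD -[(1 + _) * pi]/Cb -{1}(sqr_sqrtr Cb0) -expr2 -exprMn.
rewrite ler_sqr ?nnegrE ?mulr_ge0 ?sqrtr_ge0 ?expR_ge0 // ?le_max ?lexx ?orbT //.
by rewrite ge_max => /andP[h1 _]; lra.
Qed.

End Step.
End Boundary.

(** * Hoelder estimate at the boundary by iteration over scales *)

Section BoundaryHolder.
Context {R : realType}.
Implicit Types (p q z : R * R) (f g fx fy : R * R -> R) (U Om : set (R * R)).

Lemma frontier_open U p : open U -> frontier U p <-> closure U p /\ ~ U p.
Proof. by move=> oU; rewrite /frontier (interior_id U).1. Qed.

Lemma harmonic_bound U h (M : R) : open U -> bounded_set U -> harmonic_on U h ->
  {within closure U, continuous h} -> (forall p, frontier U p -> `|h p| <= M) ->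
  forall p, closure U p -> `|h p| <= M.
Proof.
move=> oU bU hU ch hb p cp.
have half (u : R * R -> R) : harmonic_on U u -> {within closure U, continuous u} ->
    (forall p, frontier U p -> u p <= M) -> u p <= M.
  move=> hu cu ub; apply: max_principle cp => //.
    by move=> q /hu[L _]; exists 0.
  by move=> q cq nq; apply: ub; apply/frontier_open.
rewrite ler_norml lerNl; apply/andP; split; last first.
  by apply: half => // q /hb; rewrite ler_norml => /andP[].
apply: (half (fun q => - h q)); first exact: harmonicN.
  by move=> q; apply: cvgN; exact: ch.
by move=> q /hb; rewrite ler_norml lerNl => /andP[].
Qed.

(** Logarithm of the ratio of consecutive scales. The loss from 9/20 to 3/8 leaves the factor
    [expR (- (3 / 40) Lb)], which absorbs the constant of [boundary_step_lim] and a factor 2; the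
    summand 6 leaves room for the condition [ln rho < ln r - 4]. *)
Definition Lb : R := 6 + (40 / 3) * (2 * Num.sqrt Cb * expR (9 / 5)).

Lemma Lb_ge : 6 <= Lb.
Proof.
rewrite /Lb lerDl; have := sqrtr_ge0 (Cb : R); have := expR_ge0 (9 / 5 : R) => h1 h2.
by do ! (apply: mulr_ge0 => //).
Qed.

Lemma Lb_half : Num.sqrt Cb * expR (- ((9 / 20) * (Lb - 4))) <= 2^-1 * expR (- ((3 / 8) * Lb)).
Proof.
pose X : R := 2 * Num.sqrt Cb * expR (9 / 5).
have h1 : X <= expR ((3 / 40) * Lb).
  apply: le_trans (_ : X <= expR X) _; first by have := expR_ge1Dx X; rlra.
  by rewrite ler_expR /Lb -/X; rlra.
have -> : - ((9 / 20) * (Lb - 4)) = 9 / 5 + (- ((3 / 40) * Lb) + (- ((3 / 8) * Lb))) by rlra.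
rewrite !expRD [expR (- (3 / 40 * Lb))]expRN.
set E := expR (3 / 40 * Lb) in h1 *; have E0 : 0 < E by exact: expR_gt0.
have -> : Num.sqrt Cb * (expR (9 / 5) * (E^-1 * expR (- (3 / 8 * Lb)))) =
  (2^-1 * X * E^-1) * expR (- (3 / 8 * Lb)) by rewrite /X; field; rewrite gt_eqF.
by rewrite ler_pM2r ?expR_gt0 // ler_pdivrMr // ler_pM2l // invr_gt0.
Qed.

Section Iterate.
Variables (Om : set (R * R)) (h hx hy hxx hxy hyx hyy : R * R -> R) (z0 : R * R).
Hypotheses (oOm : open Om) (sOm : simply_connected Om).
Hypothesis ch : {within closure Om, continuous h}.
Hypothesis H : C2harm Om h hx hy hxx hxy hyx hyy.
Hypothesis z0O : ~ Om z0.
Variables (sg g0 A M D al : R).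
Hypotheses (A0 : 0 <= A) (M0 : 0 < M) (D0 : 0 < D) (al0 : 0 < al) (al1 : al <= 1).
Hypothesis fb : forall p, frontier Om p -> sg * (h p - g0) <= A * nrm (p - z0) `^ al.
Hypothesis ib : forall p, Om p -> sg * (h p - g0) <= 2 * M.

Let kp := Num.min al (3 / 8).
Let T := 2 * (A * D `^ al + M) * expR Lb.

Let kp0 : 0 < kp. Proof. by rewrite lt_min al0 divr_gt0. Qed.
Let kp1 : kp <= 3 / 8. Proof. by rewrite ge_min lexx orbT. Qed.
Let kpal : kp <= al. Proof. by rewrite ge_min lexx. Qed.
Let AD0 : 0 <= A * D `^ al. Proof. by rewrite mulr_ge0 ?powR_ge0. Qed.
Let L6 := Lb_ge.
Let eL : 1 <= expR Lb. Proof. by rewrite -expR0 ler_expR; have := L6; lra. Qed.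
Let T0 : 0 < T. Proof. by rewrite /T !mulr_gt0 ?expR_gt0 ?ltr_wpDl. Qed.

(** At scale [n], subtract the oscillation [m] of the boundary values and divide by the previous
    bound [B]: [boundary_step_lim] then reduces the interior part by [expR (- (3 / 8) Lb) / 2]. The
    other half of the new bound pays for [m], which decays with exponent [al]; both rates are at
    least [kp]. *)
Lemma boundary_scales (n : nat) p : Om p -> nrm (p - z0) <= D * expR (- (n%:R * Lb)) ->
  sg * (h p - g0) <= T * expR (- (kp * (n%:R * Lb))).
Proof.
elim: n p => [|n IH] p Op pn.
  rewrite mul0r mulr0 oppr0 expR0 mulr1; apply: le_trans (ib Op) _.
  rewrite /T; have := AD0; have := eL; have := M0; nra.
have n0 : (0 : R) <= n%:R by [].
set rn := D * expR (- (n%:R * Lb)).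
have rn0 : 0 < rn by rewrite mulr_gt0 ?expR_gt0.
set Q := expR (- (kp * (n%:R * Lb))).
set B := T * Q.
have Q0 : 0 < Q by exact: expR_gt0.
have B0 : 0 < B by rewrite mulr_gt0.
set m := A * D `^ al * expR (- (al * (n%:R * Lb))).
have m0 : 0 <= m by rewrite mulr_ge0 ?expR_ge0.
(* The extra factor [expR 1] puts the closed ball of the next scale inside an open disc. *)
pose rho := D * expR (- (n.+1%:R * Lb) + 1).
have rho0 : 0 < rho by rewrite mulr_gt0 ?expR_gt0.
have lrn : ln rn = ln D - n%:R * Lb by rewrite lnM ?posrE ?expR_gt0 // expRK.
have lrho : ln rho = ln D - n.+1%:R * Lb + 1 by rewrite lnM ?posrE ?expR_gt0 // expRK addrA.
have nS : n.+1%:R = n%:R + 1 :> R by rewrite -natr1.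
have prho : disc z0 rho p.
  by apply: le_lt_trans pn _; rewrite /rho ltr_pM2l // ltr_expR; lra.
have hb q : disc z0 rn q -> frontier Om q -> sg / B * h q + (- (sg * g0) - m) / B <= 0.
  move=> qd fq; have E : sg / B * h q + (- (sg * g0) - m) / B = (sg * (h q - g0) - m) / B by ring.
  rewrite E pmulr_lle0 ?invr_gt0 // subr_le0; apply: le_trans (fb fq) _.
  rewrite /m -mulrA ler_wpM2l //.
  have -> : - (al * (n%:R * Lb)) = (- (n%:R * Lb)) * al by ring.
  rewrite expRM -powRM ?expR_ge0 // ?(ltW D0) //.
  by apply: ge0_ler_powR; rewrite ?nnegrE ?nrm_ge0 ?(ltW rn0) ?(ltW al0) // ltW.
have hi q : disc z0 rn q -> Om q -> sg / B * h q + (- (sg * g0) - m) / B <= 1.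
  move=> qd Oq; have E : sg / B * h q + (- (sg * g0) - m) / B = (sg * (h q - g0) - m) / B by ring.
  rewrite E ler_pdivrMr // mul1r; have := IH q Oq (ltW qd); rewrite -/B; lra.
have lr : ln rho < ln rn - 4 by rewrite lrho lrn nS; have := L6; lra.
have := boundary_step_lim oOm sOm ch H z0O rn0 hb hi rho0 prho Op lr.
have -> : ln rn - 3 - ln rho = Lb - 4 by rewrite lrho lrn nS; ring.
have E : sg / B * h p + (- (sg * g0) - m) / B = (sg * (h p - g0) - m) / B by ring.
rewrite E ler_pdivrMr // => hh.
have h2 := Lb_half.
have e1 : expR (- (kp * (n.+1%:R * Lb))) = Q * expR (- (kp * Lb)).
  by rewrite /Q -expRD nS; congr expR; ring.
have e2 : expR (- (3 / 8 * Lb)) <= expR (- (kp * Lb)).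
  by rewrite ler_expR lerN2 ler_wpM2r //; have := L6; lra.
have e3 : m <= A * D `^ al * Q.
  rewrite /m ler_wpM2l // /Q ler_expR lerN2 ler_wpM2r // mulr_ge0 //; have := L6; lra.
have e4 : 1 <= expR Lb * expR (- (kp * Lb)).
  rewrite -expRD -expR0 ler_expR; have : kp <= 1 by have := kp1; lra.
  by have := L6; nra.
rewrite e1; set q := expR (- (kp * Lb)) in e1 e2 e4 *.
set S := Num.sqrt Cb * _ in h2 hh.
have q0 : 0 < q by exact: expR_gt0.
have i1 : S * B <= 2^-1 * q * B by rewrite ler_pM2r //; lra.
have i2 : A * D `^ al * Q * 1 <= A * D `^ al * Q * (expR Lb * q).
  by rewrite ler_wpM2l // mulr_ge0 // ltW.
have i3 : T * (Q * q) = 2^-1 * q * B + (A * D `^ al + M) * Q * (expR Lb * q).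
  by rewrite /B /T; field.
have i4 : 0 <= M * Q * (expR Lb * q) by rewrite !mulr_ge0 ?expR_ge0 // ?ltW.
rewrite i3; lra.
Qed.

(** The scale is the integer part of [ln (D / d) / Lb]; rounding costs at most a factor
    [expR Lb]. *)
Lemma boundary_holder_half p : Om p -> nrm (p - z0) <= D ->
  sg * (h p - g0) <= 2 * expR (2 * Lb) * (A * D `^ al + M) * (nrm (p - z0) / D) `^ kp.
Proof.
move=> Op pD; have d0 : 0 < nrm (p - z0).
  rewrite lt_neqAle nrm_ge0 andbT eq_sym; apply/eqP => /nrm_eq0/eqP.
  by rewrite subr_eq0 => /eqP pz; apply: z0O; rewrite -pz.
set d := nrm (p - z0) in d0 pD *.
have L0 : 0 < Lb by have := L6; lra.
set y := ln (D / d).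
have y0 : 0 <= y by rewrite ln_ge0 // ler_pdivlMr // mul1r.
have /truncn_itv/andP[n1 n2] : 0 <= y / Lb by rewrite divr_ge0 // ltW.
move: (Num.Def.trunc (y / Lb)) n1 n2 => n n1 n2.
rewrite ler_pdivlMr // in n1; rewrite ltr_pdivrMr // -natr1 in n2.
have dE : d = D * expR (- y).
  by rewrite expRN lnK ?posrE ?divr_gt0 // invf_div mulrC divfK // gt_eqF.
apply: le_trans (@boundary_scales n p Op _) _.
  by rewrite -/d dE ler_pM2l // ler_expR lerN2.
have -> : d / D = expR (- y) by rewrite dE mulrC mulKf // gt_eqF.
rewrite -expRM /T.
have -> : 2 * expR (2 * Lb) * (A * D `^ al + M) * expR (- y * kp) =
  2 * (A * D `^ al + M) * expR Lb * expR (Lb + - y * kp).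
  by rewrite expRD (_ : 2 * Lb = Lb + Lb) ?expRD; [ring|ring].
rewrite ler_pM2l; last by rewrite !mulr_gt0 ?expR_gt0 // ltr_wpDl.
rewrite ler_expR; have : kp * ((n%:R + 1) * Lb - y) >= 0 by rewrite mulr_ge0 ?ltW // subr_gt0.
have : kp * Lb <= Lb by have := kp1; nra.
lra.
Qed.

End Iterate.

Definition Cbd : R := 2 * expR (2 * Lb).

Lemma Cbd_gt0 : 0 < Cbd. Proof. by rewrite mulr_gt0 ?expR_gt0. Qed.

Lemma boundary_holder Om h hx hy hxx hxy hyx hyy z0 (g0 A M D al : R) :
  open Om -> bounded_set Om -> simply_connected Om -> {within closure Om, continuous h} ->
  C2harm Om h hx hy hxx hxy hyx hyy -> ~ Om z0 ->
  0 <= A -> 0 < M -> 0 < D -> 0 < al -> al <= 1 ->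
  (forall p, frontier Om p -> `|h p - g0| <= A * nrm (p - z0) `^ al) ->
  (forall p, frontier Om p -> `|h p| <= M) -> `|g0| <= M ->
  forall p, Om p -> nrm (p - z0) <= D ->
  `|h p - g0| <= Cbd * (A * D `^ al + M) * (nrm (p - z0) / D) `^ Num.min al (3 / 8).
Proof.
move=> oO bO sO ch H z0O A0 M0 D0 al0 al1 fb fM gM p Op pD.
have hM q : Om q -> `|h q| <= M.
  by move=> Oq; apply: (harmonic_bound oO bO (C2harm_harmonic_on oO H) ch fM) (subset_closure Oq).
have half (sg : R) : `|sg| = 1 -> sg * (h p - g0) <=
    Cbd * (A * D `^ al + M) * (nrm (p - z0) / D) `^ Num.min al (3 / 8).
  move=> s1; have sn x : sg * x <= `|x| by rewrite -[leRHS]mul1r -s1 -normrM ler_norm.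
  rewrite /Cbd; apply: (boundary_holder_half oO sO ch H z0O A0 M0 D0 al0) => //.
    by move=> q fq; apply: le_trans (sn _) _; exact: fb.
  move=> q Oq; apply: le_trans (sn _) _; have := ler_normB (h q) g0; have := hM q Oq; rlra.
have h1 := half 1 (normr1 R); have h2 := half (-1) (normrN1 R).
by rewrite ler_norml; apply/andP; split; rlra.
Qed.

End BoundaryHolder.

(** * Local harmonic conjugates *)

Section Conjugate.
Context {R : realType}.
Implicit Types (p q z : R * R) (f g fx fy : R * R -> R) (U : set (R * R)).

Lemma cont_hslice f p (x : R) : {for p, continuous f} -> x = p.2 ->
  {for p.1, continuous (fun s => f (s, x))}.
Proof.
case: p => a b /= cf ->; apply: (@continuous_comp _ _ _ (fun s : R => (s, b)) f) => //.
by have := cvg_pair (cvg_id : id @ a --> a) (cvg_cst b : (fun=> b) @ a --> b); exact.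
Qed.

Lemma cont_vslice f p (x : R) : {for p, continuous f} -> x = p.1 ->
  {for p.2, continuous (fun s => f (x, s))}.
Proof.
case: p => a b /= cf ->; apply: (@continuous_comp _ _ _ (fun s : R => (a, s)) f) => //.
by have := cvg_pair (cvg_cst a : (fun=> a) @ b --> a) (cvg_id : id @ b --> b); exact.
Qed.

(** [phi] integrates [- hy] along the bottom side of the half-size box and then [hx] upwards. Its
    horizontal derivative is obtained under the integral sign, where [hxx = - hyy] makes the
    vertical integral explicit. *)
Lemma local_conjugate p (d : R) h hx hy hxx hxy hyx hyy :
  C2harm [set q | box p d q] h hx hy hxx hxy hyx hyy ->
  exists phi, forall q, box p (d / 2) q -> C1at q phi (fun q => - hy q) hx.
Proof.
move=> H; have [d0|d0] := leP d 0.
  by exists h => q [q1 _]; have := normr_ge0 (q.1 - p.1); rlra.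
pose b1 := p.1 - d / 2; pose b2 := p.2 - d / 2.
pose t1 := p.1 + d / 2; pose t2 := p.2 + d / 2.
have inb (x y : R) : b1 <= x <= t1 -> b2 <= y <= t2 -> box p d (x, y).
  by move=> /andP[x1 x2] /andP[y1 y2]; split; rewrite /= ltr_norml; rewrite /b1 /b2 /t1 /t2 in x1 x2 y1 y2; rlra.
have cx x y : b1 <= x <= t1 -> b2 <= y <= t2 -> {for (x, y), continuous hx}.
  move=> xb yb; have [_ Hx _ _] := H _ (inb x y xb yb).
  by apply: (C1_continuous (@open_boxset R p d) (inb x y xb yb)) => q /H[_ h1 _ _]; exact: h1.
have cy x y : b1 <= x <= t1 -> b2 <= y <= t2 -> {for (x, y), continuous hy}.
  move=> xb yb; have [_ _ Hx _] := H _ (inb x y xb yb).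
  by apply: (C1_continuous (@open_boxset R p d) (inb x y xb yb)) => q /H[_ _ h1 _]; exact: h1.
have cxx x y : b1 <= x <= t1 -> b2 <= y <= t2 -> {for (x, y), continuous hxx}.
  by move=> xb yb; have [_ [_ _ c _] _ _] := H _ (inb x y xb yb).
have [K HK] : exists K : R, forall x y, b1 <= x <= t1 -> b2 <= y <= t2 -> `|hxx (x, y)| <= K.
  pose K0 : set (R * R) := `[b1, t1]%classic `*` `[b2, t2]%classic.
  have cK : compact K0 by apply: compact_setX; exact: segment_compact.
  have K00 : K0 !=set0.
    by exists p; split; rewrite /= in_itv /= /b1 /b2 /t1 /t2; apply/andP; split; rlra.
  have cA : {within K0, continuous (fun x : R * R => `|hxx x|)}.
    apply: continuous_in_subspaceT => -[x y] /set_mem [/= q1 q2].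
    rewrite in_itv /= in q1; rewrite in_itv /= in q2.
    by apply: (@continuous_comp _ _ _ hxx); [exact: cxx|exact: norm_continuous].
  have [m _ Hm] := compact_max2 K00 cK cA.
  by exists `|hxx m| => x y xb yb; apply: (Hm (x, y)); split; rewrite /= in_itv.
pose phi (q : R * R) := intg b2 q.2 (fun t => hx (q.1, t)) - intg b1 q.1 (fun s => hy (s, b2)).
exists phi => -[x y] bq.
have [xb yb] : b1 < x < t1 /\ b2 < y < t2.
  by case: bq => /=; rewrite !ltr_norml /b1 /b2 /t1 /t2 => ? ?; split; rlra.
have xw : b1 <= x <= t1 by rlra. have yw : b2 <= y <= t2 by rlra.
have bb : b2 <= b2 <= t2 by rewrite lexx /b2 /t2; rlra.
have cxs s : b1 <= s <= t1 -> cont_on b2 t2 (fun t => hx (s, t)).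
  by move=> sb t tb; exact: (cont_vslice (cx s t sb tb)).
split => /=.
- have D1 : is_derive x 1 (fun s => intg b1 s (fun s => hy (s, b2))) (hy (x, b2)).
    have C : cont_on b1 t1 (fun s => hy (s, b2)) by move=> s sb; exact: (cont_hslice (cy s b2 sb bb)).
    by apply: int_FTC1 C _ _; rlra.
  pose r := Num.min (x - b1) (t1 - x).
  have r0 : 0 < r by rewrite lt_min; apply/andP; split; rlra.
  have sr s : `|s - x| < r -> b1 <= s <= t1.
    by rewrite /r lt_min !ltr_norml => /andP[/andP[s1 s2] /andP[s3 s4]]; rlra.
  have D2 : is_derive x 1 (fun s => intg b2 y (fun t => hx (s, t))) (intg b2 y (fun t => hxx (x, t))).
    have := @dint R b2 y (fun s t => hx (s, t)) (fun s t => hxx (s, t)) x r K r0; apply.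
      move=> s t /sr sb tb; have tw : b2 <= t <= t2 by rlra.
      by split; [have [_ [e1 _ _ _] _ _] := H _ (inb s t sb tw)|exact: HK].
    by move=> s /sr sb; apply: cont_onW (cxs s sb); rlra.
  have E : intg b2 y (fun t => hxx (x, t)) = - (hy (x, y) - hy (x, b2)).
    have dyy t : b2 <= t <= y -> is_derive t 1 (fun t => hy (x, t)) (hyy (x, t)).
      move=> tb; have tw : b2 <= t <= t2 by rlra.
      by have [_ _ [_ e1 _ _] _] := H _ (inb x t xw tw).
    have cyy : cont_on b2 y (fun t => hyy (x, t)).
      move=> t tb; have tw : b2 <= t <= t2 by rlra.
      have [_ _ [_ _ _ c] _] := H _ (inb x t xw tw).
      exact: (cont_vslice c).
    have yb2 : b2 <= y by rlra.
    rewrite -(int_FTC2 yb2 cyy dyy) -mulN1r -intZ //.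
    apply: eq_int => t tb; have tw : b2 <= t <= t2 by rlra.
    by have [_ _ _ e] := H _ (inb x t xw tw); rlra.
  by have := dB D2 D1; rewrite E; congr (is_derive _ _ _ _); ring.
- have D2 : is_derive y 1 (fun s => intg b2 s (fun t => hx (x, t))) (hx (x, y)).
    by apply: int_FTC1 (cxs x xw) _ _; rlra.
  by have := dB D2 (dcst y (intg b1 x (fun s => hy (s, b2)))); rewrite subr0.
- by apply: cvgN; exact: cy.
- exact: cx.
Qed.

Lemma gradient_unique p (r : R) f g fx fy :
  (forall q, box p r q -> C1at q f fx fy) -> (forall q, box p r q -> C1at q g fx fy) ->
  forall a b, box p r a -> box p r b -> f b - f a = g b - g a.
Proof.
move=> Hf Hg a b ba bb.
have := @rect_mvt R p r (fun q => f q - g q) (fun=> 0) (fun=> 0) 0 0 0 _ a b ba bb.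
rewrite !mul0r addr0 !subr0 => K.
suff : `|f b - g b - (f a - g a)| <= 0 by rewrite normr_le0 subr_eq0 => /eqP e; rlra.
apply: K => q bq; have [d1 d2 _ _] := Hf q bq; have [e1 e2 _ _] := Hg q bq.
split; rewrite ?subrr ?normr0 //.
  by have := dB d1 e1; rewrite subrr.
by have := dB d2 e2; rewrite subrr.
Qed.

Lemma C1_affine_error p (r L : R) f fx fy a b :
  (forall q, box p r q -> C1at q f fx fy) ->
  (forall q, box p r q -> `|fx q - fx p| <= L /\ `|fy q - fy p| <= L) ->
  box p r a -> box p r b ->
  `|f b - f a - (fx p * (b.1 - a.1) + fy p * (b.2 - a.2))| <= L * (`|b.1 - a.1| + `|b.2 - a.2|).
Proof.
move=> Hf HL ba bb; apply: (@rect_mvt R p r f fx fy) ba bb => q bq.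
by have [d1 d2 _ _] := Hf q bq; have [? ?] := HL q bq.
Qed.

(* Discrete Cauchy-Riemann relation: [w2 - w1] is [c] times the rotation of [y - x] by a
   quarter turn. *)
Lemma cauchy_riemann_error p (r L c : R) h hx hy phi x y w1 w2 :
  (forall q, box p r q -> C1at q h hx hy) ->
  (forall q, box p r q -> C1at q phi (fun q => - hy q) hx) ->
  (forall q, box p r q -> `|hx q - hx p| <= L /\ `|hy q - hy p| <= L) ->
  box p r x -> box p r y -> box p r w1 -> box p r w2 -> 0 <= c ->
  w2.1 - w1.1 = - c * (y.2 - x.2) -> w2.2 - w1.2 = c * (y.1 - x.1) ->
  `|c * (h y - h x) - (phi w2 - phi w1)| <= 2 * c * L * (`|y.1 - x.1| + `|y.2 - x.2|).
Proof.
move=> Hh Hp HL bx by_ b1 b2 c0 E1 E2.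
have k1 := C1_affine_error Hh HL bx by_.
have HL' q : box p r q -> `|- hy q - - hy p| <= L /\ `|hx q - hx p| <= L.
  by move=> /HL[? ?]; rewrite -opprD normrN.
have k2 := C1_affine_error Hp HL' b1 b2.
rewrite E1 E2 in k2.
set A := h y - h x - _ in k1; set B := phi w2 - phi w1 - _ in k2.
have -> : c * (h y - h x) - (phi w2 - phi w1) = c * A - B by rewrite /A /B; ring.
apply: le_trans (ler_normB _ _) _; rewrite normrM ger0_norm //.
have e1 : `|- c * (y.2 - x.2)| = c * `|y.2 - x.2| by rewrite normrM normrN (ger0_norm c0).
have e2 : `|c * (y.1 - x.1)| = c * `|y.1 - x.1| by rewrite normrM (ger0_norm c0).
rewrite e1 e2 in k2.
have : c * `|A| <= c * (L * (`|y.1 - x.1| + `|y.2 - x.2|)) by rewrite ler_wpM2l.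
rlra.
Qed.

End Conjugate.

(** * Faces of plane drawings *)

Section PlaneSets.
Context {R : realType}.
Implicit Types (p q z a b : R * R) (A B C U : set (R * R)).

Lemma in_itv_conn : connected (`]0, 1[%classic : set R) /\ connected (`[0, 1]%classic : set R).
Proof. by split; apply/connected_intervalP; exact: interval_is_interval. Qed.

Definition epoint a b (s : R) : R * R := (1 - s) *: a + s *: b.

Lemma epointE a b s : epoint a b s = a + s *: (b - a).
Proof. by rewrite /epoint scalerBr scalerBl scale1r addrAC addrA. Qed.

Lemma epointC a b s : epoint b a (1 - s) = epoint a b s.
Proof. by rewrite /epoint subKr addrC. Qed.

Lemma continuous_epoint a b : continuous (epoint a b).
Proof.
move=> s; apply: cvgD.
  by apply: cvgZ; [apply: cvgB; [exact: cvg_cst|exact: cvg_id]|exact: cvg_cst].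
by apply: cvgZ; [exact: cvg_id|exact: cvg_cst].
Qed.

Lemma segment2E a b : segment2 a b = [set epoint a b s | s in `[0, 1]%classic].
Proof. by []. Qed.

Lemma connected_segment2 a b : connected (segment2 a b).
Proof.
rewrite segment2E; apply: connected_continuous_connected; first exact: in_itv_conn.2.
by apply: continuous_subspaceT => s; exact: continuous_epoint.
Qed.

Lemma compact_segment2 a b : compact (segment2 a b).
Proof.
rewrite segment2E; apply: continuous_compact; last exact: segment_compact.
by apply: continuous_subspaceT => s; exact: continuous_epoint.
Qed.

Lemma segment2C a b : segment2 b a = segment2 a b.
Proof.
have H x y : segment2 x y `<=` segment2 y x.
  move=> z [t]; rewrite /= in_itv /= => tb <-; exists (1 - t); last by rewrite subKr addrC.
  by rewrite /= in_itv /=; rlra.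
by apply/seteqP; split; exact: H.
Qed.

Lemma segment2_l a b : segment2 a b a.
Proof. by exists 0; rewrite /= ?in_itv /= ?lexx ?ler01 // subr0 scale1r scale0r addr0. Qed.

Lemma segment2_r a b : segment2 a b b.
Proof. by rewrite -segment2C; exact: segment2_l. Qed.

Definition convexs A := forall p q, A p -> A q -> segment2 p q `<=` A.

Lemma convex_connected A : convexs A -> connected A.
Proof.
move=> cA; have [->|/set0P[p Ap]] := eqVneq A set0; first exact: connected0.
have -> : A = connected_component A p; last exact: component_connected.
apply/seteqP; split => [q Aq|]; last exact: connected_component_sub.
apply: (connected_component_max (segment2_l p q)) (segment2_r p q); first exact: cA.
exact: connected_segment2.
Qed.

Lemma convex_comb_lt (x y e t : R) : x < e -> y < e -> 0 <= t <= 1 -> (1 - t) * x + t * y < e.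
Proof.
move=> xe ye /andP[t0 t1]; have h1 : (1 - t) * x <= (1 - t) * e by rewrite ler_wpM2l ?subr_ge0 // ltW.
have [t00|tn] := eqVneq t 0; first by rewrite t00 mul0r addr0 subr0 mul1r.
have : t * y < t * e by rewrite ltr_pM2l // lt_def tn.
rlra.
Qed.

Lemma convex_box p e : convexs (box p e).
Proof.
move=> a b [a1 a2] [b1 b2] z [t]; rewrite /= in_itv /= => /andP[t0 t1] <-.
have t01 : 0 <= t <= 1 by rewrite t0.
have tri (x y c : R) : `|x - c| < e -> `|y - c| < e -> `|(1 - t) * x + t * y - c| < e.
  move=> hx hy; apply: le_lt_trans (convex_comb_lt hx hy t01).
  have -> : (1 - t) * x + t * y - c = (1 - t) * (x - c) + t * (y - c) by ring.
  apply: le_trans (ler_normD _ _) _.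
  by rewrite !normrM (ger0_norm t0) ger0_norm // subr_ge0.
by split; rewrite /= /GRing.scale /=; exact: tri.
Qed.

Lemma convex_half a (u : R * R) : convexs [set z | 0 < cross u (z - a)].
Proof.
move=> p q /= hp hq z [t]; rewrite /= in_itv /= => /andP[t0 t1] <-.
have -> : cross u ((1 - t) *: p + t *: q - a) = (1 - t) * cross u (p - a) + t * cross u (q - a).
  by rewrite /cross /= /GRing.scale /=; ring.
rewrite -oppr_lt0 opprD -!mulrN; apply: convex_comb_lt; rewrite ?oppr_lt0 // t0.
exact: t1.
Qed.

Lemma convexI A B : convexs A -> convexs B -> convexs (A `&` B).
Proof. by move=> cA cB p q [? ?] [? ?] z zs; split; [exact: cA zs|exact: cB zs]. Qed.

(** Without a frontier point, the trace of [A] on [B] would be both open and closed in [B]. *)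
Lemma connected_frontier B A : connected B -> B `&` A !=set0 -> B `&` ~` A !=set0 ->
  B `&` frontier A !=set0.
Proof.
move=> cB BA [q [Bq nAq]]; apply: contrapT => nf.
have fr x : B x -> A x <-> interior A x.
  move=> Bx; split=> [Ax|]; last exact: interior_subset.
  apply: contrapT => ni; apply: nf; exists x; split => //; split => //.
  exact: subset_closure.
have fc x : B x -> A x <-> closure A x.
  move=> Bx; split=> [|cx]; first exact: subset_closure.
  apply: contrapT => nA; apply: nf; exists x; split => //; split => //.
  by move/interior_subset.
have E : B `&` A = B.
  apply: cB => //.
    exists (interior A); first exact: open_interior.
    by apply/seteqP; split=> x [Bx] /(fr x Bx).
  exists (closure A); first exact: closed_closure.
  by apply/seteqP; split=> x [Bx] /(fc x Bx).
by apply: nAq; have [] : (B `&` A) q by rewrite E.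
Qed.

(** The sets where [P] holds and where it fails are traces of the unions of balls [O], so
    connectedness of the open interval applies. *)
Lemma locally_constant (P : R -> Prop) :
  (forall s : R, 0 < s < 1 -> exists2 r : R, 0 < r &
     forall s', 0 < s' < 1 -> `|s' - s| < r -> P s' <-> P s) ->
  forall s s', 0 < s < 1 -> 0 < s' < 1 -> P s -> P s'.
Proof.
move=> lc s s' s01 s'01 Ps.
pose O (Q : R -> Prop) := \bigcup_(t in [set t : R * R | [/\ 0 < t.1 < 1, Q t.1, 0 < t.2 &
   forall u, 0 < u < 1 -> `|u - t.1| < t.2 -> P u <-> P t.1]]) ball t.1 t.2.
have oO Q : open (O Q) by apply: bigcup_open => t [_ _ t0 _]; exact: ball_open.
have OE (Q : R -> Prop) : (Q = P \/ Q = (fun x => ~ P x)) -> forall x, 0 < x < 1 -> Q x <-> O Q x.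
  move=> QE x x01; split=> [Qx|[[t r] [/= t01 Qt r0 H] xb]].
    by have [r r0 H] := lc x x01; exists (x, r) => //; exact: ballxx.
  have := H x x01; rewrite distrC => /(_ xb) E.
  by case: QE Qt => ->; tauto.
have [c _] := in_itv_conn.
have E : `]0, 1[%classic `&` P = `]0, 1[%classic.
  apply: c; first by exists s; split; rewrite //= in_itv.
    exists (O P); first exact: oO.
    apply/seteqP; split=> x [/= x01] h; split => //; rewrite in_itv /= in x01;
      by apply/(OE P _ x x01); [left|].
  exists (~` O (fun x => ~ P x)); first exact: open_closedC.
  apply/seteqP; split=> x [/= x01] h; split => //; rewrite in_itv /= in x01.
    by move=> /(OE (fun x => ~ P x) (or_intror erefl) x x01).
  by apply: contrapT => /(OE (fun x => ~ P x) (or_intror erefl) x x01).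
by have [] : (`]0, 1[%classic `&` P) s' by rewrite E /= in_itv.
Qed.

(** Used to choose a height or a parameter in general position; each listed value costs at most half
    of the interval. *)
Lemma avoid_seq (t : seq R) (a b : R) : a < b -> exists2 x, a < x < b & x \notin t.
Proof.
elim: t a b => [|y t IH] a b ab; first by exists ((a + b) / 2); [rlra|].
have [yl|yl] := leP y ((a + b) / 2).
  have [|x xb xt] := IH ((a + b) / 2) b; first rlra.
  by exists x; [rlra|rewrite in_cons negb_or xt andbT gt_eqF //; rlra].
have [|x xb xt] := IH a ((a + b) / 2); first rlra.
by exists x; [rlra|rewrite in_cons negb_or xt andbT lt_eqF //; rlra].
Qed.

Definition jrot (u : R * R) : R * R := (- u.2, u.1).

Lemma cross_jrot u : cross u (jrot u) = nrm u ^+ 2.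
Proof. by rewrite nrm_sqr /cross /jrot /=; ring. Qed.

(* [C] is a union of connected components of the complement of [Ga]. *)
Definition sat (Ga C : set (R * R)) := [/\ C `<=` ~` Ga, open C &
  forall B, connected B -> B `<=` ~` Ga -> B `&` C !=set0 -> B `<=` C].

Lemma open_component U z : open U -> open (connected_component U z).
Proof.
move=> oU; rewrite openE => p cp; apply/interior_box.
have Up := connected_component_sub cp.
have [e e0 He] := open_box oU Up; exists e => // q bq.
rewrite (same_connected_component cp).
have bp : box p e p by split; rewrite subrr normr0.
by apply: (connected_component_max bp He) bq; apply: convex_connected; exact: convex_box.
Qed.

Lemma sat_component (Ga : set (R * R)) z : closed Ga -> sat Ga (connected_component (~` Ga) z).
Proof.
move=> cG; split; first exact: connected_component_sub.
  by apply: open_component; exact: closed_openC.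
move=> B cB BG [p [Bp Cp]]; rewrite (same_connected_component Cp).
exact: connected_component_max.
Qed.

(* [lside Ga a b s C]: just to the left of the point of parameter [s] of the directed
   edge from [a] to [b] one is in [C]. *)
Definition lside a b (s : R) C := exists2 r : R, 0 < r &
  forall z, box (epoint a b s) r z -> 0 < cross (b - a) (z - a) -> C z.

(** Near an interior point of the edge, [Ga] stays on the line of the edge, so the two half boxes
    beside it are free of [Ga]. *)
Definition flat (Ga : set (R * R)) a b := forall s, 0 < s < 1 -> exists2 r : R, 0 < r &
  forall z, box (epoint a b s) r z -> Ga z -> cross (b - a) (z - a) = 0.

Lemma cross_opp a b z : cross (a - b) (z - b) = - cross (b - a) (z - a).
Proof. by rewrite /cross /=; ring. Qed.

Lemma cross_epoint a b s : cross (b - a) (epoint a b s - a) = 0.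
Proof. by rewrite /cross /epoint /= /GRing.scale /=; ring. Qed.

Lemma left_point a b s (e : R) : a <> b -> 0 < e ->
  exists2 z, box (epoint a b s) e z & 0 < cross (b - a) (z - a).
Proof.
move=> ab e0; have N0 : 0 < nrm (b - a).
  rewrite lt_def nrm_ge0 andbT; apply/eqP => /nrm_eq0/eqP.
  by rewrite subr_eq0 => /eqP E; apply: ab.
pose t := e / (2 * nrm (b - a)); have t0 : 0 < t by rewrite divr_gt0 // mulr_gt0.
have tE : t * nrm (b - a) = e / 2 by rewrite /t; field; rewrite gt_eqF.
exists (epoint a b s + t *: jrot (b - a)).
  have h1 := nrm_ge1 (b - a); have h2 := nrm_ge2 (b - a); rewrite /= in h1 h2.
  have g1 : t * `|b.1 - a.1| <= e / 2 by rewrite -tE ler_pM2l.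
  have g2 : t * `|b.2 - a.2| <= e / 2 by rewrite -tE ler_pM2l.
  split; rewrite /= /GRing.scale /= addrAC subrr add0r normrM (gtr0_norm t0) ?normrN; rlra.
have -> : cross (b - a) (epoint a b s + t *: jrot (b - a) - a) = t * cross (b - a) (jrot (b - a)).
  by rewrite /cross /epoint /= /GRing.scale /=; ring.
by rewrite cross_jrot mulr_gt0 // exprn_gt0.
Qed.

Section Sides.
Variables (Ga : set (R * R)) (a b : R * R).
Hypotheses (ab : a <> b) (fG : flat Ga a b).

(** The half box on the left is connected and avoids [Ga], hence lies in [C] or misses it. *)
Lemma lside_dec C s : sat Ga C -> 0 < s < 1 -> lside a b s C \/ lside a b s (~` C).
Proof.
move=> [CG _ satC] s01; have [r r0 Hr] := fG s01.
pose B := box (epoint a b s) r `&` [set z | 0 < cross (b - a) (z - a)].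
have cB : connected B by apply: convex_connected; apply: convexI; [exact: convex_box|exact: convex_half].
have BG : B `<=` ~` Ga by move=> z [bz /= cz] /(Hr z bz) E; rewrite E ltxx in cz.
have [m|nm] := pselect (B `&` C !=set0).
  by left; exists r => // z bz cz; apply: (satC B) => //; split.
by right; exists r => // z bz cz Cz; apply: nm; exists z; split => //; split.
Qed.

Lemma lside_near C s (e : R) : lside a b s C -> 0 < e ->
  exists z, [/\ box (epoint a b s) e z, 0 < cross (b - a) (z - a) & C z].
Proof.
move=> [r r0 H] e0.
have [|z [z1 z2] cz] := @left_point a b s (Num.min r e) ab; first by rewrite lt_min r0.
rewrite !lt_min in z1 z2; move: z1 z2 => /andP[z1 z1'] /andP[z2 z2'].
by exists z; split => //; apply: H.
Qed.

Lemma lside_excl C s : lside a b s C -> lside a b s (~` C) -> False.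
Proof.
move=> H [r r0 H']; have [z [bz cz Cz]] := lside_near H r0.
exact: H' bz cz Cz.
Qed.

Lemma box_epoint s (r : R) : 0 < r -> exists2 e : R, 0 < e &
  forall s', `|s' - s| < e -> box (epoint a b s) r (epoint a b s').
Proof.
move=> r0; have : nbhs (epoint a b s) (box (epoint a b s) r) by apply/nbhs_box; exists r.
move=> /(@continuous_epoint a b s)[e e0 He].
by exists e => // s'; rewrite distrC => /He.
Qed.

Lemma lside_const C s s' : sat Ga C -> 0 < s < 1 -> 0 < s' < 1 -> lside a b s C -> lside a b s' C.
Proof.
move=> sC; apply: (@locally_constant (fun s => lside a b s C)) => {}s s01.
have [[r r0 Hr]|[r r0 Hr]] := lside_dec sC s01; have [e e0 He] := box_epoint s (divr_gt0 r0 (ltr0Sn R 1)).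
- exists e => // s'' s01' ss; have [h1 h2] := He _ ss.
  split=> _; first by exists r.
  exists (r / 2); first by rewrite divr_gt0.
  move=> z [z1 z2]; apply: Hr; split.
    by apply: le_lt_trans (ler_distD (epoint a b s'').1 _ _) _; lra.
  by apply: le_lt_trans (ler_distD (epoint a b s'').2 _ _) _; lra.
- exists e => // s'' s01' ss; have [h1 h2] := He _ ss.
  split=> H; exfalso; last by apply: (lside_excl H); exists r.
  apply: (lside_excl H); exists (r / 2); first by rewrite divr_gt0.
  move=> z [z1 z2]; apply: Hr; split.
    by apply: le_lt_trans (ler_distD (epoint a b s'').1 _ _) _; lra.
  by apply: le_lt_trans (ler_distD (epoint a b s'').2 _ _) _; lra.
Qed.

(** A point of [C] close to the edge can be moved off its line because [C] is open; the half box
    containing the moved point then lies in [C]. Reversing the edge turns the parameter [s] into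
    [1 - s]. *)
Lemma closure_sides C s : sat Ga C -> 0 < s < 1 -> closure C (epoint a b s) ->
  lside a b s C \/ lside b a (1 - s) C.
Proof.
move=> sC s01 /closure_box cC; have [CG oC satC] := sC.
have [r r0 Hr] := fG s01.
have [q Cq bq] := cC r r0.
have [e e0 He] := open_box oC Cq.
have oB : open (box (epoint a b s) r) by exact: open_boxset.
have [e' e'0 He'] := open_box oB bq.
pose m := Num.min e e'.
have m0 : 0 < m by rewrite lt_min e0.
have [z [bz Cz]] : exists z, [/\ box (epoint a b s) r z, C z & cross (b - a) (z - a) != 0].
  have [cq|cq] := eqVneq (cross (b - a) (q - a)) 0; last by exists q.
  have [z [z1 z2] cz] := left_point 0 ab m0.
  have e0E : epoint a b 0 = a by rewrite /epoint subr0 scale1r scale0r addr0.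
  rewrite e0E !lt_min in z1 z2; move: z1 z2 => /andP[z1 z1'] /andP[z2 z2'].
  have b1 x : `|z.1 - a.1| < x -> `|z.2 - a.2| < x -> box q x (q + (z - a)).
    by move=> h1 h2; split; rewrite /= addrAC subrr add0r.
  exists (q + (z - a)); split; [exact/He'/b1|exact/He/b1|].
  have -> : cross (b - a) (q + (z - a) - a) = cross (b - a) (q - a) + cross (b - a) (z - a).
    by rewrite /cross /=; ring.
  by rewrite cq add0r gt_eqF.
rewrite neq_lt => /orP[cz|cz].
  right; exists r => // y; rewrite epointC cross_opp oppr_gt0 => by_ cy.
  pose B := box (epoint a b s) r `&` [set z | 0 < cross (a - b) (z - b)].
  have cB : connected B by apply: convex_connected; apply: convexI; [exact: convex_box|exact: convex_half].
  have BG : B `<=` ~` Ga.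
    by move=> x [bx /=]; rewrite cross_opp oppr_gt0 => cx /(Hr x bx) E; rewrite E ltxx in cx.
  apply: (satC B) => //; last by split => //=; rewrite cross_opp oppr_gt0.
  by exists z; split => //; split => //=; rewrite cross_opp oppr_gt0.
left; exists r => // y by_ cy.
pose B := box (epoint a b s) r `&` [set z | 0 < cross (b - a) (z - a)].
have cB : connected B by apply: convex_connected; apply: convexI; [exact: convex_box|exact: convex_half].
have BG : B `<=` ~` Ga by move=> x [bx /= cx] /(Hr x bx) E; rewrite E ltxx in cx.
by apply: (satC B) => //; exists z; split.
Qed.

Lemma lside_closure C s s' : sat Ga C -> 0 < s < 1 -> lside a b s C ->
  0 <= s' <= 1 -> closure C (epoint a b s').
Proof.
move=> sC s01 H s'01; apply/closure_box => e e0.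
have [d d0 Hd] := box_epoint s' (divr_gt0 e0 (ltr0Sn R 1)).
have [t t01 td] : exists2 t : R, 0 < t < 1 & `|t - s'| < d.
  have [|t tb _] := @avoid_seq [::] (Num.max 0 (s' - d)) (Num.min 1 (s' + d)).
    by rewrite lt_min !gt_max; apply/andP; split; apply/andP; split; lra.
  move: tb; rewrite gt_max lt_min => /andP[/andP[? ?] /andP[? ?]].
  by exists t; [lra|rewrite ltr_norml; lra].
have [h1 h2] := Hd _ td.
have [z [[z1 z2] _ Cz]] := lside_near (lside_const sC s01 t01 H) (divr_gt0 e0 (ltr0Sn R 1)).
exists z => //; split.
  by apply: le_lt_trans (ler_distD (epoint a b t).1 _ _) _; lra.
by apply: le_lt_trans (ler_distD (epoint a b t).2 _ _) _; lra.
Qed.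

End Sides.
End PlaneSets.

(** * Topology of the drawing and of its outer face *)

Section PlaneMaps.
Context {R : realType}.
Implicit Types (p q z a b : R * R) (A B C U : set (R * R)).

Lemma interior_setC A : interior (~` A) = ~` closure A.
Proof.
apply/seteqP; split=> z.
  move=> /interior_box[e e0 He] /closure_box/(_ e e0)[q Aq /He]; exact.
move=> nc; apply/interior_box; apply: contrapT => H; apply: nc; apply/closure_box => e e0.
apply: contrapT => nq; apply: H; exists e => // q bq Aq; apply: nq; by exists q.
Qed.

Lemma nonopp_nsegment a b p : ~ segment2 a b p -> nonopp (a - p) (b - p).
Proof.
move=> H; apply: nonopp_seg => -[t t01 E]; apply: H; exists t => //.
have : (1 - t) *: (a - p) + t *: (b - p) + p = p by rewrite E add0r.
by rewrite !scalerBr addrACA -opprD -scalerDl subrK scale1r subrK.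
Qed.

(** The points reachable by polygons form a set that is open and closed in [U]. *)
Lemma polygonal_path U p q : open U -> connected U -> U p -> U q ->
  exists n (P : nat -> R * R), [/\ P 0%N = p, P n = q &
    forall i, (i < n)%N -> segment2 (P i) (P i.+1) `<=` U].
Proof.
move=> oU cU Up Uq.
pose reach z := exists n (P : nat -> R * R), [/\ P 0%N = p, P n = z &
    forall i, (i < n)%N -> segment2 (P i) (P i.+1) `<=` U].
have ext z z' : reach z -> segment2 z z' `<=` U -> reach z'.
  move=> [n [P [P0 Pn HP]]] zz'; exists n.+1, (fun i => if (i <= n)%N then P i else z').
  split; rewrite ?ltnn // => i; rewrite ltnS => ni; rewrite ni.
  by case: (leqP i.+1 n) => [/HP//|ni']; have -> : i = n; [apply/eqP; rewrite eqn_leq ni|rewrite Pn].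
have near z : U z -> exists2 e : R, 0 < e & forall z', box z e z' -> U z' /\ (reach z <-> reach z').
  move=> Uz; have [e e0 He] := open_box oU Uz; exists e => // z' bz'; split; first exact: He.
  have bz : box z e z by split; rewrite subrr normr0.
  have s1 : segment2 z z' `<=` U by move=> x xs; apply: He; exact: (convex_box bz bz').
  by split=> h; [exact: ext h s1|apply: ext h _; rewrite segment2C].
pose A1 := [set z | U z /\ reach z]; pose A2 := [set z | U z /\ ~ reach z].
have o1 : open A1.
  rewrite openE => z [Uz rz]; apply/interior_box; have [e e0 He] := near z Uz.
  by exists e => // z' /He[Uz' [r1 _]]; split => //; exact: r1.
have o2 : open A2.
  rewrite openE => z [Uz rz]; apply/interior_box; have [e e0 He] := near z Uz.
  by exists e => // z' /He[Uz' [_ r2]]; split => // /r2.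
have E : A1 = U.
  apply: cU.
  - by exists p; split => //; exists 0%N, (fun=> p).
  - exists A1 => //; apply/seteqP; split=> z; last by move=> [].
    by move=> h; split => //; case: h.
  - exists (~` A2); first exact: open_closedC.
    apply/seteqP; split=> z [Uz h]; first by split => // -[].
    by split => //; apply: contrapT => nr; apply: h.
by have [] : A1 q by rewrite E.
Qed.

(** What remains is the image of an open interval, or of two half-open intervals sharing the point
    [ga 0 = ga 1]. *)
Lemma curve_minus_point A m : simple_closed_curve A -> A m -> connected (A `\ m).
Proof.
move=> [ga [cga g01 inj im]] Am.
have ci (i : interval R) : [set` i] `<=` `[0, 1]%classic -> connected (ga @` [set` i]).
  move=> i01; apply: connected_continuous_connected; last exact: continuous_subspaceW cga.
  by apply/connected_intervalP; exact: interval_is_interval.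
have [t0 t01 gm] : exists2 t0 : R, 0 <= t0 < 1 & ga t0 = m.
  move: Am; rewrite -im => -[t]; rewrite /= in_itv /= => /andP[t0 t1] gt.
  have [tl|tg] := ltP t 1; first by exists t; rewrite ?t0.
  have t1' : t = 1 by apply/eqP; rewrite eq_le t1.
  by exists 0; rewrite ?lexx ?ltr01 // g01 -t1'.
have uniq (s : R) : 0 <= s < 1 -> ga s = m -> s = t0.
  move=> s01 gs; have h (v : R) : 0 <= v < 1 -> v \in `[0, 1[%classic by move=> vb; apply/mem_set; rewrite /= in_itv.
  exact: (inj _ _ (h _ s01) (h _ t01) (etrans gs (esym gm))).
have g1 : ga 1 = m -> t0 = 0.
  by move=> g1m; symmetry; apply: uniq; rewrite ?lexx ?ltr01 // g01.
have [t00|tn] := eqVneq t0 0.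
  have -> : A `\ m = ga @` `]0, 1[%classic.
    apply/seteqP; split=> z.
      rewrite -im => -[[s]]; rewrite /= in_itv /= => /andP[s0 s1] <- sm.
      exists s => //; rewrite /= in_itv /= !lt_neqAle s0 s1 !andbT; apply/andP; split.
        by apply/eqP => s00; apply: sm; rewrite -s00 -t00.
      by apply/eqP => s00; apply: sm; rewrite s00 -g01 -t00.
    move=> [s]; rewrite /= in_itv /= => /andP[s0 s1] <-; split.
      by rewrite -im; exists s => //; rewrite /= in_itv /= !ltW.
    by move=> /(uniq s); rewrite (ltW s0) s1 => /(_ isT) s00; rewrite s00 t00 ltxx in s0.
  by apply: ci => s; rewrite /= !in_itv /= => /andP[? ?]; rewrite !ltW.
have tp : 0 < t0 by rewrite lt_def tn; case/andP: t01.
have tl : t0 < 1 by case/andP: t01.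
have -> : A `\ m = ga @` `[0, t0[%classic `|` ga @` `]t0, 1]%classic.
  apply/seteqP; split=> z.
    rewrite -im => -[[s]]; rewrite /= in_itv /= => /andP[s0 s1] <- sm.
    case: (ltgtP s t0) => st.
    - by left; exists s => //; rewrite /= in_itv /= s0.
    - by right; exists s => //; rewrite /= in_itv /= st.
    - by case: sm; rewrite st.
  move=> [] [s]; rewrite /= in_itv /= => /andP[s0 s1] <-; split.
  - by rewrite -im; exists s => //; rewrite /= in_itv /= s0; rlra.
  - by move=> /(uniq s); rewrite s0 (lt_trans s1 tl) => /(_ isT) e; rewrite e ltxx in s1.
  - by rewrite -im; exists s => //; rewrite /= in_itv /=; rlra.
  - have [sl|sg] := ltP s 1.
      by move=> /(uniq s); rewrite sl (ltW (lt_trans tp s0)) => /(_ isT) e; rewrite e ltxx in s0.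
    have -> : s = 1 by apply/eqP; rewrite eq_le s1.
    by move=> /g1 e; rewrite e eqxx in tn.
apply: connectedU.
- exists (ga 0); split; first by exists 0 => //=; rewrite in_itv /= lexx.
  by exists 1; rewrite ?g01 //= in_itv /= lexx andbT.
- by apply: ci => s; rewrite /= !in_itv /= => /andP[? ?]; rlra.
- by apply: ci => s; rewrite /= !in_itv /= => /andP[? ?]; rlra.
Qed.

Section Graph.
Variable G : orthodiagonal_map R.
Notation V := (primal_vertex G).
Notation W := (dual_vertex G).
Implicit Types (x y u : V + W).

Definition pos x : R * R := vpos (@ppos R G) (@dpos R G) x.
Definition gadj x y : bool := adj (@edge R G) x y.
Definition Gam : set (R * R) := drawing (@ppos R G) (@dpos R G) (@edge R G).
Definition outer : set (R * R) := outer_face (@ppos R G) (@dpos R G) (@edge R G).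

Lemma pos_inj : injective pos. Proof. by have [] := om_plane G. Qed.

Lemma gadj_neq x y : gadj x y -> pos x <> pos y.
Proof. by case: x; case: y => // v w _ /pos_inj. Qed.

Lemma segment_Gam x y : gadj x y -> segment2 (pos x) (pos y) `<=` Gam.
Proof.
case: x y => [v|w] [v'|w'] //= e z zs; right; first by exists v, w'.
by exists v', w; split => //; rewrite segment2C.
Qed.

Lemma pos_Gam x : Gam (pos x). Proof. by left; exists x. Qed.

Lemma pos_segment x y u : gadj x y -> segment2 (pos x) (pos y) (pos u) -> u = x \/ u = y.
Proof.
have [_ H _] := om_plane G.
case: x y => [v|w] [v'|w'] //= e; first exact: H.
by rewrite segment2C => /(H _ _ _ e)[->|->]; [right|left].
Qed.

Lemma segment_meet x y x' y' z : gadj x y -> gadj x' y' ->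
  segment2 (pos x) (pos y) z -> segment2 (pos x') (pos y') z ->
  [\/ x' = x /\ y' = y, x' = y /\ y' = x | exists u, z = pos u].
Proof.
have [_ _ H] := om_plane G.
have H' (v : V) (w : W) (v' : V) (w' : W) : edge v w -> edge v' w' -> segment2 (ppos v) (dpos w) z ->
   segment2 (ppos v') (dpos w') z -> (v' = v /\ w' = w) \/ exists u, z = pos u.
  move=> e e' h h'; have [[-> ->]|ne] := pselect ((v, w) = (v', w')); first by left.
  by right; exact: (H v w v' w').
case: x y x' y' => [v|w] [v'|w'] [x|x] [y|y] //= e e'; rewrite /pos /=.
- move=> h h'; have [[-> ->]|?] := H' _ _ _ _ e e' h h'; by [constructor 1|constructor 3].
- rewrite [segment2 (dpos x) _]segment2C.
  move=> h h'; have [[-> ->]|?] := H' _ _ _ _ e e' h h'; by [constructor 2|constructor 3].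
- rewrite [segment2 (dpos w) _]segment2C.
  move=> h h'; have [[-> ->]|?] := H' _ _ _ _ e e' h h'; by [constructor 2|constructor 3].
- rewrite ![segment2 (dpos _) _]segment2C.
  move=> h h'; have [[-> ->]|?] := H' _ _ _ _ e e' h h'; by [constructor 1|constructor 3].
Qed.

Lemma epoint_vertex x y u s : gadj x y -> 0 < s < 1 -> epoint (pos x) (pos y) s <> pos u.
Proof.
move=> e s01 E; have ne := gadj_neq e.
have : segment2 (pos x) (pos y) (pos u) by exists s => //=; rewrite in_itv /= !ltW //; rlra.
have D : pos y - pos x <> 0 by move/eqP; rewrite subr_eq0 => /eqP h; apply: ne.
rewrite epointE in E.
move/(pos_segment e) => [uE|uE]; rewrite uE in E.
  have : s *: (pos y - pos x) = 0 by apply: (addrI (pos x)); rewrite E addr0.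
  by move/eqP; rewrite scaler_eq0 => /orP[/eqP s0|/eqP]; [rlra|].
have : (s - 1) *: (pos y - pos x) = 0.
  by rewrite scalerBl scale1r; apply/eqP; rewrite subr_eq0 -(inj_eq (addrI (pos x))) E addrC subrK.
by move/eqP; rewrite scaler_eq0 => /orP[/eqP s0|/eqP]; [rlra|].
Qed.

Lemma closed_union (T : finType) (P : pred T) (F : T -> set (R * R)) :
  (forall i, closed (F i)) -> closed [set z | exists2 i, P i & F i z].
Proof.
move=> cF; have -> : [set z | exists2 i, P i & F i z] = \bigcup_(i in [set i | P i]) F i.
  by apply/seteqP; split=> z [i Pi Fi]; exists i.
by apply: closed_bigcup => // ; exact: finite_finset.
Qed.

Lemma closed_segment2 a b : closed (segment2 a b).
Proof. by apply: compact_closed; [exact: norm_hausdorff|exact: compact_segment2]. Qed.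

Lemma GamE : Gam = [set z | exists2 x : V + W, xpredT x & [set pos x] z] `|`
  [set z | exists2 e : (V + W) * (V + W), gadj e.1 e.2 & segment2 (pos e.1) (pos e.2) z].
Proof.
apply/seteqP; split=> z.
- by move=> [[x ->]|[v [w [e zs]]]]; [left; exists x|right; exists (inl v, inr w)].
- by move=> [[x _ ->]|[[x y] /= e]]; [exact: pos_Gam|exact: segment_Gam].
Qed.

Lemma closed_Gam : closed Gam.
Proof.
rewrite GamE; apply: closedU; apply: closed_union => i; last exact: closed_segment2.
exact: accessible_closed_set1 (hausdorff_accessible (@norm_hausdorff R _)) _.
Qed.

(** The vertices and the other edges form a closed set [rest], and planarity keeps interior points
    of the edge out of it. *)
Lemma flat_Gam x y : gadj x y -> flat Gam (pos x) (pos y).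
Proof.
move=> exy s s01; set m := epoint _ _ s.
pose rest := [set z | exists2 x : V + W, xpredT x & [set pos x] z] `|`
  [set z | exists2 e : (V + W) * (V + W), gadj e.1 e.2 && (e != (x, y)) && (e != (y, x)) &
     segment2 (pos e.1) (pos e.2) z].
have cr : closed rest.
  apply: closedU; apply: closed_union => i; last exact: closed_segment2.
  exact: accessible_closed_set1 (hausdorff_accessible (@norm_hausdorff R _)) _.
have sm : segment2 (pos x) (pos y) m by exists s => //=; rewrite in_itv /= !ltW //; rlra.
have nm : ~ rest m.
  move=> [[u _ /(epoint_vertex exy s01)//]|[[x' y'] /= /andP[/andP[e n1] n2] zs]].
  have [[h1 h2]|[h1 h2]|[u]] := segment_meet exy e sm zs.
  - by rewrite h1 h2 eqxx in n1.
  - by rewrite h1 h2 eqxx in n2.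
  - exact: epoint_vertex.
have [r r0 Hr] := open_box (closed_openC cr) nm.
exists r => // z bz; rewrite GamE => Gz.
have [t _ <-] : segment2 (pos x) (pos y) z; last exact: cross_epoint.
have nz := Hr z bz.
case: Gz => [[u _ uz]|[[x' y'] /= e zs]]; first by case: nz; left; exists u.
have [[ex ey]|n1] := eqVneq (x', y') (x, y); first by rewrite ex ey in zs.
have [[ex ey]|n2] := eqVneq (x', y') (y, x); first by rewrite ex ey segment2C in zs.
by case: nz; right; exists (x', y'); rewrite //= e n1 n2.
Qed.

Lemma bounded_Gam : exists2 B : R, 0 < B & forall z, Gam z -> `|z.1| <= B /\ `|z.2| <= B.
Proof.
pose B := \sum_(x : V + W) (`|(pos x).1| + `|(pos x).2|) + 1.
have B1 (x : V + W) : `|(pos x).1| + `|(pos x).2| <= B.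
  rewrite /B (bigD1 x) //= -addrA lerDl addr_ge0 // sumr_ge0 // => i _; exact: addr_ge0.
have B0 : 0 < B by rewrite ltr_wpDl // sumr_ge0 // => i _; exact: addr_ge0.
have cvx (a b t : R) : 0 <= t <= 1 -> `|a| <= B -> `|b| <= B -> `|(1 - t) * a + t * b| <= B.
  move=> /andP[t0 t1] ha hb; apply: le_trans (ler_normD _ _) _.
  rewrite !normrM (ger0_norm t0) ger0_norm ?subr_ge0 //.
  have h1 : (1 - t) * `|a| <= (1 - t) * B by rewrite ler_wpM2l ?subr_ge0.
  have h2 : t * `|b| <= t * B by rewrite ler_wpM2l.
  rlra.
have bp (x : V + W) : `|(pos x).1| <= B /\ `|(pos x).2| <= B.
  have := B1 x; have := normr_ge0 (pos x).1; have := normr_ge0 (pos x).2; by split; rlra.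
exists B => // z; rewrite GamE => -[[x _ ->]|[[x y] _ [t]]]; first exact: bp.
rewrite /= in_itv /= => t01 <-; have [x1 x2] := bp x; have [y1 y2] := bp y.
by split; exact: cvx.
Qed.

(** The exterior [far] of a large square is connected, as a chain of overlapping half planes, and
    every unbounded component meets it. *)
Lemma outer_component : exists2 zf, ~ Gam zf & outer = connected_component (~` Gam) zf.
Proof.
have [B B0 HB] := bounded_Gam.
pose far := [set z : R * R | B < z.1] `|` [set z : R * R | B < z.2] `|`
  [set z : R * R | z.1 < - B] `|` [set z : R * R | z.2 < - B].
have farG : far `<=` ~` Gam.
  by move=> z [[[|]|]|] /= hz /HB; rewrite !ler_norml => -[/andP[? ?] /andP[? ?]]; rlra.
have cv (l : R * R) (c : R) : convexs [set z : R * R | c < l.1 * z.1 + l.2 * z.2].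
  move=> p q /= hp hq z [t]; rewrite /= in_itv /= => t01 <-; rewrite /= /GRing.scale /=.
  have := @convex_comb_lt R (- (l.1 * p.1 + l.2 * p.2)) (- (l.1 * q.1 + l.2 * q.2)) (- c) t.
  by rewrite !ltrN2 => /(_ hp hq t01); rlra.
have cfar : connected far.
  have E1 : [set z : R * R | B < z.1] = [set z : R * R | B < 1 * z.1 + 0 * z.2].
    by apply/seteqP; split=> z /=; rewrite mul1r mul0r addr0.
  have E2 : [set z : R * R | B < z.2] = [set z : R * R | B < 0 * z.1 + 1 * z.2].
    by apply/seteqP; split=> z /=; rewrite mul1r mul0r add0r.
  have E3 : [set z : R * R | z.1 < - B] = [set z : R * R | B < (-1) * z.1 + 0 * z.2].
    by apply/seteqP; split=> z /=; rewrite mul0r addr0 mulN1r ltrNr.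
  have E4 : [set z : R * R | z.2 < - B] = [set z : R * R | B < 0 * z.1 + (-1) * z.2].
    by apply/seteqP; split=> z /=; rewrite mul0r add0r mulN1r ltrNr.
  rewrite /far; apply: connectedU.
  - by exists (B + 1, - B - 1); split; [left; left|]; rewrite /=; rlra.
  - apply: connectedU; last by rewrite E3; apply: convex_connected; exact: (cv (-1, 0)).
      by exists (- B - 1, B + 1); split; [right|]; rewrite /=; rlra.
    apply: connectedU; last by rewrite E2; apply: convex_connected; exact: (cv (0, 1)).
      by exists (B + 1, B + 1); split; rewrite /=; rlra.
    by rewrite E1; apply: convex_connected; exact: (cv (1, 0)).
  - by rewrite E4; apply: convex_connected; exact: (cv (0, -1)).
pose zf : R * R := (B + 1, 0).
have ffar : far zf by left; left; left; rewrite /=; rlra.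
have nzf : ~ Gam zf by exact: farG.
exists zf => //; apply/seteqP; split=> z.
  move=> [nz nb]; apply: contrapT => nc; apply: nb; apply/bounded_set2P; exists B => // q cq.
  have nf : ~ far q.
    move=> fq; apply: nc; rewrite (same_connected_component (connected_component_max ffar farG cfar fq)).
    exact: connected_component_sym.
  have [q1|q1] := leP `|q.1| B; last first.
    by case: nf; move: q1; rewrite ltr_normr => /orP[h|h]; [left; left; left|left; right]; rewrite /=; rlra.
  have [q2|q2] := leP `|q.2| B; first by [].
  by case: nf; move: q2; rewrite ltr_normr => /orP[h|h]; [left; left; right|right]; rewrite /=; rlra.
move=> cz; split; first exact: connected_component_sub cz.
rewrite -(same_connected_component cz) => /bounded_set2P[M M0 HM].
pose q : R * R := (B + M + 1, 0).
have fq : far q by left; left; left; rewrite /=; rlra.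
have /= [] := HM q (connected_component_max ffar farG cfar fq).
rewrite ger0_norm; rlra.
Qed.

Lemma sat_outer : sat Gam outer.
Proof. by have [zf _ ->] := outer_component; exact: sat_component closed_Gam. Qed.

Lemma connected_outer : connected outer.
Proof. by have [zf _ ->] := outer_component; exact: component_connected. Qed.

Lemma open_outer : open outer. Proof. by have [] := sat_outer. Qed.

Lemma outer_Gam z : outer z -> ~ Gam z. Proof. by have [H _ _] := sat_outer; exact: H. Qed.

Lemma closure_outer_Gam z : closure outer z -> ~ outer z -> Gam z.
Proof.
move=> /closure_box cz no; apply: contrapT => nG; apply: no.
have [r r0 Hr] := open_box (closed_openC closed_Gam) nG.
have [_ _ H] := sat_outer.
have [q oq bq] := cz r r0.
have bz : box z r z by split; rewrite subrr normr0.
apply: (H (box z r)) bz => //; first by apply: convex_connected; exact: convex_box.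
by exists q.
Qed.

Lemma frontier_outerE : frontier outer = closure outer `\` outer.
Proof. by rewrite /frontier (interior_id outer).1 //; exact: open_outer. Qed.

(** The complement of the outer face consists of the drawing and the inner faces, and the interior
    of a complement is the complement of the closure. *)
Lemma hat_domainE : hat_domain G = ~` closure outer.
Proof.
rewrite /hat_domain -interior_setC; congr interior; apply/seteqP; split=> z.
  move=> [Gz /outer_Gam //|[F [[z' nz' ->] bF] Fz] oz].
  have [_ nb] := oz; apply: nb.
  by rewrite -(same_connected_component Fz).
move=> no; have [Gz|nGz] := pselect (Gam z); first by left.
right; exists (connected_component (~` Gam) z); last exact: connected_component_refl.
split; first by exists z.
by apply: contrapT => nb; apply: no.
Qed.

Lemma bdryE v : bdry (G := G) v <-> closure outer (ppos v).
Proof.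
rewrite /bdry -/outer frontier_outerE; split=> [[]//|c]; split => // /outer_Gam; apply.
exact: (pos_Gam (inl v)).
Qed.

(* A closed polygon crossing the edge once, and otherwise inside the outer face, would separate
   the two halves of the edge, but the rest of the boundary curve joins them. *)
Lemma outer_one_side x y : gadj x y -> lside (pos x) (pos y) 2^-1 outer ->
  lside (pos y) (pos x) 2^-1 outer -> False.
Proof.
move=> e [r1 r10 H1] [r2 r20 H2].
set a := pos x in H1 H2 *; set b := pos y in H1 H2 *.
have ab : a <> b := gadj_neq e.
have h01 : 0 < (2^-1 : R) < 1 by rlra.
have [r3 r30 H3] := flat_Gam e h01; rewrite -/a -/b in H3.
have mE : epoint b a 2^-1 = epoint a b 2^-1.
  have hh : 1 - 2^-1 = 2^-1 :> R by field.
  by rewrite -{1}hh epointC.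
rewrite mE in H2; set m := epoint a b 2^-1 in H1 H2 H3.
pose r := Num.min r1 (Num.min r2 r3).
have r0 : 0 < r by rewrite !lt_min r10 r20.
have br z : box m r z -> [/\ box m r1 z, box m r2 z & box m r3 z].
  by move=> [q1 q2]; rewrite !lt_min in q1 q2;
     move: q1 q2 => /and3P[? ? ?] /and3P[? ? ?]; split.
pose u := b - a; pose N := nrm u ^+ 2.
have N0 : 0 < N.
  rewrite exprn_gt0 // lt_def nrm_ge0 andbT; apply/eqP => /nrm_eq0/eqP.
  by rewrite subr_eq0 => /eqP E; apply: ab.
pose K := `|u.1| + `|u.2| + 1.
have K0 : 0 < K by rewrite ltr_wpDl // addr_ge0.
pose t := r / (2 * K); have t0 : 0 < t by rewrite divr_gt0 // mulr_gt0.
have tK : t * K < r.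
  have -> : t * K = r / 2 by rewrite /t; field; rewrite gt_eqF.
  rlra.
pose pt (s : R) := m + s *: jrot u.
have bpt (s : R) : `|s| <= t -> box m r (pt s).
  move=> st; have k1 := normr_ge0 u.1; have k2 := normr_ge0 u.2; have k3 := normr_ge0 s.
  split; rewrite /pt /= /GRing.scale /= addrAC subrr add0r normrM ?normrN;
    apply: le_lt_trans tK; rewrite /K; apply: ler_pM; rewrite // -/u; rlra.
have cpt (s : R) : cross (b - a) (pt s - a) = s * N.
  have -> : pt s - a = (m - a) + s *: jrot u by rewrite /pt addrAC.
  have -> : cross (b - a) (m - a + s *: jrot u) = cross (b - a) (m - a) + s * cross u (jrot u).
    by rewrite /cross /= /GRing.scale /=; ring.
  by rewrite cross_epoint add0r cross_jrot.
(* Two points on the normal through the midpoint, close enough to lie in the half boxes that belong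
   to the outer face. *)
pose L := pt t; pose S := pt (- t).
have oL : outer L.
  have /br[bL _ _] : box m r L by apply: bpt; rewrite ger0_norm // ltW.
  by apply: H1 => //; rewrite cpt mulr_gt0.
have oS : outer S.
  have /br[_ bS _] : box m r S by apply: bpt; rewrite normrN ger0_norm // ltW.
  by apply: H2 => //; rewrite cross_opp cpt mulNr opprK mulr_gt0.
have [n [P [P0 Pn HP]]] := polygonal_path open_outer connected_outer oL oS.
pose Q i := if (i <= n)%N then P i else L.
have Qn : Q n = S by rewrite /Q leqnn.
have QSn : Q n.+1 = L by rewrite /Q ltnn.
have Q0 : Q 0%N = L by rewrite /Q /= P0.
have Qlt i : (i < n)%N -> segment2 (Q i) (Q i.+1) `<=` outer.
  by move=> ni; rewrite /Q (ltnW ni) ni; exact: HP.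
have SL z : segment2 S L z -> Gam z -> z = m.
  move=> [s]; rewrite /= in_itv /= => /andP[s0 s1] <-.
  have -> : (1 - s) *: S + s *: L = pt ((2 * s - 1) * t).
    rewrite /S /L /pt; apply: injective_projections => /=; rewrite /GRing.scale /=; ring.
  have b' : `|(2 * s - 1) * t| <= t.
    rewrite normrM [`|t|]gtr0_norm // ger_pMl // ler_norml; rlra.
  have /br[_ _ b3] := bpt _ b'.
  move=> /(H3 _ b3)/eqP; rewrite cpt mulf_eq0 (gt_eqF N0) orbF => /eqP ->.
  by rewrite /pt scale0r addr0.
have Gm : Gam m by apply: (segment_Gam e); exists 2^-1 => //=; rewrite in_itv /=; rlra.
have QE : Q n.+1 = Q 0%N by rewrite QSn Q0.
have mSL : exists2 s : R, 0 < s < 1 & m = (1 - s) *: Q n + s *: Q n.+1.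
  exists 2^-1 => //; rewrite Qn QSn /S /L /pt.
  by apply: injective_projections => /=; rewrite /GRing.scale /=; field.
have neSL : Q n <> Q n.+1.
  rewrite Qn QSn => E; have := cpt t; rewrite -/L -E cpt => /eqP; rewrite mulNr.
  by have := mulr_gt0 t0 N0; rewrite lt_def => /andP[/eqP h _] /eqP; rlra.
have avm i : (i < n.+1)%N -> i != n -> nonopp (Q i - m) (Q i.+1 - m).
  rewrite ltnS leq_eqVlt => /predU1P[->|ni _]; first by rewrite eqxx.
  by apply: nonopp_nsegment => /(Qlt i ni)/outer_Gam.
have [d d0 Hd] := turn_jump (ltnSn n) QE mSL neSL avm.
rewrite Qn QSn in Hd.
have oG := sat_outer.
have onC (s : R) : 0 <= s <= 1 -> closure outer (epoint a b s).
  by apply: (lside_closure ab (flat_Gam e) oG h01); exists r1.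
(* [m] is the only point of the drawing on the closed polygon, so the remaining boundary curve
   avoids the polygon, and the winding number is constant along it. *)
pose A := frontier outer `\ m.
have cA : connected A.
  apply: curve_minus_point; first exact: om_outer.
  by rewrite frontier_outerE; split; [apply: onC; rlra|move/outer_Gam].
have avA p : A p -> avoids p Q n.+1.
  move=> [fp pm] i; rewrite frontier_outerE in fp; have Gp : Gam p by case: fp => ? ?; exact: closure_outer_Gam.
  rewrite ltnS leq_eqVlt => /predU1P[->|ni]; apply: nonopp_nsegment.
    by rewrite Qn QSn => /SL/(_ Gp) /pm.
  by move/(Qlt i ni)/outer_Gam.
have [d' d'0 Hd'] := @box_epoint R a b 2^-1 d d0.
pose k := Num.min (d' / 2) (1 / 4 : R).
have k0 : 0 < k by rewrite lt_min !divr_gt0.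
have k1 : k <= 1 / 4 by rewrite ge_min lexx orbT.
have k2 : k < d' by rewrite gt_min; apply/orP; left; rlra.
have inA (s : R) : 0 < s < 1 -> s != 2^-1 -> A (epoint a b s).
  move=> s01 sn; split.
    rewrite frontier_outerE; split; first by apply: onC; rlra.
    move/outer_Gam; apply; apply: (segment_Gam e); exists s => //=; rewrite in_itv /=; rlra.
  rewrite /m !epointE => /addrI/eqP; rewrite -subr_eq0 -scalerBl scaler_eq0 => /orP[].
    by rewrite subr_eq0 => /eqP E; rewrite E eqxx in sn.
  by rewrite subr_eq0 => /eqP E; apply: ab.
have cr (s : R) : cross (L - S) (epoint a b s - S) = - (2 * t * (s - 2^-1) * N).
  by rewrite /L /S /pt /m /N nrm_sqr /u /cross /epoint /= /GRing.scale /=; field.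
pose p := epoint a b (2^-1 - k); pose q := epoint a b (2^-1 + k).
have kN : 0 < k * t * N by rewrite mulr_gt0 // mulr_gt0.
have := Hd p q; rewrite !cr => T.
have {}T : turn p Q n.+1 = turn q Q n.+1 + 2 * pi.
  apply: T; first by apply: Hd'; rewrite addrAC subrr add0r normrN gtr0_norm.
  - by apply: Hd'; rewrite addrAC subrr add0r gtr0_norm.
  - rlra.
  - rlra.
have E : turn p Q n.+1 = turn q Q n.+1.
  apply: (turn_const cA avA QE); apply: inA; first rlra.
  - by rewrite lt_eqF //; rlra.
  - rlra.
  - by rewrite gt_eqF //; rlra.
have := pi_gt0 R; rlra.
Qed.

End Graph.
End PlaneMaps.

(** * Orientation and inside of the quadrilaterals *)

Section Quads.
Context {R : realType}.
Implicit Types (p q z a b c d : R * R) (A B C U : set (R * R)).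

Definition turn4 z a b c d : R :=
  ang (a - z) (b - z) + ang (b - z) (c - z) + ang (c - z) (d - z) + ang (d - z) (a - z).

Lemma subsub (x y p : R * R) : x - p - (y - p) = x - y.
Proof. by rewrite opprB addrA subrK. Qed.

Lemma nrmC (x y : R * R) : nrm (x - y) = nrm (y - x).
Proof. by rewrite -nrmN opprB. Qed.

Lemma turn4_lt z a b c d : `|turn4 z a b c d| < 4 * pi.
Proof.
have h1 := ang_lt (a - z) (b - z); have h2 := ang_lt (b - z) (c - z).
have h3 := ang_lt (c - z) (d - z); have h4 := ang_lt (d - z) (a - z).
by rewrite !ltr_norml in h1 h2 h3 h4 *; rewrite /turn4; rlra.
Qed.

Lemma turn4_rot z a b c d : turn4 z c d a b = turn4 z a b c d.
Proof. by rewrite /turn4; ring. Qed.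

(** [c] and [d] are strictly on different sides of the line [a b], and [a] and [b] of the line
    [c d]. The identity [ka = ga + al - de] places both intersection parameters in [[0, 1]]. *)
Lemma no_crossing (s t : R) a b c d :
  let al := cross (b - a) (c - a) in let de := cross (b - a) (d - a) in
  let ga := cross (d - c) (a - c) in let ka := cross (d - c) (b - c) in
  al < 0 -> 0 < de -> 0 < ga -> ka < 0 ->
  exists z, segment2 a b z /\ segment2 c d z.
Proof.
move=> al de ga ka a0 d0 g0 k0.
have E : ka = ga + al - de by rewrite /ka /ga /al /de /cross /=; ring.
have D0 : 0 < de - al by rlra.
exists (epoint a b (ga / (de - al))); split.
  exists (ga / (de - al)) => //; rewrite /= in_itv /=; apply/andP; split.
    by rewrite divr_ge0 // ltW.
  by rewrite ler_pdivrMr // mul1r; rlra.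
exists (- al / (de - al)).
  rewrite /= in_itv /=; apply/andP; split; first by rewrite divr_ge0 //; rlra.
  by rewrite ler_pdivrMr // mul1r; rlra.
have Dn : (de - al) != 0 by rewrite gt_eqF.
have e1 x y : (1 - - al / (de - al)) * x + (- al / (de - al)) * y = (de * x - al * y) / (de - al).
  by field.
have e2 x y : (1 - ga / (de - al)) * x + ga / (de - al) * y = ((de - al - ga) * x + ga * y) / (de - al).
  by field.
apply: injective_projections; rewrite /= /GRing.scale /= e1 e2; congr (_ / _);
  rewrite /de /al /ga /cross /=; ring.
Qed.

Section Graph.
Variable G : orthodiagonal_map R.
Notation V := (primal_vertex G).
Notation W := (dual_vertex G).
Implicit Types (v : V) (w : W) (F : set (R * R)).
Notation pp := (@ppos R G).
Notation dp := (@dpos R G).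

Definition quad_face F v1 v2 w1 w2 := face_quad pp dp (@edge R G) F v1 v2 w1 w2.

(** The cross product of the diagonals is twice the signed area of the cycle [v1 w1 v2 w2], so the
    last condition orients it counterclockwise. *)
Definition pquad F v1 v2 w1 w2 := [/\ is_inner_face G F, quad_face F v1 v2 w1 w2 &
  0 < cross (pp v2 - pp v1) (dp w2 - dp w1)].

Lemma quad_face_swap F v1 v2 w1 w2 : quad_face F v1 v2 w1 w2 -> quad_face F v1 v2 w2 w1.
Proof.
move=> [n1 n2 [e1 e2 e3 e4] E]; split => //; first by move/esym.
rewrite E ![segment2 (dp _) _]segment2C.
by apply/seteqP; split=> z [[[h|h]|h]|h];
  [right|left; right|left; left; right|left; left; left|right|left; right|left; left; right|left; left; left].
Qed.

Lemma quad_face_swapv F v1 v2 w1 w2 : quad_face F v1 v2 w1 w2 -> quad_face F v2 v1 w1 w2.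
Proof.
move=> [n1 n2 [e1 e2 e3 e4] E]; split => //; first by move/esym.
rewrite E ![segment2 (dp _) _]segment2C.
by apply/seteqP; split=> z [[[h|h]|h]|h];
  [left; left; right|left; left; left|right|left; right|left; left; right|left; left; left|right|left; right].
Qed.

Lemma pquad_rot F v1 v2 w1 w2 : pquad F v1 v2 w1 w2 -> pquad F v2 v1 w2 w1.
Proof.
move=> [iF fq A0]; split => //; first exact/quad_face_swap/quad_face_swapv.
by move: A0; rewrite /cross /=; rlra.
Qed.

Lemma inner_face_sat F : is_inner_face G F ->
  [/\ F !=set0, sat (Gam G) F, connected F & bounded_set F].
Proof.
move=> [[z nz ->] bF]; split => //.
- by exists z; exact: connected_component_refl.
- exact: (sat_component z (@closed_Gam R G)).
- exact: component_connected.
Qed.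

Lemma inner_face_eq F F' : is_inner_face G F -> is_inner_face G F' ->
  F `&` F' !=set0 -> F = F'.
Proof.
move=> /inner_face_sat[_ [FG _ sF] cF _] /inner_face_sat[_ [FG' _ sF'] cF' _] [z [Fz Fz']].
apply/seteqP; split; [apply: sF' => //|apply: sF => //]; by exists z.
Qed.

Section Quad.
Variables (F : set (R * R)) (v1 v2 : V) (w1 w2 : W).
Hypothesis Q : pquad F v1 v2 w1 w2.

(** The default value of [nth] closes the cycle at index 4. *)
Definition qv (k : nat) : V + W := nth (inl v1) [:: inl v1; inr w1; inl v2; inr w2] k.
Definition qP k : R * R := pos (qv k).
Definition PG := frontier F.

Let fq : quad_face F v1 v2 w1 w2. Proof. by case: Q. Qed.
Let iF : is_inner_face G F. Proof. by case: Q. Qed.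
Let A0 : 0 < cross (pp v2 - pp v1) (dp w2 - dp w1). Proof. by case: Q. Qed.

Lemma qv_adj k : (k < 4)%N -> gadj (qv k) (qv k.+1).
Proof. by case: fq => _ _ [e1 e2 e3 e4] _; case: k => [|[|[|[|]]]]. Qed.

Lemma qv_neq k j : (k < 4)%N -> (j < 4)%N -> j != k ->
  ~ (qv j = qv k /\ qv j.+1 = qv k.+1) /\ ~ (qv j = qv k.+1 /\ qv j.+1 = qv k).
Proof.
case: fq => n1 n2 _ _.
have m1 : inl v1 <> inl v2 :> V + W by case.
have m2 : inr w1 <> inr w2 :> V + W by case.
have m3 := nesym m1; have m4 := nesym m2.
by case: k => [|[|[|[|]]]] //; case: j => [|[|[|[|]]]] //= _ _ _; split=> -[].
Qed.

Lemma turn_qP z : turn z qP 4 = turn4 z (pp v1) (dp w1) (pp v2) (dp w2).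
Proof. by rewrite /turn !big_ord_recr big_ord0 /= add0r. Qed.

Lemma PG_segment k z : (k < 4)%N -> segment2 (qP k) (qP k.+1) z -> PG z.
Proof.
have [_ _ _ E] := fq; rewrite /PG E.
by case: k => [|[|[|[|]]]] // _ h; [left; left; left|left; left; right|left; right|right].
Qed.

Lemma PG_inv z : PG z -> exists2 k, (k < 4)%N & segment2 (qP k) (qP k.+1) z.
Proof.
have [_ _ _ E] := fq; rewrite /PG E.
by move=> [[[h|h]|h]|h]; [exists 0%N|exists 1%N|exists 2%N|exists 3%N].
Qed.

Lemma PG_Gam : PG `<=` Gam G.
Proof. by move=> z /PG_inv[k k4]; exact: (segment_Gam (qv_adj k4)). Qed.

Lemma sat_PG : sat PG F.
Proof.
have [_ [FG oF _] cF _] := inner_face_sat iF; split => //.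
  by move=> z /FG nG /PG_Gam.
move=> B cB BP BF z Bz; apply: contrapT => nF.
have [y [By /BP]] : B `&` frontier F !=set0; last by [].
by apply: connected_frontier => //; exists z.
Qed.

Lemma closed_PG : closed PG.
Proof.
rewrite /PG /frontier; apply: closedI; first exact: closed_closure.
exact/open_closedC/open_interior.
Qed.

Lemma avoids_PG z : ~ PG z -> avoids z qP 4.
Proof. by move=> nz k k4; apply: nonopp_nsegment => /(PG_segment k4). Qed.

Lemma other_edges k j (s : R) : (k < 4)%N -> (j < 4)%N -> j != k -> 0 < s < 1 ->
  ~ segment2 (qP j) (qP j.+1) (epoint (qP k) (qP k.+1) s).
Proof.
move=> k4 j4 jk s01 h.
have h' : segment2 (qP k) (qP k.+1) (epoint (qP k) (qP k.+1) s).
  by exists s => //=; rewrite in_itv /= !ltW //; lra.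
have [n1 n2] := qv_neq k4 j4 jk.
have [//|//|[u]] := segment_meet (qv_adj k4) (qv_adj j4) h' h.
exact: (epoint_vertex (qv_adj k4)).
Qed.

Lemma quad_jump k (s : R) : (k < 4)%N -> 0 < s < 1 ->
  exists2 d : R, 0 < d & forall p q, box (epoint (qP k) (qP k.+1) s) d p ->
    box (epoint (qP k) (qP k.+1) s) d q ->
    0 < cross (qP k.+1 - qP k) (p - qP k) -> cross (qP k.+1 - qP k) (q - qP k) < 0 ->
    turn p qP 4 = turn q qP 4 + 2 * pi.
Proof.
move=> k4 s01; apply: turn_jump => //; first by exists s.
  exact: gadj_neq (qv_adj k4).
by move=> i i4 ik; apply: nonopp_nsegment; exact: other_edges.
Qed.

Let h01 : 0 < (2^-1 : R) < 1. Proof. by lra. Qed.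

Lemma quad_sides k : (k < 4)%N ->
  lside (qP k) (qP k.+1) 2^-1 F \/ lside (qP k.+1) (qP k) (1 - 2^-1) F.
Proof.
move=> k4; have [_ sF _ _] := inner_face_sat iF.
apply: (closure_sides (gadj_neq (qv_adj k4)) (flat_Gam (qv_adj k4)) sF h01).
have : PG (epoint (qP k) (qP k.+1) 2^-1).
  by apply: (PG_segment k4); exists 2^-1 => //=; rewrite in_itv /=; lra.
by case.
Qed.

Lemma F_PG z : F z -> ~ PG z. Proof. by have [H _ _] := sat_PG; exact: H. Qed.

Lemma turn_F_const z z' : F z -> F z' -> turn z qP 4 = turn z' qP 4.
Proof.
have [_ _ cF _] := inner_face_sat iF.
by apply: (turn_const cF _) => // y /F_PG; exact: avoids_PG.
Qed.

(** The whole quadrilateral lies on the left of its first edge. The half plane [H] on the right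
    avoids it and has winding number 0, as a far point shows; [F], being bounded, misses [H], so it
    lies on the left of the edge, where the number has jumped to [2 pi]. *)
Lemma hull_turn : 0 <= cross (dp w1 - pp v1) (pp v2 - pp v1) ->
  0 <= cross (dp w1 - pp v1) (dp w2 - pp v1) -> forall z, F z -> turn z qP 4 = 2 * pi.
Proof.
set a := pp v1; set b := dp w1 => p0 q0.
have ab : a <> b := gadj_neq (qv_adj (isT : (0 < 4)%N)).
pose H := [set z | 0 < cross (a - b) (z - b)].
have HE z : H z <-> cross (b - a) (z - a) < 0 by rewrite /H /= (cross_opp a b) oppr_gt0.
have cH : connected H by apply: convex_connected; exact: convex_half.
have vH k : (k <= 4)%N -> 0 <= cross (b - a) (qP k - a).
  case: k => [|[|[|[|[|]]]]] // _; rewrite /qP /pos /= -/a -/b //.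
  - by rewrite subrr /cross /= !mulr0 subrr.
  - by rewrite /cross mulrC subrr.
  - by rewrite subrr /cross /= !mulr0 subrr.
have HP z : H z -> ~ PG z.
  move=> /HE Hz /PG_inv[k k4 [t]]; rewrite /= in_itv /= => /andP[t0 t1] E.
  have h1 := vH k (ltnW k4); have h2 := vH k.+1 k4.
  have : cross (b - a) (z - a) = (1 - t) * cross (b - a) (qP k - a) + t * cross (b - a) (qP k.+1 - a).
    by rewrite -E /cross /= /GRing.scale /=; ring.
  have : 0 <= (1 - t) * cross (b - a) (qP k - a) by apply: mulr_ge0 => //; rewrite subr_ge0.
  have : 0 <= t * cross (b - a) (qP k.+1 - a) by rewrite mulr_ge0.
  lra.
pose u := b - a; pose N := nrm u ^+ 2.
have N0 : 0 < N.
  rewrite exprn_gt0 // lt_def nrm_ge0 andbT; apply/eqP => /nrm_eq0/eqP.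
  by rewrite subr_eq0 => /eqP E; apply: ab.
pose pt (t : R) := a - t *: jrot u.
have Hpt (t : R) : 0 < t -> H (pt t).
  move=> t0; apply/HE; have -> : cross (b - a) (pt t - a) = - (t * N).
    by rewrite /pt /N nrm_sqr /u /cross /= /GRing.scale /=; ring.
  by rewrite oppr_lt0 mulr_gt0.
have npt (t : R) : 0 <= t -> nrm (pt t - a) = t * nrm u.
  move=> t0; rewrite /pt addrAC subrr add0r nrmN nrmZ ger0_norm //.
  by congr (_ * _); rewrite /nrm /jrot /= sqrrN addrC.
have u0 : 0 < nrm u by rewrite lt_def nrm_ge0 andbT; apply/eqP => h; move: N0; rewrite /N h expr0n ltxx.
pose Dm := nrm (b - a) + nrm (pp v2 - a) + nrm (dp w2 - a).
have Dm0 : 0 < Dm by rewrite /Dm -/u; have := nrm_ge0 (pp v2 - a); have := nrm_ge0 (dp w2 - a); lra.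
have HD k : (k <= 4)%N -> nrm (qP k - a) <= Dm.
  have g1 := nrm_ge0 (b - a); have g2 := nrm_ge0 (pp v2 - a); have g3 := nrm_ge0 (dp w2 - a).
  by case: k => [|[|[|[|[|]]]]] // _; rewrite /qP /pos /= -/a -/b /Dm ?subrr ?nrm0; lra.
(* From distance [9 Dm] each edge, of length at most [2 Dm], is at distance at least [8 Dm] and
   spans an angle of at most 1/2; four of these stay below [2 pi]. *)
pose t := 9 * Dm / nrm u; have t0 : 0 < t by rewrite divr_gt0 // mulr_gt0.
have tE : t * nrm u = 9 * Dm by rewrite /t divfK // gt_eqF.
have Hz : H (pt t) := Hpt t t0.
have zfar : turn (pt t) qP 4 = 0.
  apply: turn_eq0 => //; first exact/avoids_PG/HP.
  have small k : (k < 4)%N -> `|ang (qP k - pt t) (qP k.+1 - pt t)| <= 1 / 2.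
    move=> k4; have h1 := HD k (ltnW k4); have h2 := HD k.+1 k4.
    have g1 : 8 * Dm <= nrm (qP k - pt t).
      have := nrm_triangle (qP k - pt t) (a - qP k).
      rewrite (_ : qP k - pt t + (a - qP k) = a - pt t); last by rewrite addrC addrA subrK.
      have -> : nrm (a - pt t) = 9 * Dm by rewrite nrmC npt ?(ltW t0).
      by rewrite (nrmC a); lra.
    have g0 : 0 < nrm (qP k - pt t) by lra.
    have E : qP k.+1 - pt t - (qP k - pt t) = qP k.+1 - qP k by exact: subsub.
    have g2 : nrm (qP k.+1 - qP k) <= 2 * Dm.
      have := nrm_triangle (qP k.+1 - a) (a - qP k); rewrite addrA subrK.
      by rewrite (nrmC a); lra.
    have [|_] := @ang_small R (qP k - pt t) (qP k.+1 - pt t) g0; first by rewrite E; lra.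
    rewrite E => h; apply: le_trans h _.
    have : nrm (qP k.+1 - qP k) / nrm (qP k - pt t) <= 1 / 4 by rewrite ler_pdivrMr //; lra.
    lra.
  rewrite turn_qP /turn4.
  have := small 0%N isT; have := small 1%N isT; have := small 2%N isT; have := small 3%N isT.
  rewrite /qP /pos /= !ler_norml => /andP[? ?] /andP[? ?] /andP[? ?] /andP[? ?].
  by have := @pi_ge2 R; rewrite ltr_norml; lra.
have [_ _ _ bF] := inner_face_sat iF.
have HF z : H z -> ~ F z.
  move=> Hz' Fz; have [_ _ sF] := sat_PG.
  have HsF : H `<=` F by apply: sF => //; exists z.
  have /bounded_set2P[M M0 HM] := bF.
  pose t' := (nrm a + 2 * M + 1) / nrm u.
  have t'0 : 0 < t' by rewrite divr_gt0 //; have := nrm_ge0 a; lra.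
  have [h1 h2] := HM _ (HsF _ (Hpt t' t'0)).
  have := npt t' (ltW t'0); rewrite /t' divfK ?gt_eqF // -/t' => E.
  have := nrm_triangle (pt t') (- a); rewrite nrmN E.
  have := nrm_le12 (pt t'); lra.
have nr : ~ lside b a (1 - 2^-1) F.
  move=> L; have [z [_ cz Fz]] := lside_near (nesym ab) L ltr01.
  exact: HF Fz.
have [L|//] := quad_sides (isT : (0 < 4)%N).
have [d d0 Hd] := quad_jump (isT : (0 < 4)%N) h01.
have [z [bz cz Fz]] := lside_near ab L d0.
have [z' bz' cz'] := left_point (2^-1) (nesym ab) d0.
have Hz' : H z' by [].
move=> y Fy; rewrite (turn_F_const Fy Fz) (Hd z z') //.
- have -> : turn z' qP 4 = turn (pt t) qP 4; last by rewrite zfar add0r.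
  by apply: (turn_const cH _) => // x /HP; exact: avoids_PG.
- by move: bz'; rewrite (_ : epoint b a 2^-1 = epoint a b 2^-1) // -{1}(_ : 1 - 2^-1 = 2^-1) ?epointC //; field.
- by apply/HE.
Qed.

Lemma no_meet x y x' y' z : gadj (G := G) x y -> gadj x' y' ->
  x <> x' -> x <> y' -> y <> x' -> y <> y' ->
  segment2 (pos x) (pos y) z -> segment2 (pos x') (pos y') z -> False.
Proof.
move=> e e' n1 n2 n3 n4 h h'.
have [[E _]|[E _]|[u zu]] := segment_meet e e' h h'; [exact: n1|exact: n3|].
rewrite zu in h h'.
have [E|E] := pos_segment e h; have [E'|E'] := pos_segment e' h'; rewrite E in E'.
- exact: n1. - exact: n2. - exact: n3. - exact: n4.
Qed.

(** The four numbers are twice the signed areas of the triangles cut off by the two diagonals. Each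
    excluded pair of signs would make two opposite edges cross. *)
Lemma quad_signs : let p := cross (dp w1 - pp v1) (pp v2 - pp v1) in
  let q := cross (dp w1 - pp v1) (dp w2 - pp v1) in
  let p' := cross (dp w2 - pp v2) (pp v1 - pp v2) in
  let q' := cross (dp w2 - pp v2) (dp w1 - pp v2) in
  let A := cross (pp v2 - pp v1) (dp w2 - dp w1) in
  [/\ p + p' = A, q + q' = A & [/\ ~ (p < 0 /\ q' < 0), ~ (q < 0 /\ p' < 0),
    ~ (p' < 0 /\ q' < 0) & ~ (p < 0 /\ q < 0)]].
Proof.
move=> p q p' q' A.
have E1 : p + p' = A by rewrite /p /p' /A /cross /=; ring.
have E2 : q + q' = A by rewrite /q /q' /A /cross /=; ring.
have AA : 0 < A := A0.
split => //.
have [n1 n2 [e1 e2 e3 e4] _] := fq.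
have m1 : inl v1 <> inl v2 :> V + W by case.
have m2 : inr w1 <> inr w2 :> V + W by case.
have ex a b c d : cross (b - a) (c - a) < 0 -> 0 < cross (b - a) (d - a) ->
  0 < cross (d - c) (a - c) -> cross (d - c) (b - c) < 0 ->
  exists z, segment2 a b z /\ segment2 c d z := @no_crossing 0 0 a b c d.
have d02 z : segment2 (pp v1) (dp w1) z -> segment2 (pp v2) (dp w2) z -> False.
  by apply: (@no_meet (inl v1) (inr w1) (inl v2) (inr w2)).
have d13 z : segment2 (dp w1) (pp v2) z -> segment2 (dp w2) (pp v1) z -> False.
  by apply: (@no_meet (inr w1) (inl v2) (inr w2) (inl v1)) => //; apply: nesym.
rewrite /p /q /p' /q' /A /cross /= in E1 E2 AA *; clear p q p' q' A n1 n2 e1 e2 e3 e4 m1 m2.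
split=> -[h1 h2].
- by have [||||z [z1 z2]] := ex (pp v1) (dp w1) (pp v2) (dp w2); [rewrite /cross /=; lra..|exact: d02 z1 z2].
- by have [||||z [z1 z2]] := ex (pp v1) (dp w1) (dp w2) (pp v2); [rewrite /cross /=; lra..|rewrite segment2C in z2; exact: d02 z1 z2].
- by have [||||z [z1 z2]] := ex (dp w1) (pp v2) (dp w2) (pp v1); [rewrite /cross /=; lra..|exact: d13 z1 z2].
- by have [||||z [z1 z2]] := ex (dp w1) (pp v2) (pp v1) (dp w2); [rewrite /cross /=; lra..|rewrite segment2C in z2; exact: d13 z1 z2].
Qed.

End Quad.

(** The sign conditions leave only two cases: the first edge or the opposite one has the whole
    quadrilateral on its left, so [hull_turn] applies, possibly after a rotation of the cycle. *)
Lemma pquad_turn F v1 v2 w1 w2 z : pquad F v1 v2 w1 w2 -> F z ->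
  turn4 z (pp v1) (dp w1) (pp v2) (dp w2) = 2 * pi.
Proof.
move=> Q Fz; have := quad_signs Q; cbv zeta => -[E1 E2 [n1 n2 n3 n4]].
have [_ _ A0] := Q.
have [p0|p0] := leP 0 (cross (dp w1 - pp v1) (pp v2 - pp v1)).
  have [q0|q0] := leP 0 (cross (dp w1 - pp v1) (dp w2 - pp v1)).
    by rewrite -turn_qP; exact: (hull_turn Q).
  rewrite -turn4_rot -turn_qP; apply: (hull_turn (pquad_rot Q)) => //; last by rlra.
  by rewrite leNgt; apply/negP => h; apply: n2.
rewrite -turn4_rot -turn_qP; apply: (hull_turn (pquad_rot Q)) => //; first by rlra.
by rewrite leNgt; apply/negP => h; apply: n1.
Qed.

Section Left.
Variables (F : set (R * R)) (v1 v2 : V) (w1 w2 : W).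
Hypothesis Q : pquad F v1 v2 w1 w2.
Notation P := (qP v1 v2 w1 w2).

Let tF z : F z -> turn z P 4 = 2 * pi.
Proof. by move=> Fz; rewrite turn_qP; exact: pquad_turn Q Fz. Qed.

Let h01 : 0 < (2^-1 : R) < 1. Proof. by lra. Qed.

Lemma epoint_half a b : epoint b a 2^-1 = epoint a b 2^-1.
Proof. by rewrite -{1}(_ : 1 - 2^-1 = 2^-1) ?epointC //; field. Qed.

(** With [F] on the right, points on the left would have winding number [4 pi], but four angles
    below [pi] cannot add up to that. *)
Lemma not_right k : (k < 4)%N -> ~ lside (P k.+1) (P k) 2^-1 F.
Proof.
move=> k4 L; have ab := gadj_neq (qv_adj Q k4).
have [d d0 Hd] := quad_jump Q k4 h01.
have [z [bz cz Fz]] := lside_near (nesym ab) L d0.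
have [z' bz' cz'] := left_point (2^-1) ab d0.
rewrite epoint_half in bz; rewrite cross_opp oppr_gt0 in cz.
have := Hd z' z bz' bz cz' cz; rewrite (tF Fz) turn_qP => E.
have := turn4_lt z' (pp v1) (dp w1) (pp v2) (dp w2); rewrite E ltr_norml; have := pi_gt0 R; lra.
Qed.

Lemma face_left k : (k < 4)%N -> lside (P k) (P k.+1) 2^-1 F.
Proof.
move=> k4; have [//|] := quad_sides Q k4.
by rewrite (_ : 1 - 2^-1 = 2^-1 :> R) => [/(not_right k4)//|]; field.
Qed.

(** If the winding number on the component [C] of [z] were nonzero, [C] would not reach infinity,
    and a horizontal segment would leave it through the interior of an edge. On the left of this
    edge is [F], with winding number [2 pi]; so [C] is on the right and its number is 0. *)
Lemma turn_outside z : ~ F z -> ~ PG F z -> turn4 z (pp v1) (dp w1) (pp v2) (dp w2) = 0.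
Proof.
move=> nF nP; rewrite -turn_qP; apply: contrapT => tn.
have cP := @closed_PG F; have oP := closed_openC cP.
pose C := connected_component (~` PG F) z.
have Cz : C z by exact: connected_component_refl.
have sC : sat (PG F) C by exact: sat_component.
have [CP oC satC] := sC.
have cC : connected C by exact: component_connected.
have tC y : C y -> turn y P 4 = turn z P 4.
  by move=> Cy; apply: (turn_const cC _) => // x /CP; exact: avoids_PG.
have CF y : C y -> ~ F y.
  move=> Cy Fy; apply: nF; have [_ _ sF] := sat_PG Q.
  by apply: (sF C) => //; exists y.
pose ys := [seq (P k).2 | k <- [:: 0; 1; 2; 3; 4]%N].
have [e e0 He] := open_box oC Cz.
(* At a height different from those of the vertices, the horizontal segment meets the polygon in
   interior points of edges only. *)
have [y yb yn] := @avoid_seq R ys (z.2 - e) (z.2 + e) ltac:(lra).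
pose z' : R * R := (z.1, y).
have Cz' : C z' by apply: He; split; rewrite /= ?subrr ?normr0 // ltr_norml; lra.
have [M M0 HM] := bounded_Gam G.
(* Far away on the horizontal line the winding number vanishes. *)
have [x0 x00 nx] : exists2 x0 : R, z.1 <= x0 & ~ C (x0, y).
  pose far := [set p : R * R | M < p.1].
  have cfar : connected far.
    apply: convex_connected => p q /= hp hq u [t]; rewrite /= in_itv /= => t01 <-.
    have := @convex_comb_lt R (- p.1) (- q.1) (- M) t; rewrite !ltrN2 => /(_ hp hq t01).
    by rewrite /far /= /GRing.scale /=; lra.
  have farP : far `<=` ~` PG F.
    by move=> p; rewrite {1}/far /= => Mp /(PG_Gam Q)/HM[]; rewrite ler_norml => /andP[_]; lra.
  exists (Num.max z.1 (M + 1)); first by rewrite le_max lexx.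
  move=> Cx; have fx : far (Num.max z.1 (M + 1), y) by rewrite /far /= lt_max; apply/orP; right; lra.
  pose u : R * R := (1, 0).
  have fC : far `<=` C by apply: satC => //; exists (Num.max z.1 (M + 1), y).
  apply: tn; have B0 : 0 < 40 * M + 1 by lra.
  pose x : R * R := (40 * M + 1, 0).
  have Cx' : C x by apply: fC; rewrite /far /=; lra.
  rewrite -(tC _ Cx'); apply: turn_eq0 => //; first exact/avoids_PG/CP.
  have small k : (k < 4)%N -> `|ang (P k - x) (P k.+1 - x)| <= 1 / 2.
    move=> k4; have [a1 a2] := HM _ (pos_Gam (qv v1 v2 w1 w2 k)).
    have [b1 b2] := HM _ (pos_Gam (qv v1 v2 w1 w2 k.+1)).
    rewrite -/(P k) -/(P k.+1) in a1 a2 b1 b2.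
    have g1 : 39 * M <= nrm (P k - x).
      apply: le_trans (nrm_ge1 _) => /=; rewrite ler_normr; apply/orP; right.
      by move: a1; rewrite ler_norml => /andP[_]; lra.
    have g0 : 0 < nrm (P k - x) by lra.
    have g2 : nrm (P k.+1 - P k) <= 4 * M.
      have := nrm_le12 (P k.+1 - P k) => /=.
      have := ler_normB (P k.+1).1 (P k).1; have := ler_normB (P k.+1).2 (P k).2; lra.
    have E : P k.+1 - x - (P k - x) = P k.+1 - P k by exact: subsub.
    have [|_] := @ang_small R (P k - x) (P k.+1 - x) g0; first by rewrite E; lra.
    rewrite E => h; apply: le_trans h _.
    have : nrm (P k.+1 - P k) / nrm (P k - x) <= 1 / 4 by rewrite ler_pdivrMr //; lra.
    lra.
  rewrite turn_qP /turn4.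
  have := small 0%N isT; have := small 1%N isT; have := small 2%N isT; have := small 3%N isT.
  rewrite /qP /pos /= !ler_norml => /andP[? ?] /andP[? ?] /andP[? ?] /andP[? ?].
  by have := @pi_ge2 R; rewrite ltr_norml; lra.
have [m [[s _ sm] [cm nm]]] : segment2 z' (x0, y) `&` frontier C !=set0.
  apply: connected_frontier; first exact: connected_segment2.
    by exists z'; split => //; exact: segment2_l.
  by exists (x0, y); split => //; exact: segment2_r.
have my : m.2 = y by rewrite -sm /= /GRing.scale /=; ring.
have Pm : PG F m.
  apply: contrapT => nPm; have [r r0 Hr] := open_box oP nPm.
  apply: nm; rewrite (interior_id C).1 //.
  have [q Cq bq] := (closure_box C m).1 cm r r0.
  apply: (satC (box m r)) => //; first by apply: convex_connected; exact: convex_box.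
    by exists q.
  by split; rewrite subrr normr0.
have [k k4 [t]] := PG_inv Q Pm; rewrite /= in_itv /= => /andP[t0 t1] tm.
have ab := gadj_neq (qv_adj Q k4).
have vy j : (j <= 4)%N -> (P j).2 != y.
  move=> j4; apply/eqP => E; move/negP: yn; apply; rewrite -E.
  by apply: (map_f (fun k => (P k).2)); case: j j4 {E} => [|[|[|[|[|]]]]].
have t01 : 0 < t < 1.
  rewrite !lt_neqAle t0 t1 !andbT; apply/andP; split; apply/eqP => E.
    by move: (vy k (ltnW k4)); rewrite -my -tm -E subr0 scale1r scale0r addr0 eqxx.
  by move: (vy k.+1 k4); rewrite -my -tm E subrr scale0r scale1r add0r eqxx.
have flatP : flat (PG F) (P k) (P k.+1).
  move=> s' s'01; have [r r0 Hr] := flat_Gam (qv_adj Q k4) s'01.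
  by exists r => // q bq Pq; apply: Hr => //; exact: (PG_Gam Q).
have sF := sat_PG Q.
have LF := lside_const ab flatP sF h01 t01 (face_left k4).
have me : epoint (P k) (P k.+1) t = m by [].
have [d d0 Hd] := quad_jump Q k4 t01.
have cCm : closure C (epoint (P k) (P k.+1) t) by rewrite me.
have [LC|LC] := closure_sides ab flatP sC t01 cCm.
  have [r r0 Hr] := LF.
  have [q [bq cq Cq]] := lside_near ab LC r0.
  exact: (CF q Cq (Hr q bq cq)).
have [q [bq cq Cq]] := lside_near (nesym ab) LC d0.
have [p [bp cp Fp]] := lside_near ab LF d0.
rewrite epointC in bq; rewrite cross_opp oppr_gt0 in cq.
have := Hd p q bp bq cp cq; rewrite (tF Fp) (tC q Cq) => E.
by apply: tn; lra.
Qed.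

Definition otri a b c : set (R * R) := [set z | 0 < cross (b - a) (z - a)] `&`
  [set z | 0 < cross (c - b) (z - b)] `&` [set z | 0 < cross (a - c) (z - c)].

(** The open triangle is connected and contains points just to the left of the midpoint of its edge,
    which belong to [F]. *)
Lemma otri_face k c : (k < 4)%N -> 0 < cross (P k.+1 - P k) (c - P k) ->
  (forall z, otri (P k) (P k.+1) c z -> ~ PG F z) -> otri (P k) (P k.+1) c `<=` F.
Proof.
move=> k4 A1 nP; have [r r0 Hr] := face_left k4.
set a := P k in A1 nP Hr *; set b := P k.+1 in A1 nP Hr *.
have cT : connected (otri a b c).
  by apply: convex_connected; apply: convexI; [apply: convexI|]; exact: convex_half.
have [_ _ sF] := sat_PG Q.
apply: sF => //.
set m := epoint a b 2^-1 in Hr.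
pose K := `|(c - m).1| + `|(c - m).2| + 1.
have K1 : 1 <= K by rewrite lerDr addr_ge0.
pose s := Num.min (r / (2 * K)) 2^-1.
have s0 : 0 < s by rewrite lt_min divr_gt0 ?mulr_gt0 ?invr_gt0 //; lra.
have s1 : s <= 2^-1 by rewrite ge_min lexx orbT.
have sK : s * K < r.
  have : s * (2 * K) <= r by rewrite -ler_pdivlMr ?mulr_gt0 ?ge_min ?lexx //; lra.
  lra.
pose z := m + s *: (c - m).
have bz : box m r z.
  have k1 := normr_ge0 (c - m).1; have k2 := normr_ge0 (c - m).2.
  split; rewrite /z /= /GRing.scale /= addrAC subrr add0r normrM (gtr0_norm s0);
    apply: le_lt_trans sK; rewrite ler_pM2l // /K /=; lra.
have c1 : cross (b - a) (z - a) = s * cross (b - a) (c - a).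
  by rewrite /z /m /cross /epoint /= /GRing.scale /=; field.
have c2 : cross (c - b) (z - b) = (1 - s) / 2 * cross (b - a) (c - a).
  by rewrite /z /m /cross /epoint /= /GRing.scale /=; field.
have c3 : cross (a - c) (z - c) = (1 - s) / 2 * cross (b - a) (c - a).
  by rewrite /z /m /cross /epoint /= /GRing.scale /=; field.
have z1 : 0 < cross (b - a) (z - a) by rewrite c1 mulr_gt0.
exists z; split; last exact: Hr.
by split; [split|]; rewrite /= ?c2 ?c3 //; apply: mulr_gt0 => //; lra.
Qed.

Lemma half_triangle1 : let p := cross (dp w1 - pp v1) (pp v2 - pp v1) in
  let p' := cross (dp w2 - pp v2) (pp v1 - pp v2) in
  0 < p -> 0 <= p' -> otri (pp v1) (dp w1) (pp v2) `<=` F.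
Proof.
move=> p p' p0 p'0; apply: (@otri_face 0%N (pp v2)) => // z [[z1 z2] z3] /(PG_inv Q)[k k4 [t]].
rewrite /= in_itv /= => /andP[t0 t1] E.
move: z1 z2 z3; rewrite /= -E; move: k4; rewrite /p' in p'0.
have tp : 0 <= t * cross (dp w2 - pp v2) (pp v1 - pp v2) by exact: mulr_ge0.
have tp' : 0 <= (1 - t) * cross (dp w2 - pp v2) (pp v1 - pp v2) by apply: mulr_ge0 => //; rewrite subr_ge0.
rewrite /cross /= in tp tp'.
by case: k {E} => [|[|[|[|]]]] // _; rewrite /qP /pos /= /cross /= /GRing.scale /=; lra.
Qed.

Lemma half_triangle2 : let q := cross (dp w1 - pp v1) (dp w2 - pp v1) in
  let q' := cross (dp w2 - pp v2) (dp w1 - pp v2) in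
  0 < q -> 0 <= q' -> otri (pp v1) (dp w1) (dp w2) `<=` F.
Proof.
move=> q q' q0 q'0; apply: (@otri_face 0%N (dp w2)) => // z [[z1 z2] z3] /(PG_inv Q)[k k4 [t]].
rewrite /= in_itv /= => /andP[t0 t1] E.
move: z1 z2 z3; rewrite /= -E; move: k4; rewrite /q' in q'0.
have tp : 0 <= t * cross (dp w2 - pp v2) (dp w1 - pp v2) by exact: mulr_ge0.
have tp' : 0 <= (1 - t) * cross (dp w2 - pp v2) (dp w1 - pp v2) by apply: mulr_ge0 => //; rewrite subr_ge0.
rewrite /cross /= in tp tp'.
by case: k {E} => [|[|[|[|]]]] // _; rewrite /qP /pos /= /cross /= /GRing.scale /=; lra.
Qed.

End Left.

(** One diagonal cuts the quadrilateral, even a non-convex one, into two triangles of nonnegative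
    orientation; the larger has at least half of the area. This is the source of a lower bound for
    the measure of [F]. *)
Lemma big_triangle F v1 v2 w1 w2 : pquad F v1 v2 w1 w2 -> exists a b c,
  otri a b c `<=` F /\ cross (pp v2 - pp v1) (dp w2 - dp w1) / 2 <= cross (b - a) (c - a).
Proof.
move=> Q; have Q' := pquad_rot Q; have [_ _ A0] := Q.
have := quad_signs Q; cbv zeta.
set p := cross (dp w1 - pp v1) (pp v2 - pp v1); set q := cross (dp w1 - pp v1) (dp w2 - pp v1).
set p' := cross (dp w2 - pp v2) (pp v1 - pp v2); set q' := cross (dp w2 - pp v2) (dp w1 - pp v2).
set A := cross (pp v2 - pp v1) (dp w2 - dp w1) in A0 *.
move=> [E1 E2 [n1 n2 n3 n4]].
have [[p0 p'0]|np] := pselect (0 <= p /\ 0 <= p').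
  have [h|h] := leP (A / 2) p.
    by exists (pp v1), (dp w1), (pp v2); split => //; apply: (half_triangle1 Q) => //; rewrite -/p; rlra.
  exists (pp v2), (dp w2), (pp v1); split; last by rewrite -/p'; rlra.
  by apply: (half_triangle1 Q'); rewrite -/p' -/p; rlra.
have [q0 q'0] : 0 <= q /\ 0 <= q'.
  split; rewrite leNgt; apply/negP => h.
    by apply: np; split; rewrite leNgt; apply/negP => h'; [apply: n4|apply: n2].
  by apply: np; split; rewrite leNgt; apply/negP => h'; [apply: n1|apply: n3].
have [h|h] := leP (A / 2) q.
  by exists (pp v1), (dp w1), (dp w2); split => //; apply: (half_triangle2 Q) => //; rewrite -/q; rlra.
exists (pp v2), (dp w2), (dp w1); split; last by rewrite -/q'; rlra.
by apply: (half_triangle2 Q'); rewrite -/q' -/q; rlra.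
Qed.

End Graph.
End Quads.

(** * Faces around a vertex and along the boundary *)

Section Combinatorics.
Context {R : realType}.
Variable G : orthodiagonal_map R.
Notation V := (primal_vertex G).
Notation W := (dual_vertex G).
Implicit Types (x y v : V) (w : W) (F : set (R * R)).
Notation pp := (@ppos R G).
Notation dp := (@dpos R G).

Let h01 : 0 < (2^-1 : R) < 1. Proof. by lra. Qed.

Lemma quad_vertex F v1 v2 w1 w2 (u : V + W) : quad_face F v1 v2 w1 w2 -> frontier F (pos u) ->
  [\/ u = inl v1, u = inl v2, u = inr w1 | u = inr w2].
Proof.
move=> [n1 n2 [e1 e2 e3 e4] ->] h.
have H x w : edge x w -> segment2 (pp x) (dp w) (pos u) -> u = inl x \/ u = inr w.
  by move=> e; apply: (@pos_segment R G (inl x) (inr w) u).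
move: h => [[[/(H _ _ e1)|]|/(H _ _ e3)]|]; rewrite ?[segment2 (dp _) _]segment2C.
- by move=> [->|->]; [constructor 1|constructor 3].
- by move=> /(H _ _ e2) [->|->]; [constructor 2|constructor 3].
- by move=> [->|->]; [constructor 2|constructor 4].
- by move=> /(H _ _ e4) [->|->]; [constructor 1|constructor 4].
Qed.

Lemma quad_vertices F v1 v2 w1 w2 : quad_face F v1 v2 w1 w2 ->
  [/\ frontier F (pp v1), frontier F (pp v2), frontier F (dp w1) & frontier F (dp w2)].
Proof.
move=> [_ _ _ ->]; split.
- by left; left; left; exact: segment2_l.
- by left; right; exact: segment2_l.
- by left; left; right; exact: segment2_l.
- by right; exact: segment2_l.
Qed.

Lemma quad_unique F v1 v2 w1 w2 v2' w2' : quad_face F v1 v2 w1 w2 ->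
  quad_face F v1 v2' w1 w2' -> v2 = v2' /\ w2 = w2'.
Proof.
move=> Q Q'; have [_ h2 _ h4] := quad_vertices Q.
have [n1 n2 _ _] := Q.
have := @quad_vertex _ _ _ _ _ (inl v2) Q' h2; have := @quad_vertex _ _ _ _ _ (inr w2) Q' h4.
by move=> [//|//|[E]|[->]] [[E']|[->]|//|//] //; case: (n1); rewrite ?E' //; case: n2; rewrite E.
Qed.

(** Orthogonality is given for some labelling of the face. Vertices on its frontier are determined,
    so any other labelling has the same diagonals up to order. *)
Lemma quad_orthogonal F v1 v2 w1 w2 : is_inner_face G F -> quad_face F v1 v2 w1 w2 ->
  dot2 (pp v1 - pp v2) (dp w1 - dp w2) = 0.
Proof.
move=> iF Q; have [a [b [c [d [Q' D]]]]] := om_faces iF.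
have {}Q' : quad_face F a b c d by [].
have [h1 h2 h3 h4] := quad_vertices Q; have [n1 n2 _ _] := Q.
have := @quad_vertex _ _ _ _ _ (inl v1) Q' h1; have := @quad_vertex _ _ _ _ _ (inl v2) Q' h2.
have := @quad_vertex _ _ _ _ _ (inr w1) Q' h3; have := @quad_vertex _ _ _ _ _ (inr w2) Q' h4.
move=> [//|//|[E4]|[E4]] [//|//|[E3]|[E3]] [[E2]|[E2]|//|//] [[E1]|[E1]|//|//];
  subst; try (by case: n1); try (by case: n2); rewrite -?D; rewrite /dot2 /= in D *; lra.
Qed.

Lemma quad_cross_neq0 F v1 v2 w1 w2 : is_inner_face G F -> quad_face F v1 v2 w1 w2 ->
  cross (pp v2 - pp v1) (dp w2 - dp w1) != 0.
Proof.
move=> iF Q; have D := quad_orthogonal iF Q; have [n1 n2 _ _] := Q.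
apply/eqP => c0; have L := lagrange2 (pp v2 - pp v1) (dp w2 - dp w1).
have D' : dot2 (pp v2 - pp v1) (dp w2 - dp w1) = 0 by rewrite -D /dot2 /=; ring.
rewrite c0 D' expr0n /= addr0 in L.
have : nrm (pp v2 - pp v1) * nrm (dp w2 - dp w1) = 0.
  by apply/eqP; rewrite -sqrf_eq0 -L.
move/eqP; rewrite mulf_eq0 => /orP[] /eqP/nrm_eq0/eqP; rewrite subr_eq0 => /eqP E.
  by apply: n1; have /= [] := @pos_inj R G (inl v2) (inl v1) E.
by apply: n2; have /= [] := @pos_inj R G (inr w2) (inr w1) E.
Qed.

Lemma edge_quad F x w : is_inner_face G F -> edge x w ->
  closure F (epoint (pp x) (dp w) 2^-1) -> exists y w', quad_face F x y w w'.
Proof.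
move=> iF e cF; have [a [b [c [d [Q _]]]]] := om_faces iF.
have {}Q : quad_face F a b c d by [].
have [_ [FG _ _] _ _] := inner_face_sat iF.
have e' : gadj (G := G) (inl x) (inr w) by [].
set m := epoint _ _ _ in cF.
have ms : segment2 (pp x) (dp w) m by exists 2^-1 => //=; rewrite in_itv /=; lra.
have fm : frontier F m by split => // /interior_subset/FG; apply; exact: (segment_Gam e').
have H a' c' : edge a' c' -> segment2 (pp a') (dp c') m -> a' = x /\ c' = w.
  move=> ea h; have [[[] -> [] -> //]|[//]|[u mu]] :=
    @segment_meet R G (inl x) (inr w) (inl a') (inr c') m e' ea ms h.
  by case: (@epoint_vertex R G (inl x) (inr w) u 2^-1 e' h01).
have [_ _ [e1 e2 e3 e4] E] := Q.
have H1 : segment2 (pp a) (dp c) m -> exists y w', quad_face F x y w w'.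
  by move=> /(H _ _ e1)[<- <-]; exists b, d.
move: fm; rewrite E => -[[[//|]|]|]; rewrite ?[segment2 (dp _) _]segment2C.
- by move=> /(H _ _ e2)[<- <-]; exists a, d; exact: quad_face_swapv.
- by move=> /(H _ _ e3)[<- <-]; exists a, c; exact/quad_face_swapv/quad_face_swap.
- by move=> /(H _ _ e4)[<- <-]; exists b, c; exact/quad_face_swap.
Qed.

(** In the other orientation the cycle would traverse this edge from [w] to [x] and have its face on
    the right, which [not_right] excludes. *)
Lemma left_pquad F x w : is_inner_face G F -> edge x w -> lside (pp x) (dp w) 2^-1 F ->
  exists y w', pquad F x y w w'.
Proof.
move=> iF e L; have e' : gadj (G := G) (inl x) (inr w) by [].
have [_ sF _ _] := inner_face_sat iF.
have [|y [w' Q]] := edge_quad iF e.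
  by apply: (lside_closure (gadj_neq e') (flat_Gam e') sF h01 L); lra.
exists y, w'; split => //; have := quad_cross_neq0 iF Q; rewrite neq_lt => /orP[c|//].
have Q' : pquad F x y w' w.
  split => //; first exact: quad_face_swap.
  by move: c; rewrite /cross /=; lra.
by case: (@not_right R G F x y w' w Q' 3 isT).
Qed.

Lemma right_pquad F x w : is_inner_face G F -> edge x w -> lside (dp w) (pp x) 2^-1 F ->
  exists y w', pquad F x y w' w.
Proof.
move=> iF e L; have e' : gadj (G := G) (inl x) (inr w) by [].
have e'' : gadj (G := G) (inr w) (inl x) by [].
have [_ sF _ _] := inner_face_sat iF.
have [|y [w' Q]] := edge_quad iF e.
  by rewrite -epoint_half; apply: (lside_closure (gadj_neq e'') (flat_Gam e'') sF h01 L); lra.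
exists y, w'; have := quad_cross_neq0 iF Q; rewrite neq_lt => /orP[c|c].
  split => //; first exact: quad_face_swap.
  by move: c; rewrite /cross /=; lra.
have Q' : pquad F x y w w' by [].
by case: (@not_right R G F x y w w' Q' 0 isT).
Qed.

(** The half box on the left lies in one component of the complement of the drawing, and an
    unbounded component belongs to the outer face. *)
Lemma side_face (s t : V + W) : gadj s t -> ~ lside (pos s) (pos t) 2^-1 (outer G) ->
  exists2 F, is_inner_face G F & lside (pos s) (pos t) 2^-1 F.
Proof.
move=> e no; have [r r0 Hr] := flat_Gam e h01.
have [z bz cz] := left_point 2^-1 (gadj_neq e) r0.
have nz : ~ Gam G z by move=> /(Hr z bz) c; rewrite c ltxx in cz.
have half C : sat (Gam G) C -> C z -> lside (pos s) (pos t) 2^-1 C.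
  move=> sC Cz; have [//|[r' r'0 H']] := lside_dec (flat_Gam e) sC h01.
  pose B := box (epoint (pos s) (pos t) 2^-1) r `&` [set y | 0 < cross (pos t - pos s) (y - pos s)].
  have cB : connected B by apply: convex_connected; apply: convexI; [exact: convex_box|exact: convex_half].
  have BG : B `<=` ~` Gam G by move=> y [by_ /= cy] /(Hr y by_) E; rewrite E ltxx in cy.
  have [_ _ satC] := sC; exists r => // y by_ cy.
  by apply: (satC B) => //; exists z.
exists (connected_component (~` Gam G) z).
  split; first by exists z.
  apply: contrapT => nb; apply: no; apply: half; [exact: sat_outer|by split].
by apply: half; [exact: (sat_component z (@closed_Gam R G))|exact: connected_component_refl].
Qed.

(* Each inner face occurs as two such tuples, [(x, y, w1, w2)] and [(y, x, w2, w1)]. *)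
Definition posq x y w1 w2 : bool := `[< exists F, pquad F x y w1 w2 >].

Lemma posqC x y w1 w2 : posq x y w1 w2 = posq y x w2 w1.
Proof. by apply/asboolP/asboolP => -[F /pquad_rot Q]; exists F. Qed.

Lemma posq_edge x y w1 w2 : posq x y w1 w2 -> [/\ x != y, w1 != w2 &
  [/\ edge x w1, edge y w1, edge y w2 & edge x w2]].
Proof. by move/asboolP => [F [_ [/eqP ? /eqP ? h _] _]]. Qed.

Lemma posq_cross x y w1 w2 : posq x y w1 w2 ->
  0 < cross (pp y - pp x) (dp w2 - dp w1) /\ dot2 (pp y - pp x) (dp w2 - dp w1) = 0.
Proof.
move/asboolP => [F [iF Q c]]; split => //.
by have := quad_orthogonal iF Q; rewrite /dot2 /=; lra.
Qed.

Lemma pquad_face_eq F F' x y w1 w2 x' y' w1' w2' k : (k < 4)%N ->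
  pquad F x y w1 w2 -> pquad F' x' y' w1' w2' ->
  qP x y w1 w2 k = qP x' y' w1' w2' k -> qP x y w1 w2 k.+1 = qP x' y' w1' w2' k.+1 -> F = F'.
Proof.
move=> k4 Q Q' E1 E2; have L := face_left Q k4; have [r r0 Hr] := face_left Q' k4.
rewrite -E1 -E2 in Hr.
have [z [bz cz Fz]] := lside_near (gadj_neq (qv_adj Q k4)) L r0.
have [iF _ _] := Q; have [iF' _ _] := Q'.
by apply: (inner_face_eq iF iF'); exists z; split; [exact: Fz|exact: (Hr z bz cz)].
Qed.

(** The face is the one on the left of the edge directed from [x] to [w1]. *)
Lemma posq_unique1 x w1 y w2 y' w2' : posq x y w1 w2 -> posq x y' w1 w2' -> y = y' /\ w2 = w2'.
Proof.
move=> /asboolP[F Q] /asboolP[F' Q'].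
have E : F = F' by apply: (@pquad_face_eq F F' x y w1 w2 x y' w1 w2' 0 isT Q Q').
rewrite -E in Q'; have [_ q _] := Q; have [_ q' _] := Q'.
exact: (quad_unique q q').
Qed.

(** Here the common directed edge is the last one of the cycle, from [w2] to [x]. *)
Lemma posq_unique2 x w2 y w1 y' w1' : posq x y w1 w2 -> posq x y' w1' w2 -> y = y' /\ w1 = w1'.
Proof.
move=> /asboolP[F Q] /asboolP[F' Q'].
have E : F = F' by apply: (@pquad_face_eq F F' x y w1 w2 x y' w1' w2 3 isT Q Q').
rewrite -E in Q'; have [_ q _] := Q; have [_ q' _] := Q'.
exact: (quad_unique (quad_face_swap q) (quad_face_swap q')).
Qed.

Lemma posq_exists1 x w : ~ bdry x -> edge x w -> exists y w', posq x y w w'.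
Proof.
move=> nb e; have e' : gadj (G := G) (inl x) (inr w) by [].
have [|F iF L] := side_face e'.
  move=> L; apply: nb; apply/bdryE.
  have := lside_closure (gadj_neq e') (flat_Gam e') (sat_outer G) h01 L (s' := 0).
  by rewrite /epoint subr0 scale1r scale0r addr0; apply; rewrite lexx ler01.
by have [y [w' Q]] := left_pquad iF e L; exists y, w'; apply/asboolP; exists F.
Qed.

Lemma posq_exists2 x w : ~ bdry x -> edge x w -> exists y w', posq x y w' w.
Proof.
move=> nb e; have e' : gadj (G := G) (inr w) (inl x) by [].
have [|F iF L] := side_face e'.
  move=> L; apply: nb; apply/bdryE.
  have := lside_closure (gadj_neq e') (flat_Gam e') (sat_outer G) h01 L (s' := 1).
  by rewrite /epoint subrr scale0r scale1r add0r; apply; rewrite lexx ler01.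
by have [y [w' Q]] := right_pquad iF e L; exists y, w'; apply/asboolP; exists F.
Qed.

(** By [outer_one_side] at least one side of the edge belongs to an inner face, also on the
    boundary. *)
Lemma edge_inner x w : edge x w -> exists F y w', pquad F x y w w' \/ pquad F x y w' w.
Proof.
move=> e; have e' : gadj (G := G) (inl x) (inr w) by [].
have e'' : gadj (G := G) (inr w) (inl x) by [].
have [L|nL] := pselect (lside (pp x) (dp w) 2^-1 (outer G)).
  have [|F iF L'] := side_face e''; first by move=> L'; exact: (outer_one_side e' L L').
  by have [y [w' Q]] := right_pquad iF e L'; exists F, y, w'; right.
have [F iF L'] := side_face (e' : gadj (inl x) (inr w)) nL.
by have [y [w' Q]] := left_pquad iF e L'; exists F, y, w'; left.
Qed.

Lemma frontier_outer_two : exists a b, [/\ frontier (outer G) a, frontier (outer G) b & a <> b].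
Proof.
have [ga [_ _ inj im]] := om_outer G; rewrite -/(outer G) in im.
exists (ga 0), (ga 2^-1); split.
- by rewrite -im; exists 0 => //=; rewrite in_itv /= lexx ler01.
- by rewrite -im; exists 2^-1 => //=; rewrite in_itv /=; lra.
have h (u : R) : 0 <= u < 1 -> u \in `[0, 1[%classic by move=> ub; apply/mem_set; rewrite /= in_itv.
by move=> E; have := inj _ _ (h 0 ltac:(lra)) (h 2^-1 ltac:(lra)) E; lra.
Qed.

Lemma connected_frontier_outer : connected (frontier (outer G)).
Proof.
have [ga [cga _ _ im]] := om_outer G; rewrite -/(outer G) in im; rewrite -im.
by apply: connected_continuous_connected => //; exact: (@in_itv_conn R).2.
Qed.

(** An isolated vertex would be the whole connected graph; its drawing is a single point, but the
    boundary curve has two. *)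
Lemma has_edge x : exists w, edge x w.
Proof.
apply: contrapT => ne.
have all u : u = inl x :> V + W.
  have := om_connected (inl x) u; move=> /connectP[[|t p]] /=; first by move=> _ ->.
  by case: t => [//|w] /andP[e _] _; case: ne; exists w.
have GE z : Gam G z -> z = pp x.
  by move=> [[u ->]|[v [w _]]]; [rewrite (all u)|have := all (inr w)].
have [a [b [fa fb ab]]] := frontier_outer_two.
rewrite frontier_outerE in fa fb; have [ca na] := fa; have [cb nb] := fb.
by apply: ab; rewrite (GE a (closure_outer_Gam ca na)) (GE b (closure_outer_Gam cb nb)).
Qed.

Lemma inner_face_hat F : is_inner_face G F -> F `<=` hat_domain G.
Proof.
move=> iF z Fz; rewrite hat_domainE => /closure_box cz.
have [_ [FG oF sF] cF bF] := inner_face_sat iF.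
have [r r0 Hr] := open_box oF Fz; have [q oq bq] := cz r r0.
have Fq := Hr q bq; have [_ nb] := oq; apply: nb.
have /bounded_set2P[M M0 HM] := bF; apply/bounded_set2P; exists M => // t ct; apply: HM.
apply: (sF _ _ _ _ t ct); [exact: component_connected|exact: connected_component_sub|].
by exists q; split => //; apply: connected_component_refl; exact: FG.
Qed.

Lemma closure_hat x : closure (hat_domain G) (pp x).
Proof.
have [w e] := has_edge x; have [F [y [w' Q]]] := edge_inner e.
have [iF q] : is_inner_face G F /\ frontier F (pp x).
  by case: Q => -[iF Q _]; split => //; have [] := quad_vertices Q.
by apply: (closure_subset (inner_face_hat iF)); case: q.
Qed.

(** The segment meets the boundary curve at some [y]. A point of the curve within [eps] of [y] that
    is not a vertex is interior to a boundary edge, whose primal end is at most [eps] further. *)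
Lemma near_bdry p q (eps : R) : 0 < eps -> mesh_le G eps -> hat_domain G p -> ~ hat_domain G q ->
  exists2 v, bdry v & nrm (pp v - p) <= nrm (q - p) + 2 * eps.
Proof.
move=> e0 me hp nq.
have [y [ys [cy ny]]] : segment2 p q `&` frontier (hat_domain G) !=set0.
  apply: connected_frontier; first exact: connected_segment2.
    by exists p; split => //; exact: segment2_l.
  by exists q; split => //; exact: segment2_r.
have oh : open (hat_domain G) by rewrite hat_domainE; apply: closed_openC; exact: closed_closure.
rewrite (interior_id (hat_domain G)).1 // hat_domainE in ny.
have {ny} cyo : closure (outer G) y by apply: contrapT.
have noy : ~ outer G y.
  move=> oy; have [r r0 Hr] := open_box (@open_outer R G) oy.
  have [z] := (closure_box _ _).1 cy r r0; rewrite hat_domainE => nz /Hr oz.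
  by apply: nz; exact: subset_closure.
have fy : frontier (outer G) y by rewrite frontier_outerE.
(* The vertices other than [y]: a point of the curve that is near [y] and different from it is then
   no vertex. *)
pose rest := [set z | exists2 u : V + W, pos u != y & [set pos u] z].
have cr : closed rest.
  apply: closed_union => i.
  exact: accessible_closed_set1 (hausdorff_accessible (@norm_hausdorff R _)) _.
have nr : ~ rest y by move=> [u /eqP un E]; apply: un; rewrite E.
have [r1 r10 Hr1] := open_box (closed_openC cr) nr.
pose r := Num.min r1 (eps / 2); have r0 : 0 < r by rewrite lt_min r10 divr_gt0.
have [y' [fy' by' yy']] : exists y' : R * R, [/\ frontier (outer G) y', box y r y' & y' <> y].
  apply: contrapT => none.
  have E : frontier (outer G) `&` [set y] = frontier (outer G).
    apply: connected_frontier_outer; first by exists y.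
      exists (box y r); first exact: open_boxset.
      apply/seteqP; split=> z [fz].
        by move=> /= ->; split => //; split; rewrite subrr normr0.
      by move=> bz; split => //=; apply: contrapT => zy; apply: none; exists z.
    exists [set y] => //.
    exact: accessible_closed_set1 (hausdorff_accessible (@norm_hausdorff R _)) _.
  have [a [b [fa fb]]] := frontier_outer_two; rewrite -E in fa fb.
  by case: fa fb => _ /= -> [_ /= ->].
have b1 : box y r1 y' by move: by' => [h1 h2]; rewrite /r !lt_min in h1 h2; case/andP: h1 => ? _; case/andP: h2.
have ncy : nrm (y' - y) <= eps.
  have := nrm_le12 (y' - y); move: by' => [h1 h2]; rewrite /r !lt_min in h1 h2.
  by case/andP: h1 => _ h1; case/andP: h2 => _ h2 /=; lra.
have nv (u : V + W) : y' <> pos u.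
  move=> E; apply: (Hr1 y' b1); exists u => //; apply/eqP => E'; apply: yy'.
  by rewrite E E'.
rewrite frontier_outerE in fy'; have [cy' noy'] := fy'.
have [[u /nv //]|[v [w [e [t]]]]] : Gam G y' := closure_outer_Gam cy' noy'.
rewrite /= in_itv /= => /andP[t0 t1] ty.
have e' : gadj (G := G) (inl v) (inr w) by [].
have e'' : gadj (G := G) (inr w) (inl v) by [].
have t01 : 0 < t < 1.
  rewrite !lt_neqAle t0 t1 !andbT; apply/andP; split; apply/eqP => E.
    by apply: (nv (inl v)); rewrite -ty -E subr0 scale1r scale0r addr0.
  by apply: (nv (inr w)); rewrite -ty E subrr scale0r scale1r add0r.
have bv : bdry v.
  apply/bdryE; have cE : closure (outer G) (epoint (pp v) (dp w) t) by rewrite /epoint ty.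
  have [L|L] := closure_sides (gadj_neq e') (flat_Gam e') (sat_outer G) t01 cE.
    have := lside_closure (gadj_neq e') (flat_Gam e') (sat_outer G) t01 L (s' := 0).
    by rewrite /epoint subr0 scale1r scale0r addr0; apply; rewrite lexx ler01.
  have t01' : 0 < 1 - t < 1 by lra.
  have := lside_closure (gadj_neq e'') (flat_Gam e'') (sat_outer G) t01' L (s' := 1).
  by rewrite /epoint subrr scale0r scale1r add0r; apply; rewrite lexx ler01.
exists v => //.
have d1 : nrm (pp v - y') <= eps.
  have -> : pp v - y' = t *: (pp v - dp w).
    by rewrite -ty; apply: injective_projections => /=; rewrite /GRing.scale /=; ring.
  rewrite nrmZ ger0_norm //; have := me v w e; rewrite nrm_dist2; have := nrm_ge0 (pp v - dp w); nra.
have d2 : nrm (y - p) <= nrm (q - p).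
  move: ys => [s]; rewrite /= in_itv /= => /andP[s0 s1] <-.
  have -> : (1 - s) *: p + s *: q - p = s *: (q - p).
    by apply: injective_projections => /=; rewrite /GRing.scale /=; ring.
  by rewrite nrmZ ger0_norm // ler_piMl // nrm_ge0.
have := nrm_triangle (pp v - y') (y' - p); rewrite addrA subrK => T1.
have := nrm_triangle (y' - y) (y - p); rewrite addrA subrK => T2.
lra.
Qed.

End Combinatorics.

(** * Total area of the quadrilaterals *)

Lemma sum_measure_le (R : realType) (d : measure_display) (T : measurableType d)
  (mu : {measure set T -> \bar R}) (I : eqType) (s : seq I) (S : I -> set T) (B : set T) :
  uniq s -> measurable B -> (forall i, measurable (S i)) ->
  (forall i, i \in s -> S i `<=` B) ->
  (forall i j, i \in s -> j \in s -> S i `&` S j !=set0 -> i = j) ->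
  (\sum_(i <- s) mu (S i) <= mu B)%E.
Proof.
move=> us mB mS SB dS.
pose U (t : seq I) := [set z | exists2 i, i \in t & S i z].
have H t : {subset t <= s} -> uniq t -> measurable (U t) /\ mu (U t) = (\sum_(i <- t) mu (S i))%E.
  elim: t => [|i t IH] ts ut.
    have -> : U [::] = set0 by apply/seteqP; split=> z // [].
    by rewrite big_nil measure0.
  move: ut => /= /andP[it ut].
  have [mt Et] := IH (fun j jt => ts j (@mem_behead _ (i :: t) j jt)) ut.
  have -> : U (i :: t) = S i `|` U t.
    apply/seteqP; split=> z.
      by move=> [j]; rewrite in_cons => /predU1P[->|jt] Sj; [left|right; exists j].
    by move=> [h|[j jt h]]; [exists i; rewrite ?mem_head|exists j => //; rewrite in_cons jt orbT].
  split; first exact: measurableU.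
  rewrite big_cons -Et; apply: measureU => //.
  apply/seteqP; split=> z // -[Si [j jt Sj]].
  have E : i = j by apply: dS; [exact/ts/mem_head|apply: ts; rewrite in_cons jt orbT|exists z].
  by rewrite E jt in it.
have [mU <-] := H s (fun _ => id) us.
by apply: le_measure; rewrite ?inE // => z [i si]; exact: SB.
Qed.

Section Area.
Context {R : realType}.
Implicit Types (a b c z : R * R).

Let TR := measurableTypeR R.

Definition area2 : {measure set (TR * TR) -> \bar R} :=
  (@lebesgue_measure R \x @lebesgue_measure R)%E.

(** A parallelogram with two vertical sides: its vertical sections are intervals of constant length,
    so its product measure is immediate. *)
Definition shear (x0 x1 k al l : R) : set (R * R) :=
  [set z | x0 < z.1 < x1 /\ 0 < z.2 - k * z.1 - al < l].

Lemma measurable_shear x0 x1 k al l : measurable (shear x0 x1 k al l : set (TR * TR)).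
Proof.
have -> : shear x0 x1 k al l = (fst @^-1` `]x0, x1[%classic) `&`
  ((fun p : R * R => p.2 - k * p.1 - al) @^-1` `]0, l[%classic).
  by apply/seteqP; split=> z; rewrite /shear /= !in_itv.
apply: measurableI; rewrite -[X in measurable X]setTI.
  exact: (measurable_fst : measurable_fun setT _).
apply: (_ : measurable_fun setT (fun p : R * R => p.2 - k * p.1 - al)) => //.
by apply: measurable_funB => //; apply: measurable_funB => //; apply: measurable_funM.
Qed.

Lemma area_shear x0 x1 k al l : x0 <= x1 -> 0 <= l ->
  area2 (shear x0 x1 k al l) = (l * (x1 - x0))%:E.
Proof.
move=> x01 l0.
have -> : area2 (shear x0 x1 k al l) = (\int[lebesgue_measure]_x
   lebesgue_measure (xsection (shear x0 x1 k al l) x))%E by [].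
have -> : (fun x => lebesgue_measure (xsection (shear x0 x1 k al l) x)) =
   (cst l%:E \_ `]x0, x1[%classic).
  apply/funext => x; rewrite patchE; case: ifPn => [|nx].
    rewrite inE /= in_itv /= => xb.
    have -> : xsection (shear x0 x1 k al l) x = `](k * x + al), (k * x + al + l)[%classic.
      apply/seteqP; split=> y; rewrite /xsection /= inE /shear /= in_itv /=.
        by move=> [_ h]; rlra.
      by move=> h; split => //; rlra.
    rewrite lebesgue_measure_itv /= lte_fin -EFinB.
    by case: ifPn => h; congr EFin; rlra.
  have -> : xsection (shear x0 x1 k al l) x = set0; last exact: measure0.
  apply/seteqP; split=> y //; rewrite /xsection /= inE => -[/= h _].
  by move/negP: nx; apply; rewrite inE /= in_itv.
rewrite -integral_mkcond.
have mI : measurable (`]x0, x1[%classic : set TR) by exact: measurable_itv.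
have E : lebesgue_measure (`]x0, x1[%classic : set TR) = (x1 - x0)%:E.
  rewrite lebesgue_measure_itv /= lte_fin -EFinB; have [//|h] := ltP x0 x1.
  by congr EFin; rlra.
have I := integral_cst (@lebesgue_measure R) mI l%:E.
exact: (etrans I (congr1 (fun u => (l%:E * u)%E) E)).
Qed.

(** The open triangle in barycentric coordinates, a description that permits any permutation of the
    vertices, whereas [otri] fixes the orientation. *)
Definition btri a b c : set (R * R) := [set z | exists wa wb wc : R,
  [/\ 0 < wa, 0 < wb, 0 < wc, wa + wb + wc = 1 & z = wa *: a + wb *: b + wc *: c]].

Lemma btri_perm1 a b c : btri b a c `<=` btri a b c.
Proof.
move=> z [wa [wb [wc [h1 h2 h3 h4 ->]]]]; exists wb, wa, wc; split => //; first rlra.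
by rewrite [wb *: a + _]addrC.
Qed.

Lemma btri_perm2 a b c : btri a c b `<=` btri a b c.
Proof.
move=> z [wa [wb [wc [h1 h2 h3 h4 ->]]]]; exists wa, wc, wb; split => //; first rlra.
by rewrite -!addrA [wc *: b + _]addrC.
Qed.

Lemma btri_otri a b c : 0 < cross (b - a) (c - a) -> btri a b c `<=` otri a b c.
Proof.
move=> A0 z [wa [wb [wc [h1 h2 h3 h4 ->]]]].
have wE : wa = 1 - wb - wc by rlra.
have p1 := mulr_gt0 h1 A0; have p2 := mulr_gt0 h2 A0; have p3 := mulr_gt0 h3 A0.
split; [split|] => /=.
- suff -> : cross (b - a) (wa *: a + wb *: b + wc *: c - a) = wc * cross (b - a) (c - a) by [].
  by rewrite wE /cross /= /GRing.scale /=; ring.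
- suff -> : cross (c - b) (wa *: a + wb *: b + wc *: c - b) = wa * cross (b - a) (c - a) by [].
  by rewrite wE /cross /= /GRing.scale /=; ring.
- suff -> : cross (a - c) (wa *: a + wb *: b + wc *: c - c) = wb * cross (b - a) (c - a) by [].
  by rewrite wE /cross /= /GRing.scale /=; ring.
Qed.

Lemma half_ratio (u X : R) : X != 0 ->
  Num.min 0 (X / 2) < u < Num.min 0 (X / 2) + `|X| / 2 -> 0 < 2 * u / X < 1.
Proof.
move=> X0; have [h|h] := ltP X 0.
  rewrite (ltr0_norm h) min_r => [/andP[h1 h2]|]; last rlra.
  by rewrite ltr_ndivlMr // ltr_ndivrMr // mul0r mul1r; apply/andP; split; rlra.
have h' : 0 < X by rewrite lt_def X0.
rewrite (ger0_norm h) min_l => [/andP[h1 h2]|]; last rlra.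
by rewrite ltr_pdivlMr // ltr_pdivrMr // mul0r mul1r; apply/andP; split; rlra.
Qed.

(** The vertical line through [a] meets the opposite side at [m]. The parallelogram at [a] spanned
    by the halves of [m - a] and [e - a] lies in the triangle; its area is [(1 - sg) / 4] times the
    cross product, and [sg <= 1/2]. *)
Lemma shear_core a e o (sg : R) : 0 <= sg < 1 -> (1 - sg) * o.1 + sg * e.1 = a.1 ->
  `|e.1 - o.1| <= 2 * `|e.1 - a.1| -> cross (e - a) (o - a) != 0 ->
  exists x0 x1 k al l, [/\ x0 <= x1, 0 <= l, shear x0 x1 k al l `<=` btri a e o &
    `|cross (e - a) (o - a)| / 8 <= l * (x1 - x0)].
Proof.
move=> /andP[s0 s1] aE eo A0; set A := cross _ _ in A0 *.
pose m := (1 - sg) *: o + sg *: e.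
have m1 : m.1 = a.1 by rewrite /m /= /GRing.scale /=.
pose L := m.2 - a.2; pose X := e.1 - a.1.
have XE : (1 - sg) * (e.1 - o.1) = X by rewrite /X -aE; ring.
have LE : X * L = (1 - sg) * A.
  rewrite /X /L /A /m /cross /= /GRing.scale /= -aE; ring.
have X0 : X != 0.
  apply/eqP => X0; have : (1 - sg) * A = 0 by rewrite -LE X0 mul0r.
  by move/eqP; rewrite mulf_eq0 (negbTE A0) orbF subr_eq0 => /eqP E; rewrite -E ltxx in s1.
have L0 : L != 0.
  apply/eqP => L0; have : (1 - sg) * A = 0 by rewrite -LE L0 mulr0.
  by move/eqP; rewrite mulf_eq0 (negbTE A0) orbF subr_eq0 => /eqP E; rewrite -E ltxx in s1.
have nX : 0 < `|X| by rewrite normr_gt0.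
have nL : 0 < `|L| by rewrite normr_gt0.
have NE : `|X| * `|L| = (1 - sg) * `|A| by rewrite -normrM LE normrM ger0_norm // subr_ge0 ltW.
have sg2 : 1 <= 2 * (1 - sg).
  have h : `|X| = (1 - sg) * `|e.1 - o.1| by rewrite -XE normrM ger0_norm // subr_ge0 ltW.
  rewrite -/X in eo; have e0 : 0 < `|e.1 - o.1|.
    by rewrite lt_def normr_ge0 andbT; apply/eqP => z; rewrite z mulr0 in h; rlra.
  have : `|e.1 - o.1| * 1 <= `|e.1 - o.1| * (2 * (1 - sg)) by rlra.
  by rewrite ler_pM2l.
pose k := (e.2 - a.2) / X; have kX : k * X = e.2 - a.2 by rewrite /k divfK.
pose x0 := a.1 + Num.min 0 (X / 2); pose x1 := x0 + `|X| / 2.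
have x10 : x1 - x0 = `|X| / 2 by rewrite /x1 addrC addKr.
exists x0, x1, k, (a.2 - k * a.1 + Num.min 0 (L / 2)), (`|L| / 2); split.
- by rewrite -subr_ge0 x10 divr_ge0.
- by rewrite divr_ge0.
- move=> z [z1 z2]; pose t := 2 * (z.1 - a.1) / X; pose s := 2 * (z.2 - a.2 - k * (z.1 - a.1)) / L.
  have tX : t * X = 2 * (z.1 - a.1) by rewrite /t divfK.
  have sL : s * L = 2 * (z.2 - a.2 - k * (z.1 - a.1)) by rewrite /s divfK.
  have t01 : 0 < t < 1.
    apply: half_ratio X0 _; move: z1; rewrite /x1 /x0; move: (Num.min _ _) (`|X|) => y N'.
    by clear => /andP[h1 h2]; apply/andP; split; rlra.
  have s01 : 0 < s < 1.
    apply: half_ratio L0 _; move: z2; move: (Num.min _ _) (`|L|) => y N'.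
    by clear => /andP[h1 h2]; apply/andP; split; rlra.
  have s_sg : 0 <= s * sg by apply: mulr_ge0 => //; case/andP: s01 => /ltW.
  have s_sg' : 0 < s * (1 - sg) by apply: mulr_gt0; [case/andP: s01|rewrite subr_gt0].
  exists (1 - s / 2 - t / 2), (s * sg / 2 + t / 2), (s * (1 - sg) / 2); split.
  - clear -s01 t01 s_sg; rlra.
  - clear -s01 t01 s_sg; rlra.
  - clear -s_sg'; rlra.
  - ring.
  have e1 : z.1 = a.1 + t * X / 2 by rlra.
  have e2 : z.2 = a.2 + s * L / 2 + k * (t * X) / 2.
    by rewrite tX sL; field.
  apply: injective_projections; rewrite /= /GRing.scale /=.
    by rewrite e1 -aE /X -aE; field.
  rewrite e2 (_ : k * (t * X) = t * (e.2 - a.2)); last by rewrite -kX; ring.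
  by rewrite /L /m /= /GRing.scale /=; field.
- rewrite x10; have -> : `|L| / 2 * (`|X| / 2) = `|X| * `|L| / 4 by field.
  rewrite NE; have := normr_ge0 A; nra.
Qed.

(** [a] has the middle abscissa; the vertex horizontally farther from it is taken as [e]. *)
Lemma shear_median a b c : b.1 <= a.1 -> a.1 <= c.1 -> 0 < `|cross (b - a) (c - a)| ->
  exists x0 x1 k al l, [/\ x0 <= x1, 0 <= l, shear x0 x1 k al l `<=` btri a b c &
    `|cross (b - a) (c - a)| / 8 <= l * (x1 - x0)].
Proof.
move=> ba ac; rewrite normr_gt0 => A0.
have bc : b.1 < c.1.
  rewrite lt_neqAle (le_trans ba ac) andbT; apply/eqP => E; move/eqP: A0; apply.
  have e1 : b.1 = a.1 by rlra. have e2 : c.1 = a.1 by rlra.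
  by rewrite /cross /= e1 e2 subrr !mul0r mulr0 subrr.
have D0 : 0 < c.1 - b.1 by rewrite subr_gt0.
have Dn : c.1 - b.1 != 0 by rewrite gt_eqF.
have cE : cross (c - a) (b - a) = - cross (b - a) (c - a) by rewrite /cross; ring.
have [h|h] := leP (a.1 - b.1) (c.1 - a.1).
  have [|||//|x0 [x1 [k [al [l [h1 h2 h3 h4]]]]]] := @shear_core a c b ((a.1 - b.1) / (c.1 - b.1)).
  - by rewrite divr_ge0 ?ltr_pdivrMr //; rlra.
  - by field.
  - by rewrite !ger0_norm; rlra.
  - by rewrite cE oppr_eq0.
  exists x0, x1, k, al, l; split => //; last by rewrite cE normrN in h4.
  by apply: subset_trans h3 _; exact: btri_perm2.
have [|||//|x0 [x1 [k [al [l [h1 h2 h3 h4]]]]]] := @shear_core a b c ((c.1 - a.1) / (c.1 - b.1)).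
- by rewrite divr_ge0 ?ltr_pdivrMr //; rlra.
- by field.
- rewrite distrC ger0_norm; last rlra. by rewrite distrC ger0_norm; rlra.
by exists x0, x1, k, al, l; split.
Qed.

Lemma triangle_shear a b c : 0 < cross (b - a) (c - a) ->
  exists x0 x1 k al l, [/\ x0 <= x1, 0 <= l, shear x0 x1 k al l `<=` otri a b c &
    cross (b - a) (c - a) / 8 <= l * (x1 - x0)].
Proof.
move=> A0; set A := cross _ _ in A0 *.
have T := btri_otri A0.
have nb : `|cross (a - b) (c - b)| = A.
  by rewrite -(gtr0_norm A0) -normrN; congr `|_|; rewrite /A /cross /=; ring.
have nc : `|cross (a - c) (b - c)| = A.
  by rewrite -(gtr0_norm A0); congr `|_|; rewrite /A /cross /=; ring.
have na : `|cross (b - a) (c - a)| = A by exact: gtr0_norm.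
have na' : `|cross (c - a) (b - a)| = A.
  by rewrite -(gtr0_norm A0) -normrN; congr `|_|; rewrite /A /cross /=; ring.
have nb' : `|cross (c - b) (a - b)| = A.
  by rewrite -(gtr0_norm A0); congr `|_|; rewrite /A /cross /=; ring.
have nc' : `|cross (b - c) (a - c)| = A.
  by rewrite -(gtr0_norm A0) -normrN; congr `|_|; rewrite /A /cross /=; ring.
have fin u v w : btri u v w `<=` btri a b c -> u.1 >= v.1 -> u.1 <= w.1 ->
    `|cross (v - u) (w - u)| = A ->
    exists x0 x1 k al l, [/\ x0 <= x1, 0 <= l, shear x0 x1 k al l `<=` otri a b c &
      A / 8 <= l * (x1 - x0)].
  move=> S h1 h2 E.
  have [|x0 [x1 [k [al [l [g1 g2 g3 g4]]]]]] := shear_median h1 h2; first by rewrite E.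
  rewrite E in g4; exists x0, x1, k, al, l; split => //.
  by apply: subset_trans g3 _; apply: subset_trans S T.
have s1 := @btri_perm1; have s2 := @btri_perm2.
have S2 : btri b a c `<=` btri a b c by exact: s1.
have S3 : btri a c b `<=` btri a b c by exact: s2.
have S4 : btri b c a `<=` btri a b c by apply: subset_trans S2; exact: s2.
have S5 : btri c a b `<=` btri a b c by apply: subset_trans S3; exact: s1.
have S6 : btri c b a `<=` btri a b c by apply: subset_trans S4; exact: s1.
have [ab|/ltW ab] := leP a.1 b.1; have [bc|/ltW bc] := leP b.1 c.1; have [ac|/ltW ac] := leP a.1 c.1.
- exact: (fin b a c).
- exact: (fin b a c).
- exact: (fin c a b).
- exact: (fin a c b).
- exact: (fin a b c).
- exact: (fin c b a).
- exact: (fin b c a).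
- exact: (fin b c a).
Qed.

Section Graph.
Variable G : orthodiagonal_map R.
Notation V := (primal_vertex G).
Notation W := (dual_vertex G).
Notation pp := (@ppos R G).
Notation dp := (@dpos R G).

Definition qarea (x y : V) (w1 w2 : W) : R := cross (pp y - pp x) (dp w2 - dp w1).

Let tup : finType := (V * V * W * W)%type.
Let pt (t : tup) : bool := posq t.1.1.1 t.1.1.2 t.1.2 t.2.
Let ar (t : tup) : R := qarea t.1.1.1 t.1.1.2 t.1.2 t.2.

(** A large triangle has at least half of [qarea] as cross product, and the parallelogram in it at
    least 1/8 of that. Faces are disjoint and lie in a square of area [4 D^2], whence [64 D^2] when
    each face is listed once, as the order of [enum_rank] arranges, and twice this for both
    listings. *)
Lemma qarea_sum (c : R * R) (D : R) :
  (forall p, hat_domain G p -> `|p.1 - c.1| <= D /\ `|p.2 - c.2| <= D) ->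
  \sum_(t : tup | pt t) ar t <= 128 * D ^+ 2.
Proof.
move=> HD.
pose lt (t : tup) := (enum_rank t.1.1.1 < enum_rank t.1.1.2)%N.
have split2 : \sum_(t : tup | pt t) ar t = 2 * \sum_(t : tup | pt t && lt t) ar t.
  rewrite (bigID lt) /= mulr2n mulrDl !mul1r; congr (_ + _).
  pose rv (t : tup) : tup := (t.1.1.2, t.1.1.1, t.2, t.1.2).
  have rvK : involutive rv by case=> [[[x y] w1] w2].
  rewrite (reindex_inj (inv_inj rvK)) /=.
  apply: eq_big => -[[[x y] w1] w2]; rewrite /pt /lt /ar /=.
    rewrite posqC -leqNgt; case: (boolP (posq _ _ _ _)) => //= q.
    have [xy _ _] := posq_edge q; rewrite leq_eqVlt [X in X || _](_ : _ = false) //.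
    by apply/negbTE; apply: contra xy => /eqP/val_inj/enum_rank_inj ->.
  by move=> _; rewrite /qarea /cross /=; ring.
have ch (t : tup) : exists S : set (TR * TR), measurable S /\ (pt t ->
    (exists2 F, pquad F t.1.1.1 t.1.1.2 t.1.2 t.2 & S `<=` F) /\ ((ar t / 16)%:E <= area2 S)%E).
  have [/asboolP[F Q]|np] := boolP (pt t); last by exists set0; split; rewrite ?measurable0.
  have [a [b [c' [T h]]]] := big_triangle Q.
  have [_ _ A0] := Q.
  have [|x0 [x1 [k [al [l [h1 h2 h3 h4]]]]]] := @triangle_shear a b c'; first by apply: lt_le_trans h; rewrite divr_gt0.
  exists (shear x0 x1 k al l); split; first exact: measurable_shear.
  move=> _; split; first by exists F => //; exact: subset_trans h3 T.
  rewrite area_shear // lee_fin; apply: le_trans h4.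
  by move: h; rewrite /ar /qarea; rlra.
have [S HS] := choice ch.
pose B : set (TR * TR) := `[c.1 - `|D|, c.1 + `|D|]%classic `*` `[c.2 - `|D|, c.2 + `|D|]%classic.
have itvE (u : R) : lebesgue_measure (`[u - `|D|, u + `|D|]%classic : set TR) = (2 * `|D|)%:E.
  rewrite lebesgue_measure_itv /= lte_fin -EFinB; have nD := normr_ge0 D.
  by case: ifPn => h; congr EFin; rlra.
have mB1 (u v : R) : measurable (`[u, v]%classic : set TR) by exact: measurable_itv.
have aB : area2 B = (4 * D ^+ 2)%:E.
  have := product_measure1E (@lebesgue_measure R) (@lebesgue_measure R)
    (mB1 (c.1 - `|D|) (c.1 + `|D|)) (mB1 (c.2 - `|D|) (c.2 + `|D|)).
  move=> E; apply: (etrans E); rewrite [X in (X * _)%E](itvE c.1) [X in (_ * X)%E](itvE c.2).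
  by rewrite -EFinM; congr EFin; rewrite -[D ^+ 2]real_normK ?num_real //; ring.
pose s := [seq t <- index_enum tup | pt t && lt t].
have sP t : t \in s -> pt t /\ lt t by rewrite mem_filter => /andP[/andP[]].
have : (\sum_(t <- s) area2 (S t) <= area2 B)%E.
  apply: (@sum_measure_le _ _ _ area2).
  - by rewrite filter_uniq // index_enum_uniq.
  - exact: measurableX.
  - by move=> t; have [] := HS t.
  - move=> t /sP[p _]; have [_ /(_ p)[[F Q SF] _]] := HS t.
    move=> z /SF Fz; have [iF _ _] := Q; have [z1 z2] := HD z (inner_face_hat iF Fz).
    have nD := ler_norm D.
    by split; rewrite /= in_itv /= -ler_distl; [rewrite distrC|rewrite distrC]; apply: le_trans nD; rewrite distrC.
  - move=> t t' /sP[p l] /sP[p' l'] [z [Sz Sz']].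
    have [_ /(_ p)[[F Q SF] _]] := HS t; have [_ /(_ p')[[F' Q' SF'] _]] := HS t'.
    have [iF q A0] := Q; have [iF' q' A0'] := Q'.
    have E : F = F' by apply: (inner_face_eq iF iF'); exists z; split; [exact: SF|exact: SF'].
    rewrite -E in q'.
    have [v1 v2 u1 u2] := quad_vertices q'.
    have := quad_vertex (u := inl t'.1.1.1) q v1; have := quad_vertex (u := inl t'.1.1.2) q v2.
    have := quad_vertex (u := inr t'.1.2) q u1; have := quad_vertex (u := inr t'.2) q u2.
    have [n1 n2 _ _] := q'.
    move: t t' p l p' l' Sz Sz' Q SF Q' SF' q q' A0 A0' v1 v2 u1 u2 n1 n2.
    move=> [[[x y] w1] w2] [[[x' y'] w1'] w2'] /= _ l _ l' _ _ _ _ _ _ _ _ A0 A0' _ _ _ _ n1 n2.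
    rewrite /lt /= in l l'.
    move=> [//|//|[E4]|[E4]] [//|//|[E3]|[E3]] [[E2]|[E2]|//|//] [[E1]|[E1]|//|//]; subst; try (by case: n1); try (by case: n2); try done;
    exfalso; first [by rewrite ltnNge ltnW in l'|by move: A0 A0'; rewrite /cross /=; rlra].
rewrite aB => le1.
have : (\sum_(t <- s) (ar t / 16)%:E <= (4 * D ^+ 2)%:E)%E.
  apply: le_trans le1; rewrite big_seq [leRHS]big_seq; apply: lee_sum => t /sP[p _].
  by have [_ /(_ p)[]] := HS t.
rewrite sumEFin lee_fin /s big_filter -mulr_suml split2; rlra.
Qed.

End Graph.
End Area.

(** * The primal network *)

Section Network.
Context {R : realType}.
Variable G : orthodiagonal_map R.
Notation V := (primal_vertex G).
Notation W := (dual_vertex G).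
Implicit Types (x y v u : V) (w : W) (f : V -> R).
Notation pp := (@ppos R G).
Notation dp := (@dpos R G).

Definition cq x y w1 w2 : R := nrm (dp w2 - dp w1) / nrm (pp y - pp x).

Lemma pp_dist x y : x != y -> 0 < nrm (pp y - pp x).
Proof.
move=> /eqP xy; rewrite lt_def nrm_ge0 andbT; apply/eqP => /nrm_eq0/eqP; rewrite subr_eq0 => /eqP E.
by apply: xy; have /= [] := @pos_inj R G (inl y) (inl x) E.
Qed.

Lemma dp_dist w1 w2 : w1 != w2 -> 0 < nrm (dp w2 - dp w1).
Proof.
move=> /eqP xy; rewrite lt_def nrm_ge0 andbT; apply/eqP => /nrm_eq0/eqP; rewrite subr_eq0 => /eqP E.
by apply: xy; have /= [] := @pos_inj R G (inr w2) (inr w1) E.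
Qed.

Lemma cq_gt0 x y w1 w2 : posq x y w1 w2 -> 0 < cq x y w1 w2.
Proof. by move=> /posq_edge[xy ww _]; rewrite divr_gt0 ?pp_dist ?dp_dist. Qed.

Lemma cqC x y w1 w2 : cq y x w2 w1 = cq x y w1 w2.
Proof. by rewrite /cq (nrmC (dp w1)) (nrmC (pp x)). Qed.

Lemma qarea_nrm x y w1 w2 : posq x y w1 w2 ->
  qarea x y w1 w2 = nrm (pp y - pp x) * nrm (dp w2 - dp w1).
Proof.
move=> /posq_cross[c0 d0]; have := lagrange2 (pp y - pp x) (dp w2 - dp w1).
rewrite d0 expr0n /= add0r => /eqP; rewrite eqrXn2 //; first by move/eqP.
  exact: ltW.
exact: nrmM_ge0.
Qed.

(** Orthogonality and positive orientation make the dual diagonal the primal one turned by a right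
    angle and scaled by the conductance. *)
Lemma dual_edge x y w1 w2 : posq x y w1 w2 ->
  (dp w2).1 - (dp w1).1 = - cq x y w1 w2 * ((pp y).2 - (pp x).2) /\
  (dp w2).2 - (dp w1).2 = cq x y w1 w2 * ((pp y).1 - (pp x).1).
Proof.
move=> q; have A := qarea_nrm q; have [_ D] := posq_cross q; have [xy _ _] := posq_edge q.
have N0 := pp_dist xy; have N2 := nrm_sqr (pp y - pp x).
have cE : cq x y w1 w2 = qarea x y w1 w2 / nrm (pp y - pp x) ^+ 2.
  by rewrite A /cq expr2; field; rewrite gt_eqF.
have Nn : nrm (pp y - pp x) ^+ 2 != 0 by rewrite expf_neq0 // gt_eqF.
rewrite cE; split; apply: (mulIf Nn).
  rewrite mulNr mulrAC mulNr divfK // N2; move: D; rewrite /qarea /cross /dot2 /=.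
  set a := (dp w2).1 - _; set b := (dp w2).2 - _; set c := (pp y).1 - _; set d := (pp y).2 - _ => D.
  have D' : c * a = - (d * b) by rlra.
  rewrite (_ : a * (c ^+ 2 + d ^+ 2) = (c * a) * c + d * a * d); last by ring.
  by rewrite D'; ring.
rewrite mulrAC divfK // N2; move: D; rewrite /qarea /cross /dot2 /=.
set a := (dp w2).1 - _; set b := (dp w2).2 - _; set c := (pp y).1 - _; set d := (pp y).2 - _ => D.
have D' : d * b = - (c * a) by rlra.
rewrite (_ : b * (c ^+ 2 + d ^+ 2) = b * c * c + (d * b) * d); last by ring.
by rewrite D'; ring.
Qed.

Definition qsum x (F : V -> W -> W -> R) : R :=
  \sum_(y : V) \sum_(w1 : W) \sum_(w2 : W | posq x y w1 w2) F y w1 w2.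

Lemma eq_qsum x F1 F2 : (forall y w1 w2, posq x y w1 w2 -> F1 y w1 w2 = F2 y w1 w2) ->
  qsum x F1 = qsum x F2.
Proof. by move=> H; apply: eq_bigr => y _; apply: eq_bigr => w1 _; apply: eq_bigr => w2; exact: H. Qed.

Lemma qsumD x F1 F2 : qsum x (fun y w1 w2 => F1 y w1 w2 + F2 y w1 w2) = qsum x F1 + qsum x F2.
Proof.
rewrite /qsum -big_split; apply: eq_bigr => y _; rewrite -big_split; apply: eq_bigr => w1 _.
by rewrite -big_split.
Qed.

Lemma qsumZ x (k : R) F : qsum x (fun y w1 w2 => k * F y w1 w2) = k * qsum x F.
Proof.
rewrite /qsum mulr_sumr; apply: eq_bigr => y _; rewrite mulr_sumr; apply: eq_bigr => w1 _.
by rewrite mulr_sumr.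
Qed.

Lemma ler_qsum x F1 F2 : (forall y w1 w2, posq x y w1 w2 -> F1 y w1 w2 <= F2 y w1 w2) ->
  qsum x F1 <= qsum x F2.
Proof. by move=> H; apply: ler_sum => y _; apply: ler_sum => w1 _; apply: ler_sum => w2; exact: H. Qed.

Lemma qsum_gt0 x F y w1 w2 : posq x y w1 w2 -> (forall y w1 w2, posq x y w1 w2 -> 0 <= F y w1 w2) ->
  0 < F y w1 w2 -> 0 < qsum x F.
Proof.
move=> q F0 Fp; apply: lt_le_trans Fp _.
rewrite /qsum (bigD1 y) //= (bigD1 w1) //= (bigD1 w2) //= -!addrA lerDl.
apply: addr_ge0; first by apply: sumr_ge0 => i /andP[qi _]; exact: F0.
apply: addr_ge0; first by apply: sumr_ge0 => i _; apply: sumr_ge0 => j qj; exact: F0.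
by apply: sumr_ge0 => i _; apply: sumr_ge0 => j _; apply: sumr_ge0 => k qk; exact: F0.
Qed.

(** Of the two listings of the dual vertices of a face exactly one is positively oriented, which
    uses up the factor 1/2. *)
Lemma conductanceE x y : conductance x y = \sum_(w1 : W) \sum_(w2 : W | posq x y w1 w2) cq x y w1 w2.
Proof.
pose c w1 w2 : R := cq x y w1 w2.
have cc w1 w2 : c w2 w1 = c w1 w2 by rewrite /c /cq nrmC.
have iqE w1 w2 : `[< inner_quad x y w1 w2 >] = posq x y w1 w2 || posq x y w2 w1.
  apply/asboolP/orP.
    move=> [F iF Q]; have := quad_cross_neq0 iF Q; rewrite neq_lt => /orP[h|h].
      right; apply/asboolP; exists F; split => //; first exact: quad_face_swap.
      by move: h; rewrite /cross /=; rlra.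
    by left; apply/asboolP; exists F.
  move=> [] /asboolP[F [iF Q _]]; exists F => //.
  exact: quad_face_swap.
have ex w1 w2 : ~~ (posq x y w1 w2 && posq x y w2 w1).
  by apply/negP => /andP[/posq_cross[h _] /posq_cross[h' _]]; move: h h'; rewrite /cross /=; rlra.
have E w1 : \sum_(w2 : W | `[< inner_quad x y w1 w2 >]) dist2 (dp w1) (dp w2) / dist2 (pp x) (pp y) =
    \sum_(w2 | posq x y w1 w2) c w1 w2 + \sum_(w2 | posq x y w2 w1) c w1 w2.
  rewrite big_mkcond [X in _ = X + _]big_mkcond [X in _ = _ + X]big_mkcond -big_split.
  apply: eq_bigr => w2 _ /=; rewrite iqE; have := ex w1 w2.
  have -> : dist2 (dp w1) (dp w2) / dist2 (pp x) (pp y) = c w1 w2.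
    by rewrite !nrm_dist2 /c /cq nrmC (nrmC (pp x)).
  by case: (posq x y w1 w2); case: (posq x y w2 w1) => //= _; rewrite ?addr0 ?add0r.
rewrite /conductance; under eq_bigr do rewrite E.
rewrite big_split /=.
have -> : \sum_w1 \sum_(w2 | posq x y w2 w1) c w1 w2 = \sum_w1 \sum_(w2 | posq x y w1 w2) c w1 w2.
  under eq_bigr do rewrite big_mkcond.
  rewrite exchange_big /=; apply: eq_bigr => w1 _; rewrite [RHS]big_mkcond; apply: eq_bigr => w2 _.
  by rewrite cc.
rewrite -[X in _ * (X + _)]mul1r -[X in _ * (_ + X)]mul1r -mulrDl mulrA.
by rewrite (_ : 2^-1 * (1 + 1) = 1) ?mul1r //; field.
Qed.

Lemma conductance_ge0 x y : 0 <= conductance x y.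
Proof.
rewrite conductanceE; apply: sumr_ge0 => w1 _; apply: sumr_ge0 => w2 q.
exact/ltW/cq_gt0.
Qed.

Lemma dlaplacianE f x : dlaplacian f x = qsum x (fun y w1 w2 => cq x y w1 w2 * (f y - f x)).
Proof.
apply: eq_bigr => y _; rewrite conductanceE mulr_suml; apply: eq_bigr => w1 _.
by rewrite mulr_suml.
Qed.

Lemma posq_exists x : exists y w1 w2, posq x y w1 w2.
Proof.
have [w e] := has_edge x; have [F [y [w' Q]]] := edge_inner e.
by case: Q => Q; [exists y, w, w'|exists y, w', w]; apply/asboolP; exists F.
Qed.

Lemma total_conductance_gt0 x : 0 < \sum_(y : V) conductance x y.
Proof.
have [y [w1 [w2 q]]] := posq_exists x.
have -> : \sum_(y : V) conductance x y = qsum x (fun y w1 w2 => cq x y w1 w2).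
  by apply: eq_bigr => z _; exact: conductanceE.
apply: (qsum_gt0 q); last exact: cq_gt0.
by move=> *; exact/ltW/cq_gt0.
Qed.

(* Around an interior vertex each incident edge occurs once as first and once as second edge
   of a positively oriented quadrilateral. *)
Lemma qsum_telescope x (phi : W -> R) : ~ bdry x -> qsum x (fun _ w1 w2 => phi w2 - phi w1) = 0.
Proof.
move=> nb.
have S1 : qsum x (fun _ w1 _ => phi w1) = \sum_(w | edge x w) phi w.
  rewrite /qsum exchange_big /= [RHS]big_mkcond; apply: eq_bigr => w1 _.
  rewrite pair_big_dep /=; case: ifP => e.
    have [y [w2 q]] := posq_exists1 nb e.
    rewrite (big_pred1 (y, w2)) // => -[y' w2'] /=.
    apply/idP/eqP => [q'|[-> ->]//].
    by have [-> ->] := posq_unique1 q q'.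
  rewrite big_pred0 // => -[y' w2'] /=; apply/negP => /posq_edge[_ _ [e' _ _ _]].
  by rewrite e' in e.
have S2 : qsum x (fun _ _ w2 => phi w2) = \sum_(w | edge x w) phi w.
  rewrite /qsum; under eq_bigr => y _ do (under eq_bigr => w1 _ do rewrite big_mkcond; rewrite exchange_big /=).
  rewrite exchange_big /= [RHS]big_mkcond; apply: eq_bigr => w2 _.
  under eq_bigr => y _ do rewrite -big_mkcond /=.
  rewrite pair_big_dep /=; case: ifP => e.
    have [y [w1 q]] := posq_exists2 nb e.
    rewrite (big_pred1 (y, w1)) // => -[y' w1'] /=.
    apply/idP/eqP => [q'|[-> ->]//].
    by have [-> ->] := posq_unique2 q q'.
  rewrite big_pred0 // => -[y' w1'] /=; apply/negP => /posq_edge[_ _ [_ _ _ e']].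
  by rewrite e' in e.
have := qsumD x (fun _ _ w2 => phi w2) (fun _ w1 _ => -1 * phi w1).
rewrite qsumZ S1 S2 mulN1r subrr => <-; apply: eq_qsum => y w1 w2 _; by rewrite mulN1r.
Qed.

(** By [dual_edge] the flow of the first coordinate is the increment of the second coordinate along
    the dual edges, and these increments telescope. *)
Lemma dlaplacian_coord1 x : ~ bdry x -> dlaplacian (fun v => (pp v).1) x = 0.
Proof.
move=> nb; rewrite dlaplacianE -(qsum_telescope (fun w => (dp w).2) nb); apply: eq_qsum => y w1 w2 q.
by have [_ ->] := dual_edge q.
Qed.

Lemma dlaplacian_coord2 x : ~ bdry x -> dlaplacian (fun v => (pp v).2) x = 0.
Proof.
move=> nb; rewrite dlaplacianE; have := qsum_telescope (fun w => - (dp w).1) nb => <-.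
apply: eq_qsum => y w1 w2 q; have [E _] := dual_edge q; rewrite -opprD E; ring.
Qed.

Lemma dlaplacianD f1 f2 x : dlaplacian (fun v => f1 v + f2 v) x = dlaplacian f1 x + dlaplacian f2 x.
Proof. by rewrite /dlaplacian -big_split; apply: eq_bigr => y _ /=; ring. Qed.

Lemma dlaplacianZ (k : R) f x : dlaplacian (fun v => k * f v) x = k * dlaplacian f x.
Proof. by rewrite /dlaplacian mulr_sumr; apply: eq_bigr => y _ /=; ring. Qed.

Lemma dlaplacian_cst (k : R) x : dlaplacian (fun=> k) x = 0.
Proof. by rewrite /dlaplacian big1 // => y _; rewrite subrr mulr0. Qed.

(** Since the coordinates are harmonic, [|v|^2] may be replaced by [|v - x|^2], whose Laplacian at
    [x] is a sum of positive terms. *)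
Lemma dlaplacian_sqr x : ~ bdry x ->
  0 < dlaplacian (fun v => (pp v).1 ^+ 2 + (pp v).2 ^+ 2) x.
Proof.
move=> nb; have [y0 [w10 [w20 q0]]] := posq_exists x.
have -> : dlaplacian (fun v => (pp v).1 ^+ 2 + (pp v).2 ^+ 2) x =
    qsum x (fun y w1 w2 => cq x y w1 w2 * nrm (pp y - pp x) ^+ 2).
  have E : qsum x (fun y w1 w2 => cq x y w1 w2 * nrm (pp y - pp x) ^+ 2) =
     dlaplacian (fun v => (pp v).1 ^+ 2 + (pp v).2 ^+ 2 +
       (- (2 * (pp x).1) * (pp v).1 + - (2 * (pp x).2) * (pp v).2)) x.
    by rewrite dlaplacianE; apply: eq_qsum => y w1 w2 _; rewrite nrm_sqr /=; ring.
  have L : dlaplacian (fun v => - (2 * (pp x).1) * (pp v).1 + - (2 * (pp x).2) * (pp v).2) x = 0.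
    rewrite (dlaplacianD (fun v => - (2 * (pp x).1) * (pp v).1) (fun v => - (2 * (pp x).2) * (pp v).2)).
    rewrite (dlaplacianZ _ (fun v => (pp v).1)) (dlaplacianZ _ (fun v => (pp v).2)).
    by rewrite dlaplacian_coord1 // dlaplacian_coord2 // !mulr0 addr0.
  rewrite E (dlaplacianD (fun v => (pp v).1 ^+ 2 + (pp v).2 ^+ 2)
    (fun v => - (2 * (pp x).1) * (pp v).1 + - (2 * (pp x).2) * (pp v).2)).
  by rewrite L addr0.
have P y w1 w2 : posq x y w1 w2 -> 0 < cq x y w1 w2 * nrm (pp y - pp x) ^+ 2.
  by move=> q; rewrite mulr_gt0 ?cq_gt0 // exprn_gt0 // pp_dist //; have [] := posq_edge q.
apply: (qsum_gt0 q0); last exact: P.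
by move=> y w1 w2 q; exact/ltW/P.
Qed.

(** A small multiple of the strictly subharmonic [|v|^2] makes an interior maximum impossible at
    once, without propagating equality through the network. *)
Lemma discrete_max_principle f (M : R) : (forall x, ~ bdry x -> 0 <= dlaplacian f x) ->
  (forall x, bdry x -> f x <= M) -> forall x, f x <= M.
Proof.
move=> sub bM x0.
pose sq v : R := (pp v).1 ^+ 2 + (pp v).2 ^+ 2.
have sq0 v : 0 <= sq v by rewrite addr_ge0 // sqr_ge0.
pose B := \sum_v sq v + 1.
have B0 : 0 < B by rewrite ltr_wpDl // sumr_ge0.
have sqB v : sq v <= B.
  by rewrite /B (bigD1 v) //= -addrA lerDl addr_ge0 // sumr_ge0.
apply/ler_addgt0Pr => e e0; pose d := e / B; have d0 : 0 < d by rewrite divr_gt0.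
have dB : d * B = e by rewrite /d divfK // gt_eqF.
pose g v := f v + d * sq v.
pose xm := [arg max_(v > x0) g v]%O.
have Hm v : g v <= g xm by rewrite /xm; case: arg_maxP => // m _; apply.
have bx : bdry xm.
  apply: contrapT => nb; have h := sub xm nb; have := dlaplacian_sqr nb; rewrite -/sq => h2.
  have : dlaplacian g xm <= 0.
    rewrite /dlaplacian -oppr_ge0 -sumrN; apply: sumr_ge0 => y _.
    by rewrite -mulrN mulr_ge0 ?conductance_ge0 // oppr_ge0 subr_le0.
  by rewrite /g dlaplacianD dlaplacianZ; have := mulr_gt0 d0 h2; rlra.
have := Hm x0; have := bM xm bx; have := mulr_ge0 (ltW d0) (sq0 x0).
have : d * sq xm <= e by rewrite -dB ler_pM2l.
rewrite /g; rlra.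
Qed.

Lemma discrete_comparison f F : (forall x, ~ bdry x -> dlaplacian f x = 0) ->
  (forall x, ~ bdry x -> dlaplacian F x = 0) ->
  (forall x, bdry x -> f x <= F x) -> forall x, f x <= F x.
Proof.
move=> hf hF b x; rewrite -subr_le0.
have -> : f x - F x = f x + -1 * F x by rewrite mulN1r.
apply: (@discrete_max_principle (fun v => f v + -1 * F v)) => v.
  by move=> nb; rewrite dlaplacianD dlaplacianZ hf // hF // mulr0 addr0.
by move=> /b; rewrite mulN1r subr_le0.
Qed.

End Network.

(** * Hitting probabilities of the random walk *)

Section Hitting.
Context {R : realType}.
Variable G : orthodiagonal_map R.
Notation V := (primal_vertex G).
Implicit Types (x y v u : V).

Lemma step_prob_ge0 x y : 0 <= step_prob x y.
Proof. by rewrite divr_ge0 ?conductance_ge0 // ltW // total_conductance_gt0. Qed.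

Lemma step_prob_sum x : \sum_y step_prob x y = 1.
Proof. by rewrite -mulr_suml divff // gt_eqF // total_conductance_gt0. Qed.

Lemma step_harmonic (f : V -> R) x : f x = \sum_y step_prob x y * f y -> dlaplacian f x = 0.
Proof.
move=> E; have T0 := total_conductance_gt0 x; set T := \sum_(y : V) _ in T0.
have : \sum_y conductance x y * f y = T * f x.
  rewrite E mulr_sumr; apply: eq_bigr => y _; rewrite /step_prob -/T.
  by field; rewrite gt_eqF.
have : \sum_y conductance x y * f x = T * f x by rewrite -mulr_suml.
move=> E1 E2; have : dlaplacian f x = \sum_y conductance x y * f y - \sum_y conductance x y * f x.
  by rewrite -sumrB; apply: eq_bigr => y _; ring.
by rewrite E1 E2 subrr.
Qed.

Variable A : pred V.

(* Probability of having hit the boundary, in [A], within [N] steps. *)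
Fixpoint hit_within (N : nat) x : R :=
  if `[< bdry x >] then (A x)%:R else
  if N is N'.+1 then \sum_y step_prob x y * hit_within N' y else 0.

Lemma hit_within01 N x : 0 <= hit_within N x <= 1.
Proof.
elim: N x => [|N IH] x /=; case: ifP => _; try by case: (A x); rewrite ?lexx ?ler01.
apply/andP; split.
  by apply: sumr_ge0 => y _; rewrite mulr_ge0 ?step_prob_ge0 //; case/andP: (IH y).
rewrite -(step_prob_sum x); apply: ler_sum => y _.
by rewrite ler_piMr ?step_prob_ge0 //; case/andP: (IH y).
Qed.

Lemma hit_within_mono N x : hit_within N x <= hit_within N.+1 x.
Proof.
elim: N x => [|N IH] x; rewrite [leRHS]/=; rewrite /hit_within -/hit_within; case: ifP => _; [exact: lexx| |exact: lexx|].
  apply: sumr_ge0 => y _; rewrite mulr_ge0 ?step_prob_ge0 //.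
  by have /andP[] := hit_within01 0 y.
by apply: ler_sum => y _; rewrite ler_wpM2l ?step_prob_ge0 //; exact: IH.
Qed.

(** The limit of the increasing sequence [hit_within]; harmonicity is the limit of its one-step
    recursion. *)
Lemma hitting_function : exists h : V -> R, [/\ dharmonic h,
  forall x, bdry x -> h x = (A x)%:R &
  forall u B, (forall N, hit_within N u <= B) -> h u <= B].
Proof.
pose h x := limn (hit_within ^~ x).
have nd x : nondecreasing_seq (hit_within ^~ x).
  by apply/nondecreasing_seqP => N; exact: hit_within_mono.
have cv x : hit_within N x @[N --> \oo] --> h x.
  apply: nondecreasing_is_cvgn => //; exists 1 => _ [N _ <-].
  by have /andP[] := hit_within01 N x.
exists h; split.
- move=> x nb; apply: step_harmonic.
  have c1 : hit_within N.+1 x @[N --> \oo] --> h x by rewrite (cvg_shiftS (hit_within ^~ x)); exact: cv.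
  have c2 : hit_within N.+1 x @[N --> \oo] --> \sum_y step_prob x y * h y.
    have -> : (fun N => hit_within N.+1 x) = (fun N => \sum_y step_prob x y * hit_within N y).
      by apply/funext => N /=; case: asboolP.
    elim: (index_enum V) => [|y s IH].
      rewrite big_nil (_ : (fun N => _) = (fun=> 0)); first exact: cvg_cst.
      by apply/funext => N; rewrite big_nil.
    rewrite big_cons (_ : (fun N => _) = (fun N => step_prob x y * hit_within N y +
      \sum_(z <- s) step_prob x z * hit_within N z)); last by apply/funext => N; rewrite big_cons.
    by apply: cvgD => //; apply: cvgM; [exact: cvg_cst|exact: cv].
  exact: (cvg_unique _ c1 c2).
- move=> x bx; have : hit_within N x @[N --> \oo] --> ((A x)%:R : R).
    have -> : (fun N => hit_within N x) = (fun=> (A x)%:R).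
      by apply/funext => -[|N] /=; case: asboolP.
    exact: cvg_cst.
  exact: (cvg_unique _ (cv x)).
- move=> u B HB; have cu := cv u.
  by apply: limr_le; [apply/cvg_ex; exists (h u)|exact: nearW].
Qed.

Section Walk.
Variables (d : measure_display) (T : measurableType d) (P : probability T R).
Variables (u : V) (S : nat -> T -> V).
Hypothesis SRW : is_srw P u S.

Let mS n x : measurable [set t | S n t = x]. Proof. by case: SRW. Qed.

Let Ev (x : nat -> V) n := [set t | forall i, (i <= n)%N -> S i t = x i].
Let Hit n := [set t | exists k, (k <= n)%N /\ hits_at (S ^~ t) k /\ A (S k t)].

Let mEv (x : nat -> V) n : measurable (Ev x n).
Proof.
elim: n => [|n IH].
  rewrite (_ : Ev x 0 = [set t | S 0%N t = x 0%N]) //.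
  apply/seteqP; split=> t; first exact.
  by move=> h [|//] _.
rewrite (_ : Ev x n.+1 = Ev x n `&` [set t | S n.+1 t = x n.+1]); first exact: measurableI.
apply/seteqP; split=> t.
  by move=> h; split; [move=> i ni; apply: h; rewrite (leq_trans ni)|exact: h].
by move=> [h1 h2] i; rewrite leq_eqVlt => /predU1P[->//|]; rewrite ltnS; exact: h1.
Qed.

Let mSset n (B : pred V) : measurable [set t | B (S n t)].
Proof.
rewrite (_ : [set t | B (S n t)] = \bigcup_(x in [set x | B x]) [set t | S n t = x]).
  by apply: fin_bigcup_measurable => //; exact: finite_finset.
by apply/seteqP; split=> t; [move=> Bt; exists (S n t)|move=> [x Bx /= ->]].
Qed.

Let mhit k : measurable [set t | hits_at (S ^~ t) k /\ A (S k t)].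
Proof.
rewrite (_ : [set t | _] = [set t | (`[< bdry (S k t) >] && A (S k t))%B] `&`
   \bigcap_(m in [set m | (m < k)%N]) [set t | ~~ `[< bdry (S m t) >]]).
  apply: measurableI; first exact: (mSset k (fun x => `[< bdry x >] && A x)).
  by apply: bigcap_measurableType => m _; exact: (mSset m (fun x => ~~ `[< bdry x >])).
apply/seteqP; split=> t.
  move=> [[h1 h2] h3]; split; first by apply/andP; split => //; exact/asboolP.
  by move=> m mk; apply/asboolPn; exact: h2.
move=> [/andP[/asboolP h1 h3] h2]; split => //; split => // m mk.
by apply/asboolPn; exact: h2.
Qed.

Let mHit n : measurable (Hit n).
Proof.
rewrite (_ : Hit n = \bigcup_(k in [set k | (k <= n)%N]) [set t | hits_at (S ^~ t) k /\ A (S k t)]).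
  by apply: bigcup_measurable => k _; exact: mhit.
by apply/seteqP; split=> t [k]; [move=> [kn h]; exists k|move=> kn h; exists k].
Qed.

Let hit_now N n (x : nat -> V) t : bdry (x n) -> A (x n) -> (forall i, (i < n)%N -> ~ bdry (x i)) ->
  Ev x n t -> Hit (n + N) t.
Proof.
move=> bx Ax nb h; exists n; split; first exact: leq_addr.
have Sx := h n (leqnn n); split; last by rewrite Sx.
by split=> [|m mn]; [rewrite Sx|rewrite (h m (ltnW mn)); exact: nb].
Qed.

(** The law of the walk is known only through the probabilities of finite trajectories, so the
    induction fixes a prefix that has not yet met the boundary and splits according to its one-step
    extensions, which are disjoint events. *)
Lemma hit_prefix N n (x : nat -> V) : (forall i, (i < n)%N -> ~ bdry (x i)) ->
  (P (Ev x n) * (hit_within N (x n))%:E <= P (Ev x n `&` Hit (n + N)))%E.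
Proof.
elim: N n x => [|N IH] n x nb.
  rewrite /=; case: asboolP => [bx|_]; last by rewrite mule0.
  have [Ax|nA] := boolP (A (x n)); last by rewrite mule0.
  rewrite mule1 (_ : Ev x n `&` _ = Ev x n); first exact: lexx.
  by apply/seteqP; split=> [t []|t h]; [|split; [|exact: hit_now h]].
have [bx|nbx] := pselect (bdry (x n)).
  rewrite /=; case: asboolP => // _.
  have [Ax|nA] := boolP (A (x n)); last by rewrite mule0.
  rewrite mule1 (_ : Ev x n `&` _ = Ev x n); first exact: lexx.
  by apply/seteqP; split=> [t []|t h]; [|split; [|exact: hit_now h]].
pose xy y i := if i == n.+1 then y else x i.
have xyS y : xy y n.+1 = y by rewrite /xy eqxx.
have xyi y i : (i <= n)%N -> xy y i = x i by rewrite /xy; case: eqP => // ->; rewrite ltnn.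
have EvE y : Ev (xy y) n = Ev x n.
  by apply/seteqP; split=> t h i ni; have := h i ni; rewrite xyi.
have PE y : P (Ev (xy y) n.+1) = (P (Ev x n) * (step_prob (x n) y)%:E)%E.
  by have [_ _ /(_ n (xy y))] := SRW; rewrite -/(Ev (xy y) n.+1) -/(Ev (xy y) n) EvE xyS xyi.
have fP : P (Ev x n) \is a fin_num by exact: fin_num_measure.
rewrite /=; case: asboolP => // _.
apply: (@le_trans _ _ (\sum_(y <- index_enum V) P (Ev (xy y) n.+1 `&` Hit (n + N.+1)))%E).
  rewrite -(fineK fP) -EFinM mulr_sumr -sumEFin; apply: lee_sum => y _.
  rewrite mulrA EFinM EFinM fineK // -PE addnS -addSn.
  have := IH n.+1 (xy y); rewrite xyS; apply => i.
  rewrite ltnS => ni; rewrite (xyi y i ni).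
  by move: ni; rewrite leq_eqVlt => /predU1P[->//|]; exact: nb.
apply: sum_measure_le.
- exact: index_enum_uniq.
- exact: measurableI.
- by move=> y; exact: measurableI.
- move=> y _ t [h1 h2]; split => //; rewrite -(EvE y) => i ni; apply: h1.
  exact: leq_trans ni _.
- move=> y y' _ _ [t [[h1 _] [h2 _]]].
  by have := h1 n.+1 (leqnn _); rewrite h2 // !xyS.
Qed.

Lemma hit_within_le N : ((hit_within N u)%:E <= P [set t | exists n, hits_at (S ^~ t) n /\ A (S n t)])%E.
Proof.
have := @hit_prefix N 0 (fun=> u); rewrite add0n => H.
have P0 : P (Ev (fun=> u) 0) = 1%E.
  have [_ <- _] := SRW; congr (P _); apply/seteqP; split=> t; first exact.
  by move=> h [|//] _.
have n0 (i : nat) : (i < 0)%N -> ~ bdry u by [].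
have {}H := H n0.
rewrite P0 mul1e in H; apply: le_trans H _.
apply: le_measure; rewrite ?inE.
- exact: measurableI.
- rewrite (_ : [set t | _] = \bigcup_k [set t | hits_at (S ^~ t) k /\ A (S k t)]).
    by apply: bigcup_measurable => k _; exact: mhit.
  by apply/seteqP; split=> t [k]; [move=> h; exists k|move=> _ h; exists k].
- by move=> t [_ [k [_ h]]]; exists k.
Qed.

End Walk.
End Hitting.

(** * The uniform distribution on the unit interval *)

Section UniformSample.
Context {R : realType}.

Lemma measurable_unit_interval : measurable (`[0, 1[%classic : set (measurableTypeR R)).
Proof. exact: measurable_itv. Qed.

Definition unif01 : set (measurableTypeR R) -> \bar R :=
  mrestr (@lebesgue_measure R) measurable_unit_interval.

HB.instance Definition _ := Measure.on unif01.

Lemma unif01_setT : unif01 setT = 1%E.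
Proof.
have E : lebesgue_measure (`[0, 1[%classic : set (measurableTypeR R)) = 1%E.
  by rewrite lebesgue_measure_itv /= lte_fin ltr01 sube0.
by rewrite /unif01 /mrestr setTI; exact: E.
Qed.

HB.instance Definition _ := Measure_isProbability.Build _ _ _ unif01 unif01_setT.

Lemma unif01_itv (a b : R) : 0 <= a -> a <= b -> b <= 1 -> unif01 `[a, b[%classic = (b - a)%:E.
Proof.
move=> a0 ab b1.
have E : lebesgue_measure (`[a, b[%classic : set (measurableTypeR R)) = (b - a)%:E.
  rewrite lebesgue_measure_itv /= lte_fin -EFinB; case: ifPn => // h; congr EFin; rlra.
rewrite /unif01 /mrestr setIidl; first exact: E.
by move=> x /=; rewrite !in_itv /= => /andP[? ?]; rlra.
Qed.

Lemma unif01_eq (A B : set (measurableTypeR R)) :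
  (forall t : R, 0 <= t < 1 -> A t <-> B t) -> unif01 A = unif01 B.
Proof.
move=> H; rewrite /unif01 /mrestr; congr lebesgue_measure; apply/seteqP.
by split=> t [h]; rewrite /= in_itv /= => t01; split; rewrite ?in_itv //=; apply/(H t t01).
Qed.

End UniformSample.

(** * A random walk driven by one uniform variable *)

Section RandomWalk.
Context {R : realType}.
Variable G : orthodiagonal_map R.
Notation V := (primal_vertex G).
Implicit Types (x y v u : V).
Variable u : V.

Let e : seq V := enum V.
Let cum x (k : nat) : R := \sum_(0 <= j < k) step_prob x (nth u e j).

Let cumS x k : cum x k.+1 = cum x k + step_prob x (nth u e k).
Proof. by rewrite /cum big_nat_recr. Qed.

Let cum_le x k l : (k <= l)%N -> cum x k <= cum x l.
Proof.
elim: l => [|l IH]; first by rewrite leqn0 => /eqP ->.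
rewrite leq_eqVlt => /predU1P[->//|]; rewrite ltnS => /IH h; rewrite cumS.
by apply: le_trans h _; rewrite lerDl step_prob_ge0.
Qed.

Let cum_max x : cum x (size e) = 1.
Proof.
rewrite -(step_prob_sum x) /cum -(big_nth u xpredT (fun y => step_prob x y)) /e.
by rewrite big_enum.
Qed.

Let lo x y := cum x (index y e).
Let hi x y := cum x (index y e).+1.

Let hiE x y : hi x y = lo x y + step_prob x y.
Proof. by rewrite /hi cumS nth_index // mem_enum. Qed.

Let hi1 x y : hi x y <= 1.
Proof. by rewrite -(cum_max x); apply: cum_le; rewrite index_mem mem_enum. Qed.

Let lo0 x y : 0 <= lo x y. Proof. by apply: sumr_ge0 => j _; exact: step_prob_ge0. Qed.

(** A state consists of the current vertex and of the left end and length of the interval of samples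
    producing the trajectory so far. This interval is divided into consecutive slots with lengths
    proportional to the step probabilities; the slot containing [t] decides the next vertex. *)
Let slot (s : V * R * R) (t : R) (y : V) : bool :=
  (s.1.2 + s.2 * lo s.1.1 y <= t) && (t < s.1.2 + s.2 * hi s.1.1 y).

Let slot_unique s t y y' : 0 <= s.2 -> slot s t y -> slot s t y' -> y = y'.
Proof.
move=> s0 /andP[a1 a2] /andP[b1 b2].
have H z z' : s.1.2 + s.2 * lo s.1.1 z <= t -> t < s.1.2 + s.2 * hi s.1.1 z' ->
    (index z e <= index z' e)%N.
  move=> h1 h2; rewrite leqNgt; apply/negP => zz.
  have := ler_wpM2l s0 (cum_le s.1.1 zz); rewrite -/(hi s.1.1 z') -/(lo s.1.1 z); lra.
have E : index y e = index y' e by apply/eqP; rewrite eqn_leq (H _ _ a1 b2) (H _ _ b1 a2).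
by rewrite -(nth_index u (mem_enum V y : y \in e)) E nth_index // mem_enum.
Qed.

Let slot_exists s t : s.1.2 <= t < s.1.2 + s.2 -> exists y, slot s t y.
Proof.
move=> /andP[t1 t2].
have ex : exists k, t < s.1.2 + s.2 * cum s.1.1 k by exists (size e); rewrite cum_max mulr1.
case: (ex_minnP ex) => -[|k].
  by rewrite /cum big_geq // mulr0 addr0; lra.
move=> h mn; have kn : (k < size e)%N by apply: mn; rewrite cum_max mulr1.
exists (nth u e k); rewrite /slot /lo /hi index_uniq ?enum_uniq // h andbT leNgt.
by apply/negP => h'; have := mn _ h'; rewrite ltnn.
Qed.

Definition next_state (s : V * R * R) (t : R) : V * R * R :=
  let y := odflt s.1.1 [pick y | slot s t y] in
  (y, s.1.2 + s.2 * lo s.1.1 y, s.2 * step_prob s.1.1 y).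

Definition walk_state (n : nat) (t : R) : V * R * R := iter n (next_state ^~ t) (u, 0, 1).

(** The state reached along a prescribed trajectory. Its interval has the product of the step
    probabilities as length, and on this interval the walk follows the trajectory. *)
Fixpoint path_state (x : nat -> V) (n : nat) : V * R * R :=
  if n is n'.+1 then let s := path_state x n' in
    (x n, s.1.2 + s.2 * lo s.1.1 (x n), s.2 * step_prob s.1.1 (x n))
  else (u, 0, 1).

Definition in_state (s : V * R * R) (t : R) := s.1.2 <= t < s.1.2 + s.2.

Let path_st0 (x : nat -> V) n : x 0%N = u -> (path_state x n).1.1 = x n.
Proof. by case: n. Qed.

Let path_bounds (x : nat -> V) n : [/\ 0 <= (path_state x n).1.2, 0 <= (path_state x n).2 &
  (path_state x n).1.2 + (path_state x n).2 <= 1].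
Proof.
elim: n => [|n [h1 h2 h3]] /=; first by rewrite add0r lexx ler01.
set s := path_state x n in h1 h2 h3 *.
split; first by rewrite addr_ge0 // mulr_ge0 // lo0.
  by rewrite mulr_ge0 // step_prob_ge0.
rewrite -addrA -mulrDr -hiE; apply: le_trans h3; rewrite lerD2l.
by rewrite ler_piMr // hi1.
Qed.

Let path_nested (x : nat -> V) n t : in_state (path_state x n.+1) t -> in_state (path_state x n) t.
Proof.
have [h1 h2 h3] := path_bounds x n.
rewrite /in_state /=; set s := path_state x n in h1 h2 h3 *.
rewrite -addrA -mulrDr -hiE => /andP[g1 g2]; apply/andP; split.
  by apply: le_trans g1; rewrite lerDl mulr_ge0 // lo0.
by apply: lt_le_trans g2 _; rewrite lerD2l ler_piMr // hi1.
Qed.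

Let next_path (x : nat -> V) n t : in_state (path_state x n.+1) t ->
  next_state (path_state x n) t = path_state x n.+1.
Proof.
move=> I; have sl : slot (path_state x n) t (x n.+1).
  by move: I; rewrite /in_state /slot /= -addrA -mulrDr -hiE.
rewrite /next_state; case: pickP => [y sy|]; last by move/(_ (x n.+1)); rewrite sl.
have [_ h2 _] := path_bounds x n.
by have -> : y = x n.+1 by exact: slot_unique h2 sy sl.
Qed.

Let walk_path (x : nat -> V) n t : in_state (path_state x n) t -> forall i, (i <= n)%N ->
  walk_state i t = path_state x i.
Proof.
elim: n => [|n IH] I i; first by rewrite leqn0 => /eqP ->.
have h := IH (path_nested I).
rewrite leq_eqVlt => /predU1P[->|]; last by rewrite ltnS; exact: h.
by rewrite /walk_state iterS -/(walk_state n t) h // next_path.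
Qed.

Let path_walk (x : nat -> V) n t : x 0%N = u -> 0 <= t < 1 ->
  (forall i, (i <= n)%N -> (walk_state i t).1.1 = x i) -> in_state (path_state x n) t.
Proof.
move=> x0 t01; elim: n => [|n IH] H; first by rewrite /in_state /= add0r.
have I := IH (fun i ni => H i (leq_trans ni (leqnSn n))).
have W := walk_path I (leqnn n).
have [y sy] := slot_exists I.
have := H n.+1 (leqnn _); rewrite /walk_state iterS -/(walk_state n t) W /next_state.
case: pickP => [y' sy' /= E|]; last by move/(_ y); rewrite sy.
by move: sy'; rewrite E /slot /in_state /= -addrA -mulrDr -hiE.
Qed.

Definition rw (n : nat) (t : measurableTypeR R) : V :=
  if (0 <= (t : R)) && ((t : R) < 1) then (walk_state n t).1.1 else u.

Let Ev (x : nat -> V) n := [set t | forall i, (i <= n)%N -> rw i t = x i].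

Let EvE (x : nat -> V) n (t : R) : x 0%N = u -> 0 <= t < 1 -> Ev x n t <-> in_state (path_state x n) t.
Proof.
move=> x0 t01; split=> [h|I i ni].
  by apply: path_walk => // i ni; rewrite -(h i ni) /rw t01.
by rewrite /rw t01 (walk_path I ni) path_st0.
Qed.

Let in_state01 (x : nat -> V) n t : in_state (path_state x n) t -> 0 <= t < 1.
Proof. by have [h1 h2 h3] := path_bounds x n; rewrite /in_state => /andP[? ?]; lra. Qed.

Let Ev_neq (x : nat -> V) n : x 0%N <> u -> Ev x n = set0.
Proof.
move=> x0; apply/seteqP; split=> t // /(_ 0%N (leq0n n)) E; case: x0.
by rewrite -E /rw; case: ifP.
Qed.

Let in_stateE (x : nat -> V) n : [set t : measurableTypeR R | in_state (path_state x n) t] =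
  `[(path_state x n).1.2, (path_state x n).1.2 + (path_state x n).2[%classic.
Proof. by apply/seteqP; split=> t; rewrite /= in_itv. Qed.

Let mEv (x : nat -> V) n : measurable (Ev x n).
Proof.
have [x0|x0] := eqVneq (x 0%N) u; last by rewrite Ev_neq //; exact/eqP.
(* Outside the unit interval [rw] rests at [u], so these samples belong to the event exactly when
   the prescribed trajectory is constant. *)
pose out := if [forall i : 'I_n.+1, x i == u] then ~` (`[0, 1[%classic : set (measurableTypeR R)) else set0.
have mo : measurable out.
  by rewrite /out; case: ifP => _; [apply: measurableC; exact: measurable_itv|exact: measurable0].
have -> : Ev x n = [set t : measurableTypeR R | in_state (path_state x n) t] `|` out.
  apply/seteqP; split=> t.
    move=> h; case: (boolP ((0 <= (t : R)) && ((t : R) < 1))) => t01; first by left; apply/EvE.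
    right; rewrite /out; case: forallP => [_|nf].
      by move=> /=; rewrite in_itv /=; exact/negP.
    case: nf => i; apply/eqP; have := h i; rewrite /rw (negbTE t01) -ltnS ltn_ord => /(_ isT) //.
  move=> [I|]; first by apply/EvE => //; exact: in_state01 I.
  rewrite /out; case: forallP => [f|//] /=; rewrite in_itv /= => /negP t01 i ni.
  have ni' : (i < n.+1)%N by rewrite ltnS.
  by rewrite /rw (negbTE t01); have /eqP := f (Ordinal ni').
by apply: measurableU => //; rewrite in_stateE; exact: measurable_itv.
Qed.

Let PEv (x : nat -> V) n : x 0%N = u -> unif01 (Ev x n) = (path_state x n).2%:E.
Proof.
move=> x0; have [h1 h2 h3] := path_bounds x n.
rewrite (@unif01_eq _ _ [set t : measurableTypeR R | in_state (path_state x n) t]); last first.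
  by move=> t t01; exact: EvE.
rewrite in_stateE unif01_itv //; last by rewrite lerDl.
by congr EFin; rewrite addrC addrA addNr add0r.
Qed.

Lemma srw_exists : is_srw (unif01 : probability (measurableTypeR R) R) u rw.
Proof.
split.
- move=> n x; pose pa (f : n.+1.-tuple V) i := tnth f (inord i).
  have -> : [set t | rw n t = x] = \bigcup_(f in [set f : n.+1.-tuple V | tnth f ord_max == x]) Ev (pa f) n.
    apply/seteqP; split=> t.
      move=> /= rx; exists [tuple rw i t | i < n.+1]; first by rewrite /= tnth_mktuple /= rx.
      by move=> i ni; rewrite /pa tnth_mktuple inordK.
    move=> [f /= /eqP <-] h; rewrite /= (h n (leqnn n)) /pa; congr (tnth f _).
    by apply/val_inj; rewrite /= inordK.
  by apply: fin_bigcup_measurable => //; exact: finite_finset.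
- rewrite (_ : [set t | rw 0 t = u] = setT); first exact: unif01_setT.
  by apply/seteqP; split=> t //= _; rewrite /rw; case: ifP.
- move=> n x; rewrite -/(Ev x n.+1) -/(Ev x n).
  have [x0|x0] := eqVneq (x 0%N) u; last by rewrite !Ev_neq ?measure0 ?mul0e //; exact/eqP.
  apply: (etrans (PEv n.+1 x0)); rewrite [X in (X * _)%E](PEv n x0).
  by rewrite -EFinM /= path_st0.
Qed.

End RandomWalk.

(** * Discrete harmonic functions near the boundary *)

Section BoundaryDiscrete.
Context {R : realType}.
Variable G : orthodiagonal_map R.
Notation V := (primal_vertex G).
Notation pp := (@ppos R G).

(** The Beurling hypothesis, applied to the constructed walk, becomes a bound at [u] for a harmonic
    function with boundary values 0 and 1. *)
Lemma beurling_function (C K be eps r : R) (u : V) : weak_beurling C K be -> mesh_le G eps ->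
  ~ bdry u -> 0 < r -> exists h : V -> R, [/\ dharmonic h,
    forall x, bdry x -> h x = (r <= nrm (pp x - pp u))%R%:R &
    h u <= C * (Num.max (dist_bdry u) (K * eps) / r) `^ be].
Proof.
move=> HB me nb r0; pose A : pred V := fun x => r <= nrm (pp x - pp u).
have [h [h1 h2 h3]] := hitting_function A.
exists h; split => //; apply: h3 => N; rewrite -lee_fin.
apply: le_trans (HB G eps me u r nb r0 _ _ _ _ (srw_exists u)).
exact: (hit_within_le A (srw_exists u) N).
Qed.

Lemma dist_set_ge0 (p : R * R) (A : set (R * R)) : 0 <= dist_set p A.
Proof.
rewrite /dist_set; have [->|/set0P[x Ax]] := eqVneq A set0; first by rewrite image_set0 inf0.
by apply: lb_le_inf; [exists (dist2 p x), x|move=> _ [y _ <-]; exact: sqrtr_ge0].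
Qed.

Lemma dyadic_scale (dl rho : R) n : 0 < dl -> dl <= rho -> rho < dl * 2 ^+ n.+1 ->
  exists2 k, (k <= n)%N & dl * 2 ^+ k <= rho < dl * 2 ^+ k.+1.
Proof.
move=> d0 dr; elim: n => [|n IH] h; first by exists 0%N => //; rewrite expr0 mulr1 dr.
have [h'|h'] := ltP rho (dl * 2 ^+ n.+1); last by exists n.+1 => //; rewrite h'.
by have [k kn ?] := IH h'; exists k => //; exact: leqW.
Qed.

(** The majorant [Phi] is [A dl^al] plus, for each [k], the value [A (2^(k+1) dl)^al] times the exit
    function of radius [2^k dl]. On the boundary, the term of the annulus containing the point
    dominates; at [u], each exit function is at most [C 2^(- k be)]. *)
Lemma layer_cake (C K be al eps dl D A g0 : R) (u : V) (f : V -> R) n :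
  weak_beurling C K be -> 0 < C -> 0 < be -> 0 < al -> al <= 1 -> mesh_le G eps -> ~ bdry u ->
  0 < dl -> dist_bdry u <= dl -> K * eps <= dl -> 0 <= A ->
  dharmonic f ->
  (forall z, bdry z -> nrm (pp z - pp u) <= D) ->
  (forall z, bdry z -> `|f z - g0| <= A * nrm (pp z - pp u) `^ al) ->
  D < dl * 2 ^+ n.+1 ->
  `|f u - g0| <= A * dl `^ al * (1 + 2 * C * \sum_(k < n.+1) 2 `^ (k%:R * (al - be))).
Proof.
move=> HB C0 be0 al0 al1 me nb d0 dd Kd A0 hf zD fb Dn.
have rk (k : nat) : 0 < dl * 2 ^+ k by rewrite mulr_gt0 // exprn_gt0.
have {HB me nb} [H HH] := choice (fun k : nat => beurling_function HB me nb (rk k)).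
pose Phi (x : V) := A * dl `^ al * (1 + \sum_(k < n.+1) (2 `^ al * 2 `^ (k%:R * al)) * H k x).
have P0 (x : R) : 0 < 2 `^ x by rewrite powR_gt0.
have hPhi x : ~ bdry x -> dlaplacian Phi x = 0.
  move=> nx; rewrite /Phi (dlaplacianZ (A * dl `^ al)).
  rewrite (dlaplacianD (fun=> 1)) dlaplacian_cst add0r.
  have -> : dlaplacian (fun v => \sum_(k < n.+1) (2 `^ al * 2 `^ (k%:R * al)) * H k v) x = 0.
    elim: (n.+1) => [|m IH].
      rewrite (_ : (fun v => _) = fun=> 0) ?dlaplacian_cst //.
      by apply/funext => v; rewrite big_ord0.
    rewrite (_ : (fun v => _) = fun v => \sum_(k < m) (2 `^ al * 2 `^ (k%:R * al)) * H k v +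
      (2 `^ al * 2 `^ (m%:R * al)) * H m v); last by apply/funext => v; rewrite big_ord_recr.
    rewrite dlaplacianD IH add0r dlaplacianZ.
    by have [-> //] := HH m; rewrite mulr0.
  by rewrite mulr0.
have bPhi x : bdry x -> A * nrm (pp x - pp u) `^ al <= Phi x.
  move=> bx; rewrite /Phi -mulrA ler_wpM2l //.
  have t0 (k : nat) : 0 <= 2 `^ al * 2 `^ (k%:R * al) * H k x.
    have [_ E _] := HH k; rewrite (E x bx); apply: mulr_ge0; last exact: ler0n.
    by apply: mulr_ge0; exact: ltW.
  have dp : 0 <= dl `^ al by exact: powR_ge0.
  have S0 : 0 <= \sum_(k < n.+1) 2 `^ al * 2 `^ (k%:R * al) * H k x by apply: sumr_ge0 => k _.
  have [sm|lg] := ltP (nrm (pp x - pp u)) dl.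
    apply: (@le_trans _ _ (dl `^ al)); last by rewrite ler_peMr // lerDl.
    by apply: ge0_ler_powR; rewrite ?nnegrE ?nrm_ge0 // ltW.
  have [k kn /andP[k1 k2]] := dyadic_scale d0 lg (le_lt_trans (zD x bx) Dn).
  apply: (@le_trans _ _ (dl `^ al * (2 `^ al * 2 `^ (k%:R * al)))).
    apply: (@le_trans _ _ ((dl * 2 ^+ k.+1) `^ al)).
      by apply: ge0_ler_powR; rewrite ?nnegrE ?nrm_ge0 ?(ltW (rk _)) ?(ltW al0) // ltW.
    rewrite powRM ?(ltW d0) ?exprn_ge0 // -powR_mulrn // -powRrM -powRD ?pnatr_eq0 ?implybT //.
    by rewrite (_ : k.+1%:R * al = al + k%:R * al) // -natr1; ring.
  rewrite ler_pM2l ?powR_gt0 //.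
  have ko : (k < n.+1)%N by rewrite ltnS.
  rewrite (bigD1 (Ordinal ko)) //=; have [_ E _] := HH k; rewrite E // k1 mulr1.
  rewrite addrCA lerDl addr_ge0 //; apply: sumr_ge0 => j _; exact: t0.
have Pu : Phi u <= A * dl `^ al * (1 + 2 * C * \sum_(k < n.+1) 2 `^ (k%:R * (al - be))).
  rewrite /Phi ler_wpM2l //; first by rewrite mulr_ge0 ?powR_ge0.
  rewrite lerD2l mulr_sumr; apply: ler_sum => k _.
  have [_ _ hk] := HH k.
  have h1 : H k u <= C * 2 `^ (- (k%:R * be)).
    apply: le_trans hk _; rewrite ler_pM2l // -mulNr powRrM powRN powR_mulrn //.
    apply: ge0_ler_powR; rewrite ?nnegrE ?(ltW be0) //.
    - by rewrite divr_ge0 ?(ltW (rk _)) // le_max dist_set_ge0.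
    by rewrite ler_pdivrMr // mulrCA mulVf ?mulr1 ?expf_neq0 // ge_max dd Kd //.
  have p1 : 2 `^ al <= 2 `^ 1 by rewrite ler_powR // ler1n.
  rewrite powRr1 // in p1.
  have E : 2 `^ (k%:R * (al - be)) = 2 `^ (k%:R * al) * 2 `^ (- (k%:R * be)).
    by rewrite -powRD ?pnatr_eq0 ?implybT // mulrBr.
  have q0 := P0 (k%:R * al); have q1 := P0 al; have q2 := P0 (- (k%:R * be)).
  apply: le_trans (_ : 2 `^ al * 2 `^ (k%:R * al) * (C * 2 `^ (- (k%:R * be))) <= _).
    by rewrite ler_pM2l // mulr_gt0.
  rewrite E; have : 2 `^ al * (C * (2 `^ (k%:R * al) * 2 `^ (- (k%:R * be)))) <=
      2 * (C * (2 `^ (k%:R * al) * 2 `^ (- (k%:R * be)))).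
    by rewrite ler_pM2r // !mulr_gt0.
  rlra.
apply: le_trans Pu; rewrite ler_norml; apply/andP; split.
  rewrite lerNl opprB.
  have -> : g0 - f u = g0 + -1 * f u by ring.
  apply: (@discrete_comparison _ _ (fun v => g0 + -1 * f v)) => //.
    by move=> x nx; rewrite (dlaplacianD (fun=> g0)) dlaplacian_cst dlaplacianZ hf // mulr0 addr0.
  move=> x bx; apply: le_trans (bPhi x bx); apply: le_trans (fb x bx).
  by rewrite distrC mulN1r ler_norm.
apply: (@discrete_comparison _ _ (fun v => f v + - g0)) => //.
  by move=> x nx; rewrite (dlaplacianD f (fun=> - g0)) dlaplacian_cst hf // addr0.
by move=> x bx; apply: le_trans (bPhi x bx); apply: le_trans (fb x bx); exact: ler_norm.
Qed.

Lemma pow2_ge (x : R) : 0 <= x -> 1 + x / 2 <= 2 `^ x.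
Proof.
move=> x0; have l2 : 1 / 2 <= ln (2 : R).
  have := @le_ln1Dx R (- (1 / 2)); rewrite (_ : 1 + - (1 / 2) = 2^-1 :> R) ?lnV ?posrE //; last by field.
  by move=> /(_ ltac:(rlra)); rlra.
have : 1 + x * ln 2 <= 2 `^ x by rewrite /powR pnatr_eq0 /=; exact: expR_ge1Dx.
by have : x * (1 / 2) <= x * ln 2 by [rewrite ler_wpM2l|]; rlra.
Qed.

Lemma geometric_sum (q : R) n : (1 - q) * (\sum_(k < n) q ^+ k) = 1 - q ^+ n.
Proof.
elim: n => [|n IH]; first by rewrite big_ord0 mulr0 expr0 subrr.
by rewrite big_ord_recr /= mulrDr IH exprS; ring.
Qed.

Lemma pow2X (x : R) (k : nat) : 2 `^ (k%:R * x) = (2 `^ x) ^+ k.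
Proof. by rewrite mulrC powRrM powR_mulrn ?powR_ge0. Qed.

(** For the ratio [q = 2^(- x)], the inequality [(1 - x/4) (1 + x/2) >= 1] on [[0, 1]] gives
    [1 - q >= x / 4]. *)
Lemma geometric_decreasing (x : R) n : 0 < x -> x <= 1 ->
  \sum_(k < n) 2 `^ (k%:R * (- x)) <= 4 / x.
Proof.
move=> x0 x1; set q := 2 `^ (- x).
have q0 : 0 < q by rewrite powR_gt0.
have h := pow2_ge (ltW x0).
have qE : q * 2 `^ x = 1 by rewrite /q powRN mulVf // gt_eqF // powR_gt0.
have q1 : q <= 1 - x / 4.
  rewrite leNgt; apply/negP => lt.
  have : (1 - x / 4) * (1 + x / 2) < q * 2 `^ x.
    by apply: lt_le_trans (_ : q * (1 + x / 2) <= _); [rewrite ltr_pM2r //; rlra|rewrite ler_pM2l].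
  rewrite qE; nra.
under eq_bigr => k _ do rewrite pow2X -/q.
have := geometric_sum q n; have := exprn_ge0 n (ltW q0).
set S := \sum_(k < n) q ^+ k => qn E.
have S0 : 0 <= S by apply: sumr_ge0 => k _; rewrite exprn_ge0 // ltW.
by rewrite ler_pdivlMr //; nra.
Qed.

Lemma geometric_increasing (x : R) n : 0 < x -> x <= 1 ->
  \sum_(k < n.+1) 2 `^ (k%:R * x) <= 4 / x * 2 `^ (n%:R * x).
Proof.
move=> x0 x1; set q := 2 `^ x.
have q0 : 0 < q by rewrite powR_gt0.
have h := pow2_ge (ltW x0); rewrite -/q in h.
have q2 : q <= 2 by rewrite -[leRHS]powRr1 // ler_powR // ler1n.
under eq_bigr => k _ do rewrite pow2X -/q.
rewrite pow2X -/q; have := geometric_sum q n.+1; have := exprn_ge0 n (ltW q0).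
rewrite exprS; set S := \sum_(k < n.+1) q ^+ k => qn E.
have S0 : 0 <= S by apply: sumr_ge0 => k _; rewrite exprn_ge0 // ltW.
have h1 : (x / 2) * S <= (q - 1) * S by rewrite ler_wpM2r //; rlra.
have h2 : q * q ^+ n <= 2 * q ^+ n by rewrite ler_wpM2r.
have h3 : x * S <= 4 * q ^+ n by rlra.
rewrite mulrAC ler_pdivlMr //; rlra.
Qed.

End BoundaryDiscrete.

(** * Energy and the pointwise estimate *)

Section Energy.
Context {R : realType}.
Variable G : orthodiagonal_map R.
Notation V := (primal_vertex G).
Notation W := (dual_vertex G).
Implicit Types (x y v u : V) (w : W).
Notation pp := (@ppos R G).
Notation dp := (@dpos R G).

(** Every inner face is counted twice, once from each of its primal vertices. *)
Definition tsum (F : V -> V -> W -> W -> R) : R := \sum_(x : V) qsum x (F x).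

Lemma eq_tsum F1 F2 : (forall x y w1 w2, posq x y w1 w2 -> F1 x y w1 w2 = F2 x y w1 w2) ->
  tsum F1 = tsum F2.
Proof. by move=> H; apply: eq_bigr => x _; apply: eq_qsum; exact: H. Qed.

Lemma tsumD F1 F2 : tsum (fun x y w1 w2 => F1 x y w1 w2 + F2 x y w1 w2) = tsum F1 + tsum F2.
Proof. by rewrite /tsum -big_split; apply: eq_bigr => x _; exact: qsumD. Qed.

Lemma tsumZ (k : R) F : tsum (fun x y w1 w2 => k * F x y w1 w2) = k * tsum F.
Proof. by rewrite /tsum mulr_sumr; apply: eq_bigr => x _; exact: qsumZ. Qed.

Lemma ler_tsum F1 F2 : (forall x y w1 w2, posq x y w1 w2 -> F1 x y w1 w2 <= F2 x y w1 w2) ->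
  tsum F1 <= tsum F2.
Proof. by move=> H; apply: ler_sum => x _; apply: ler_qsum; exact: H. Qed.

Lemma tsum_rev F : tsum F = tsum (fun x y w1 w2 => F y x w2 w1).
Proof.
rewrite /tsum /qsum exchange_big /=; apply: eq_bigr => y _; apply: eq_bigr => x _.
under eq_bigr => w1 _ do rewrite big_mkcond.
rewrite exchange_big /=; apply: eq_bigr => w2 _; rewrite [RHS]big_mkcond; apply: eq_bigr => w1 _.
by rewrite posqC.
Qed.

Lemma tsum_term F x y w1 w2 : (forall x y w1 w2, posq x y w1 w2 -> 0 <= F x y w1 w2) ->
  posq x y w1 w2 -> F x y w1 w2 <= tsum F.
Proof.
move=> F0 q; have := F0 _ _ _ _ q; rewrite le_eqVlt => /predU1P[<-|Fp].
  by apply: sumr_ge0 => i _; apply: sumr_ge0 => j _; apply: sumr_ge0 => k _; apply: sumr_ge0 => l ql; exact: F0.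
rewrite /tsum (bigD1 x) //= /qsum (bigD1 y) //= (bigD1 w1) //= (bigD1 w2) //= -!addrA lerDl.
apply: addr_ge0; first by apply: sumr_ge0 => i /andP[qi _]; exact: F0.
apply: addr_ge0; first by apply: sumr_ge0 => i _; apply: sumr_ge0 => j qj; exact: F0.
apply: addr_ge0; first by apply: sumr_ge0 => i _; apply: sumr_ge0 => j _; apply: sumr_ge0 => k qk; exact: F0.
by apply: sumr_ge0 => i _; apply: sumr_ge0 => j _; apply: sumr_ge0 => k _; apply: sumr_ge0 => l ql; exact: F0.
Qed.

Lemma tsum_qarea (c : R * R) (D : R) :
  (forall p, hat_domain G p -> `|p.1 - c.1| <= D /\ `|p.2 - c.2| <= D) ->
  tsum (@qarea R G) <= 128 * D ^+ 2.
Proof.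
move=> /qarea_sum; apply: le_trans; rewrite le_eqVlt; apply/orP; left; apply/eqP.
rewrite /tsum /qsum pair_big /= pair_big /= pair_big_dep /=.
by apply: eq_bigr => -[[[x y] w1] w2].
Qed.

Lemma qarea_cq x y w1 w2 : posq x y w1 w2 ->
  qarea x y w1 w2 = cq x y w1 w2 * nrm (pp y - pp x) ^+ 2 /\
  nrm (dp w2 - dp w1) = cq x y w1 w2 * nrm (pp y - pp x).
Proof.
move=> q; have [xy _ _] := posq_edge q; have n0 := pp_dist xy.
by rewrite qarea_nrm // /cq; split; field; rewrite gt_eqF.
Qed.

(* Summation by parts, followed by [2 a b <= a ^ 2 + b ^ 2]; only the antisymmetric part
   of [th] contributes. *)
Lemma energy_le (u U : V -> R) (th : V -> V -> W -> W -> R) (L eta : R) :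
  (forall x, U x = Num.max 0 (u x - eta)) ->
  (forall x, 0 < U x -> dlaplacian u x = - qsum x (th x)) ->
  (forall x y w1 w2, posq x y w1 w2 -> 0 < U x ->
     `|th x y w1 w2| <= 4 * cq x y w1 w2 * L * nrm (pp y - pp x)) ->
  (forall x y w1 w2, posq x y w1 w2 -> 0 < U x -> 0 < U y -> th y x w2 w1 = - th x y w1 w2) ->
  tsum (fun x y w1 w2 => cq x y w1 w2 * (U y - U x) ^+ 2) <= 16 * L ^+ 2 * tsum (@qarea R G).
Proof.
move=> UE Hlap Hth Has; set A := tsum _.
have U0 x : 0 <= U x by rewrite UE le_max lexx.
have Um x y : (U y - U x) ^+ 2 <= (U y - U x) * (u y - u x).
  have K (a b : R) : (Num.max 0 b - Num.max 0 a) ^+ 2 <= (Num.max 0 b - Num.max 0 a) * (b - a).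
    rewrite expr2; case: (ltP 0 a); case: (ltP 0 b) => h1 h2; nra.
  by rewrite !UE; have := K (u x - eta) (u y - eta); rewrite (_ : u y - eta - (u x - eta) = u y - u x) //; ring.
pose B := fun x y w1 w2 => U x * (cq x y w1 w2 * (u y - u x)).
have E1 : A <= -2 * tsum B.
  have -> : -2 * tsum B = tsum (fun x y w1 w2 => -1 * B x y w1 w2 + -1 * B y x w2 w1).
    by rewrite tsumD !tsumZ -(tsum_rev B); ring.
  apply: ler_tsum => x y w1 w2 q; rewrite /B.
  have h : cq x y w1 w2 * (U y - U x) ^+ 2 <= cq x y w1 w2 * ((U y - U x) * (u y - u x)).
    by rewrite ler_wpM2l // ltW // cq_gt0.
  rewrite (cqC x y w1 w2); apply: le_trans h _; rewrite le_eqVlt; apply/orP; left; apply/eqP; ring.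
have E2 : -2 * tsum B =
    2 * tsum (fun x y w1 w2 => U x * th x y w1 w2).
  rewrite mulNr -mulrN; congr (_ * _); rewrite /tsum -sumrN; apply: eq_bigr => x _.
  rewrite !qsumZ -dlaplacianE; have := U0 x; rewrite le_eqVlt => /predU1P[<-|Up].
    by rewrite !mul0r oppr0.
  by rewrite Hlap // mulrN opprK.
have E3 : 2 * tsum (fun x y w1 w2 => U x * th x y w1 w2) <=
    2^-1 * A + 8 * L ^+ 2 * tsum (@qarea R G).
  have -> : 2 * tsum (fun x y w1 w2 => U x * th x y w1 w2) =
      tsum (fun x y w1 w2 => U x * th x y w1 w2 + U y * th y x w2 w1).
    by rewrite tsumD -(tsum_rev (fun x y w1 w2 => U x * th x y w1 w2)); ring.
  have -> : 2^-1 * A + 8 * L ^+ 2 * tsum (@qarea R G) = tsum (fun x y w1 w2 =>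
      2^-1 * (cq x y w1 w2 * (U y - U x) ^+ 2) + 8 * L ^+ 2 * qarea x y w1 w2).
    pose F1 x y w1 w2 := 2^-1 * (cq x y w1 w2 * (U y - U x) ^+ 2).
    pose F2 x y w1 w2 := 8 * L ^+ 2 * qarea (x : V) y (w1 : W) w2.
    by have := tsumD F1 F2; rewrite /F1 /F2 => ->; rewrite -!tsumZ.
  apply: ler_tsum => x y w1 w2 q.
  have [-> _] := qarea_cq q; set c := cq _ _ _ _; set e := nrm _.
  have c0 : 0 < c by exact: cq_gt0.
  have e0 : 0 <= e := nrm_ge0 _.
  (* Both signs of the square of [s -+ 4 L e], with weights that leave half of the energy to be
     absorbed on the left. *)
  have AG (s t : R) : `|t| <= 4 * c * L * e -> s * t <= 2^-1 * (c * s ^+ 2) + 8 * L ^+ 2 * (c * e ^+ 2).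
    rewrite ler_norml => /andP[t1 t2].
    have h1 : 0 <= c * (s - 4 * (L * e)) ^+ 2 by rewrite mulr_ge0 ?sqr_ge0 // ltW.
    have h2 : 0 <= c * (s + 4 * (L * e)) ^+ 2 by rewrite mulr_ge0 ?sqr_ge0 // ltW.
    have [s0|s0] := leP 0 s.
      have := ler_wpM2l s0 t2; rlra.
    have : (- s) * (- t) <= (- s) * (4 * c * L * e) by apply: ler_wpM2l; rlra.
    rlra.
  (* If only one end is positive, only its own [th] enters; antisymmetry is called upon only where
     both ends are positive. *)
  have := U0 x; rewrite le_eqVlt => /predU1P[x0|xp]; have := U0 y; rewrite le_eqVlt => /predU1P[y0|yp].
  - rewrite -x0 -y0 !mul0r addr0 subrr expr0n /= mulr0 mulr0 add0r.
    by apply: mulr_ge0; apply: mulr_ge0; rewrite ?sqr_ge0 // ltW.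
  - rewrite -x0 mul0r add0r subr0; apply: AG.
    have qr : posq y x w2 w1 by rewrite posqC.
    by have := Hth _ _ _ _ qr yp; rewrite cqC (nrmC (pp x)).
  - rewrite -y0 mul0r addr0 sub0r sqrrN; apply: AG; exact: Hth.
  - rewrite (Has _ _ _ _ q xp yp).
    rewrite (_ : U x * _ + _ = (U y - U x) * - th x y w1 w2); last by ring.
    by apply: AG; rewrite normrN; exact: Hth.
rlra.
Qed.

(** The triangle [x a b] is far from [p] compared with its size, so its three small angles add up to
    0 and the difference is the angle of the side [a b]. *)
Lemma ang_chord (p a b x : R * R) (r : R) : 0 < r -> r <= nrm (x - p) -> 16 * nrm (a - x) <= r -> 16 * nrm (b - x) <= r ->
  `|ang (x - p) (a - p) - ang (x - p) (b - p)| <= 4 * (nrm (a - b) / r).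
Proof.
move=> r0 xr ar br.
have T (y z : R * R) : nrm (y - p) <= nrm (z - p) + nrm (y - z).
  by have := nrm_triangle (z - p) (y - z); rewrite (_ : z - p + (y - z) = y - p) // addrC addrA subrK.
have T' (y z : R * R) : nrm (y - z) <= nrm (y - x) + nrm (z - x).
  have := nrm_triangle (y - x) (x - z); rewrite (_ : y - x + (x - z) = y - z) ?(nrmC x) //.
  by rewrite addrA subrK.
have xa := T x a; have xb := T x b; rewrite nrmC in xa; rewrite (nrmC x) in xb.
rewrite (nrmC x) in xa.
have ap : 2^-1 * r <= nrm (a - p) by have := nrmC x a; have := T x a; rlra.
have bp : 2^-1 * r <= nrm (b - p) by have := nrmC x b; have := T x b; rlra.
have ab := T' a b.
have S (y z : R * R) : 2^-1 * r <= nrm (y - p) -> 8 * nrm (z - y) <= r ->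
    nonopp (y - p) (z - p) /\ `|ang (y - p) (z - p)| <= 4 * (nrm (z - y) / r).
  move=> yp zy; have yp0 : 0 < nrm (y - p) by rlra.
  have := @ang_small R (y - p) (z - p) yp0; rewrite subsub => /(_ _)[]; first by rlra.
  move=> no h; split=> //; apply: le_trans h _.
  rewrite (_ : 4 * (nrm (z - y) / r) = 2 * (nrm (z - y) / (2^-1 * r))); last by field; rewrite gt_eqF.
  rewrite ler_pM2l // ler_wpM2l ?nrm_ge0 // lef_pV2 // posrE //; rlra.
have [n1 h1] : nonopp (x - p) (a - p) /\ `|ang (x - p) (a - p)| <= 4 * (nrm (a - x) / r) by apply: S; rlra.
have [n2 h2] : nonopp (a - p) (b - p) /\ `|ang (a - p) (b - p)| <= 4 * (nrm (b - a) / r).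
  by apply: S; [rlra|rewrite nrmC; rlra].
have [n3 h3] : nonopp (b - p) (x - p) /\ `|ang (b - p) (x - p)| <= 4 * (nrm (x - b) / r).
  by apply: S; [rlra|rewrite nrmC; rlra].
have dr (t : R) : 16 * t <= 2 * r -> 4 * (t / r) <= 2^-1.
  by move=> h; rewrite mulrA ler_pdivrMr //; rlra.
have := pi_ge2 R => pi2.
pose P (k : nat) := nth x [:: x; a; b; x] k.
have E : turn p P 3 = 0.
  apply: turn_eq0 => //.
    by move=> [|[|[|//]]] _.
  rewrite /turn !big_ord_recr big_ord0 /= add0r.
  apply: le_lt_trans (ler_normD _ _) _; apply: le_lt_trans (lerD (ler_normD _ _) (lexx _)) _.
  have := dr (nrm (a - x)); have := dr (nrm (b - a)); have := dr (nrm (x - b)).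
  rewrite (nrmC x b) (nrmC b a) in h2 h3 *; rlra.
move: E; rewrite /turn !big_ord_recr big_ord0 /= add0r => E.
rewrite (angC (b - p) (x - p)) opprK.
rewrite (_ : _ + _ = - ang (a - p) (b - p)); last by rlra.
by rewrite normrN (nrmC a b).
Qed.

(* The increments of the angle seen from [p0] form a flow with a unit source at the face
   containing [p0]. *)
Lemma flow_le (U : V -> R) (F : set (R * R)) p0 (r : R) v y0 w0 w0' :
  pquad F v y0 w0 w0' -> F p0 -> 0 < r ->
  (forall x, bdry x -> U x = 0) -> (forall x, 0 <= U x) ->
  (forall x w, edge x w -> 16 * nrm (dp w - pp x) <= r) ->
  (forall x y w1 w2, posq x y w1 w2 -> nrm (pp y - p0) < r -> U y = U x) ->
  2 * pi * U v <= tsum (fun x y w1 w2 => `|U y - U x| * (4 * (nrm (dp w2 - dp w1) / r))).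
Proof.
move=> Q Fp r0 Ub U0 mesh far.
have qv0 : posq v y0 w0 w0' by apply/asboolP; exists F.
pose psi x w1 w2 : R := ang (pp x - p0) (dp w2 - p0) - ang (pp x - p0) (dp w1 - p0).
have nG : ~ Gam G p0.
  by have [iF _ _] := Q; have [_ [H _ _] _ _] := inner_face_sat iF; exact: H.
pose T x y w1 w2 := turn4 p0 (pp x) (dp w1) (pp y) (dp w2).
have Tv x y w1 w2 : posq x y w1 w2 -> 0 <= T x y w1 w2.
  move=> /asboolP[F' Q']; have [Fp'|nFp'] := pselect (F' p0).
    by rewrite /T (pquad_turn Q') // mulr_ge0 // pi_ge0.
  rewrite /T (turn_outside Q') // => h; exact: nG (PG_Gam Q' h).
have S0 : tsum (fun x y w1 w2 => U x * psi x w1 w2) = 0.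
  rewrite /tsum big1 // => x _; rewrite qsumZ.
  have [b|nb] := pselect (bdry x); first by rewrite Ub // mul0r.
  by rewrite (qsum_telescope (fun w => ang (pp x - p0) (dp w - p0)) nb) mulr0.
(* The four angles of a face, grouped at its two primal vertices, give minus its winding number
   around [p0]: [2 pi] for the face of [p0], 0 for all others. *)
have psiT x y w1 w2 : psi x w1 w2 + psi y w2 w1 = - T x y w1 w2.
  rewrite /psi /T /turn4 (angC (pp y - p0) (dp w1 - p0)) (angC (dp w2 - p0) (pp x - p0)); ring.
have S1 : tsum (fun x y w1 w2 => U x * T x y w1 w2) =
    tsum (fun x y w1 w2 => (U y - U x) * psi y w2 w1).
  have E : tsum (fun x y w1 w2 => U x * T x y w1 w2) =
      tsum (fun x y w1 w2 => (U y - U x) * psi y w2 w1 + (-1 * (U x * psi x w1 w2) +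
         -1 * (U y * psi y w2 w1))).
    by apply: eq_tsum => x y w1 w2 _; have := psiT x y w1 w2; nra.
  rewrite E !tsumD !tsumZ -(tsum_rev (fun x y w1 w2 => U x * psi x w1 w2)) S0.
  by rewrite mulr0 !addr0.
have h1 : 2 * pi * U v <= tsum (fun x y w1 w2 => U x * T x y w1 w2).
  rewrite mulrC -{1}(pquad_turn Q Fp).
  apply: (@tsum_term (fun x y w1 w2 => U x * T x y w1 w2)) qv0.
  by move=> x y w1 w2 q; apply: mulr_ge0 => //; exact: Tv.
apply: le_trans h1 _; rewrite S1; apply: ler_tsum => x y w1 w2 q.
(* Near [p0] the angles are not small, but there the increments of [U] vanish. *)
have [near|fr] := ltP (nrm (pp y - p0)) r.
  by rewrite (far _ _ _ _ q near) subrr normr0 !mul0r.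
apply: le_trans (ler_norm _) _; rewrite normrM ler_wpM2l //.
have [_ _ [e1 e2 e3 e4]] := posq_edge q.
rewrite /psi (nrmC (dp w2)); apply: ang_chord => //; exact: mesh.
Qed.

End Energy.

(** * The estimate at vertices away from the boundary *)

Section Deep.
Context {R : realType}.
Variable G : orthodiagonal_map R.
Notation V := (primal_vertex G).
Notation W := (dual_vertex G).
Notation pp := (@ppos R G).
Notation dp := (@dpos R G).

Lemma nrm_sub (a b c : R * R) : nrm (a - c) <= nrm (a - b) + nrm (b - c).
Proof. by have := nrm_triangle (a - b) (b - c); rewrite addrA subrK. Qed.

Lemma min_lipschitz (a b m : R) : `|Num.min a m - Num.min b m| <= `|a - b|.
Proof.
rewrite ler_norml; have := ler_norm (a - b); have := ler_norm (b - a); rewrite (distrC b).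
by move: (`|a - b|) => d; case: (leP a m); case: (leP b m) => h1 h2 h3 h4; apply/andP; split; rlra.
Qed.

Lemma nrm_box (a p : R * R) (r : R) : nrm (a - p) < r -> box p r a.
Proof.
move=> h; split; first exact: le_lt_trans (nrm_ge1 (a - p)) h.
exact: le_lt_trans (nrm_ge2 (a - p)) h.
Qed.

Lemma bdry_exists (v : V) : ~ bdry v -> exists z : V, bdry z.
Proof.
move=> nb; have hv : hat_domain G (pp v) by rewrite hat_domainE => /bdryE.
have [a [b [fa _ _]]] := frontier_outer_two G.
have na : ~ hat_domain G a by rewrite hat_domainE => /(_ _)[]; case: fa.
(* The sum of all distances between primal and dual vertices serves as a crude mesh size for
   [near_bdry]. *)
pose m : R := 1 + \sum_(x : V) \sum_(w : W) nrm (pp x - dp w).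
have m1 : 1 <= m by rewrite lerDl sumr_ge0 // => x _; rewrite sumr_ge0 // => w _; exact: nrm_ge0.
have mm : mesh_le G m.
  move=> x w _; rewrite nrm_dist2.
  have h1 : nrm (pp x - dp w) <= \sum_(w : W) nrm (pp x - dp w).
    by rewrite (bigD1 w) //= lerDl sumr_ge0 // => i _; exact: nrm_ge0.
  have h2 : \sum_(w : W) nrm (pp x - dp w) <= \sum_(x : V) \sum_(w : W) nrm (pp x - dp w).
    rewrite [leRHS](bigD1 x) //= lerDl sumr_ge0 // => i _; apply: sumr_ge0 => j _; exact: nrm_ge0.
  by rewrite /m; rlra.
have m0 : 0 < m by rlra.
by have [z bz _] := near_bdry m0 mm hv na; exists z.
Qed.

Lemma dist_bdry_ge (x z0 : V) (r : R) : bdry z0 -> (forall z, bdry z -> r <= nrm (pp z - pp x)) ->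
  r <= dist_bdry x.
Proof.
move=> b0 H; apply: lb_le_inf.
  by exists (dist2 (pp x) (pp z0)); exists (pp z0) => //; exists z0.
by move=> _ [_ [z bz <-] <-]; rewrite nrm_dist2 nrmC; exact: H.
Qed.

Lemma face_point F (v y : V) (w w' : W) (eps : R) : pquad F v y w w' -> 0 < eps ->
  exists2 p, F p & nrm (p - pp v) <= eps.
Proof.
move=> [_ fq _] e0; have [[cF _] _ _ _] := quad_vertices fq.
have e2 : 0 < eps / 2 by rewrite divr_gt0.
have [p Fp [h1 h2]] := (closure_box _ _).1 cF _ e2; exists p => //.
by apply: le_trans (nrm_le12 _) _; rewrite /=; rlra.
Qed.

Section Estimate.
Variables (Om : set (R * R)) (h hx hy hxx hxy hyx hyy : R * R -> R).
Variables (eps d D N eta L C' K be : R) (c : R * R) (hd : V -> R).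
Hypotheses (oOm : open Om) (H : C2harm Om h hx hy hxx hxy hyx hyy).
Hypotheses (e0 : 0 < eps) (mesh : mesh_le G eps) (ed : 128 * eps <= d) (N0 : 0 < N).
Hypotheses (L0 : 0 < L) (LE : 4096 * N * eps / d ^+ 2 <= L).
Hypothesis hN : forall p, Om p -> `|h p| <= N.
Hypothesis hdN : forall x : V, `|hd x| <= N.
Hypothesis hdh : dharmonic hd.
Hypothesis hatD : forall p, hat_domain G p -> `|p.1 - c.1| <= D /\ `|p.2 - c.2| <= D.
Hypothesis bOm : forall z : V, bdry z -> exists2 q, ~ Om q & nrm (q - pp z) <= 2 * eps.
Hypotheses (C0 : 0 < C') (K0 : 0 < K) (b0 : 0 < be) (b1 : be < 1) (HH : hoelder_harmonic C' K be).
Hypothesis eta0 : 0 <= eta.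
Hypothesis shallow : forall x : V, (bdry x \/ ~ (box (pp x) d `<=` Om)) -> hd x - h (pp x) <= eta.

Variables u U : V -> R.
Hypothesis uE : forall x, u x = hd x - h (pp x).
Hypothesis UE : forall x, U x = Num.max 0 (u x - eta).

Let d0 : 0 < d. Proof. by have := e0; have := ed; lra. Qed.
Let basics : [/\ 0 < eps, 128 * eps <= d, 0 < N & 0 < d]. Proof. by []. Qed.
Let U0 x : 0 <= U x. Proof. by rewrite UE le_max lexx. Qed.

Let deepP x : 0 < U x -> ~ bdry x /\ box (pp x) d `<=` Om.
Proof.
rewrite UE lt_max ltxx /= => Ux; split=> [b|].
  by have := shallow (or_introl b); rewrite -uE; lra.
by apply: contrapT => nb; have := shallow (or_intror nb); rewrite -uE; lra.
Qed.

Lemma quad_close x y w1 w2 : posq x y w1 w2 ->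
  [/\ nrm (dp w1 - pp x) <= eps, nrm (dp w2 - pp x) <= eps & nrm (pp y - pp x) <= 2 * eps].
Proof.
move=> /posq_edge[_ _ [e1 e2 e3 e4]].
have := mesh e1; have := mesh e2; have := mesh e4; rewrite !nrm_dist2.
rewrite (nrmC (pp x) (dp w1)) (nrmC (pp x) (dp w2)) => h4 h2 h1.
by split=> //; apply: le_trans (nrm_sub _ (dp w1) _) _; lra.
Qed.

(** Within [4 eps] of the vertex the two coordinates vary by at most [8 eps] together; with the
    constant 512 of the second-order estimate this gives the 4096 in [LE]. *)
Lemma gradient_variation x : box (pp x) d `<=` Om -> forall q, box (pp x) (4 * eps) q ->
  `|hx q - hx (pp x)| <= L /\ `|hy q - hy (pp x)| <= L.
Proof.
move=> bx q [q1 q2]; have [e0' ed' N0' d0'] := basics.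
have hb : harmonic_on [set p | box (pp x) d p] h.
  by apply: harmonicS (C2harm_harmonic_on oOm H) => p; exact: bx.
have hNb p : box (pp x) d p -> `|h p| <= N by move=> /bx; exact: hN.
have d1 p : box (pp x) d p -> is_derive p.1 1 (fun s => h (s, p.2)) (hx p).
  by move=> /bx/H[[]].
have d2 p : box (pp x) d p -> is_derive p.2 1 (fun s => h (p.1, s)) (hy p).
  by move=> /bx/H[[]].
have bq : box (pp x) (d / 32) q by split; lra.
have bp : box (pp x) (d / 32) (pp x) by split; rewrite subrr normr0; lra.
have LE' : 512 * N / d ^+ 2 * (`|q.1 - (pp x).1| + `|q.2 - (pp x).2|) <= L.
  apply: le_trans LE; rewrite mulrAC; apply: ler_wpM2r; first by rewrite invr_ge0 sqr_ge0.
  rewrite (_ : 4096 * N * eps = 512 * N * (8 * eps)); last by ring.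
  apply: ler_wpM2l; lra.
split; first exact: le_trans (harmonic_derive_lip1 hb hNb d1 bq bp) LE'.
exact: le_trans (harmonic_derive_lip2 hb hNb d2 bq bp) LE'.
Qed.

(** [th] is the flow of [h] minus the increment of a local conjugate chosen at [x]; the increments
    cancel around [x], so [u] has Laplacian minus the sum of [th]. Conjugates chosen at neighbouring
    vertices have equal increments on the common dual edge, whence antisymmetry. *)
Lemma error_energy : tsum (fun x y w1 w2 => cq x y w1 w2 * (U y - U x) ^+ 2) <=
  16 * L ^+ 2 * tsum (@qarea R G).
Proof.
have [e0' ed' N0' d0'] := basics.
have [phi Hphi] : exists phi : V -> R * R -> R, forall x, 0 < U x ->
    forall q, box (pp x) (d / 2) q -> C1at q (phi x) (fun q => - hy q) hx.
  suff /choice[phi Hphi] : forall x, exists f : R * R -> R, 0 < U x ->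
    forall q, box (pp x) (d / 2) q -> C1at q f (fun q => - hy q) hx by exists phi.
  move=> x; have [/deepP[_ bx]|_] := ltP 0 (U x); last by exists h.
  have Hb : C2harm [set q | box (pp x) d q] h hx hy hxx hxy hyx hyy by move=> p /bx; exact: H.
  by have [f Hf] := local_conjugate Hb; exists f.
pose th x y w1 w2 := cq x y w1 w2 * (h (pp y) - h (pp x)) - (phi x (dp w2) - phi x (dp w1)).
have phis x q : 0 < U x -> box (pp x) (4 * eps) q -> C1at q (phi x) (fun q => - hy q) hx.
  by move=> Ux [q1 q2]; apply: (Hphi x Ux); split; lra.
apply: (@energy_le R G u U th L eta UE).
- move=> x /deepP[nb bx].
  have -> : dlaplacian u x = dlaplacian hd x + -1 * dlaplacian (fun v => h (pp v)) x.
    by rewrite -dlaplacianZ -dlaplacianD; apply: eq_bigr => y _; rewrite !uE; ring.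
  rewrite hdh // add0r mulN1r dlaplacianE; congr (- _).
  have -> : qsum x (th x) = qsum x (fun y w1 w2 => cq x y w1 w2 * (h (pp y) - h (pp x)) +
      -1 * (phi x (dp w2) - phi x (dp w1))).
    by apply: eq_qsum => y w1 w2 _; rewrite /th; ring.
  rewrite qsumD (qsumZ _ _ (fun y w1 w2 => phi x (dp w2) - phi x (dp w1))).
  by rewrite (qsum_telescope (fun w => phi x (dp w)) nb) mulr0 addr0.
- move=> x y w1 w2 q Ux; have [_ bx] := deepP Ux; have [q1 q2 q3] := quad_close q.
  have [E1 E2] := dual_edge q; have c0 := ltW (cq_gt0 q).
  have Hh p : box (pp x) (4 * eps) p -> C1at p h hx hy.
    by move=> [p1 p2]; have [] // := H (bx p _); split; lra.
  have bb (p : R * R) : nrm (p - pp x) <= 2 * eps -> box (pp x) (4 * eps) p.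
    by move=> hp; apply: nrm_box; lra.
  have bxx : box (pp x) (4 * eps) (pp x) by apply: bb; rewrite subrr nrm0; lra.
  have := @cauchy_riemann_error R (pp x) (4 * eps) L (cq x y w1 w2) h hx hy (phi x)
    (pp x) (pp y) (dp w1) (dp w2) Hh (fun p => @phis x p Ux) (gradient_variation bx) bxx.
  move=> /(_ (bb _ q3) (bb _ _) (bb _ _) c0 E1 E2) K'.
  apply: le_trans (K' _ _) _; [lra|lra|].
  have n1 := nrm_ge1 (pp y - pp x); have n2 := nrm_ge2 (pp y - pp x).
  rewrite (_ : 4 * cq x y w1 w2 * L * nrm (pp y - pp x) =
    2 * cq x y w1 w2 * L * (nrm (pp y - pp x) + nrm (pp y - pp x))); last by ring.
  apply: ler_wpM2l; first by apply: mulr_ge0 (ltW L0); apply: mulr_ge0 c0; exact: ler0n.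
  exact: lerD.
- move=> x y w1 w2 q Ux Uy; have [q1 q2 q3] := quad_close q.
  rewrite /th cqC.
  have bb (p : R * R) : nrm (p - pp x) <= eps -> box (pp x) (4 * eps) p.
    by move=> hp; apply: nrm_box; lra.
  have := @gradient_unique R (pp x) (4 * eps) (phi x) (phi y) (fun q => - hy q) hx
    (fun p => @phis x p Ux) _ (dp w1) (dp w2) (bb _ q1) (bb _ q2).
  move=> E; have {}E : phi x (dp w2) - phi x (dp w1) = phi y (dp w2) - phi y (dp w1).
    apply: E => p [p1 p2]; apply: (Hphi y Uy).
    have n1 := nrm_ge1 (pp y - pp x); have n2 := nrm_ge2 (pp y - pp x).
    have t1 := ler_distD (pp x).1 p.1 (pp y).1; have t2 := ler_distD (pp x).2 p.2 (pp y).2.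
    rewrite (distrC (pp x).1) in t1; rewrite (distrC (pp x).2) in t2.
    rewrite /= in n1 n2; split; lra.
  rewrite E; ring.
Qed.

(** All vertices within [t d / 2] of [v] keep distance at least [d / 2] from the boundary. The
    discrete part varies by the Hoelder hypothesis, the continuous part by the gradient bound
    together with [t <= t^be]. *)
Lemma error_oscillation v x (t : R) : 0 < U v -> 0 < t -> t <= 4^-1 -> 2 * K * eps <= t * d ->
  nrm (pp x - pp v) <= t * d / 2 ->
  `|u x - u v| <= (C' + 16) * N * t `^ be.
Proof.
move=> Uv t0 t2 Kt xv; have [nb bv] := deepP Uv; have [z0 bz0] := bdry_exists nb; clear nb.
have [e0' ed' N0' d0'] := basics.
have td : t * d <= d / 4 by have := ler_wpM2r (ltW d0) t2; lra.
have far y : nrm (pp y - pp v) <= t * d / 2 -> d / 2 <= dist_bdry y.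
  move=> yv; apply: (dist_bdry_ge bz0) => z /bOm[q nq qz].
  have dq : d <= nrm (q - pp v) by rewrite leNgt; apply/negP => /nrm_box/bv.
  have := nrm_sub q (pp z) (pp v); have := nrm_sub (pp z) (pp y) (pp v); lra.
have fv : d / 2 <= dist_bdry v by apply: far; have := mulr_gt0 t0 d0; rewrite subrr nrm0; lra.
have fx := far _ xv.
have mn : d / 2 <= Num.min (dist_bdry v) (dist_bdry x) by rewrite le_min fv.
have mn0 : 0 < Num.min (dist_bdry v) (dist_bdry x) by apply: lt_le_trans mn; lra.
have := HH mesh hdh mn0; rewrite nrm_dist2 => E1.
have bm : \big[Num.max/0]_(y : V) `|hd y| <= N.
  elim/big_ind: _ => [|a b ha hb|i _]; [exact: ltW|by rewrite ge_max ha|exact: hdN].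
have p1 : (Num.max (nrm (pp x - pp v)) (K * eps) / Num.min (dist_bdry v) (dist_bdry x)) `^ be <= t `^ be.
  apply: ge0_ler_powR; rewrite ?nnegrE; first exact: ltW.
  - by rewrite divr_ge0 ?(ltW mn0) // le_max nrm_ge0.
  - exact: ltW.
  rewrite ler_pdivrMr; last exact: mn0.
  apply: le_trans (ler_wpM2l (ltW t0) mn).
  by rewrite ge_max; apply/andP; split; lra.
have h1 : `|hd x - hd v| <= C' * N * t `^ be.
  apply: le_trans E1 _; apply: ler_pM; [|exact: powR_ge0| |exact: p1].
    by apply: mulr_ge0; [exact: ltW|elim/big_ind: _ => // a b ha hb; rewrite le_max ha].
  by apply: ler_wpM2l bm; exact: ltW.
have hb : harmonic_on [set p | box (pp v) d p] h.
  by apply: harmonicS (C2harm_harmonic_on oOm H) => p; exact: bv.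
have hNb p : box (pp v) d p -> `|h p| <= N by move=> /bv; exact: hN.
have bx4 : box (pp v) (d / 4) (pp x).
  split; [have := nrm_ge1 (pp x - pp v)|have := nrm_ge2 (pp x - pp v)] => /= hh;
  apply: le_lt_trans hh _; apply: le_lt_trans xv _; lra.
have bv4 : box (pp v) (d / 4) (pp v) by split; rewrite subrr normr0; lra.
have h2 := harmonic_lip hb hNb bx4 bv4.
have h3 : 8 * N / d * (`|(pp x).1 - (pp v).1| + `|(pp x).2 - (pp v).2|) <= 16 * N * t `^ be.
  apply: le_trans (_ : 8 * N / d * (t * d) <= _).
    apply: ler_wpM2l; first by apply: divr_ge0; [lra|exact: ltW].
    by have := nrm_ge1 (pp x - pp v); have := nrm_ge2 (pp x - pp v); rewrite /=; lra.
  rewrite (_ : 8 * N / d * (t * d) = 8 * N * t); last by field; exact: lt0r_neq0.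
  have tt : t <= t `^ be by apply: ger1_powR; rewrite ?(ltW b1) //; apply/andP; split; lra.
  have := ler_wpM2l (ltW N0) tt; have : 0 <= N * t `^ be := mulr_ge0 (ltW N0) (powR_ge0 _ _).
  lra.
rewrite (_ : u x - u v = (hd x - hd v) - (h (pp x) - h (pp v))); last by rewrite !uE; ring.
apply: le_trans (ler_normB _ _) _; lra.
Qed.

(* The radial flow tested against the truncation of [U] at half its value at [v]. *)
Lemma error_flow v (t : R) : 0 < U v -> 0 < t -> t <= 4^-1 -> 2 * K * eps <= t * d ->
  64 * eps <= t * d -> (C' + 16) * N * t `^ be <= U v / 2 ->
  U v * (t * d) <= 8192 * L * D ^+ 2.
Proof.
move=> Uv t0 t2 Kt et osc; have [e0' ed' N0' d0'] := basics.
have [y0 [w0 [w0' /asboolP[F Q]]]] := posq_exists v.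
have [p0 Fp pv] := face_point Q e0.
(* [Uh] is constant on the ball of radius [t d / 2] around [v]. With [r] half of this radius, a
   vertex within [r] of [p0] and its neighbours across a face, at most [3 eps] farther from [v],
   stay in the ball. *)
pose m := U v / 2; pose Uh x := Num.min (U x) m; pose r := t * d / 4.
have r0 : 0 < r by have := mulr_gt0 t0 d0; rewrite /r; lra.
have m0 : 0 < m by rewrite /m; lra.
have td0 := mulr_gt0 t0 d0.
have Uhm x : nrm (pp x - pp v) <= t * d / 2 -> Uh x = m.
  move=> xv; have := error_oscillation Uv t0 t2 Kt xv; rewrite ler_norml => /andP[h1 _].
  apply/min_idPr; rewrite /m; move: Uv osc h1; rewrite !UE lt_max ltxx /= => Uv.
  by rewrite (max_idPr (ltW Uv)) => osc h1; rewrite le_max; apply/orP; right; lra.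
have Uhl x y : `|Uh x - Uh y| <= `|U x - U y| by exact: min_lipschitz.
have Uhv : Uh v = m by apply: Uhm; rewrite subrr nrm0; lra.
have := @flow_le R G Uh F p0 r v y0 w0 w0' Q Fp r0.
have A1 x : bdry x -> Uh x = 0.
  move=> bx; have : U x = 0 by rewrite UE; apply/max_idPl; have := shallow (or_introl bx); rewrite -uE; lra.
  by move=> Ux; rewrite /Uh Ux min_l //; exact: ltW.
have A2 x : 0 <= Uh x by rewrite le_min U0 /= ltW.
clearbody Uh.
have A3 x w : edge x w -> 16 * nrm (dp w - pp x) <= r.
  by move=> /mesh; rewrite nrm_dist2 nrmC /r; lra.
have A4 x y w1 w2 : posq x y w1 w2 -> nrm (pp y - p0) < r -> Uh y = Uh x.
  move=> q yp; have [_ _ xy] := quad_close q.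
  have yv := nrm_sub (pp y) p0 (pp v); have xv := nrm_sub (pp x) (pp y) (pp v).
  rewrite nrmC in xy; move: yp; rewrite /r => yp; rewrite (Uhm y); last by lra.
  by rewrite Uhm //; lra.
move=> /(_ A1 A2 A3 A4); rewrite Uhv => B1.
have B2 : tsum (fun x y w1 w2 => `|Uh y - Uh x| * (4 * (nrm (dp w2 - dp w1) / r))) <=
    tsum (fun x y w1 w2 => (4 / r * (8 * L)^-1) * (cq x y w1 w2 * (U y - U x) ^+ 2) +
       (4 / r * (2 * L)) * qarea x y w1 w2).
  apply: ler_tsum => x y w1 w2 q; have [-> ->] := qarea_cq q.
  set cc := cq _ _ _ _; set e := nrm _; have c0 : 0 < cc := cq_gt0 q.
  have e1 : 0 <= e := nrm_ge0 _.
  clearbody cc e; have dU : `|Uh y - Uh x| <= `|U y - U x| by exact: Uhl.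
  move: (`|Uh y - Uh x|) dU => a' dU; rewrite -(real_normK (num_real (U y - U x))).
  move: (`|U y - U x|) dU => a dU.
  have k0 : 0 <= 4 / r by apply: divr_ge0 (ltW r0); exact: ler0n.
  have hk := ler_wpM2l k0 (ler_wpM2l (ltW c0) (ler_wpM2r e1 dU)).
  rewrite (_ : a' * (4 * (cc * e / r)) = 4 / r * (cc * (a' * e))); last by ring.
  apply: le_trans hk _.
  (* The weight [8 L] balances the two terms: the energy bound [16 L^2] times the area also becomes
     [2 L] times the area. *)
  have K1 : 0 <= cc * (8 * L)^-1 * (a - 4 * L * e) ^+ 2.
    by apply: mulr_ge0 (sqr_ge0 _); apply: mulr_ge0 (ltW c0) _; rewrite invr_ge0; apply: mulr_ge0 (ltW L0); exact: ler0n.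
  have K2 : cc * (8 * L)^-1 * (a - 4 * L * e) ^+ 2 =
      (8 * L)^-1 * (cc * a ^+ 2) + 2 * L * (cc * e ^+ 2) - cc * (a * e).
    by field; exact: lt0r_neq0.
  rewrite -!mulrA -mulrDr; apply: ler_wpM2l; first exact: ler0n.
  rewrite -mulrDr; apply: ler_wpM2l; first by rewrite invr_ge0 ltW.
  by move: K1; rewrite K2 subr_ge0 -!mulrA.
have B3 := error_energy; have B4 := tsum_qarea hatD.
have B5 : tsum (fun x y w1 w2 => (4 / r * (8 * L)^-1) * (cq x y w1 w2 * (U y - U x) ^+ 2) +
       (4 / r * (2 * L)) * qarea x y w1 w2) <= 4 / r * (4 * L) * (128 * D ^+ 2).
  rewrite tsumD (tsumZ _ (fun x y w1 w2 => cq x y w1 w2 * (U y - U x) ^+ 2)) (tsumZ _ (@qarea R G)).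
  apply: le_trans (_ : 4 / r * (4 * L) * tsum (@qarea R G) <= _); last first.
    by apply: ler_wpM2l B4; apply: mulr_ge0; [apply: divr_ge0 (ltW r0)|apply: mulr_ge0 (ltW L0)]; exact: ler0n.
  have k0 : 0 <= 4 / r * (8 * L)^-1.
    apply: mulr_ge0; first by apply: divr_ge0 (ltW r0); exact: ler0n.
    by rewrite invr_ge0; apply: mulr_ge0 (ltW L0); exact: ler0n.
  have := ler_wpM2l k0 B3; move: (tsum (@qarea R G)) (tsum _) => S A.
  rewrite (_ : 4 / r * (8 * L)^-1 * (16 * L ^+ 2 * S) = 4 / r * (2 * L) * S); last first.
    by field; apply/andP; split; exact: lt0r_neq0.
  lra.
have B6 := le_trans B1 (le_trans B2 B5).
have pi2 := pi_ge2 R.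
have B7 : 4 * m <= 4 / r * (4 * L) * (128 * D ^+ 2).
  apply: le_trans B6; apply: ler_wpM2r; [exact: ltW|lra].
have E : 4 / r * (4 * L) * (128 * D ^+ 2) = 8192 * L * D ^+ 2 / (t * d) .
  by rewrite /r; field; rewrite !gt_eqF.
have td : 0 < t * d by rewrite mulr_gt0.
have Um : U v <= 4 * m.
  by rewrite /m mulrC -mulrA ler_peMr ?(ltW Uv) // -(ler_pM2l (ltr0n R 2)) mulr1 mulrA mulfV // mul1r ler_nat.
by rewrite -(ler_pdivlMr _ _ td) -E; exact: le_trans Um B7.
Qed.

(** With [s = U v / (2 N)], the flow estimate [s t <= const q^(1/4)] at the radius [t] of order
    [s^(1 / be)] bounds [s^(1 + 1 / be)], and [b = be / (1 + be)] is the inverse of this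
    exponent. *)
Lemma deep_bound (q : R) v : 0 < q -> q <= 1 -> 0 < D -> eps = q * D -> d = D * q `^ 4^-1 ->
  L = 4096 * N * eps / d ^+ 2 ->
  U v <= 2 * N * (C' + 16) * (4096 * 8192 + (2 * K + 64)) * q `^ (be / (1 + be) / 4).
Proof.
move=> q0 q1 D0 eq_ dq Leq.
(* The two numerals are generalised; only that they are at least 1 matters from here on. *)
have P1 : 1 <= (4096 : R) by rewrite ler1n.
have Q1 : 1 <= (8192 : R) by rewrite ler1n.
have Fl := @error_flow v; move: P1 Q1 Fl Leq; move: (4096 : R) (8192 : R) => P Q P1 Q1 Fl Leq.
set b := be / (1 + be).
have qb : 0 <= q `^ (b / 4) := powR_ge0 _ _.
have A0 : 0 < C' + 16 by have := C0; lra.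
have PQ : 1 <= P * Q by apply: mulr_ege1.
have K64 : 64 <= 2 * K + 64 by have := K0; lra.
have [Uv|Uv] := ltP 0 (U v); last first.
  apply: le_trans Uv _; apply: mulr_ge0 qb; apply: mulr_ge0; last by lra.
  by apply: mulr_ge0 (ltW A0); have := N0; lra.
have [nb bv] := deepP Uv; clear nb.
set A := C' + 16 in A0 *; set K1 := 2 * K + 64 in K64 *.
pose s := U v / (2 * N).
have N20 : 0 < 2 * N by have := N0; lra.
have s0 : 0 < s by rewrite divr_gt0.
have Us : U v = 2 * N * s by rewrite /s mulrC divfK ?gt_eqF.
have s1 : s <= 1.
  have vO : Om (pp v) by apply: bv; split; rewrite subrr normr0.
  rewrite /s ler_pdivrMr // mul1r UE ge_max (ltW N20) uE /=.
  have := hN vO; have := hdN v; rewrite !ler_norml => /andP[_ h1] /andP[h2 _].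
  by have := eta0; lra.
have A16 : 16 <= A by have := C0; rewrite /A; lra.
have sA0 : 0 < s / A by rewrite divr_gt0.
have sA : s / A <= 4^-1 by rewrite ler_pdivrMr //; lra.
have bV : 1 <= be^-1 by rewrite invf_ge1 // ltW.
(* The value for which the oscillation bound [A N t^be] equals [U v / 2]. *)
pose t := (s / A) `^ be^-1.
have t0 : 0 < t by exact: powR_gt0.
have t4 : t <= 4^-1.
  have sl : s / A <= 1 by lra.
  by apply: le_trans sA; apply: ge1r_powR => //; rewrite sA0.
have tb : t `^ be = s / A by rewrite -powRrM mulVf ?gt_eqF // powRr1 // ltW.
have D4 : 0 < q `^ 4^-1 by exact: powR_gt0.
have main : s / A <= (P * Q + K1) * q `^ (b / 4).
  have bb : 0 < b by rewrite divr_gt0 // ltr_wpDl.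
  have b1' : b <= 1 by rewrite ler_pdivrMr ?mul1r; have := b0; lra.
  (* If [t d] falls below a multiple of the mesh, then [t] is at most of order [q^(3/4)], and the
     claim already follows from the choice of [t]. *)
  have [ct|ct] := leP (K1 * eps) (t * d).
    have Ke : 2 * K * eps <= t * d by apply: le_trans ct; have := e0; rewrite /K1; lra.
    have Ke2 : 64 * eps <= t * d.
      by apply: le_trans ct; apply: ler_wpM2r; [exact: ltW|].
    have osc : (C' + 16) * N * t `^ be <= U v / 2.
      rewrite tb Us -/A (_ : A * N * (s / A) = N * s); last by field; rewrite gt_eqF.
      by lra.
    have := Fl t Uv t0 t4 Ke Ke2 osc; rewrite Us Leq eq_ => F1.
    have st : s * t <= Q * P * q `^ 4^-1.
      have e3 : q = (q `^ 4^-1) ^+ 4 by rewrite -powR_mulrn ?(ltW D4) // -powRrM mulVf // powRr1 // ltW.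
      have E : Q * (P * N * (q * D) / d ^+ 2) * D ^+ 2 = (N * d) * (Q * P * q `^ 4^-1).
        rewrite dq {1}e3; field; by rewrite !gt_eqF.
      move: F1; rewrite E (_ : 2 * N * s * (t * d) = N * d * (2 * (s * t))); last by ring.
      rewrite ler_pM2l ?mulr_gt0 //; have := mulr_gt0 s0 t0; lra.
    have st2 : (s / A) `^ b^-1 <= P * Q * q `^ 4^-1.
      have -> : b^-1 = 1 + be^-1 by rewrite /b; field; rewrite !gt_eqF // addr_gt0.
      rewrite powRD; last by rewrite (gt_eqF sA0) implybT.
      rewrite powRr1 ?(ltW sA0) // -/t.
      apply: le_trans (_ : s * t <= _); last by rewrite (mulrC P).
      apply: ler_wpM2r; first exact: ltW.
      by rewrite ler_pdivrMr // ler_peMr ?(ltW s0) //; lra.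
    have : ((s / A) `^ b^-1) `^ b <= (P * Q * q `^ 4^-1) `^ b.
      apply: ge0_ler_powR st2; rewrite ?nnegrE ?powR_ge0 ?(ltW bb) //.
      by apply: mulr_ge0; [lra|exact: ltW].
    rewrite -powRrM mulVf ?gt_eqF // powRr1 ?(ltW sA0) // => h1; apply: le_trans h1 _.
    rewrite powRM ?(ltW D4) //; last by lra.
    rewrite -powRrM (mulrC 4^-1); apply: ler_wpM2r => //.
    by apply: le_trans (ler1_powR _ _) _ => //; lra.
  have tK : t <= K1 * q `^ (3 / 4).
    have e3 : q = q `^ 4^-1 * q `^ (3 / 4).
      rewrite -powRD; last by rewrite (gt_eqF q0) implybT.
      by rewrite (_ : 4^-1 + 3 / 4 = 1) ?powRr1 ?(ltW q0) //; field.
    have EE : K1 * (q * D) = K1 * q `^ (3 / 4) * (D * q `^ 4^-1) by rewrite {1}e3; ring.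
    by move: ct; rewrite dq eq_ EE => /ltW; rewrite ler_pM2r // mulr_gt0.
  have : t `^ be <= (K1 * q `^ (3 / 4)) `^ be.
    apply: ge0_ler_powR tK; rewrite ?nnegrE ?(ltW b0) ?(ltW t0) //.
    by apply: mulr_ge0; [lra|exact: powR_ge0].
  rewrite tb => h1; apply: le_trans h1 _.
  rewrite powRM ?powR_ge0 //; last by lra.
  rewrite -powRrM; apply: ler_pM; rewrite ?powR_ge0 //.
    by apply: le_trans (ler1_powR _ _) _; have := b1; lra.
  apply: ger_powR; first by rewrite q0.
  have bbe : b <= be.
    rewrite /b ler_pdivrMr; last by have := b0; lra.
    by have := mulr_gt0 b0 b0; lra.
  by have := b0; lra.
move: main; rewrite ler_pdivrMr // => h1; rewrite Us.
apply: le_trans (ler_wpM2l (ltW N20) h1) _.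
by rewrite le_eqVlt; apply/orP; left; apply/eqP; ring.
Qed.

End Estimate.
End Deep.

(** * The exponent *)

Section LambdaBounds.
Context {R : realType}.
Variables (al be : R).
Hypotheses (a0 : 0 < al) (a1 : al < 1) (b0 : 0 < be) (b1 : be < 1).
Let a := Num.min al be.
Let b := be / (1 + be).

Let a_gt0 : 0 < a. Proof. by rewrite /a lt_min a0 b0. Qed.
Let a_le : a <= be. Proof. by rewrite /a ge_min lexx orbT. Qed.
Let b_gt0 : 0 < b. Proof. by have := b0 => h; rewrite /b divr_gt0 //; lra. Qed.
Let b_lt : b < 2^-1.
Proof. by have := b0; have := b1 => h1 h0; rewrite /b ltr_pdivrMr; lra. Qed.

Lemma Xi_ge0 (r s : R) : 0 <= r -> 0 <= Xi al be r s.
Proof. by move=> r0; rewrite /Xi le_max; apply/orP; left; rewrite mulr_ge0 // ltW. Qed.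

Lemma Xi_le1 (r s : R) : 0 <= r -> r < s -> s < 1 -> Xi al be r s <= 1.
Proof.
move=> r0 rs s1; have [h1 h2 h3 h4] := And4 a_gt0 a_le b0 b1.
rewrite /Xi -/a ge_max; apply/andP; split; first by nra.
by rewrite ge_min; apply/orP; left; nra.
Qed.

Let ubX (r : R) : 0 <= r -> has_ubound [set Xi al be r s | s in `]r, 1[%classic].
Proof.
by move=> r0; exists 1 => ? [s /=]; rewrite in_itv /= => /andP[rs s1] <-; exact: Xi_le1.
Qed.

Let sup_ge0 (r : R) : 0 <= r -> r < 1 -> 0 <= sup [set Xi al be r s | s in `]r, 1[%classic].
Proof.
move=> r0 r1; apply: le_trans (Xi_ge0 ((r + 1) / 2) r0) _.
apply: (ub_le_sup (ubX r0)); exists ((r + 1) / 2) => //=; rewrite in_itv /=.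
by apply/andP; split; lra.
Qed.

Lemma lambda_ge0 : 0 <= lambda al be.
Proof.
apply: lb_le_inf; first by eexists; exists 0 => //=; rewrite in_itv /= lexx ltr01.
by move=> ? [r /=]; rewrite in_itv /= => /andP[r0 r1] <-; exact: sup_ge0.
Qed.

Lemma lambda_le (r c : R) : 0 <= r -> r < 1 ->
  (forall s, r < s -> s < 1 -> Xi al be r s <= c) -> lambda al be <= c.
Proof.
move=> r0 r1 H; apply: le_trans (_ : sup [set Xi al be r s | s in `]r, 1[%classic] <= _).
  apply: ge_inf; last by exists r => //=; rewrite in_itv /= r0.
  by exists 0 => ? [t /=]; rewrite in_itv /= => /andP[t0 t1] <-; exact: sup_ge0.
apply: ge_sup.
  by exists (Xi al be r ((r + 1) / 2)), ((r + 1) / 2) => //=; rewrite in_itv /=; apply/andP; split; lra.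
by move=> ? [s /=]; rewrite in_itv /= => /andP[rs s1] <-; exact: H.
Qed.

(** At [r = 0] the last entry of the minimum is at most [a / 4] for [s <= 1/4]; for larger [s] the
    middle entry is negative, because [b < 1/2]. *)
Lemma lambda_le_min : lambda al be <= a / 4.
Proof.
have [h1 h2 h3 h4] := And4 a_gt0 a_le b_gt0 b_lt.
apply: (@lambda_le 0) => // s s0 s1.
rewrite /Xi -/a -/b mulr0 mul0r addr0 ge_max; apply/andP; split; first by lra.
rewrite ge_min; apply/orP; right; rewrite ge_min.
have [s4|s4] := leP s 4^-1; apply/orP; [right|left]; nra.
Qed.

(* The choice of [r] for which [be * (s - r)] and [b - (2 + b) * s + r / 2] agree at [s = 2 * r]. *)
Let lambda_le_ratio : lambda al be <= be * (b / (7 / 2 + 2 * b + be)).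
Proof.
have [h1 h2 h3 h4] := And4 a_gt0 a_le b_gt0 b_lt; have h5 := b0; have h6 := b1.
set w := 7 / 2 + 2 * b + be; have w0 : 0 < w by rewrite /w; lra.
pose r := b / w; have rw : r * w = b by rewrite /r divfK // gt_eqF.
have r0 : 0 < r by rewrite divr_gt0.
have r1 : r < 1 by rewrite /r ltr_pdivrMr // /w; lra.
apply: (@lambda_le r) => // [|s rs s1]; first exact: ltW.
rewrite /Xi -/a -/b -/r ge_max; apply/andP; split; first by rewrite ler_pM2r.
have [s2|s2] := leP s (2 * r); rewrite ge_min; apply/orP; [left|right].
  by rewrite ler_pM2l //; lra.
rewrite ge_min; apply/orP; left; move: rw; rewrite /w => rw.
have : b * (2 * r) <= b * s by rewrite ler_pM2l // ltW.
lra.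
Qed.

Lemma lambda_le_b : lambda al be <= b / 4.
Proof.
have [h3 h4] := conj b_gt0 b_lt; have h5 := b0; have h6 := b1.
apply: le_trans lambda_le_ratio _; rewrite mulrA ler_pdivrMr; last by lra.
have : be * b <= b by rewrite ler_piMl // ltW.
have : 0 <= b * b by rewrite mulr_ge0 // ltW.
lra.
Qed.

Lemma lambda_le_3_32 : lambda al be <= 3 / 32.
Proof.
have [h3 h4] := conj b_gt0 b_lt; have h5 := b0; have h6 := b1.
apply: le_trans lambda_le_ratio _; rewrite mulrA ler_pdivrMr; last by lra.
have : be * b <= be / 2 by rewrite ler_pM2l // ltW.
have : be * b <= b by rewrite ler_piMl // ltW.
lra.
Qed.

End LambdaBounds.

(** * The error estimate *)

Section PlaneDomains.
Context {R : realType}.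
Implicit Types (p q z : R * R) (A Om : set (R * R)).

(** Passing to the closure matters because vertices of the map may lie on the frontier of the
    domain. *)
Lemma diam_bound A p q : bounded_set A -> closure A p -> closure A q -> nrm (p - q) <= diam A.
Proof.
move=> /bounded_set2P[M M0 HM] cp cq.
have ub : has_ubound [set dist2 p.1 p.2 | p in A `*` A].
  exists (4 * M) => ? [[a b] /= [/HM[a1 a2] /HM[b1 b2]] <-]; rewrite nrm_dist2.
  apply: le_trans (nrm_le12 _) _ => /=.
  have := ler_normB a.1 b.1; have := ler_normB a.2 b.2; rlra.
apply/ler_addgt0Pr => e e0; have e4 : 0 < e / 4 by rlra.
have [p' Ap [p1 p2]] := (closure_box _ _).1 cp _ e4.
have [q' Aq [q1 q2]] := (closure_box _ _).1 cq _ e4.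
have h1 : nrm (p' - q') <= diam A by apply: (ub_le_sup ub); exists (p', q').
have := nrm_sub p p' q; have := nrm_sub p' q' q.
have := nrm_le12 (p' - p); have := nrm_le12 (q' - q); rewrite /= (nrmC p p') => *; rlra.
Qed.

Lemma diam_gt0 A : open A -> bounded_set A -> A !=set0 -> 0 < diam A.
Proof.
move=> oA bA [p Ap]; have [e e0 He] := open_box oA Ap.
have Aq : A (p.1 + e / 2, p.2).
  by apply: He; split; rewrite /= ?subrr ?normr0 // addrAC subrr add0r gtr0_norm; rlra.
have := diam_bound bA (subset_closure Aq) (subset_closure Ap).
by apply: lt_le_trans; apply: lt_le_trans (nrm_ge1 _); rewrite /= addrAC subrr add0r gtr0_norm; rlra.
Qed.

Lemma frontier_between A p q : A p -> ~ A q ->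
  exists2 z, frontier A z & nrm (z - p) <= nrm (q - p).
Proof.
move=> Ap nq; have [z [[s] ]] : segment2 p q `&` frontier A !=set0.
  apply: connected_frontier; first exact: connected_segment2.
    by exists p; split => //; exact: segment2_l.
  by exists q; split => //; exact: segment2_r.
rewrite /= in_itv /= => /andP[s0 s1] <- fz; exists ((1 - s) *: p + s *: q) => //.
have -> : (1 - s) *: p + s *: q - p = s *: (q - p).
  by apply: injective_projections => /=; rewrite /GRing.scale /=; ring.
by rewrite nrmZ ger0_norm // ler_piMl // nrm_ge0.
Qed.

Lemma near_frontier A p (eps : R) : frontier A !=set0 -> 0 < eps -> dist_set p (frontier A) <= eps ->
  exists2 z, frontier A z & nrm (z - p) <= 2 * eps.
Proof.
move=> [z0 f0] e0 de; apply: contrapT => no.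
suff : 2 * eps <= dist_set p (frontier A) by rlra.
apply: lb_le_inf; first by exists (dist2 p z0); exists z0.
move=> ? [z fz <-]; rewrite nrm_dist2 nrmC leNgt; apply/negP => /ltW h.
by apply: no; exists z.
Qed.

Lemma frontier_nonempty A : bounded_set A -> A !=set0 -> frontier A !=set0.
Proof.
move=> /bounded_set2P[M M0 HM] [p Ap].
have nq : ~ A (M + 1, 0) by move=> /HM[/=]; rewrite gtr0_norm; rlra.
by have [z fz _] := frontier_between Ap nq; exists z.
Qed.

Lemma norm_le_sides (x y z : R) : y - x <= z -> - y - x <= z -> `|y| <= x + z.
Proof. by move=> h1 h2; rewrite ler_norml; apply/andP; split; rlra. Qed.

Lemma C2harmN A (h hx hy hxx hxy hyx hyy : R * R -> R) : C2harm A h hx hy hxx hxy hyx hyy ->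
  C2harm A (fun p => -1 * h p + 0) (fun p => -1 * hx p) (fun p => -1 * hy p)
    (fun p => -1 * hxx p) (fun p => -1 * hxy p) (fun p => -1 * hyx p) (fun p => -1 * hyy p).
Proof.
move=> H p /H[h1 h2 h3 h4]; split; first exact: C1_affine.
- have := C1_affine (-1) 0 h2; rewrite (_ : (fun q => _) = fun p => -1 * hx p) //.
  by apply/funext => x; rewrite addr0.
- have := C1_affine (-1) 0 h3; rewrite (_ : (fun q => _) = fun p => -1 * hy p) //.
  by apply/funext => x; rewrite addr0.
by rewrite -mulrDr h4 mulr0.
Qed.

End PlaneDomains.

(** * Comparison of the two solutions *)

Section Comparison.
Context {R : realType}.
Variables (C C' K be : R).
Hypotheses (C0 : 0 < C) (C'0 : 0 < C') (K0 : 0 < K) (be0 : 0 < be) (be1 : be < 1).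
Hypotheses (HB : weak_beurling C K be) (HH : hoelder_harmonic C' K be).
Variables (Om : set (R * R)) (g h hx hy hxx hxy hyx hyy : R * R -> R) (al : R).
Variables (G : orthodiagonal_map R) (eps : R) (hd : primal_vertex G -> R).
Notation V := (primal_vertex G).
Notation pp := (@ppos R G).
Hypotheses (oOm : open Om) (bOm : bounded_set Om) (sOm : simply_connected Om) (neOm : Om !=set0).
Hypotheses (al0 : 0 < al) (al1 : al < 1) (e0 : 0 < eps) (mesh : mesh_le G eps).
Hypothesis hatO : hat_domain G `<=` Om.
Hypothesis hatF : forall z, frontier (hat_domain G) z -> dist_set z (frontier Om) <= eps.
Hypotheses (H : C2harm Om h hx hy hxx hxy hyx hyy) (ch : {within closure Om, continuous h}).
Hypothesis hg : forall p, frontier Om p -> h p = g p.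
Hypothesis hdh : dharmonic hd.
Hypothesis hdg : forall x, bdry x -> hd x = g (pp x).
Variables (A N : R).
Hypotheses (A0 : 0 <= A) (N0 : 0 < N) (gN : forall p, `|g p| <= N).
Hypothesis gA : forall p q, `|g p - g q| <= A * nrm (p - q) `^ al.
Let D := diam Om.

Let D0 : 0 < D. Proof. exact: diam_gt0. Qed.

Lemma closure_vertex (v : V) : closure Om (pp v).
Proof. by apply: closure_subset hatO _ _; exact: closure_hat. Qed.

Lemma harmonic_sup p : closure Om p -> `|h p| <= N.
Proof.
apply: (harmonic_bound oOm bOm (C2harm_harmonic_on oOm H) ch) => z fz.
by rewrite hg.
Qed.

Lemma discrete_sup (v : V) : `|hd v| <= N.
Proof.
have h1 : hd v <= N.
  apply: (@discrete_max_principle R G hd N) => x; first by move=> /hdh ->.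
  by move=> bx; rewrite hdg //; apply: le_trans (ler_norm _) _; exact: gN.
have h2 : -1 * hd v <= N.
  apply: (@discrete_max_principle R G (fun v => -1 * hd v) N) => x.
    by move=> nx; rewrite dlaplacianZ hdh // mulr0.
  move=> bx; rewrite hdg // mulN1r; apply: le_trans (ler_norm _) _; rewrite normrN; exact: gN.
by rewrite ler_norml; apply/andP; split; lra.
Qed.

Lemma bdry_frontier (v : V) : bdry v -> exists2 z, frontier Om z & nrm (z - pp v) <= 2 * eps.
Proof.
move=> bv; apply: near_frontier e0 _; first exact: frontier_nonempty.
apply: hatF; split; first exact: closure_hat.
have oh : open (hat_domain G) by rewrite hat_domainE; apply: closed_openC; exact: closed_closure.
rewrite (interior_id (hat_domain G)).1 // hat_domainE; move/bdryE: bv => cb nb; exact: nb.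
Qed.

Variables (q d dl : R) (n : nat).
Hypotheses (qE : q = eps / D) (q1 : q <= 1) (dE : d = D * q `^ 4^-1) (ed : 128 * eps <= d).
Hypotheses (dlE : dl = (3 + K) * d) (nE : D < d * 2 ^+ n.+1).

(** The bound in the layer, one term for each step from [hd v] to [h v]: to [g] at [v] by
    [layer_cake], to [g] at a frontier point within [2 d], and from there to [h] by
    [boundary_holder]. *)
Let X := A * dl `^ al * (1 + 2 * C * \sum_(k < n.+1) 2 `^ (k%:R * (al - be))) +
  A * (2 * d) `^ al + Cbd * (A * D `^ al + N) * (2 * d / D) `^ Num.min al (3 / 8).

Let d0 : 0 < d. Proof. by have := e0; have := ed; lra. Qed.
Let dl0 : 0 < dl. Proof. by rewrite dlE mulr_gt0 // addr_gt0. Qed.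
Let X1 : 0 <= A * dl `^ al * (1 + 2 * C * \sum_(k < n.+1) 2 `^ (k%:R * (al - be))).
Proof.
apply: mulr_ge0; first by apply: mulr_ge0 (powR_ge0 _ _).
apply: addr_ge0 => //; apply: mulr_ge0; first by apply: mulr_ge0; [|exact: ltW].
by apply: sumr_ge0 => k _; exact: powR_ge0.
Qed.
Let X3 : 0 <= Cbd * (A * D `^ al + N) * (2 * d / D) `^ Num.min al (3 / 8).
Proof.
apply: mulr_ge0 (powR_ge0 _ _); apply: mulr_ge0; first exact: ltW (@Cbd_gt0 R).
by apply: addr_ge0; [apply: mulr_ge0 (powR_ge0 _ _)|exact: ltW].
Qed.

Lemma continuous_layer p z : Om p -> frontier Om z -> nrm (z - p) <= 2 * d ->
  `|g p - h p| <= A * (2 * d) `^ al +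
     Cbd * (A * D `^ al + N) * (2 * d / D) `^ Num.min al (3 / 8).
Proof.
move=> Op fz zp; have [cz nz] := (frontier_open _ oOm).1 fz.
have pz : nrm (p - z) <= D by apply: diam_bound => //; exact: subset_closure.
have h1 : `|h p - g z| <= Cbd * (A * D `^ al + N) * (nrm (p - z) / D) `^ Num.min al (3 / 8).
  apply: (boundary_holder oOm bOm sOm ch H nz A0 N0 D0 al0 (ltW al1)) => // w fw; rewrite hg //.
have h2 : (nrm (p - z) / D) `^ Num.min al (3 / 8) <= (2 * d / D) `^ Num.min al (3 / 8).
  apply: ge0_ler_powR; rewrite ?nnegrE.
  - by rewrite le_min (ltW al0) /= divr_ge0.
  - exact: divr_ge0 (nrm_ge0 _) (ltW D0).
  - by apply: divr_ge0 (ltW D0); have := d0; lra.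
  by apply: ler_wpM2r; [rewrite invr_ge0 ltW|rewrite nrmC].
have h3 : `|g p - g z| <= A * (2 * d) `^ al.
  apply: le_trans (gA _ _) _; apply: ler_wpM2l => //.
  apply: ge0_ler_powR; rewrite ?nnegrE ?(ltW al0) ?nrm_ge0 //; first by have := d0; lra.
  by rewrite nrmC.
have h4 : Cbd * (A * D `^ al + N) * (nrm (p - z) / D) `^ Num.min al (3 / 8) <=
    Cbd * (A * D `^ al + N) * (2 * d / D) `^ Num.min al (3 / 8).
  apply: ler_wpM2l => //; apply: mulr_ge0; first exact: ltW (@Cbd_gt0 R).
  by apply: addr_ge0; [apply: mulr_ge0 (powR_ge0 _ _)|exact: ltW].
rewrite (_ : g p - h p = (g p - g z) - (h p - g z)); last by ring.
apply: le_trans (ler_normB _ _) _; exact: lerD h3 (le_trans h1 h4).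
Qed.

(** A point of the box outside [Om] gives a frontier point within [2 d] and, by [near_bdry], a
    boundary vertex within [3 d]; the radius [dl = (3 + K) d] covers this distance as well as
    [K eps]. *)
Lemma shallow_bound (v : V) : bdry v \/ ~ (box (pp v) d `<=` Om) -> `|hd v - h (pp v)| <= X.
Proof.
have d1 := d0; have eps0 := e0; have ed1 := ed.
have Kdl : K * eps <= dl.
  rewrite dlE mulrDl; have : K * eps <= K * d by rewrite ler_pM2l //; lra.
  lra.
have zD (y : V) : bdry y -> nrm (pp y - pp v) <= D.
  by move=> _; apply: (diam_bound bOm); exact: closure_vertex.
have Dn : D < dl * 2 ^+ n.+1.
  apply: lt_le_trans nE _; rewrite ler_pM2r ?exprn_gt0 // dlE.
  have := mulr_gt0 K0 d0; lra.
have fb (y : V) : bdry y -> `|hd y - g (pp v)| <= A * nrm (pp y - pp v) `^ al.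
  by move=> b_y; rewrite hdg.
have d3 : 3 * d <= dl by rewrite dlE ler_pM2r // lerDl ltW.
have [bv _|nb] := pselect (bdry v).
  rewrite hdg //; have [z fz zv] := bdry_frontier bv.
  have [Ov|nO] := pselect (Om (pp v)).
    have zd : nrm (z - pp v) <= 2 * d by apply: le_trans zv _; lra.
    apply: le_trans (continuous_layer Ov fz zd) _.
    by rewrite /X -addrA lerDr.
  (* A boundary vertex outside [Om] lies on its frontier, where both solutions equal [g]. *)
  have fv : frontier Om (pp v) by apply/(frontier_open _ oOm); split=> //; exact: closure_vertex.
  rewrite hg // subrr normr0; apply: addr_ge0 X3; apply: addr_ge0 X1 _.
  exact: mulr_ge0 (powR_ge0 _ _).
move=> [//|nbx]; have [w [w1 w2] nw] : exists2 w, box (pp v) d w & ~ Om w.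
  by apply: contrapT => no; apply: nbx => w bw; apply: contrapT => nw; apply: no; exists w.
have hv : hat_domain G (pp v) by rewrite hat_domainE => /bdryE.
have LC dd := @layer_cake R G C K be al eps dl D A (g (pp v)) v hd n HB C0 be0 al0 (ltW al1) mesh nb
  dl0 dd Kdl A0 hdh zD fb Dn.
clear nb nbx; have Ov := hatO hv.
have [z fz zv] := frontier_between Ov nw; clear nw.
have wd : nrm (w - pp v) <= 2 * d by apply: le_trans (nrm_le12 _) _ => /=; lra.
have zd := le_trans zv wd.
have [_ nz] := (frontier_open _ oOm).1 fz.
have [b bb bz] := near_bdry e0 mesh hv (fun hz => nz (hatO hz)).
clear nz; have db : dist_bdry v <= 3 * d.
  apply: le_trans (_ : nrm (pp b - pp v) <= _); last by lra.
  rewrite nrmC -nrm_dist2; apply: ge_inf; last by exists (pp b) => //; exists b.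
  by exists 0 => ? [y _ <-]; exact: sqrtr_ge0.
have h1 := LC (le_trans db d3).
have h2 := continuous_layer Ov fz zd.
rewrite (_ : hd v - h (pp v) = (hd v - g (pp v)) + (g (pp v) - h (pp v))); last by ring.
by apply: le_trans (ler_normD _ _) _; rewrite /X -addrA; exact: lerD h1 h2.
Qed.

(** [deep_bound] is one-sided, being about an error truncated from below; it is applied to both
    solutions and to their negatives. *)
Lemma error_bound (v : V) : `|hd v - h (pp v)| <= X +
  2 * N * (C' + 16) * (4096 * 8192 + (2 * K + 64)) * q `^ (be / (1 + be) / 4).
Proof.
have X0 : 0 <= X by apply: addr_ge0 X3; apply: addr_ge0 X1 _; exact: mulr_ge0 (powR_ge0 _ _).
have q0 : 0 < q by rewrite qE divr_gt0.
have eE : eps = q * D by rewrite qE divfK // gt_eqF.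
pose L := 4096 * N * eps / d ^+ 2.
have L0 : 0 < L by apply: divr_gt0; [have := mulr_gt0 N0 e0; lra|exact: exprn_gt0].
have [c Oc] := neOm.
have hatD p : hat_domain G p -> `|p.1 - c.1| <= D /\ `|p.2 - c.2| <= D.
  move=> /hatO Op; have h1 : nrm (p - c) <= D by apply: diam_bound => //; exact: subset_closure.
  by split; apply: le_trans h1; [exact: (nrm_ge1 (p - c))|exact: (nrm_ge2 (p - c))].
have bO (z : V) : bdry z -> exists2 w, ~ Om w & nrm (w - pp z) <= 2 * eps.
  by move=> /bdry_frontier[w /(frontier_open _ oOm)[_ nw] wz]; exists w.
have hO p : Om p -> `|h p| <= N by move=> Op; apply: harmonic_sup; exact: subset_closure.
have side1 : hd v - h (pp v) - X <=
    2 * N * (C' + 16) * (4096 * 8192 + (2 * K + 64)) * q `^ (be / (1 + be) / 4).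
  pose u (x : V) := hd x - h (pp x).
  have sh (x : V) : bdry x \/ ~ (box (pp x) d `<=` Om) -> hd x - h (pp x) <= X.
    by move=> hx'; apply: le_trans (ler_norm _) (shallow_bound hx').
  have := @deep_bound R G Om h hx hy hxx hxy hyx hyy eps d D N X L C' K be c hd oOm H e0 mesh ed N0
    L0 (lexx _) hO discrete_sup hdh hatD bO C'0 K0 be0 be1 HH X0 sh u
    (fun x => Num.max 0 (u x - X)) (fun=> erefl) (fun=> erefl) q v q0 q1 D0 eE dE erefl.
  by apply: le_trans; rewrite le_max lexx orbT.
have side2 : - (hd v - h (pp v)) - X <=
    2 * N * (C' + 16) * (4096 * 8192 + (2 * K + 64)) * q `^ (be / (1 + be) / 4).
  pose hn p := -1 * h p + 0; pose hdn (x : V) := -1 * hd x.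
  pose u (x : V) := hdn x - hn (pp x).
  have uE x : u x = - (hd x - h (pp x)) by rewrite /u /hn /hdn; ring.
  have sh (x : V) : bdry x \/ ~ (box (pp x) d `<=` Om) -> hdn x - hn (pp x) <= X.
    move=> hx'; rewrite -/(u x) uE; apply: le_trans (ler_norm _) _; rewrite normrN.
    exact: shallow_bound hx'.
  have hnN p : Om p -> `|hn p| <= N by rewrite /hn addr0 mulN1r normrN; exact: hO.
  have hdnN x : `|hdn x| <= N by rewrite /hdn mulN1r normrN; exact: discrete_sup.
  have hdnh : dharmonic hdn by move=> x nx; rewrite dlaplacianZ hdh // mulr0.
  have := @deep_bound R G Om hn _ _ _ _ _ _ eps d D N X L C' K be c hdn oOm (C2harmN H) e0 mesh ed N0
    L0 (lexx _) hnN hdnN hdnh hatD bO C'0 K0 be0 be1 HH X0 sh u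
    (fun x => Num.max 0 (u x - X)) (fun=> erefl) (fun=> erefl) q v q0 q1 D0 eE dE erefl.
  by apply: le_trans; rewrite uE le_max lexx orbT.
exact: norm_le_sides side1 side2.
Qed.

End Comparison.

(** * The three regimes of the exponents *)

Section Regimes.
Context {R : realType}.
Implicit Types (x y q al be la : R).

Lemma dyadic_below x : 1 <= x -> exists n, 2 ^+ n <= x < 2 ^+ n.+1.
Proof.
move=> x1; have ex : exists m, x < 2 ^+ m.
  exists (Num.truncn x).+1; apply: lt_le_trans (truncnS_gt x) _.
  by rewrite -natrX ler_nat ltnW // ltn_expl.
case: (ex_minnP ex) => -[|m] hm minm; first by rewrite expr0 in hm; rlra.
by exists m; rewrite hm andbT leNgt; apply/negP => /minm; rewrite ltnn.
Qed.

Lemma ln2_ge : 2^-1 <= ln (2 : R).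
Proof.
have := @le_ln1Dx R (- 2^-1); rewrite (_ : 1 + - 2^-1 = 2^-1); last by field.
rewrite lnV ?posrE // => h; have : - ln 2 <= - 2^-1 :> R by apply: h; rlra.
rlra.
Qed.

Lemma powR_ratio q (al la : R) : 0 < q -> q <= 1 -> la <= al / 4 -> (q `^ 4^-1) `^ al <= q `^ la.
Proof. by move=> q0 q1 h; rewrite -powRrM; apply: ger_powR; [rewrite q0|rlra]. Qed.

Lemma powR_le_base (c al : R) : 1 <= c -> al <= 1 -> c `^ al <= c.
Proof. exact: ler1_powR. Qed.

Variables (C C' K be : R).
Hypotheses (C0 : 0 < C) (C'0 : 0 < C') (K0 : 0 < K) (be0 : 0 < be) (be1 : be < 1).
Variables (al D q A N la B : R) (n : nat).
Hypotheses (al0 : 0 < al) (al1 : al < 1) (D0 : 0 < D) (q0 : 0 < q) (q1 : q <= 1).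
Hypotheses (A0 : 0 <= A) (N0 : 0 <= N) (B0 : 0 <= B).
Hypotheses (la_min : la <= Num.min al be / 4) (la3 : la <= 3 / 32) (lab : la <= be / (1 + be) / 4).
Hypotheses (n1 : 2 ^+ n <= (q `^ 4^-1)^-1).
Let d := D * q `^ 4^-1.
Let dl := (3 + K) * d.
Let S := \sum_(k < n.+1) 2 `^ (k%:R * (al - be)).
Let X := A * dl `^ al * (1 + 2 * C * S) +
  A * (2 * d) `^ al + Cbd * (A * D `^ al + N) * (2 * d / D) `^ Num.min al (3 / 8).
Let c2 : R := 2 + 2 * Cbd.
Let c1 : R := 2 * Cbd + 2 * (C' + 16) * B.

Let y0 : 0 < q `^ 4^-1. Proof. exact: powR_gt0. Qed.
Let d0 : 0 < d. Proof. exact: mulr_gt0. Qed.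
Let AD : 0 <= A * D `^ al. Proof. exact: mulr_ge0 (powR_ge0 _ _). Qed.
Let ql : 0 <= q `^ la. Proof. exact: powR_ge0. Qed.
Let la_al : la <= al / 4.
Proof. by apply: le_trans la_min _; rewrite ler_pM2r // ge_min lexx. Qed.
Let la_be : la <= be / 4.
Proof. by apply: le_trans la_min _; rewrite ler_pM2r // ge_min lexx orbT. Qed.

(** The regimes differ only in the dyadic sum [S]; [W] isolates its contribution. The other terms
    have exponents at least [la] by the bounds on [lambda]. *)
Lemma regime_bound (W : R) : q `^ (al / 4) * (1 + 2 * C * S) <= W * q `^ la ->
  X + 2 * N * (C' + 16) * B * q `^ (be / (1 + be) / 4) <=
  (N * c1 + A * D `^ al * ((3 + K) * W + c2)) * q `^ la.
Proof.
move=> HW; have K3 : 1 <= 3 + K by have := K0; lra.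
have S0 : 0 <= S by apply: sumr_ge0 => k _; exact: powR_ge0.
have T1 : A * dl `^ al * (1 + 2 * C * S) <= A * D `^ al * ((3 + K) * W) * q `^ la.
  have -> : dl `^ al = (3 + K) `^ al * (D `^ al * q `^ (al / 4)).
    rewrite /dl powRM ?(ltW d0) //; last by lra.
    by rewrite /d powRM ?(ltW D0) ?(ltW y0) // -powRrM (mulrC 4^-1).
  have hk : (3 + K) `^ al <= 3 + K by exact: powR_le_base (ltW al1).
  have h0 : 0 <= q `^ (al / 4) * (1 + 2 * C * S).
    apply: mulr_ge0 (powR_ge0 _ _) _; apply: addr_ge0 => //; apply: mulr_ge0 S0.
    by have := C0; lra.
  have := ler_wpM2l AD (ler_pM (powR_ge0 _ _) h0 hk HW).
  by congr (_ <= _); ring.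
have T2 : A * (2 * d) `^ al <= 2 * (A * D `^ al) * q `^ la.
  rewrite powRM ?(ltW d0) // /d powRM ?(ltW D0) ?(ltW y0) //.
  have h2 : (2 : R) `^ al <= 2 by apply: powR_le_base (ltW al1); rewrite ler1n.
  have := ler_wpM2l AD (ler_pM (powR_ge0 _ _) (powR_ge0 _ _) h2 (powR_ratio q0 q1 la_al)).
  by rewrite (_ : A * (2 `^ al * (D `^ al * (q `^ 4^-1) `^ al)) =
     A * D `^ al * (2 `^ al * (q `^ 4^-1) `^ al)); [lra|ring].
have T3 : Cbd * (A * D `^ al + N) * (2 * d / D) `^ Num.min al (3 / 8) <=
    Cbd * (A * D `^ al + N) * (2 * q `^ la).
  apply: ler_wpM2l; first by apply: mulr_ge0 (ltW (@Cbd_gt0 R)) _; exact: addr_ge0.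
  rewrite (_ : 2 * d / D = 2 * q `^ 4^-1); last by rewrite /d; field; rewrite gt_eqF.
  rewrite powRM ?(ltW y0) //.
  apply: ler_pM; rewrite ?powR_ge0 //.
    by apply: powR_le_base; [rewrite ler1n|rewrite ge_min (ltW al1)].
  apply: powR_ratio => //; rewrite ler_pdivlMr // le_min; apply/andP; split.
    by have := la_al; lra.
  by have := la3; lra.
have T4 : 2 * N * (C' + 16) * B * q `^ (be / (1 + be) / 4) <= 2 * N * (C' + 16) * B * q `^ la.
  apply: ler_wpM2l; last by apply: ger_powR; rewrite ?q0.
  apply: mulr_ge0 B0; apply: mulr_ge0; last by have := C'0; lra.
  exact: mulr_ge0.
rewrite /X /c1 /c2; lra.
Qed.

Lemma regime_lt : al < be -> q `^ (al / 4) * (1 + 2 * C * S) <=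
  (1 + 8 * C / be) * (be / (be - al)) * q `^ la.
Proof.
move=> ab; have x0 : 0 < be - al by lra.
have x1 : be - al <= 1 by have := al0; have := be1; lra.
have hS : S <= 4 / (be - al).
  by have := geometric_decreasing n.+1 x0 x1; rewrite opprB.
rewrite mulrC; apply: ler_pM; rewrite ?powR_ge0 //.
- apply: addr_ge0 => //; apply: mulr_ge0; first by have := C0; lra.
  by apply: sumr_ge0 => k _; exact: powR_ge0.
- have h1 : 2 * C * S <= 2 * C * (4 / (be - al)) by apply: ler_wpM2l => //; have := C0; lra.
  have h2 : 1 <= be / (be - al) by rewrite ler_pdivlMr //; have := al0; lra.
  have -> : (1 + 8 * C / be) * (be / (be - al)) = be / (be - al) + 2 * C * (4 / (be - al)).
    by field; rewrite !gt_eqF.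
  lra.
by apply: ger_powR; rewrite ?q0.
Qed.

(** The sum is governed by its last term [2^(n (al - be))], and [2^n <= q^(- 1/4)] lowers the power
    [q^(al / 4)] exactly to [q^(be / 4)]. *)
Lemma regime_gt : be < al -> q `^ (al / 4) * (1 + 2 * C * S) <=
  (1 + 8 * C / be) * (al / (al - be)) * q `^ la.
Proof.
move=> ab; have x0 : 0 < al - be by lra.
have x1 : al - be <= 1 by have := be0; have := al1; lra.
have hS : S <= 4 / (al - be) * 2 `^ (n%:R * (al - be)) := geometric_increasing n x0 x1.
have h2 : (2 : R) `^ (n%:R * (al - be)) <= (q `^ 4^-1) `^ (- (al - be)).
  rewrite powRrM powR_mulrn // powRN.
  rewrite (_ : ((q `^ 4^-1) `^ (al - be))^-1 = ((q `^ 4^-1)^-1) `^ (al - be)); last first.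
    by rewrite -[in RHS](powR_inv1 (ltW y0)) (powRAC _ (-1)) powR_inv1 // powR_ge0.
  by apply: ge0_ler_powR n1; rewrite ?nnegrE ?(ltW x0) ?invr_ge0 ?(ltW y0) ?exprn_ge0.
have h3 : q `^ (al / 4) * (2 `^ (n%:R * (al - be))) <= q `^ la.
  apply: le_trans (ler_wpM2l (powR_ge0 _ _) h2) _.
  rewrite -powRrM -powRD; last by rewrite (gt_eqF q0) implybT.
  by apply: ger_powR; rewrite ?q0 //; have := la_be; lra.
have h4 : q `^ (al / 4) <= q `^ la by apply: ger_powR; rewrite ?q0.
have h5 : 1 <= al / (al - be) by rewrite ler_pdivlMr //; have := be0; lra.
have h6 : (al - be)^-1 <= be^-1 * (al / (al - be)).
  rewrite mulrA ler_peMl ?invr_ge0 ?(ltW x0) //.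
  by rewrite mulrC ler_pdivlMr // mul1r ltW.
have k0 : 0 <= 8 * C by have := C0; lra.
apply: le_trans (_ : q `^ (al / 4) + 8 * C * (al - be)^-1 * (q `^ (al / 4) * 2 `^ (n%:R * (al - be))) <= _).
  have := ler_wpM2l (mulr_ge0 (powR_ge0 q (al / 4)) (ltW C0)) hS; lra.
have xV : 0 <= (al - be)^-1 by rewrite invr_ge0 ltW.
have := ler_wpM2l (mulr_ge0 k0 xV) h3.
have := ler_wpM2r ql h5; have := ler_wpM2r (mulr_ge0 k0 ql) h6.
lra.
Qed.

(** All summands equal 1, and the number of scales is logarithmic because [2^n <= q^(- 1/4)]. *)
Lemma regime_eq : al = be -> q `^ (al / 4) * (1 + 2 * C * S) <=
  (2 + 12 * C) * ln (Num.max q^-1 2) * q `^ la.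
Proof.
move=> ab; set L := ln _.
have SE : S = n.+1%:R.
  rewrite /S (eq_bigr (fun=> 1)); last by move=> k _; rewrite ab subrr mulr0 powRr0.
  by rewrite sumr_const card_ord.
have l2 := ln2_ge.
have L2 : ln 2 <= L by rewrite ler_ln ?posrE // ?le_max ?lexx ?orbT // lt_max ltr0n orbT.
have nL : n%:R * ln 2 <= L / 4.
  apply: le_trans (_ : ln (q `^ 4^-1)^-1 <= _).
    by rewrite mulr_natl -lnXn // ler_ln ?posrE ?invr_gt0 ?exprn_gt0.
  rewrite lnV ?posrE // ln_powR mulrC -mulNr -lnV ?posrE // ler_pM2r //.
  by rewrite ler_ln ?posrE ?invr_gt0 // ?le_max ?lexx // lt_max ltr0n orbT.
have n0 : 0 <= n%:R :> R by [].
have nn : n%:R <= L / 2 by nra.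
have SL : S <= 6 * L by rewrite SE -natr1; lra.
have hS0 : 0 <= S by rewrite SE.
rewrite mulrC; apply: ler_pM; rewrite ?powR_ge0 //.
- by apply: addr_ge0 => //; apply: mulr_ge0 hS0; have := C0; lra.
- have := ler_wpM2l (ltW C0) SL; lra.
by apply: ger_powR; rewrite ?q0.
Qed.

End Regimes.

(** * Absorption of constants into the factors of the three regimes *)

Section RegimeArithmetic.
Context {R : realType}.
Implicit Types (E X Y F L c k a b : R).

Lemma half_le_scaled E X Y F : 0 <= X -> 0 <= Y -> 0 <= F -> E <= X / 2 -> E <= X + F * Y.
Proof. by move=> X0 Y0 F0 h; have := mulr_ge0 F0 Y0; rlra. Qed.

(** The trivial bound is kept with a spare factor 2 since the logarithmic factor is only known to be
    at least 1/2. *)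
Lemma half_le_log E X Y L : 0 <= X -> 0 <= Y -> 2^-1 <= L -> E <= X / 2 -> E <= (X + Y) * L.
Proof.
move=> X0 Y0 L2 h; have := ler_wpM2l X0 L2; have L0 : 0 <= L by rlra.
by have := mulr_ge0 Y0 L0; rlra.
Qed.

Lemma regime_constant K c k F c2 : 0 <= 3 + K -> 0 <= c -> 0 <= c2 -> 1 <= F ->
  (3 + K) * ((1 + k) * F) + c2 <= ((3 + K) * (2 + 12 * c + k) + 2 * c2) * F.
Proof.
move=> K3 c0 c20 F1; have F0 : 0 <= F by rlra.
have := mulr_ge0 (mulr_ge0 K3 c0) F0; have := mulr_ge0 K3 F0.
have := ler_wpM2l c20 F1; have := mulr_ge0 c20 F0; rlra.
Qed.

Lemma log_constant K c k L c2 : 0 <= 3 + K -> 0 <= k -> 0 <= c2 -> 2^-1 <= L ->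
  (3 + K) * ((2 + 12 * c) * L) + c2 <= ((3 + K) * (2 + 12 * c + k) + 2 * c2) * L.
Proof.
move=> K3 k0 c20 L2; have L0 : 0 <= L by rlra.
by have := mulr_ge0 (mulr_ge0 K3 k0) L0; have := ler_wpM2l c20 L2; rlra.
Qed.

End RegimeArithmetic.

(** * The rates with explicit constants *)

Section Rates.
Context {R : realType}.
Variables (C C' K be : R).
Hypotheses (C0 : 0 < C) (C'0 : 0 < C') (K0 : 0 < K) (be0 : 0 < be) (be1 : be < 1).
Hypotheses (HB : weak_beurling C K be) (HH : hoelder_harmonic C' K be).

Variable B : R.
Hypotheses (B0 : 0 <= B) (BE : B = 4096 * 8192 + (2 * K + 64)).
(** The last summand makes the estimate trivial for [q] above [8^-4], where the mesh may be too
    coarse for the layer. *)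
Definition sup_constant : R := 4 * Cbd + 4 * (C' + 16) * B + 4 * 8 ^+ 4.
Definition hoelder_constant : R := (3 + K) * (2 + 12 * C + 8 * C / be) + 4 * (1 + Cbd).
Let C1 := sup_constant.
Let C2 := hoelder_constant.

Lemma sup_constant_gt0 : 0 < sup_constant.
Proof.
have h1 : 0 <= (C' + 16) * B by apply: mulr_ge0 B0; have := C'0; lra.
have h2 : 0 < (8 : R) ^+ 4 by exact: exprn_gt0.
by have := @Cbd_gt0 R; rewrite /sup_constant; lra.
Qed.

Lemma hoelder_constant_gt0 : 0 < hoelder_constant.
Proof.
rewrite /hoelder_constant; apply: ltr_wpDl; last by have := @Cbd_gt0 R; lra.
have h1 : 0 <= 8 * C / be by apply: divr_ge0 (ltW be0); have := C0; lra.
by apply: mulr_ge0; have := C0; have := K0; lra.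
Qed.

Section Data.
Variables (Om : set (R * R)) (g h : R * R -> R) (al : R).
Variables (G : orthodiagonal_map R) (eps : R) (hd : primal_vertex G -> R).
Notation V := (primal_vertex G).
Notation pp := (@ppos R G).
Hypotheses (dOm : is_domain Om) (bOm : bounded_set Om) (sOm : simply_connected Om).
Hypotheses (al0 : 0 < al) (al1 : al < 1) (e0 : 0 < eps) (mesh : mesh_le G eps).
Hypothesis hatO : hat_domain G `<=` Om.
Hypothesis hatF : forall z, frontier (hat_domain G) z -> dist_set z (frontier Om) <= eps.
Hypotheses (Hh : dirichlet_solution Om g h) (Hhd : discrete_dirichlet_solution g hd).
Variables (A N : R).
Hypotheses (A0 : 0 <= A) (N0 : 0 <= N) (gN : forall p, `|g p| <= N).
Hypothesis gA : forall p q, `|g p - g q| <= A * nrm (p - q) `^ al.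
Let D := diam Om.
Let q := eps / D.
Let la := lambda al be.
Let L := ln (Num.max (D / eps) 2).

Lemma error_regimes (v : V) :
  [/\ al < be -> `|hd v - h (pp v)| <= (C1 * N + C2 * (be / (be - al)) * A * D `^ al) * q `^ la,
      al = be -> `|hd v - h (pp v)| <= (C1 * N + C2 * A * D `^ al) * L * q `^ la &
      be < al -> `|hd v - h (pp v)| <= (C1 * N + C2 * (al / (al - be)) * A * D `^ al) * q `^ la].
Proof.
have [neO oO _] := dOm; have [C2h ch lap hg] := Hh; have [hdh hdg] := Hhd.
have [hx [hy [hxx [hxy [hyx [hyy H]]]]]] := C2_on_harm C2h lap.
have D0 : 0 < D by exact: diam_gt0.
have q0 : 0 < q by rewrite divr_gt0.
have qV : q^-1 = D / eps by rewrite /q invf_div.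
have la0 : 0 <= la := lambda_ge0 al0 be0 be1.
have la3 : la <= 3 / 32 := lambda_le_3_32 al0 be0 be1.
have lam : la <= Num.min al be / 4 := lambda_le_min al0 be0 be1.
have lab : la <= be / (1 + be) / 4 := lambda_le_b al0 be0 be1.
have Cb0 := @Cbd_gt0 R.
have CB : 0 <= 8 * C / be by apply: divr_ge0 (ltW be0); have := C0; lra.
have C20 : 0 <= C2.
  rewrite /C2 /hoelder_constant; apply: addr_ge0; last by lra.
  by apply: mulr_ge0; have := K0; have := C0; lra.
pose c1 : R := 2 * Cbd + 2 * (C' + 16) * B; pose c2 : R := 2 + 2 * Cbd.
have p8 : 0 < (8 : R) ^+ 4 by exact: exprn_gt0.
have c10 : 0 <= c1.
  apply: addr_ge0; first by lra.
  by apply: mulr_ge0 B0; have := C'0; lra.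
have c1C : 2 * c1 <= C1 by rewrite /c1 /C1 /sup_constant; lra.
have c1C' : c1 <= C1 by lra.
have C10 : 0 <= C1 by lra.
have c20 : 0 <= c2 by rewrite /c2; lra.
have K3 : 0 <= 3 + K by have := K0; lra.
have half0 : 0 < (2^-1 : R) by rewrite invr_gt0.
have C2E : C2 = (3 + K) * (2 + 12 * C + 8 * C / be) + 2 * c2 by rewrite /C2 /hoelder_constant /c2; ring.
have AD : 0 <= A * D `^ al := mulr_ge0 A0 (powR_ge0 _ _).
have ql : 0 <= q `^ la := powR_ge0 _ _.
have l2 := @ln2_ge R.
have L2 : 2^-1 <= L.
  apply: le_trans l2 _; rewrite ler_ln ?posrE ?le_max ?lexx ?orbT //.
  by rewrite lt_max ltr0n orbT.
have F1 (x y : R) : 0 < x -> x < y -> 1 <= y / (y - x).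
  by move=> x0 xy; rewrite ler_pdivlMr; lra.
(* For [8^-4 < q <= 1] one has [q^la >= q > 8^-4] because [la <= 1]; for larger [q] even
   [q^la >= 1]. *)
have small : 2 * N <= C1 * N * q `^ la / 2 \/ q <= 8^-1 ^+ 4.
  have [qs|qb] := leP q (8^-1 ^+ 4); [by right|left].
  have pq8 : (8^-1 : R) ^+ 4 <= q `^ la.
    have [q1|q1] := leP q 1.
      apply: le_trans (ltW qb) _; apply: ger1_powR; first by rewrite q0.
      by lra.
    apply: le_trans (_ : 1 <= _); first by rewrite exprn_ile1 // ?invr_ge0 // invf_le1 // ler1n.
    by rewrite -(powRr0 q) ler_powR // ltW.
  have e8 : (8 : R) ^+ 4 * 8^-1 ^+ 4 = 1 by rewrite -exprMn mulfV ?expr1n.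
  have h1 : 4 * 8 ^+ 4 <= C1.
    have : 0 <= (C' + 16) * B by apply: mulr_ge0 B0; have := C'0; lra.
    by rewrite /C1 /sup_constant; lra.
  have h2 : 4 <= C1 * q `^ la.
    apply: le_trans (_ : 4 * 8 ^+ 4 * 8^-1 ^+ 4 <= _); first by rewrite -mulrA e8 mulr1.
    by apply: ler_pM => //; rewrite ?mulr_ge0 ?exprn_ge0 ?invr_ge0.
  by have := ler_wpM2r N0 h2; lra.
have XN : 0 <= C1 * N * q `^ la by apply: mulr_ge0 ql; exact: mulr_ge0.
have YA : 0 <= C2 * (A * D `^ al) * q `^ la by apply: mulr_ge0 ql; exact: mulr_ge0.
have cv : closure Om (pp v) by exact: closure_vertex.
have e2N : `|hd v - h (pp v)| <= 2 * N.
  apply: le_trans (ler_normB _ _) _.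
  have := discrete_sup hdh hdg gN v; have := harmonic_sup oO bOm H ch hg gN cv; lra.
suff [tr|[W1 W2 W3]] : `|hd v - h (pp v)| <= C1 * N * q `^ la / 2 \/
  [/\ al < be -> `|hd v - h (pp v)| <= (N * c1 + A * D `^ al *
         ((3 + K) * ((1 + 8 * C / be) * (be / (be - al))) + c2)) * q `^ la,
      al = be -> `|hd v - h (pp v)| <= (N * c1 + A * D `^ al * ((3 + K) * ((2 + 12 * C) * L) + c2)) * q `^ la &
      be < al -> `|hd v - h (pp v)| <= (N * c1 + A * D `^ al *
         ((3 + K) * ((1 + 8 * C / be) * (al / (al - be))) + c2)) * q `^ la].
- have tr' (F : R) : 0 <= F -> `|hd v - h (pp v)| <= (C1 * N + C2 * F * A * D `^ al) * q `^ la.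
    move=> F0; rewrite (_ : _ * q `^ la = C1 * N * q `^ la + F * (C2 * (A * D `^ al) * q `^ la)); last by ring.
    exact: half_le_scaled tr.
  split=> [ab|ab|ab]; first by apply: tr'; apply: le_trans (F1 _ _ al0 ab).
    rewrite (_ : _ * q `^ la = (C1 * N * q `^ la + C2 * (A * D `^ al) * q `^ la) * L); last by ring.
    exact: half_le_log tr.
  by apply: tr'; apply: le_trans (F1 _ _ be0 ab).
- have W0 (F : R) : 1 <= F -> (N * c1 + A * D `^ al * ((3 + K) * ((1 + 8 * C / be) * F) + c2)) * q `^ la
      <= (C1 * N + C2 * F * A * D `^ al) * q `^ la.
    move=> F1'; apply: ler_wpM2r => //.
    rewrite (_ : C1 * N + C2 * F * A * D `^ al = N * C1 + A * D `^ al * (C2 * F)); last by ring.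
    apply: lerD; first exact: ler_wpM2l.
    apply: ler_wpM2l => //; rewrite C2E; apply: regime_constant => //; exact: ltW.
  split=> [ab|ab|ab]; first exact: le_trans (W1 ab) (W0 _ (F1 _ _ al0 ab)).
    apply: le_trans (W2 ab) _; apply: ler_wpM2r => //.
    rewrite (_ : (C1 * N + C2 * A * D `^ al) * L = N * C1 * L + A * D `^ al * (C2 * L)); last by ring.
    apply: lerD; last by apply: ler_wpM2l => //; rewrite C2E; exact: log_constant.
    rewrite -mulrA; apply: ler_wpM2l => //.
    by have := ler_wpM2l C10 L2; move: c1C; rewrite (mulrC 2) -ler_pdivlMr // => h1; exact: le_trans.
  exact: le_trans (W3 ab) (W0 _ (F1 _ _ be0 ab)).
have [sm|qs] := small; first by left; apply: le_trans e2N sm.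
(* For [N = 0] both solutions vanish, and the trivial bound suffices. *)
have [N1|N1] := ltP 0 N; last by left; lra.
right; have q1 : q <= 1 by apply: le_trans qs _; rewrite exprn_ile1 // ?invr_ge0 // invf_le1 // ler1n.
have y0 : 0 < q `^ 4^-1 by exact: powR_gt0.
have y1 : 1 <= (q `^ 4^-1)^-1.
  have q01 : 0 < q <= 1 by rewrite q0.
  have V4 : 0 <= 4^-1 :> R by rewrite invr_ge0.
  have y1' : q `^ 4^-1 <= 1 by have := ger_powR q01 V4; rewrite powRr0.
  by rewrite invf_ge1.
have [n /andP[n1 n2]] := dyadic_below y1.
have y4 : q = (q `^ 4^-1) ^+ 4 by rewrite -powR_mulrn ?(ltW y0) // -powRrM mulVf // powRr1 // ltW.
have y8 : q `^ 4^-1 <= 8^-1.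
  by move: qs; rewrite {1}y4 ler_pXn2r // ?nnegrE ?invr_ge0 ?(ltW y0).
(* In terms of [y = q^(1/4)] this asks for [128 y^3 <= 1], and [y <= 1/8] gives 128 / 512. *)
have ed : 128 * eps <= D * q `^ 4^-1.
  have -> : eps = q * D by rewrite /q divfK // gt_eqF.
  rewrite mulrA mulrC ler_pM2l // {1}y4; set y := q `^ 4^-1 in y8 y0 *.
  have yy : y * y <= 8^-1 * 8^-1 by apply: ler_pM => //; exact: ltW.
  have y3 : y * y * y <= 8^-1 * 8^-1 * 8^-1 by apply: ler_pM => //; rewrite ?mulr_ge0 ?(ltW y0).
  have := ler_wpM2r (ltW y0) y3; rewrite (_ : y ^+ 4 = y * y * y * y); last by ring.
  lra.
have nE : D < D * q `^ 4^-1 * 2 ^+ n.+1.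
  rewrite -mulrA ltr_pMr // mulrC.
  by move: n2; rewrite -ltr_pdivrMr ?div1r.
have EB := error_bound C0 C'0 K0 be0 be1 HB HH oO bOm sOm neO al0 al1 e0 mesh hatO hatF H ch hg
  hdh hdg A0 N1 gN gA (erefl q) q1 (erefl (D * q `^ 4^-1)) ed
  (erefl ((3 + K) * (D * q `^ 4^-1))) nE v; rewrite -BE in EB.
have RB W := @regime_bound R C C' K be C0 C'0 K0 al D q A N la B n al1 D0 q0 q1 A0 N0 B0 lam la3 lab W.
have LE : L = ln (Num.max q^-1 2) by rewrite /L qV.
split=> ab; apply: le_trans EB (RB _ _).
- exact: (regime_lt C0 be0 be1 n al0 q0 q1 lam ab).
- rewrite LE; exact: (regime_eq C0 q0 q1 lam n1 ab).
exact: (regime_gt C0 be0 al1 q0 q1 lam n1 ab).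
Qed.

End Data.
End Rates.

(** * Finite and infinite norms *)

Section Norms.
Context {R : realType}.
Implicit Types (g : R * R -> R) (A N : R).

Lemma sup_norm_ge g p : (`|g p|%:E <= sup_norm g)%E.
Proof. by apply: ereal_sup_ubound; exists p. Qed.

Lemma sup_normP g : sup_norm g = +oo%E \/
  exists N, [/\ 0 <= N, sup_norm g = N%:E & forall p, `|g p| <= N].
Proof.
have H := sup_norm_ge g; move: H; case: (sup_norm g) => [N||] H.
- right; exists N; split=> //.
  by apply: le_trans (normr_ge0 (g 0)) _; have := H 0; rewrite lee_fin.
- by left.
by have := H 0.
Qed.

(** The supremum is not [-oo], since the plane has two distinct points, and equal points satisfy the
    real inequality trivially. *)
Lemma hoelder_normP g (al : R) : 0 < al -> is_hoelder al g ->
  exists A, [/\ 0 <= A, hoelder_norm al g = A%:E & forall p q, `|g p - g q| <= A * nrm (p - q) `^ al].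
Proof.
move=> al0 Hg.
have H (p q : R * R) : p <> q ->
    ((`|g p - g q| / dist2 p q `^ al)%:E <= hoelder_norm al g)%E.
  by move=> pq; apply: ereal_sup_ubound; exists (p, q).
have n01 : (0 : R * R) <> (1, 1) by move=> [] /esym/eqP; rewrite oner_eq0.
move: Hg H; rewrite /is_hoelder; case: (hoelder_norm al g) => [A _|//|_] H; last by have := H _ _ n01.
have A0 : 0 <= A by have := H _ _ n01; rewrite lee_fin; apply: le_trans; rewrite divr_ge0 ?powR_ge0.
exists A; split=> // p q; have [->|/eqP pq] := eqVneq p q.
  by rewrite subrr normr0 mulr_ge0 ?powR_ge0.
have := H _ _ pq; rewrite lee_fin nrm_dist2 ler_pdivrMr // powR_gt0 //.
by rewrite lt_def nrm_ge0 andbT; apply/eqP => /nrm_eq0/eqP; rewrite subr_eq0 => /eqP.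
Qed.

End Norms.

Theorem theorem3p1 (R : realType) (C C' K beta : R)
  (C_gt0 : 0 < C) (C'_gt0 : 0 < C') (K_gt0 : 0 < K)
  (beta_gt0 : 0 < beta) (beta_lt1 : beta < 1)
  (Hbeurling : weak_beurling C K beta)
  (Hhoelder : hoelder_harmonic C' K beta) :
  exists C1 C2 : R, [/\ 0 < C1, 0 < C2 &
  forall (Omega : set (R * R)) (alpha : R) (g : R * R -> R)
    (G : orthodiagonal_map R) (eps : R)
    (h : R * R -> R) (hd : primal_vertex G -> R),
    is_domain Omega -> bounded_set Omega -> simply_connected Omega ->
    0 < alpha -> alpha < 1 -> is_hoelder alpha g ->
    0 < eps -> mesh_le G eps ->
    hat_domain G `<=` Omega ->
    (forall z, frontier (hat_domain G) z -> dist_set z (frontier Omega) <= eps) ->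
    dirichlet_solution Omega g h ->
    discrete_dirichlet_solution g hd ->
    forall v : primal_vertex G,
    [/\ alpha < beta ->
          ((`|hd v - h (ppos v)|)%:E <=
           (C1%:E * sup_norm g +
            (C2 * (beta / (beta - alpha)))%:E * hoelder_norm alpha g *
            (diam Omega `^ alpha)%:E) *
           ((eps / diam Omega) `^ lambda alpha beta)%:E)%E,
        (* Equals ln (diam Omega / eps) once eps <= diam Omega / 2; without the
           cut-off this bound fails for eps close to or above diam Omega. *)
        alpha = beta ->
          ((`|hd v - h (ppos v)|)%:E <=
           (C1%:E * sup_norm g +
            C2%:E * hoelder_norm alpha g * (diam Omega `^ alpha)%:E) *
           (ln (Num.max (diam Omega / eps) 2))%:E *
           ((eps / diam Omega) `^ lambda alpha beta)%:E)%E &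
        beta < alpha ->
          ((`|hd v - h (ppos v)|)%:E <=
           (C1%:E * sup_norm g +
            (C2 * (alpha / (alpha - beta)))%:E * hoelder_norm alpha g *
            (diam Omega `^ alpha)%:E) *
           ((eps / diam Omega) `^ lambda alpha beta)%:E)%E]].
Proof.
have [B B0 BE] : exists2 B : R, 0 <= B & B = 4096 * 8192 + (2 * K + 64).
  eexists; last by [].
  apply: addr_ge0; first by apply: mulr_ge0; exact: ler0n.
  by apply: addr_ge0; [apply: mulr_ge0 (ltW K_gt0)|]; exact: ler0n.
have C1p := sup_constant_gt0 C'_gt0 B0.
have C2p := hoelder_constant_gt0 C_gt0 K_gt0 beta_gt0.
exists (sup_constant C' B), (hoelder_constant C K beta); split=> //.
move=> Om al g G eps h hd dOm bOm sOm al0 al1 Hg e0 mesh hatO hatF Hh Hhd v.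
have [neO oO _] := dOm; have D0 := diam_gt0 oO bOm neO.
have [A [A0 AE gA]] := hoelder_normP al0 Hg.
have ql : 0 < (eps / diam Om) `^ lambda al beta by rewrite powR_gt0 // divr_gt0.
have l2 : 0 < ln (Num.max (diam Om / eps) 2).
  by rewrite ln_gt0 // lt_max ltr1n orbT.
rewrite AE; have [NE|[N [N0 NE gN]]] := sup_normP g; rewrite NE.
  (* A Hoelder function may be unbounded on the whole plane; then each right-hand side is [+oo], all
     other factors being positive. *)
  have inf (k : R) : ((sup_constant C' B)%:E * +oo + k%:E * A%:E * (diam Om `^ al)%:E = +oo)%E.
    by rewrite gt0_muley ?lte_fin // -!EFinM addye.
  by split=> _; rewrite inf !gt0_mulye ?lte_fin // leey.
have := error_regimes C_gt0 C'_gt0 K_gt0 beta_gt0 beta_lt1 Hbeurling Hhoelder B0 BE dOm bOm sOm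
  al0 al1 e0 mesh hatO hatF Hh Hhd A0 N0 gN gA v.
move=> [H1 H2 H3].
by split=> ab; rewrite -2?EFinM -?EFinD -?EFinM lee_fin; [exact: H1|exact: H2|exact: H3].
Qed.
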